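(* Let $p$ be a prime, $K_0/\mathbb{Q}_p$ a finite extension with uniformizer $\pi$, $K/K_0$ a finite unramified extension, $L/K$ a finite extension, and $M/L$ a finite unramified extension with Galois group $G=\mathrm{Gal}(M/L)$ of order $p^m$, generated by $\sigma$. Let $F$ be a Honda formal group over $\mathcal{O}_K$ relative to $K/K_0$ and $\pi$, of height $h$, and put $n=[L:K_0]$. Suppose that $W_F\cap F(\mathfrak{p}_L)=W_F\cap F(\mathfrak{p}_M)=W^s_F$ for some $s\geq 1$. Then $h\leq n$, and the $\mathcal{O}_{K_0}[G]$-module $F(\mathfrak{p}_M)$ has a system of generators $\theta_j$ ($1\le j\le n-h$), $\xi_i,\omega_i$ ($1\le i\le h$) whose only defining relations are $$[\pi^s]_F(\xi_i)=\sigma(\omega_i)\underset{F}{-}\omega_i,\qquad 1\leq i\leq h.$$ That is, these $n+h$ elements generate $F(\mathfrak{p}_M)$ as an $\mathcal{O}_{K_0}[G]$-module, and the kernel of the surjection $\mathcal{O}_{K_0}[G]^{n+h}\to F(\mathfrak{p}_M)$ sending the standard basis vectors to these generators is the $\mathcal{O}_{K_0}[G]$-submodule generated by the $h$ elements $\pi^s e_{\xi_i}-(\sigma-1)e_{\omega_i}$.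
   Context: Honda formal groups: let $q=|k_0|$ where $k_0$ is the residue field of $K_0$, and let $\varphi$ be the Frobenius automorphism of $K/K_0$ (acting on power series coefficientwise). $\mathcal{O}_{K,\varphi}[[T]]$ is the noncommutative power series ring with $Ta=\varphi(a)T$ for $a\in\mathcal{O}_K$, acting on $K[[X]]$ by $T*g(X)=g^{\varphi}(X^q)$. A type is $u=\pi+\sum_{i\ge1}a_iT^i$ with $a_i\in\mathcal{O}_K$; its height $h$ is the least $i$ with $a_i$ a unit. A one-dimensional formal group $F$ over $\mathcal{O}_K$ with logarithm $f$ is a Honda formal group relative to $K/K_0$ of type $u$ if $u*f\equiv 0 \pmod{\pi}$ coefficientwise; the height of $F$ is the height of $u$. There is a ring embedding $\mathcal{O}_{K_0}\hookrightarrow\mathrm{End}_{\mathcal{O}_K}(F)$, $a\mapsto [a]_F$, with $f\circ[a]_F=af$. For a finite extension $E/K$, $F(\mathfrak{p}_E)$ denotes the maximal ideal $\mathfrak{p}_E$ of $\mathcal{O}_E$ with group law $x\underset{F}{+}y=F(x,y)$; it is an $\mathcal{O}_{K_0}$-module via $a\cdot x=[a]_F(x)$ and, for $E=M$, an $\mathcal{O}_{K_0}[G]$-module with $G$ acting naturally. $W^k_F=\{x\in\mathfrak{p}_{K^{\mathrm{alg}}}:[\pi^k]_F(x)=0\}$ and $W_F=\bigcup_{k\ge1}W^k_F$. *)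

(* Defs.v *)
From HB Require Import structures.
From mathcomp Require Import all_boot all_order all_fingroup all_algebra.
From mathcomp Require Import all_solvable all_field.
From mathcomp Require Import mpoly boolp.

Set Implicit Arguments.
Unset Strict Implicit.
Unset Printing Implicit Defensive.

Import GRing.Theory.
Local Open Scope ring_scope.

(* Z_p as the inverse limit of the Z/p^n: the class mod p^n is represented by
   its least nonnegative residue. *)
Record padic_int (p : nat) (p_pr : prime p) := PadicInt {
  padic_res :> nat -> nat;
  padic_resP : forall n, padic_res n = (padic_res n.+1 %% p ^ n)%N }.

Section PadicIntRing.
Variables (p : nat) (p_pr : prime p).
Local Notation Zp := (padic_int p_pr).
Implicit Types a b c : Zp.

HB.instance Definition _ := gen_eqMixin Zp.
HB.instance Definition _ := gen_choiceMixin Zp.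

Lemma padic_int_eq a b : (forall n, a n = b n) -> a = b.
Proof.
case: a b => [a aP] [b bP] /= /funext eab; case: _ / eab bP => bP.
by congr PadicInt; apply: Prop_irrelevance.
Qed.

Lemma padic_res_mod a n k : (a (n + k) %% p ^ n)%N = a n.
Proof.
elim: k => [|k IH]; first by rewrite addn0 padic_resP modn_mod.
rewrite addnS -IH [a (n + k)%N]padic_resP modn_dvdm //.
by rewrite expnD dvdn_mulr.
Qed.

Lemma padic_res_modn a n : (a n %% p ^ n)%N = a n.
Proof. by rewrite -{1}[n]addn0 padic_res_mod. Qed.

Lemma modn_exp_step x n : (x %% p ^ n = x %% p ^ n.+1 %% p ^ n)%N.
Proof. by rewrite modn_dvdm // expnS dvdn_mull. Qed.

Definition padic_of_nat x : Zp := @PadicInt p p_pr _ (modn_exp_step x).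

Fact padic_add_subproof a b n :
  ((a n + b n) %% p ^ n = (a n.+1 + b n.+1) %% p ^ n.+1 %% p ^ n)%N.
Proof. by rewrite -modn_exp_step -[RHS]modnDm -!padic_resP. Qed.

Definition padic_add a b := @PadicInt p p_pr _ (padic_add_subproof a b).

Fact padic_mul_subproof a b n :
  ((a n * b n) %% p ^ n = (a n.+1 * b n.+1) %% p ^ n.+1 %% p ^ n)%N.
Proof. by rewrite -modn_exp_step -[RHS]modnMm -!padic_resP. Qed.

Definition padic_mul a b := @PadicInt p p_pr _ (padic_mul_subproof a b).

Fact padic_opp_subproof a n :
  ((p ^ n - a n) %% p ^ n = (p ^ n.+1 - a n.+1) %% p ^ n.+1 %% p ^ n)%N.
Proof.
have lea k : (a k <= p ^ k)%N.
  by rewrite -(padic_res_modn a k) ltnW // ltn_mod expn_gt0 prime_gt0.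
rewrite -modn_exp_step; apply/eqP.
rewrite -(eqn_modDr (a n)) subnK // modnn [X in (_ + X)%N]padic_resP.
by rewrite modnDmr subnK // expnS modnMl.
Qed.

Definition padic_opp a := @PadicInt p p_pr _ (padic_opp_subproof a).

Fact padic_addA : associative padic_add.
Proof. by move=> a b c; apply: padic_int_eq => n /=; rewrite modnDmr modnDml addnA. Qed.

Fact padic_addC : commutative padic_add.
Proof. by move=> a b; apply: padic_int_eq => n /=; rewrite addnC. Qed.

Fact padic_add0 : left_id (padic_of_nat 0) padic_add.
Proof. by move=> a; apply: padic_int_eq => n /=; rewrite mod0n add0n padic_res_modn. Qed.

Fact padic_addN : left_inverse (padic_of_nat 0) padic_opp padic_add.
Proof.
move=> a; apply: padic_int_eq => n /=; rewrite modnDml subnK ?modnn ?mod0n //.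
by rewrite -(padic_res_modn a n) ltnW // ltn_mod expn_gt0 prime_gt0.
Qed.

HB.instance Definition _ :=
  GRing.isZmodule.Build Zp padic_addA padic_addC padic_add0 padic_addN.

Fact padic_mulA : associative padic_mul.
Proof. by move=> a b c; apply: padic_int_eq => n /=; rewrite modnMmr modnMml mulnA. Qed.

Fact padic_mulC : commutative padic_mul.
Proof. by move=> a b; apply: padic_int_eq => n /=; rewrite mulnC. Qed.

Fact padic_mul1 : left_id (padic_of_nat 1) padic_mul.
Proof. by move=> a; apply: padic_int_eq => n /=; rewrite modnMml mul1n padic_res_modn. Qed.

Fact padic_mulDl : left_distributive padic_mul padic_add.
Proof.
by move=> a b c; apply: padic_int_eq => n /=; rewrite modnMml modnDm mulnDl.
Qed.

Fact padic_1neq0 : padic_of_nat 1 != 0 :> Zp.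
Proof.
apply/eqP => /(congr1 (fun a : Zp => a 1%N)) /=.
by rewrite expn1 mod0n modn_small ?prime_gt1.
Qed.

HB.instance Definition _ := GRing.Zmodule_isComNzRing.Build Zp
  padic_mulA padic_mulC padic_mul1 padic_mulDl padic_1neq0.

Definition padic_unit : pred Zp := fun a => `[< exists b, b * a = 1 >].

Definition padic_inv a : Zp :=
  if pselect (exists b, b * a = 1) is left ex_b then projT1 (cid ex_b) else a.

Fact padic_mulVr : {in padic_unit, left_inverse 1 padic_inv *%R}.
Proof.
move=> a /asboolP ua; rewrite /padic_inv; case: pselect => // ex_b.
by case: (cid ex_b).
Qed.

Fact padic_unitP a b : b * a = 1 -> padic_unit a.
Proof. by move=> ba1; apply/asboolP; exists b. Qed.

Fact padic_inv_out : {in [predC padic_unit], padic_inv =1 id}.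
Proof.
by move=> a /asboolPn nua; rewrite /padic_inv; case: pselect => // ex_b.
Qed.

HB.instance Definition _ := GRing.ComNzRing_hasMulInverse.Build Zp
  padic_mulVr padic_unitP padic_inv_out.

Fact padic_domain : GRing.integral_domain_axiom Zp.
Proof.
have nz a : a != 0 -> exists i, forall k, ~~ (p ^ i %| a (i + k))%N.
  move=> /eqP a0; have [i ai] : exists i, a i <> 0%N.
    apply/not_existsP => a0'; apply: a0; apply: padic_int_eq => n /=.
    by rewrite mod0n; apply: contrapT (a0' n).
  by exists i => k; rewrite /dvdn padic_res_mod; apply/eqP.
move=> a b ab0; apply/norP => -[/nz[i ai] /nz[j bj]].
have /= := congr1 (fun c : Zp => c (i + j)%N) ab0.
rewrite mod0n => /eqP; move: (ai j) (bj i); rewrite (addnC j i).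
set x := a _; set y := b _ => nx ny; rewrite -[_ == _]/(_ %| _)%N.
have pos z k : ~~ (p ^ k %| z)%N -> (0 < z)%N by case: z; rewrite ?dvdn0.
have [x0 y0] := (pos _ _ nx, pos _ _ ny).
rewrite pfactor_dvdn // in nx; rewrite pfactor_dvdn // in ny.
rewrite pfactor_dvdn ?muln_gt0 ?x0 // lognM //.
rewrite -!ltnNge in nx ny; apply/negP; rewrite -ltnNge -addSn.
by rewrite leq_add // ltnW.
Qed.

HB.instance Definition _ :=
  GRing.ComUnitRing_isIntegral.Build Zp padic_domain.

End PadicIntRing.

Definition padic (p : nat) (p_pr : prime p) := {fraction padic_int p_pr}.
HB.instance Definition _ p (p_pr : prime p) := GRing.Field.on (padic p_pr).

(* Series are given by their coefficients.  Each coefficient of a substitution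
   of series without constant term is computed on truncations, as it only
   depends on coefficients of no greater degree. *)

Definition fps (R : Type) := nat -> R.
Definition mfps (k : nat) (R : Type) := 'X_{1..k} -> R.

Section FormalPowerSeries.
Variable R : comNzRingType.

Definition fps_trunc (d : nat) (g : fps R) : {poly R} := \poly_(i < d) g i.

Definition fps_comp (f g : fps R) : fps R :=
  fun d => (fps_trunc d.+1 f \Po fps_trunc d.+1 g)`_d.

Definition mfps_trunc k (d : nat) (G : mfps k R) : {mpoly R[k]} :=
  \sum_(m : 'X_{1..k < d}) G m *: 'X_[m].

Definition mfps_comp n k (F : mfps n R) (G : n.-tuple (mfps k R)) : mfps k R :=
  fun m => let d := (mdeg m).+1 in
  (mfps_trunc d F \mPo [tuple of map (mfps_trunc d) G])@_m.

Definition fps_mcomp k (f : fps R) (G : mfps k R) : mfps k R :=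
  mfps_comp (fun m : 'X_{1..1} => f (mdeg m)) [tuple G].

Definition mfps0 k : mfps k R := fun=> 0.
Definition mfpsX k (i : 'I_k) : mfps k R := fun m => (m == U_(i)%MM)%:R.

(* The truncations of the inverse of f = X + ... under composition: if g is
   correct below degree d, the coefficient of 'X^d in f o (g + c 'X^d) is that
   of f o g plus c. *)
Fixpoint fps_inv_trunc (f : fps R) (d : nat) : {poly R} :=
  if d is d'.+1 then
    let g := fps_inv_trunc f d' in
    g + ('X`_d' - (fps_trunc d f \Po g)`_d')%:P * 'X^d'
  else 0.

Definition fps_inv (f : fps R) : fps R := fun d => (fps_inv_trunc f d.+1)`_d.

Definition is_formal_group (F : mfps 2 R) :=
  let X := mfpsX 0 : mfps 1 R in let O := @mfps0 1 in
  let X0 := mfpsX 0 : mfps 2 R in let X1 := mfpsX 1 : mfps 2 R in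
  let Y0 := mfpsX 0 : mfps 3 R in let Y1 := mfpsX 1 : mfps 3 R in
  let Y2 := mfpsX (inord 2) : mfps 3 R in
  [/\ mfps_comp F [tuple X; O] =1 X,
      mfps_comp F [tuple O; X] =1 X,
      mfps_comp F [tuple X1; X0] =1 F &
      mfps_comp F [tuple mfps_comp F [tuple Y0; Y1]; Y2]
        =1 mfps_comp F [tuple Y0; mfps_comp F [tuple Y1; Y2]]].

Definition is_logarithm (F : mfps 2 R) (f : fps R) :=
  [/\ f 0%N = 0, f 1%N = 1 &
      forall m, fps_mcomp f F m =
                fps_mcomp f (mfpsX 0) m + fps_mcomp f (mfpsX 1) m].

(* [a]_F = f^-1 (a f(X)), for f the logarithm of F. *)
Definition fg_mul (f : fps R) (a : R) : fps R :=
  fps_comp (fps_inv f) (fun d => a * f d).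

(* The action of the noncommutative series u = \sum_i u_i T^i, where
   T * g = g^phi('X^q).  For d > 0, T^i * g has no term of degree d if i > d
   (q > 1); the action is only used on series g without constant term. *)
Definition honda_T (q : nat) (phi : R -> R) (g : fps R) : fps R :=
  fun d => if (q %| d)%N then phi (g (d %/ q)%N) else 0.

Definition honda_act (q : nat) (phi : R -> R) (u g : fps R) : fps R :=
  fun d => \sum_(i < d.+1) u i * iter i (honda_T q phi) g d.

End FormalPowerSeries.

Section Integers.
Variables (p : nat) (p_pr : prime p) (E : fieldType).
(* The structure map of E as a Z_p-algebra; the ring of integers of E is the
   integral closure of Z_p. *)
Variable j : padic_int p_pr -> E.

Definition integer (x : E) : Prop := integralOver j x.

Definition integer_unit (x : E) : Prop :=
  integer x /\ exists2 y, integer y & x * y = 1.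

Definition maxideal (x : E) : Prop := integer x /\ ~ integer_unit x.

Definition padic_cvg (w : nat -> E) (l : E) : Prop :=
  forall N, exists k0, forall k, (k0 <= k)%N ->
    exists2 z, integer z & w k - l = p%:R ^+ N * z.

Definition padic_lim (w : nat -> E) : E :=
  if pselect (exists l, padic_cvg w l) is left ex_l then projT1 (cid ex_l)
  else 0.

Definition fps_eval (g : fps E) (x : E) : E :=
  padic_lim (fun d => (fps_trunc d g).[x]).

Definition mfps_eval k (G : mfps k E) (x : k.-tuple E) : E :=
  padic_lim (fun d => (mfps_trunc d G).@[tnth x]).

End Integers.

Section SubfieldIntegers.
Variables (p : nat) (p_pr : prime p) (Omega : fieldExtType (padic p_pr)).

Definition padic_int_in (a : padic_int p_pr) : Omega := (tofrac a : padic p_pr)%:A.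

Implicit Types E : {subfield Omega}.

Definition integer_of E (x : Omega) := x \in E /\ integer padic_int_in x.
Definition unit_of E (x : Omega) := x \in E /\ integer_unit padic_int_in x.
Definition maxideal_of E (x : Omega) := x \in E /\ maxideal padic_int_in x.

Definition is_uniformizer E (pi : Omega) :=
  forall x, maxideal_of E x <-> exists2 y, integer_of E y & x = pi * y.

(* Ramification index 1: p_E' is generated by the (principal) ideal p_E;
   residue field extensions are always separable here. *)
Definition unramified E E' :=
  forall x, maxideal_of E' x <->
    exists y z, [/\ maxideal_of E y, integer_of E' z & x = y * z].

(* O_E / p_E has q elements: r is a complete system of representatives. *)
Definition residue_card E (q : nat) :=
  exists r : 'I_q -> Omega,
    (forall i, integer_of E (r i)) /\
    (forall x, integer_of E x -> exists! i, maxideal_of E (x - r i)).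

End SubfieldIntegers.

Section Honda.
Variables (p : nat) (p_pr : prime p) (Omega : splittingFieldType (padic p_pr)).
Implicit Types (K : {subfield Omega}) (x y pi : Omega) (F : mfps 2 Omega).
Implicit Types (f u : fps Omega).

Definition is_frobenius K0 K (q : nat) (phi : gal_of K) :=
  phi \in ('Gal(K / K0))%g /\
  forall x, integer_of K x -> maxideal_of K (phi x - x ^+ q).

Definition is_honda_type K pi u :=
  u 0%N = pi /\ forall i, (0 < i)%N -> integer_of K (u i).

Definition type_height K u (h : nat) :=
  [/\ (0 < h)%N, unit_of K (u h) &
      forall i, (0 < i < h)%N -> ~ unit_of K (u i)].

(* F is a Honda formal group over O_K of type u, with logarithm f in K[[X]]. *)
Definition is_honda_group K pi (q : nat) (phi : gal_of K) u F f :=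
  [/\ is_formal_group F, (forall m, integer_of K (F m)),
      is_logarithm F f, (forall d, f d \in K) &
      forall d, exists2 y, integer_of K y & honda_act q phi u f d = pi * y].

Local Notation O := (@padic_int_in p p_pr Omega).

(* The group law of F(p_E), and [a]_F(x), for F with logarithm f. *)
Definition fg_add F x y : Omega := mfps_eval O F [tuple x; y].
Definition fg_act f (a x : Omega) : Omega := fps_eval O (fg_mul f a) x.

(* W_F^k, in an algebraic closure C. *)
Definition fg_torsion (C : fieldType) (iota : {rmorphism Omega -> C})
    f pi (k : nat) (z : C) : Prop :=
  maxideal (iota \o O) z /\
  fps_eval (iota \o O) (iota \o fg_mul f (pi ^+ k)) z = 0.

Definition fg_torsion_all (C : fieldType) (iota : {rmorphism Omega -> C})
    f pi (z : C) : Prop :=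
  exists2 k, (1 <= k)%N & fg_torsion iota f pi k z.

End Honda.

Section GroupRing.
Variables (R : nzRingType) (gT : finGroupType).
Implicit Types a b : {ffun gT -> R}.

(* An element \sum_g a_g g of R[gT] is the function g |-> a_g. *)
Definition gr_monom (c : R) (g : gT) : {ffun gT -> R} :=
  [ffun x => if x == g then c else 0].

Definition gr_mul a b : {ffun gT -> R} :=
  [ffun g => \sum_t a t * b (t^-1 * g)%g].

(* a lies in A[G], for A a subring of R. *)
Definition in_group_ring (A : R -> Prop) (G : {set gT}) a :=
  forall g, A (a g) /\ (g \notin G -> a g = 0).

Definition gr_basis (I : finType) (i : I) a : {ffun I -> {ffun gT -> R}} :=
  [ffun k => if k == i then a else 0].

End GroupRing.

Section GaloisModule.
Variables (p : nat) (p_pr : prime p) (Omega : splittingFieldType (padic p_pr)).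
Variables (M : {subfield Omega}) (G : {set gal_of M}).
Variables (F : mfps 2 Omega) (f : fps Omega).

(* (\sum_g a_g g) . x = \sum_g [a_g]_F (g x), the outer sum being for F; as
   (g * g') x = g' (g x), this is a left action only for commutative G. *)
Definition fg_gact (a : {ffun gal_of M -> Omega}) (x : Omega) : Omega :=
  \big[fg_add F/0]_(g in G) fg_act f (a g) (g x).

Definition fg_lincomb (I : finType) (c : {ffun I -> {ffun gal_of M -> Omega}})
    (x : I -> Omega) : Omega :=
  \big[fg_add F/0]_i fg_gact (c i) (x i).

End GaloisModule.

(* The indices of the generators theta_j (1 <= j <= r), xi_i and omega_i
   (1 <= i <= h). *)
Definition gen_index (r h : nat) : finType := ('I_r + ('I_h + 'I_h))%type.
Definition xi_index r h (i : 'I_h) : gen_index r h := inr (inl i).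
Definition omega_index r h (i : 'I_h) : gen_index r h := inr (inr i).

Definition gens (T : Type) r h (theta : 'I_r -> T) (xi omega : 'I_h -> T)
    (i : gen_index r h) : T :=
  match i with
  | inl k => theta k
  | inr (inl k) => xi k
  | inr (inr k) => omega k
  end.

(* pi^s e_(xi_i) - (sigma - 1) e_(omega_i) *)
Definition gen_rel (R : nzRingType) (gT : finGroupType) r h
    (pi : R) (s : nat) (sigma : gT) (i : 'I_h) :
    {ffun gen_index r h -> {ffun gT -> R}} :=
  gr_basis (xi_index r i) (gr_monom (pi ^+ s) 1%g)
  - gr_basis (omega_index r i) (gr_monom 1 sigma - gr_monom 1 1%g).

(* Main.v *)
From HB Require Import structures.
Require Import Defs.
From mathcomp Require Import all_boot all_order all_fingroup all_algebra.
From mathcomp Require Import all_solvable all_field.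
From mathcomp Require Import mpoly boolp ring zify.

(* Write R for the ring of integers of K0, A for F(p_M), B for F(p_L), which is
   the submodule of A fixed by sigma, and N for the norm of A over B.  As M/L is
   unramified, O_M has an element of trace one, and successive approximation
   along the powers of the maximal ideal shows that N(A) = B and that the kernel
   of N is (sigma - 1)A.  Since [pi^k](x) is close to pi^k x for small x, B has
   rank n over R.  The type of F gives the shape of [pi](X), and Weierstrass
   preparation for [pi](X) - y shows that the fibers of [pi] over the points
   killed by pi^(s-1) have q^h elements, all of them in L; hence the torsion of A
   is (R/pi^s)^h, with a basis zeta_i.  Valuations of a nonzero point killed by
   pi give h <= n.

   Choose xi_i with N(xi_i) = zeta_i.  As N(pi^s xi_i) = 0, there is omega_i with
   pi^s xi_i = (sigma - 1) omega_i.  The norms of the omega_i are independent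
   modulo pi and the torsion, hence they are completed by norms of elements
   theta_j to a basis of B modulo its torsion.  These elements generate A modulo
   sigma - 1, and every relation between them is a combination of the given ones
   modulo sigma - 1.  This lifts to A because sigma has order a power of p, so
   that a power of sigma - 1 is divisible by pi. *)

Set Implicit Arguments.
Unset Strict Implicit.
Unset Printing Implicit Defensive.

Import GRing.Theory.
Local Open Scope ring_scope.

(** * Complete discrete valuation rings *)

(** The group ring enters as [R[X] / (X ^ Q - 1)], with [Q = p ^ m] and [X] acting as [sigma]. Two
    congruences modulo [p] carry the argument: [(X - 1) ^ Q] is [X ^ Q - 1], which converts
    statements modulo [sigma - 1] into statements modulo [pi], and [1 + X + ... + X ^ (Q - 1)] is
    [(X - 1) ^ (Q - 1)], which allows a torsion norm to be divided by [pi] and so makes the norms of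
    the [omega_i] independent.

    The series [[a](X)] is defined through the logarithm, which has denominators, so its integrality
    is itself a theorem: the congruence [u * f = 0] modulo [pi] gives it degree by degree, together
    with the reduction of [[pi](X)]. Identities between series are checked over the field, where the
    logarithm can be cancelled, as congruences of polynomials modulo [X ^ d]; only then are they
    evaluated at points.

    The hypothesis on [W_F] acts twice: it brings the points of the closure in the fibers of [[pi]]
    into [A], and it makes the torsion of [A] fixed by [sigma] with exponent [pi ^ s]. The bound on
    the height is [h <= q ^ h - 1 <= e <= n], with [e] the ramification index. *)

Record cdvr (R : comNzRingType) (w : R) : Prop := Cdvr {
  cdvr_dich : forall a, (exists b, a = w * b) \/ (exists b, a * b = 1);
  cdvr_sep : forall a, (forall k, exists b, a = w ^+ k * b) -> a = 0;
  cdvr_lim : forall a : nat -> R, exists l, forall k, exists b,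
    l = \sum_(i < k) a i * w ^+ i + w ^+ k * b;
  cdvr_reg : forall a, w * a = 0 -> a = 0;
  cdvr_nonunit : forall b, w * b <> 1 }.

(** Gaussian elimination without division: a pivot [v i0 0] clears the first coordinate of the other
    vectors by cross-multiplication, and its own coefficient is recovered at the end. Without a
    pivot one vector is dropped and the first coordinate ignored. *)
Lemma domain_dependence (R : comNzRingType) :
    (forall a b : R, a * b = 0 -> a = 0 \/ b = 0) ->
  forall n (v : 'I_n.+1 -> 'I_n -> R), exists a : 'I_n.+1 -> R,
    (exists i, a i <> 0) /\ forall j, \sum_i a i * v i j = 0.
Proof.
move=> dom; elim=> [|n IH] v.
  exists (fun=> 1); split; last by case.
  by exists ord0; apply/eqP; rewrite oner_eq0.
have [[i0 v0]|allz] := pselect (exists i, v i ord0 <> 0); last first.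
  have z i : v i ord0 = 0 by apply: contrapT => vi; apply: allz; exists i.
  have [a [[i ai] aP]] := IH (fun i j => v (lift ord0 i) (lift ord0 j)).
  exists (fun i => oapp a 0 (unlift ord0 i)); split.
    by exists (lift ord0 i); rewrite liftK.
  move=> j; case: (unliftP ord0 j) => [j'|] ->; last first.
    by apply: big1 => k _; rewrite z mulr0.
  rewrite big_ord_recl unlift_none mul0r add0r -[RHS](aP j').
  by apply: eq_bigr => k _; rewrite liftK.
have [a [[i ai] aP]] := IH (fun i j => v i0 ord0 * v (lift i0 i) (lift ord0 j)
   - v (lift i0 i) ord0 * v i0 (lift ord0 j)).
exists (fun i => oapp (fun k => v i0 ord0 * a k)
   (- \sum_k a k * v (lift i0 k) ord0) (unlift i0 i)); split.
  by exists (lift i0 i); rewrite liftK /= => /dom[].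
move=> j; rewrite (bigD1_ord i0) //= unlift_none /=.

under [X in _ + X]eq_bigr do rewrite liftK /=.
case: (unliftP ord0 j) => [j'|] ->; last first.
  rewrite mulNr mulr_suml addrC -sumrB big1 // => k _; ring.
rewrite mulNr mulr_suml addrC -sumrB -[RHS](aP j').
by apply: eq_bigr => k _; ring.
Qed.

Section Cdvr.
Variables (R : comNzRingType) (w : R) (cd : cdvr w).

Lemma cdvr_factor a : a <> 0 -> exists k u v, a = w ^+ k * u /\ u * v = 1.
Proof.
move=> a0; apply: contrapT => H; apply: a0; apply: (cdvr_sep cd).
elim=> [|k [b E]]; first by exists a; rewrite mul1r.
have [[c Ec]|[v uv]] := cdvr_dich cd b.
  by exists c; rewrite E Ec exprSr mulrA.
by case: H; exists k, b, v.
Qed.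

Lemma cdvr_regX k a : w ^+ k * a = 0 -> a = 0.
Proof.
elim: k => [|k IH]; first by rewrite mul1r.
by rewrite exprS -mulrA => /(cdvr_reg cd).
Qed.

Lemma cdvr_domain (a b : R) : a * b = 0 -> a = 0 \/ b = 0.
Proof.
have [->|/eqP a0] := eqVneq a 0; first by left.
have [k [u [v [-> uv]]]] := cdvr_factor a0 => E; right.
have /cdvr_regX ub : w ^+ k * (u * b) = 0 by rewrite mulrA.
by rewrite -[b]mul1r -uv mulrAC ub mul0r.
Qed.

Lemma cdvr_unitN a b c : a * b = 1 -> a <> w * c.
Proof. by move=> ab E; apply: (cdvr_nonunit cd (b := c * b)); rewrite mulrA -E. Qed.

(** By separatedness a nonzero entry bounds the powers of [w] dividing the whole family; dividing by
    the largest one leaves a unit somewhere. Relations are made primitive in this way before being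
    reduced modulo [w]. *)
Lemma cdvr_primitive (a : nat -> R) n i : (i < n)%N -> a i <> 0 ->
  exists k a', (forall j, (j < n)%N -> a j = w ^+ k * a' j) /\
    exists j b, (j < n)%N /\ a' j * b = 1.
Proof.
move=> ltin ai; apply: contrapT => H; apply: ai; apply: (cdvr_sep cd) => k.
suff: exists a', forall j, (j < n)%N -> a j = w ^+ k * a' j.
  by case=> a' /(_ i ltin) ->; exists (a' i).
elim: k => [|k [a' E]]; first by exists a => j _; rewrite mul1r.
have D j : exists c, (j < n)%N -> a' j = w * c.
  have [[b ab]|[b ab]] := cdvr_dich cd (a' j); first by exists b.
  by exists 0 => ltj; case: H; exists k, a'; split=> //; exists j, b.
have [a'' E''] := choice D.
by exists a'' => j ltj; rewrite E // E'' // exprSr mulrA.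
Qed.

Lemma cdvr_dependence n (v : nat -> nat -> R) : exists a : nat -> R,
  (exists i, (i <= n)%N /\ a i <> 0) /\
  forall j, (j < n)%N -> \sum_(i < n.+1) a i * v i j = 0.
Proof.
have [a [[i ai] aP]] := domain_dependence cdvr_domain
  (fun (i : 'I_n.+1) (j : 'I_n) => v i j).
exists (fun k => a (inord k)); split.
  by exists i; rewrite inord_val -ltnS.
move=> j ltj; rewrite -[RHS](aP (Ordinal ltj)).
by apply: eq_bigr => k _; rewrite inord_val.
Qed.

(** Successive approximation in which only the coefficients converge. As [V] is not assumed
    complete, the conclusion keeps an error term [w ^ k] times another combination of the [v j];
    each use disposes of it by its own separatedness. *)
Lemma complete_generation (V : lmodType R) r (v : nat -> V)
    (Vf : nat -> V -> Prop) :
    (forall k x, Vf k x -> exists a : nat -> R,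
       Vf k.+1 (x - \sum_(j < r) (a j * w ^+ k) *: v j)) ->
  forall x, Vf 0%N x -> exists a : nat -> R, forall k, exists c : nat -> R,
    Vf k (x - \sum_(j < r) a j *: v j + w ^+ k *: \sum_(j < r) c j *: v j).
Proof.
move=> step x x0.
have step' (kx : nat * V) : exists a : nat -> R, Vf kx.1 kx.2 ->
    Vf kx.1.+1 (kx.2 - \sum_(j < r) (a j * w ^+ kx.1) *: v j).
  have [H|H] := pselect (Vf kx.1 kx.2); last by exists (fun=> 0) => /H.
  by have [a Ha] := step _ _ H; exists a.
have [al alP] := choice step'.
(* [X k] is the remainder after [k] corrections, and the coefficients chosen at stage [k] are the
   [w]-adic digits of index [k] of the limits. *)
pose X := fix X k := if k is k'.+1 then
  X k' - \sum_(j < r) (al (k', X k') j * w ^+ k') *: v j else x.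
have XP k : Vf k (X k) by elim: k => //= k /(alP (k, X k)).
have XE k : X k =
    x - \sum_(j < r) (\sum_(i < k) al (val i, X i) j * w ^+ i) *: v j.
  elim: k => [|k IH] /=.
    by rewrite big1 ?subr0 // => j _; rewrite big_ord0 scale0r.
  rewrite {1}IH -addrA -opprD -big_split /=; congr (_ - _).
  by apply: eq_bigr => j _; rewrite big_ord_recr /= scalerDl.
have lim j := cdvr_lim cd (fun i => al (i, X i) j).
have [a aP] := choice lim.
exists a => k; have [c cP] := choice (fun j => aP j k); exists c.
have -> : x - \sum_(j < r) a j *: v j + w ^+ k *: (\sum_(j < r) c j *: v j)
    = X k; last exact: XP.
rewrite XE -addrA; congr (_ + _); rewrite scaler_sumr addrC -sumrB -sumrN.
apply: eq_bigr => j _; rewrite {1}(cP j) scalerA -scalerBl -scaleNr.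
by congr (_ *: _); ring.
Qed.

(** * Weierstrass preparation *)

Section Weierstrass.
Variables (g : nat -> R) (N : nat).
Hypothesis g_low : forall i, (i < N)%N -> exists b, g i = w * b.
Hypothesis g_unit : exists v, g N * v = 1.

(** The series [g N + g (N + 1) X + ...] has a unit constant term, so it can be divided by: the
    coefficients of [S] are found one after the other, as a list of growing length. *)
Lemma triangular_solve (c : nat -> R) :
  exists S : nat -> R, forall e, \sum_(i < e.+1) S i * g (N + (e - i)) = c e.
Proof.
have [v gv] := g_unit.
pose lst := fix lst n := if n is n'.+1 then let s := lst n' in
  rcons s (v * (c n' - \sum_(i < n') s`_i * g (N + (n' - i)))) else [::].
have sz n : size (lst n) = n by elim: n => //= n IH; rewrite size_rcons IH.
have coh n i : (i < n)%N -> (lst n)`_i = (lst i.+1)`_i.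
  elim: n => // n IH; rewrite ltnS leq_eqVlt => /orP[/eqP-> //|lt].
  by rewrite [lst n.+1]/= nth_rcons sz lt IH.
exists (fun e => (lst e.+1)`_e) => e; rewrite big_ord_recr /=.
rewrite [(rcons _ _)`_e]nth_rcons sz ltnn eqxx subnn addn0 mulrAC [v * _]mulrC gv mul1r.
rewrite (_ : \sum_(i < e) _ = \sum_(i < e) (lst e)`_i * g (N + (e - i))).
  by rewrite addrCA subrr addr0.
by apply: eq_bigr => i _; rewrite (coh e i).
Qed.

(** Write [g] as [w] times a polynomial of degree below [N] plus [X ^ N] times an invertible series.
    Asking that [Q * g] have coefficient one in degree [N] and zero above is an equation for [Q]
    that contracts modulo [w]; its solution is a [w]-adic series with terms [q k * w ^ k]. *)
Lemma weierstrass_preparation : exists (Q : nat -> R) (D : {poly R}),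
  [/\ D \is monic, size D = N.+1, forall i, (i < N)%N -> exists b, D`_i = w * b,
      forall d, D`_d = \sum_(i < d.+1) Q i * g (d - i) & exists v, Q 0%N * v = 1].
Proof.
have [sol solP] := choice triangular_solve.
have gl' i : exists b, (i < N)%N -> g i = w * b.
  by case: (ltnP i N) => [/g_low[b E]|_]; [exists b|exists 0].
have [g' g'P] := choice gl'.
(* The contribution of the low coefficients of [g], divided by [w], to the coefficient of degree
   [N + e] of [S * g]; below, [conv S e] is that whole coefficient. *)
pose La (S : nat -> R) e := \sum_(j < N) S (e + N - j)%N * g' j.
pose q := fix q k := if k is k'.+1 then sol (fun e => - La (q k') e)
  else sol (fun e => (e == 0)%:R).
have lim i := cdvr_lim cd (fun k => q k i).
have [Q QP] := choice lim.
pose conv (S : nat -> R) e := \sum_(i < e.+1) S i * g (N + (e - i))%N + w * La S e.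
(* The partial sums telescope: the error left by the term [q K] is what [q K.+1] is chosen to
   cancel. *)
have cq K e : conv (fun i => \sum_(k < K.+1) q k i * w ^+ k) e
    = (e == 0)%:R + w ^+ K.+1 * La (q K) e.
  have linL (S S' : nat -> R) a :
      La (fun i => S i + S' i * a) e = La S e + La S' e * a.
    by rewrite /La mulr_suml -big_split; apply: eq_bigr => j _ /=; ring.
  have linC (S S' : nat -> R) a :
      conv (fun i => S i + S' i * a) e = conv S e + conv S' e * a.
    rewrite /conv linL (_ : \sum_(i < e.+1) _ = \sum_(i < e.+1) S i * g (N + (e - i))
        + (\sum_(i < e.+1) S' i * g (N + (e - i))) * a); first ring.
    by rewrite mulr_suml -big_split; apply: eq_bigr => j _ /=; ring.
  elim: K => [|K IH].
    have -> : (fun i => \sum_(k < 1) q k i * w ^+ k) = q 0%N.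
      by apply/funext => i; rewrite big_ord1 expr0 mulr1.
    by rewrite /conv [q _]/= solP expr1.
  have -> : (fun i => \sum_(k < K.+2) q k i * w ^+ k) =
      (fun i => \sum_(k < K.+1) q k i * w ^+ k + q K.+1 i * w ^+ K.+1).
    by apply/funext => i; rewrite big_ord_recr.
  rewrite linC IH /conv [q K.+1]/= solP [w ^+ K.+2]exprS; ring.
have cQ e : conv Q e = (e == 0)%:R.
  apply/eqP; rewrite -subr_eq0; apply/eqP/(cdvr_sep cd) => K.
  have [b bP] := choice (fun i => QP i K.+1).
  have -> : conv Q e = conv (fun i => \sum_(k < K.+1) q k i * w ^+ k) e
      + w ^+ K.+1 * conv b e.
    rewrite /conv /La !mulrDr !mulr_sumr addrACA -!big_split /=.
    congr (_ + _); apply: eq_bigr => j _; rewrite bP; ring.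
  exists (w * La (q K) e + w * conv b e); rewrite cq exprSr; ring.
have prodE e : \sum_(i < (N + e).+1) Q i * g (N + e - i)%N = (e == 0)%:R.
  rewrite -cQ /conv -addnS addnC big_split_ord /=.
  congr (_ + _).
    by apply: eq_bigr => i _; rewrite addnBA // -ltnS.
  rewrite /La mulr_sumr (reindex_inj rev_ord_inj) /=.
  apply: eq_bigr => j _; have jN := ltn_ord j.
  rewrite (_ : (e.+1 + (N - j.+1) = e + N - j)%N); last by lia.
  rewrite (_ : (N + e - (e + N - j) = j)%N); last by lia.
  by rewrite g'P // mulrA [_ * w]mulrC mulrA.
pose D := \poly_(d < N.+1) \sum_(i < d.+1) Q i * g (d - i)%N.
have DE d : D`_d = \sum_(i < d.+1) Q i * g (d - i)%N.
  rewrite coef_poly; case: ltnP => // /subnKC <-.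
  by rewrite addSnnS prodE.
have DN : D`_N = 1 by rewrite DE; have := prodE 0%N; rewrite addn0 => ->.
have szD : size D = N.+1.
  apply/eqP; rewrite eqn_leq size_poly /= ltnNge; apply/negP => /(nth_default 0).
  by rewrite DN => /eqP; rewrite oner_eq0.
have dlow d : (d < N)%N -> exists b, D`_d = w * b.
  move=> ltd; rewrite DE; exists (\sum_(i < d.+1) Q i * g' (d - i)%N).
  rewrite mulr_sumr; apply: eq_bigr => i _; rewrite g'P; first ring.
  by rewrite (leq_ltn_trans (leq_subr _ _)).
exists Q, D; split=> //; first by rewrite monicE lead_coefE szD DN.
have [[b E]|//] := cdvr_dich cd (Q 0%N).
have := cQ 0%N; rewrite /conv big_ord1 E => C.
by case: (cdvr_nonunit cd (b := b * g (N + (0 - 0)) + La Q 0%N)); rewrite mulrDr mulrA C.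
Qed.

(** Divisibility of all [H i] by [w ^ k] improves to [w ^ k.+1]. In the coefficient of degree
    [N + i] of [H * g], the terms [H j] with [j > i] meet a low coefficient of [g], divisible by
    [w], and those with [j < i] are covered by induction on [i]; only [H i * g N] remains, with
    [g N] a unit. *)
Lemma weierstrass_uniqueness (H : nat -> R) :
    (forall d, (N <= d)%N -> \sum_(i < d.+1) H i * g (d - i)%N = 0) ->
  forall i, H i = 0.
Proof.
move=> H0 i; apply: (cdvr_sep cd) => k; elim: k i => [|k IH] i.
  by exists (H i); rewrite mul1r.
have [H' H'P] := choice IH; have [v gv] := g_unit.
elim/ltn_ind: i => i IHi.
have := H0 (N + i)%N (leq_addr _ _); rewrite (bigD1 (inord i)) //=.
have li : (i < (N + i).+1)%N by rewrite ltnS leq_addl.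
rewrite inordK // addnK => /eqP; rewrite addr_eq0 => /eqP E.
suff [b Eb] : exists b, \sum_(j < (N + i).+1 | j != inord i)
    H j * g (N + i - j)%N = w ^+ k.+1 * b.
  by exists (- b * v); rewrite -[H i]mulr1 -gv mulrA E Eb; ring.
elim/big_ind: _ => [|x y [bx ->] [by_ ->]|j ji]; first by exists 0; rewrite mulr0.
  by exists (bx + by_); rewrite mulrDr.
have [ltji|leij] := ltnP j i.
  by have [b ->] := IHi j ltji; exists (b * g (N + i - j)); rewrite mulrA.
have ltij : (i < j)%N.
  by rewrite ltn_neqAle leij andbT; apply: contra ji => ij;
    rewrite -val_eqE /= inordK // eq_sym.
have [|b ->] := g_low (i := (N + i - j)%N).
  by have := ltn_ord j; lia.
by exists (H' j * b); rewrite H'P exprSr; ring.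
Qed.

End Weierstrass.

(** Preparation gives only a series [Q] with [Q * P = D]. With [S] the quotient of the division of
    [P] by [D], the series [1 - S * Q] times [P] is the remainder, of degree below [N]; by
    uniqueness this series is zero, and so is the remainder. *)
Lemma weierstrass_factor (P : {poly R}) N :
    (forall i, (i < N)%N -> exists b, P`_i = w * b) ->
    (exists v, P`_N * v = 1) ->
  exists D S : {poly R}, [/\ P = D * S, D \is monic, size D = N.+1 &
    forall i, (i < N)%N -> exists b, D`_i = w * b].
Proof.
move=> low uni; have [Q [D [mD sD lD DE _]]] := weierstrass_preparation low uni.
exists D, (Pdiv.Ring.rdivp P D); split=> //.
set S := Pdiv.Ring.rdivp P D; have PE := Pdiv.RingMonic.rdivp_eq mD P.
pose Qd d := \poly_(i < d.+1) Q i.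
have QdE d e : (e <= d)%N -> (Qd d * P)`_e = D`_e.
  move=> led; rewrite coefM DE; apply: eq_bigr => i _; rewrite coef_poly.
  by rewrite (leq_trans (ltn_ord i)).
pose H i := (1 - S * Qd i)`_i.
have H0 : forall i, H i = 0.
  apply: (weierstrass_uniqueness low uni) => d led.
  transitivity (((1 - S * Qd d) * P)`_d).
    rewrite coefM; apply: eq_bigr => i _; congr (_ * _).
    rewrite /H !coefB; congr (_ - _); rewrite !coefM; apply: eq_bigr => j _.
    have ij : (i - j <= i)%N by rewrite leq_subr.
    by rewrite !coef_poly !ltnS ij (leq_trans ij) // -ltnS.
  rewrite mulrBl mul1r coefB -mulrA [in X in _ - X]coefM.
  under [X in _ - X]eq_bigr do rewrite QdE ?leq_subr //.
  rewrite -coefM {1}PE addrC coefD addKr.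
  apply: nth_default; rewrite (leq_trans _ led) // -ltnS -sD.
  by rewrite Pdiv.Ring.ltn_rmodp monic_neq0.
apply/polyP => d; rewrite mulrC.
rewrite {1}PE coefD -[RHS]addr0; congr (_ + _).
have [led|ltd] := leqP N d.
  apply: nth_default; rewrite (leq_trans _ led) // -ltnS -sD.
  by rewrite Pdiv.Ring.ltn_rmodp monic_neq0.
have -> : (Pdiv.Ring.rmodp P D)`_d = ((1 - S * Qd d) * P)`_d.
  rewrite mulrBl mul1r coefB -mulrA [in X in _ - X]coefM.
  under [X in _ - X]eq_bigr do rewrite QdE ?leq_subr //.
  by rewrite -coefM {2}PE addrC coefD addKr.
rewrite coefM big1 // => i _.
suff -> : (1 - S * Qd d)`_i = H i by rewrite H0 mul0r.
rewrite /H !coefB; congr (_ - _); rewrite !coefM; apply: eq_bigr => j _.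
have ij : (i - j <= i)%N by rewrite leq_subr.
by rewrite !coef_poly !ltnS ij (leq_trans ij) // -ltnS.
Qed.

(** * Submodules and bases modulo torsion *)

Section Modules.
Variable V : lmodType R.
Implicit Types (B D T : V -> Prop).

Definition submod B := B 0 /\ forall a x y, B x -> B y -> B (a *: x + y).

Lemma submod_sum B n (a : nat -> R) (x : nat -> V) : submod B ->
  (forall i, (i < n)%N -> B (x i)) -> B (\sum_(i < n) a i *: x i).
Proof.
case=> B0 BD; elim: n => [|n IH] Bx; first by rewrite big_ord0.
rewrite big_ord_recr /= addrC; apply: BD; first exact: Bx.
by apply: IH => i lin; apply: Bx; apply: ltnW.
Qed.

Lemma submodD B x y : submod B -> B x -> B y -> B (x + y).
Proof. by case=> _ BD Bx By; rewrite -[x]scale1r; apply: BD. Qed.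

Lemma submodZ B a x : submod B -> B x -> B (a *: x).
Proof. by case=> B0 BD Bx; rewrite -[_ *: _]addr0; apply: BD. Qed.

Lemma submodN B x : submod B -> B x -> B (- x).
Proof. by move=> BS Bx; rewrite -scaleN1r; apply: submodZ. Qed.

Lemma submodB B x y : submod B -> B x -> B y -> B (x - y).
Proof. by move=> BS Bx By; apply: submodD => //; apply: submodN. Qed.

(** When [D] contains [w] times the submodule at hand, this is linear independence over the residue
    field in the quotient by [D]. The residue field itself is never formed. *)
Definition pi_indep D r (x : nat -> V) := forall a : nat -> R,
  D (\sum_(i < r) a i *: x i) -> forall i, (i < r)%N -> exists b, a i = w * b.

Definition rcons_family r (x : nat -> V) z i := if (i < r)%N then x i else z.

Lemma sum_rcons_family r x z (a : nat -> R) :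
  \sum_(i < r.+1) a i *: rcons_family r x z i
  = \sum_(i < r) a i *: x i + a r *: z.
Proof.
rewrite big_ord_recr /= {2}/rcons_family ltnn; congr (_ + _).
by apply: eq_bigr => i _; rewrite /rcons_family ltn_ord.
Qed.

(** A family of maximal length spans modulo [D]: if appending [z] destroys independence, some
    relation has a unit coefficient at [z] and can be solved for it. The bound [n] ensures that a
    maximal length exists. *)
Lemma extend_pi_indep B D h x n : submod B -> submod D ->
    (forall y, B y -> D (w *: y)) ->
    (forall i, (i < h)%N -> B (x i)) -> pi_indep D h x ->
    (forall r y, (forall i, (i < r)%N -> B (y i)) -> pi_indep D r y -> (r <= n)%N) ->
  exists r y, [/\ (h <= r)%N, forall i, (i < h)%N -> y i = x i,
    forall i, (i < r)%N -> B (y i), pi_indep D r y &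
    forall z, B z -> exists a : nat -> R, D (z - \sum_(i < r) a i *: y i)].
Proof.
move=> BS DS wBD Bx ix bnd.
pose P r := exists y, [/\ (h <= r)%N, forall i, (i < h)%N -> y i = x i,
  forall i, (i < r)%N -> B (y i) & pi_indep D r y].
have Ph : P h by exists x.
have bP r : `[< P r >] -> (r <= n)%N by move=> /asboolP[y [_ _ By iy]]; apply: bnd By iy.
have [|r /asboolP[y [hr yx By iy]] rmax] := ex_maxnP _ bP.
  by exists h; apply/asboolP.
exists r, y; split=> // z Bz; apply: contrapT => Hz.
suff : P r.+1 by move=> /asboolP/rmax; rewrite ltnn.
exists (rcons_family r y z); split; first exact: leqW.
- by move=> i ih; rewrite /rcons_family (leq_trans ih hr) yx.
- by move=> i _; rewrite /rcons_family; case: ifP => // /By.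
move=> a; rewrite sum_rcons_family => Da.
have [[b Eb]|[b Eb]] := cdvr_dich cd (a r).
  move=> i; rewrite ltnS leq_eqVlt => /orP[/eqP->|]; first by exists b.
  apply: iy; rewrite -[X in D X](addrK (a r *: z)); apply: submodB Da _ => //.
  by rewrite Eb mulrC -scalerA; apply: submodZ => //; apply: wBD.
case: Hz; exists (fun i => - (b * a i)).
rewrite -[X in X - _]scale1r -Eb mulrC -scalerA -sumrN.
rewrite (_ : _ + _ = b *: (\sum_(i < r) a i *: y i + a r *: z)); last first.
  rewrite scalerDr addrC scaler_sumr; congr (_ + _).
  by apply: eq_bigr => i _; rewrite scaleNr opprK scalerA.
exact: submodZ.
Qed.

Section Free.
Variables (B T : V -> Prop) (BS : submod B) (TS : submod T).
Hypothesis TB : forall x, T x -> B x.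
Hypothesis T_tf : forall x, B x -> T (w *: x) -> T x.
Hypothesis T_sep : forall x, B x ->
  (forall k, exists2 y, B y & T (x - w ^+ k *: y)) -> T x.

Definition indep_mod r (x : nat -> V) := forall a : nat -> R,
  T (\sum_(i < r) a i *: x i) -> forall i, (i < r)%N -> a i = 0.

Let D x := exists2 y, B y & T (x - w *: y).

(** As [B / T] has no [w]-torsion, a nontrivial relation modulo [T] can be divided by a power of [w]
    until one coefficient is a unit, against independence modulo [w]. *)
Lemma pi_indep_free r x : (forall i, (i < r)%N -> B (x i)) ->
  pi_indep D r x -> indep_mod r x.
Proof.
move=> Bx ix a Ta i ir; apply: contrapT => ai.
have [k [a' [aE [j [b [jr jb]]]]]] := cdvr_primitive ir ai.
have Ta' : T (\sum_(i < r) a' i *: x i).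
  have: T (w ^+ k *: \sum_(i < r) a' i *: x i).
    rewrite scaler_sumr; congr T: Ta; apply: eq_bigr => l _.
    by rewrite aE // scalerA.
  elim: k {aE} => [|k IH]; first by rewrite scale1r.
  rewrite exprS -scalerA => H; apply: IH; apply: T_tf H.
  by apply: submodZ => //; exact: (submod_sum a' BS Bx).
suff [c E] : exists c, a' j = w * c by exact: (cdvr_unitN jb E).
by apply: (ix a') => //; exists 0; [case: BS|rewrite scaler0 subr0].
Qed.

(** Nakayama's lemma over a complete ring: a family that is a basis of [B / T] modulo [w] is a basis
    of [B / T]. The rank is given by an upper and a lower bound on independent families, because
    freeness is part of what is proved. *)
Lemma free_extension n h x :
    (forall i, (i < h)%N -> B (x i)) -> pi_indep D h x ->
    (forall y, (forall i, (i <= n)%N -> B (y i)) -> ~ indep_mod n.+1 y) ->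
    (exists2 y, forall i, (i < n)%N -> B (y i) & indep_mod n y) ->
  (h <= n)%N /\ exists y, [/\ forall i, (i < h)%N -> y i = x i,
    forall i, (i < n)%N -> B (y i), indep_mod n y &
    forall z, B z -> exists a : nat -> R, T (z - \sum_(i < n) a i *: y i)].
Proof.
move=> Bx ix ub [y0 By0 iy0].
have DS : submod D.
  split; first by exists 0; [case: BS|rewrite scaler0 subr0; case: TS].
  move=> a u v [u' Bu Tu] [v' Bv Tv]; exists (a *: u' + v'); first by case: BS => _; apply.
  have -> : a *: u + v - w *: (a *: u' + v') = a *: (u - w *: u') + (v - w *: v').
    by rewrite scalerDr scalerBr !scalerA mulrC opprD addrACA.
  by case: TS => _; apply.
have wD y : B y -> D (w *: y) by exists y => //; rewrite subrr; case: TS.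
have bnd r y : (forall i, (i < r)%N -> B (y i)) -> pi_indep D r y -> (r <= n)%N.
  move=> By /(pi_indep_free By) iy; rewrite leqNgt; apply/negP => nr.
  apply: (ub y) => [i ni|a Ta i ni]; first by apply: By; apply: leq_trans nr.
  pose a' i := if (i <= n)%N then a i else 0.
  have := iy a' _ i (leq_trans ni nr); rewrite /a' -ltnS ni; apply.
  rewrite -(subnKC nr) big_split_ord /= [X in _ + X]big1 => [|j _]; last first.
    by rewrite leqNgt ltnS leq_addr scale0r.
  rewrite addr0; congr T: Ta; apply: eq_bigr => j _.
  by rewrite -ltnS ltn_ord.
have [r [y [hr yx By iy geny]]] := extend_pi_indep BS DS wD Bx ix bnd.
have gen z : B z -> exists a : nat -> R, T (z - \sum_(i < r) a i *: y i).
  pose Vf k x := exists2 u, B u & T (x - w ^+ k *: u).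
  have step k u : Vf k u -> exists a : nat -> R,
      Vf k.+1 (u - \sum_(j < r) (a j * w ^+ k) *: y j).
    case=> u' Bu Tu; have [a [u'' Bu'' Tu'']] := geny _ Bu.
    exists a, u'' => //.
    rewrite (_ : _ - _ = (u - w ^+ k *: u') +
        w ^+ k *: (u' - \sum_(i < r) a i *: y i - w *: u'')).
      by apply: submodD => //; apply: submodZ.
    rewrite !scalerBr scaler_sumr exprSr scalerA.
    rewrite (eq_bigr (fun j : 'I_r => w ^+ k *: (a j *: y j))) => [|j _]; last first.
      by rewrite scalerA mulrC.
    by rewrite !addrA subrK.
  move=> Bz; have [a aP] : exists a : nat -> R, forall k, exists c : nat -> R,
      Vf k (z - \sum_(j < r) a j *: y j + w ^+ k *: \sum_(j < r) c j *: y j).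
    apply: (complete_generation step); exists z => //.
    by rewrite scale1r subrr; case: TS.
  exists a; apply: T_sep.
    by apply: submodB => //; exact: (submod_sum a BS By).
  move=> k; have [c [u Bu Tu]] := aP k.
  exists (u - \sum_(j < r) c j *: y j).
    by apply: submodB => //; exact: (submod_sum c BS By).
  by rewrite scalerBr opprB addrA addrAC [_ - _ + _]addrAC; congr T: Tu; rewrite addrAC.
have rn := bnd _ _ By iy.
have nr : (n <= r)%N.
  rewrite leqNgt; apply/negP => ltrn.
  have vex i : exists a : nat -> R, (i < n)%N -> T (y0 i - \sum_(j < r) a j *: y j).
    have [lti|_] := ltnP i n; last by exists (fun=> 0).
    by have [a Ha] := gen _ (By0 i lti); exists a.
  have [v vP] := choice vex.
  have [a [[i [ir ai]] aP]] := cdvr_dependence r v.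
  apply: ai; pose a' j := if (j <= r)%N then a j else 0.
  have := iy0 a' _ i (leq_ltn_trans ir ltrn); rewrite /a' ir; apply.
  rewrite -(subnKC ltrn) big_split_ord /= [X in _ + X]big1 => [|j _]; last first.
    by rewrite leqNgt ltnS leq_addr scale0r.
  rewrite addr0.
  have -> : \sum_(j < r.+1) (if (j <= r)%N then a j else 0) *: y0 j =
      \sum_(j < r.+1) a j *: (y0 j - \sum_(l < r) v j l *: y l).
    under eq_bigr do rewrite -ltnS ltn_ord.
    under [RHS]eq_bigr do rewrite scalerBr scaler_sumr.
    rewrite sumrB exchange_big /= [X in _ - X]big1 ?subr0 // => l _.
    under eq_bigr do rewrite scalerA.
    by rewrite -scaler_suml aP // scale0r.
  apply: (@submod_sum _ _ a (fun j => y0 j - \sum_(l < r) v j l *: y l)) => // j jr.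
  by apply: vP; apply: leq_trans ltrn.
have ern : r = n by apply/eqP; rewrite eqn_leq rn.
move: rn nr hr By iy gen; rewrite ern => _ _ hn By iy gen.
split=> //; exists y; split=> //; exact: pi_indep_free.
Qed.

End Free.

(* Counting classes modulo [D]: the family [rho] represents [R / w], and the
   family [z] represents [B / D]. *)
Lemma class_count B D (q N : nat) (rho : nat -> R) (z : nat -> V) :
    submod B -> submod D -> (forall y, B y -> D (w *: y)) -> (1 < q)%N ->
    (forall a, exists i b, (i < q)%N /\ a - rho i = w * b) ->
    (forall i j b, (i < q)%N -> (j < q)%N -> rho i - rho j = w * b -> i = j) ->
    (forall i, (i < N)%N -> B (z i)) ->
    (forall x, B x -> exists2 i, (i < N)%N & D (x - z i)) ->
    (forall i j, (i < N)%N -> (j < N)%N -> D (z i - z j) -> i = j) ->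
  exists r y, [/\ N = (q ^ r)%N, forall i, (i < r)%N -> B (y i), pi_indep D r y &
    forall x, B x -> exists a : nat -> R, D (x - \sum_(i < r) a i *: y i)].
Proof.
move=> BS DS wD q1 rex runi Bz zex zuni.
have comb r y (f : {ffun 'I_r -> 'I_q}) : (forall i, (i < r)%N -> B (y i)) ->
    exists k : 'I_N, D (\sum_(i < r) rho (f i) *: y i - z k).
  move=> By; have [|k kN Dk] := zex (\sum_(i < r) rho (f i) *: y i).
    elim/big_ind: _ => [|u v|i _]; [by case: BS|exact: submodD|].
    by apply: submodZ => //; apply: By.
  by exists (Ordinal kN).
have inj r y (d : {ffun 'I_r -> 'I_q} -> 'I_N) : pi_indep D r y ->
    (forall f : {ffun 'I_r -> 'I_q}, D (\sum_(i < r) rho (f i) *: y i - z (d f))) ->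
    injective d.
  move=> iy dP f f' E; apply/ffunP => i; apply: val_inj.
  pose a n := oapp (fun j => rho (f j) - rho (f' j)) 0 (insub n).
  have aE (j : 'I_r) : a j = rho (f j) - rho (f' j) by rewrite /a valK.
  have DD : D (\sum_(j < r) a j *: y j).
    under eq_bigr do rewrite aE scalerBl.
    by rewrite sumrB; have := submodB DS (dP f) (dP f'); rewrite E opprB addrA subrK.
  have [b] := iy a DD i (ltn_ord i); rewrite aE; exact: runi.
have bnd r y : (forall i, (i < r)%N -> B (y i)) -> pi_indep D r y -> (r <= N)%N.
  move=> By iy; have [c cP] := choice (fun f => comb r y f By).
  have := leq_card c (inj _ _ _ iy cP); rewrite card_ffun !card_ord.
  by apply: leq_trans; rewrite ltnW // ltn_expl.
have [r [y [_ _ By iy gen]]] : exists r y, [/\ (0 <= r)%N,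
    forall i, (i < 0)%N -> y i = (fun=> 0) i,
    forall i, (i < r)%N -> B (y i), pi_indep D r y &
    forall z, B z -> exists a : nat -> R, D (z - \sum_(i < r) a i *: y i)].
  by apply: extend_pi_indep bnd.
exists r, y; split=> //.
have cP (k : 'I_N) : exists f : {ffun 'I_r -> 'I_q},
    D (\sum_(i < r) rho (f i) *: y i - z k).
  have [a Da] := gen _ (Bz _ (ltn_ord k)).
  have [f fP] := choice (fun n : nat => rex (a n)).
  have fq n : (f n < q)%N by have [b []] := fP n.
  exists [ffun i : 'I_r => Ordinal (fq i)].
  have [b bP] := choice fP.
  have -> : \sum_(i < r) rho ([ffun i : 'I_r => Ordinal (fq i)] i) *: y i =
      \sum_(i < r) a i *: y i - w *: \sum_(i < r) b i *: y i.
    rewrite scaler_sumr -sumrB; apply: eq_bigr => i _; rewrite ffunE /= scalerA.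
    by rewrite -scalerBl; have [_ <-] := bP i; rewrite opprB addrCA subrr addr0.
  rewrite addrAC; apply: submodB (wD _ (submod_sum b BS By)) => //.
  by rewrite -opprB; apply: submodN.
have [c cE] := choice cP; have [d dP] := choice (fun f => comb r y f By).
(* Both maps between classes and vectors of residue representatives, [c] and [d], are injective, so
   the cardinals [N] and [q ^ r] agree. *)
apply/eqP; rewrite eqn_leq; apply/andP; split.
  have -> : (q ^ r)%N = #|{: {ffun 'I_r -> 'I_q}}| by rewrite card_ffun !card_ord.
  rewrite -{1}(card_ord N); apply: (leq_card c) => k k' E; apply: val_inj.
  apply: zuni; try exact: ltn_ord; have := cE k'; rewrite -E => Ek'.
  by have := submodB DS Ek' (cE k); rewrite opprB addrC addrA subrK.
have -> : (q ^ r)%N = #|{: {ffun 'I_r -> 'I_q}}| by rewrite card_ffun !card_ord.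
by rewrite -[X in (_ <= X)%N](card_ord N); apply: (leq_card d); apply: inj dP.
Qed.

End Modules.

End Cdvr.

(** * Modules with a cyclic p-group action *)

Lemma frobenius_add (S : comNzRingType) p m (a b : S) : prime p ->
  exists c, (a + b) ^+ (p ^ m) = a ^+ (p ^ m) + b ^+ (p ^ m) + p%:R * c.
Proof.
move=> p_pr.
have base x y : exists c : S, (x + y) ^+ p = x ^+ p + y ^+ p + p%:R * c.
  case: p p_pr => // q q_pr.
  exists (\sum_(i < q) (x ^+ (q - i) * y ^+ i.+1) *+ ('C(q.+1, i.+1) %/ q.+1)).
  rewrite exprDn big_ord_recl big_ord_recr /= /bump /=.
  rewrite subn0 bin0 expr0 mulr1 mulr1n add1n subnn expr0 mul1r binn mulr1n.
  rewrite -addrA [X in _ + X]addrC; congr (_ + (_ + _)).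
  rewrite mulr_sumr; apply: eq_bigr => i _; rewrite add1n subSS.
  rewrite mulrnAr mulr_natl -mulrnA mulnC divnK // prime_dvd_bin //=.
  by rewrite ltnS.
elim: m a b => [|m IH] a b; first by exists 0; rewrite !expr1 mulr0 addr0.
have [c Ec] := IH a b.
rewrite expnSr !exprM Ec.
have [d ->] := base (a ^+ (p ^ m) + b ^+ (p ^ m)) (p%:R * c).
have [e ->] := base (a ^+ (p ^ m)) (b ^+ (p ^ m)).
exists (e + p%:R ^+ p.-1 * c ^+ p + d); rewrite exprMn.
have -> : p%:R ^+ p = p%:R * p%:R ^+ p.-1 :> S.
  by rewrite -exprS prednK // prime_gt0.
ring.
Qed.

Lemma subrACA (V : zmodType) (x y z t : V) : x - y - (z - t) = x - z - (y - t).
Proof. by rewrite !opprD !opprK addrACA. Qed.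

Section Cyclic.
Variables (R : comNzRingType) (w : R) (cd : cdvr w).
Variables (A : lmodType R) (sg : {linear A -> A}).
Implicit Types (P S : {poly R}) (x y z : A).

(** Evaluation of [P] at the endomorphism [sg]. Once [sg] has order dividing [Q], it makes [A] a
    module over the quotient by ['X^Q - 1], which stands for the group ring of the cyclic group. *)
Definition pact (P : {poly R}) (x : A) := \sum_(i < size P) P`_i *: iter i sg x.

Lemma pactE n P x : (size P <= n)%N -> pact P x = \sum_(i < n) P`_i *: iter i sg x.
Proof.
move=> le; rewrite -(subnKC le) big_split_ord /= [X in _ + X]big1 ?addr0 // => i _.
by rewrite nth_default ?scale0r // leq_addr.
Qed.

Lemma iter_sg_linear k a x y : iter k sg (a *: x + y) = a *: iter k sg x + iter k sg y.
Proof. by elim: k => //= k ->; rewrite linearP. Qed.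

Lemma pact_linear P a x y : pact P (a *: x + y) = a *: pact P x + pact P y.
Proof.
rewrite /pact scaler_sumr -big_split; apply: eq_bigr => i _ /=.
by rewrite iter_sg_linear scalerDr !scalerA mulrC.
Qed.

Lemma pact_add P x y : pact P (x + y) = pact P x + pact P y.
Proof. by rewrite -[x]scale1r pact_linear !scale1r. Qed.

Lemma pact_zero P : pact P 0 = 0.
Proof. by apply: (addrI (pact P 0)); rewrite -pact_add !addr0. Qed.

Lemma pact_scale P a x : pact P (a *: x) = a *: pact P x.
Proof. by rewrite -[a *: x]addr0 pact_linear pact_zero addr0. Qed.

Lemma pact_opp P x : pact P (- x) = - pact P x.
Proof. by rewrite -scaleN1r pact_scale scaleN1r. Qed.

Lemma pact_sum P n (x : 'I_n -> A) : pact P (\sum_i x i) = \sum_i pact P (x i).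
Proof.
elim: n x => [|n IH] x; first by rewrite !big_ord0 pact_zero.
by rewrite !big_ord_recl pact_add IH.
Qed.

Lemma pactD P S x : pact (P + S) x = pact P x + pact S x.
Proof.
pose n := maxn (size P) (size S).
rewrite !(@pactE n) ?leq_maxl ?leq_maxr ?size_polyD // -big_split.
by apply: eq_bigr => i _; rewrite coefD scalerDl.
Qed.

Lemma pactZ c P x : pact (c *: P) x = c *: pact P x.
Proof.
rewrite (@pactE (size P)) ?size_scale_leq // scaler_sumr.
by apply: eq_bigr => i _; rewrite coefZ scalerA.
Qed.

Lemma pactN P x : pact (- P) x = - pact P x.
Proof. by rewrite -[- P]scaleN1r pactZ scaleN1r. Qed.

Lemma pactC c x : pact c%:P x = c *: x.
Proof. by rewrite (@pactE 1) ?size_polyC ?leq_b1 // big_ord1 coefC. Qed.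

Lemma pact1 x : pact 1 x = x.
Proof. by rewrite pactC scale1r. Qed.

Lemma pact0 x : pact 0 x = 0.
Proof. by rewrite pactC scale0r. Qed.

Lemma pactMX P x : pact (P * 'X) x = sg (pact P x).
Proof.
rewrite (@pactE (size P).+1).
  rewrite big_ord_recl coefMX /= scale0r add0r linear_sum.
  by apply: eq_bigr => i _; rewrite coefMX /= linearZ.
by rewrite (leq_trans (size_polyMleq _ _)) // size_polyX addnC.
Qed.

Lemma pactM P S x : pact (P * S) x = pact P (pact S x).
Proof.
elim/poly_ind: P => [|P c IH]; first by rewrite mul0r !pact0.
rewrite mulrDl !pactD mulrAC !pactMX IH; congr (_ + _).
by rewrite mul_polyC pactZ pactC.
Qed.

Lemma pactX x : pact 'X x = sg x.
Proof. by rewrite -['X]mul1r pactMX pact1. Qed.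

Lemma pactXn n x : pact 'X^n x = iter n sg x.
Proof. by elim: n => [|n IH]; [rewrite pact1|rewrite exprSr pactMX IH]. Qed.

Lemma pactX1 x : pact ('X - 1) x = sg x - x.
Proof. by rewrite pactD pactN pact1 pactX. Qed.

Lemma pact_psum n (P : 'I_n -> {poly R}) x :
  pact (\sum_i P i) x = \sum_i pact (P i) x.
Proof.
elim: n P => [|n IH] P; first by rewrite !big_ord0 pact0.
by rewrite !big_ord_recl pactD IH.
Qed.

Variables (p m : nat) (p_pr : prime p) (r0 : R).
Hypothesis p_w : p%:R = w * r0.
Hypothesis p_neq0 : p%:R <> 0 :> R.
Local Notation Q := (p ^ m)%N.
Hypothesis sgQ : forall x, iter Q sg x = x.

Definition nrm x := \sum_(i < Q) iter i sg x.
Definition nrmp : {poly R} := \sum_(i < Q) 'X^i.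

Lemma nrmE x : nrm x = pact nrmp x.
Proof. by rewrite pact_psum; apply: eq_bigr => i _; rewrite pactXn. Qed.

Lemma nrmpM : ('X - 1) * nrmp = 'X^Q - 1.
Proof. by rewrite subrX1. Qed.

(** Expand [('X - 1) + 1] to the power [Q] modulo [p]. Evaluation at [1] gives [p * mu(1) = 0], so
    ['X - 1] divides [mu], as [p] is nonzero in a domain; cancelling this factor in
    [('X - 1) * nrmp = 'X^Q - 1] yields the second identity. *)
Lemma nrm_frobenius : exists mu nu : {poly R},
  ('X - 1) ^+ Q = 'X^Q - 1 - p%:R *: mu /\ nrmp = ('X - 1) ^+ Q.-1 + p%:R *: nu.
Proof.
have Q0 : (0 < Q)%N by rewrite expn_gt0 prime_gt0.
have [mu] := @frobenius_add {poly R} p m ('X - 1) 1 p_pr.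
rewrite subrK expr1n -polyC_natr mul_polyC => Emu; exists mu.
have E : ('X - 1) ^+ Q = 'X^Q - 1 - p%:R *: mu.
  by rewrite Emu addrAC addrK addrK.
have mu1 : mu.[1] = 0.
  have /eqP := congr1 (fun P => P.[1]) E.
  rewrite !(hornerE, horner_exp) subrr expr0n expr1n subrr sub0r.
  rewrite (gtn_eqF Q0) eq_sym oppr_eq0 => /eqP /(cdvr_domain cd)[//|//].
have /factor_theorem[nu Enu] : root mu 1 by apply/rootP.
exists nu; split=> //.
have reg (P S : {poly R}) : ('X - 1) * P = ('X - 1) * S -> P = S.
  by rewrite -[1]/(1%:P) => /(monic_lreg (monicXsubC 1)).
apply: reg; rewrite nrmpM mulrDr -exprS prednK // E -scalerAr Enu.
by rewrite [nu * _]mulrC subrK.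
Qed.

Definition cyc (P : {poly R}) := exists S, P = ('X^Q - 1) * S.

Lemma monic_cyc : ('X^Q - 1 : {poly R}) \is monic.
Proof. by rewrite -[1]/(1%:P) monicXnsubC // expn_gt0 prime_gt0. Qed.

Lemma cycP P : cyc P <-> Pdiv.Ring.rmodp P ('X^Q - 1) = 0.
Proof.
split=> [[S ->]|E].
  by rewrite mulrC Pdiv.RingMonic.rmodp_mull // monic_cyc.
exists (Pdiv.Ring.rdivp P ('X^Q - 1)).
by rewrite {1}(Pdiv.RingMonic.rdivp_eq monic_cyc P) E addr0 mulrC.
Qed.

(** Division by the monic polynomial ['X^Q - 1] identifies the quotient with a free module of finite
    rank, where separatedness can be tested on the coefficients of the remainder. The same remark
    gives [cyc_reg]. *)
Lemma cyc_sep P : (forall k, exists Z, cyc (P - w ^+ k *: Z)) -> cyc P.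
Proof.
move=> H; apply/cycP/polyP => i; rewrite coef0; apply: (cdvr_sep cd) => k.
have [Z /cycP] := H k; rewrite Pdiv.RingMonic.rmodpD ?monic_cyc //.
rewrite -scaleNr Pdiv.RingMonic.rmodpZ ?monic_cyc // scaleNr.
move/eqP; rewrite subr_eq0 => /eqP ->.
by exists (Pdiv.Ring.rmodp Z ('X^Q - 1))`_i; rewrite coefZ.
Qed.

Lemma cyc_reg k P : cyc (w ^+ k *: P) -> cyc P.
Proof.
move=> /cycP; rewrite Pdiv.RingMonic.rmodpZ ?monic_cyc // => E.
apply/cycP/polyP => i; rewrite coef0; apply: (cdvr_regX cd (k := k)).
by rewrite -coefZ E coef0.
Qed.

Lemma cycD P S : cyc P -> cyc S -> cyc (P + S).
Proof. by case=> [P' ->] [S' ->]; exists (P' + S'); rewrite mulrDr. Qed.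

Lemma cycM P S : cyc P -> cyc (P * S).
Proof. by case=> [P' ->]; exists (P' * S); rewrite mulrA. Qed.

Lemma cyc0 : cyc 0. Proof. by exists 0; rewrite mulr0. Qed.

Lemma pact_cyc P x : cyc P -> pact P x = 0.
Proof. by case=> S ->; rewrite mulrC pactM pactD pactN pact1 pactXn sgQ subrr pact_zero. Qed.

Lemma nrm_sg x : nrm (sg x) = nrm x.
Proof.
apply/eqP; rewrite -subr_eq0 !nrmE -pact_opp -pact_add -pactX1 -pactM mulrC nrmpM.
by rewrite pact_cyc //; exists 1; rewrite mulr1.
Qed.

Lemma sg_nrm x : sg (nrm x) = nrm x.
Proof.
apply/eqP; rewrite -subr_eq0 -pactX1 nrmE -pactM nrmpM.
by rewrite pact_cyc //; exists 1; rewrite mulr1.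
Qed.

Lemma nrm_pact P x : nrm (pact P x) = P.[1] *: nrm x.
Proof.
rewrite nrmE {2}/pact pact_sum horner_coef scaler_suml; apply: eq_bigr => i _.
rewrite pact_scale -nrmE expr1n mulr1; congr (_ *: _).
by elim: (val i) => //= k IH; rewrite nrm_sg.
Qed.

Variables (h n s : nat) (zeta : nat -> A).
Hypothesis s_gt0 : (0 < s)%N.
Hypothesis hn : (h <= n)%N.
Hypothesis nrm_surj : forall x, sg x = x -> exists y, x = nrm y.
Hypothesis nrm_ker : forall x, nrm x = 0 -> exists y, x = sg y - y.
Hypothesis A_sep : forall x, (forall k, exists y, x = w ^+ k *: y) -> x = 0.
Hypothesis zeta_fix : forall i, (i < h)%N -> sg (zeta i) = zeta i.

Definition torsion x := exists k, w ^+ k *: x = 0.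
Definition fixed x := sg x = x.

Hypothesis torsion_span : forall x, torsion x ->
  exists b : nat -> R, x = \sum_(i < h) b i *: zeta i.
Hypothesis zeta_rel : forall b : nat -> R, \sum_(i < h) b i *: zeta i = 0 ->
  forall i, (i < h)%N -> exists c, b i = w ^+ s * c.
Hypothesis zeta_ord : forall i, (i < h)%N -> w ^+ s *: zeta i = 0.
Hypothesis fixed_ub : forall y : nat -> A, (forall i, (i <= n)%N -> fixed (y i)) ->
  ~ indep_mod torsion n.+1 y.
Hypothesis fixed_lb : exists2 y, forall i, (i < n)%N -> fixed (y i) &
  indep_mod torsion n y.

Lemma submod_fixed : submod fixed.
Proof.
by split=> [|a x y]; rewrite /fixed ?linear0 // linearP => -> ->.
Qed.

Lemma submod_torsion : submod torsion.
Proof.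
split=> [|a x y [k kx] [l ly]]; first by exists 0%N; rewrite scaler0.
exists (k + l)%N; rewrite scalerDr exprD -[_ *: y]scalerA ly scaler0 addr0.
by rewrite scalerA mulrAC mulrC -scalerA [in X in _ *: X]mulrC -scalerA kx !scaler0.
Qed.

Lemma torsion_fixed x : torsion x -> fixed x.
Proof.
move=> /torsion_span[b ->]; rewrite /fixed linear_sum; apply: eq_bigr => i _.
by rewrite linearZ /= zeta_fix.
Qed.

Lemma torsion_ord x : torsion x -> w ^+ s *: x = 0.
Proof.
move=> /torsion_span[b ->]; rewrite scaler_sumr big1 // => i _.
by rewrite scalerA mulrC -scalerA zeta_ord // scaler0.
Qed.

Lemma torsion_w x : torsion (w *: x) -> torsion x.
Proof. by case=> k kx; exists k.+1; rewrite exprSr -scalerA. Qed.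

Lemma fixed_sep x : fixed x ->
  (forall k, exists2 y, fixed y & torsion (x - w ^+ k *: y)) -> torsion x.
Proof.
move=> _ H; exists s; apply: A_sep => k.
have [y _ /torsion_ord E] := H k; exists (w ^+ s *: y).
by apply/eqP; rewrite -subr_eq0 scalerA mulrC -scalerA -scalerBr E.
Qed.

Definition norm_basis (g xi : nat -> A) := [/\
  indep_mod torsion n (fun i => nrm (g i)),
  forall z, fixed z -> exists a : nat -> R,
    torsion (z - \sum_(i < n) a i *: nrm (g i)),
  forall i, (i < h)%N -> w ^+ s *: xi i = sg (g i) - g i &
  forall i, (i < h)%N -> nrm (xi i) = zeta i].

(* For a relation modulo [w] between the norms of the [om i], the vector [t]
   below is torsion while [sg t - t] is a nonzero combination of the
   [w ^+ s.-1 *: zeta i]. *)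
Lemma omega_norm_indep (xi om : nat -> A) : (0 < m)%N ->
    (forall i, (i < h)%N -> nrm (xi i) = zeta i) ->
    (forall i, (i < h)%N -> w ^+ s *: xi i = sg (om i) - om i) ->
  pi_indep w (fun x => exists2 y, fixed y & torsion (x - w *: y)) h
    (fun i => nrm (om i)).
Proof.
move=> m0 xiP omP a [y0 fy0 Ty0] i ih.
have [y Ey] := nrm_surj fy0; have [mu [nu [_ nuE]]] := nrm_frobenius.
have Q1 : (1 < Q)%N by rewrite -(expn0 p) ltn_exp2l // prime_gt1.
pose v := \sum_(i < h) a i *: om i - w *: y.
pose eta := \sum_(i < h) (a i * w ^+ s.-1) *: xi i - (sg y - y).
have weta : w *: eta = sg v - v.
  have -> : sg v = \sum_(i < h) a i *: sg (om i) - w *: sg y.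
    rewrite linearB linear_sum linearZ; congr (_ - _).
    by apply: eq_bigr => j _; rewrite linearZ.
  rewrite /eta scalerBr scaler_sumr /v subrACA -sumrB -scalerBr; congr (_ - _).
  apply: eq_bigr => j _; rewrite -scalerBr -omP // !scalerA.
  by rewrite mulrCA -exprS prednK.
have Nv : torsion (nrm v).
  congr torsion: Ty0; rewrite Ey /v !nrmE pact_add pact_opp pact_scale.
  by congr (_ - _); rewrite pact_sum; apply: eq_bigr => j _; rewrite pact_scale nrmE.
have Neta : nrm eta = \sum_(i < h) (a i * w ^+ s.-1) *: zeta i.
  rewrite /eta nrmE pact_add pact_opp pact_sum.
  rewrite -pactX1 -pactM mulrC nrmpM pact_cyc ?subr0; last by exists 1; rewrite mulr1.
  by apply: eq_bigr => j _; rewrite pact_scale -nrmE xiP.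
(* This is [nrm v] divided by [w]: write [nrmp] as [('X - 1) ^ Q.-1] plus a multiple of [p], and use
   that [sg v - v] is [w *: eta]. The exponent [Q.-2] requires a nontrivial group. *)
pose t := pact (('X - 1) ^+ Q.-2) eta + r0 *: pact nu v.
have wt : w *: t = nrm v.
  rewrite /t scalerDr -pact_scale weta -pactX1 -pactM -exprSr prednK; last first.
    by rewrite -ltnS prednK // ltnW.
  by rewrite scalerA -p_w -pactZ -pactD -nuE nrmE.
have /torsion_fixed ft : torsion t by apply: torsion_w; rewrite wt.
have lt : sg t - t = nrm eta.
  rewrite -pactX1 /t pact_add -pactM -exprS prednK; last first.
    by rewrite -ltnS prednK // ltnW.
  rewrite pact_scale -pactM mulrC pactM pactX1 -weta pact_scale scalerA mulrC -p_w.
  by rewrite -pactZ -pactD -nuE nrmE.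
have := lt; rewrite ft subrr Neta => /esym E0.
have [c Ec] := zeta_rel (b := fun i => a i * w ^+ s.-1) E0 ih.
exists c; apply/eqP; rewrite -subr_eq0; apply/eqP/(cdvr_regX cd (k := s.-1)).
by rewrite mulrBr mulrC Ec -[in w ^+ s](prednK s_gt0) exprSr mulrA subrr.
Qed.

Lemma exists_norm_basis : exists g xi, norm_basis g xi.
Proof.
have xiex i : exists y, (i < h)%N -> nrm y = zeta i.
  have [lti|_] := ltnP i h; last by exists 0.
  by have [y E] := nrm_surj (zeta_fix lti); exists y.
have [xi xiP] := choice xiex.
have omex i : exists y, (i < h)%N -> w ^+ s *: xi i = sg y - y.
  have [lti|_] := ltnP i h; last by exists 0.
  have [|y E] := nrm_ker (x := w ^+ s *: xi i); last by exists y.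
  by rewrite nrmE pact_scale -nrmE xiP // zeta_ord.
have [om omP] := choice omex.
have FE := free_extension cd submod_fixed submod_torsion
  (fun x _ => @torsion_w x) fixed_sep.
(* For the trivial group nothing constrains the [om i], whose norms may be dependent. Then [sg - 1]
   vanishes and [w ^ s] kills the [zeta i], so any basis of the fixed points modulo torsion will do,
   with the [zeta i] as [xi i]. *)
have [m0|m0] := posnP m.
  have Q1 : Q = 1%N by rewrite m0.
  have nid x : nrm x = x by rewrite /nrm Q1 big_ord1.
  have sid x : sg x = x by have := sgQ x; rewrite Q1.
  have [||_ [y [_ fy iy geny]]] := FE n 0%N (fun=> 0) _ _ fixed_ub fixed_lb.
  - by [].
  - by [].
  exists y, zeta; split; rewrite ?(funext nid) //.
  by move=> i ih; rewrite sid subrr zeta_ord.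
have [||_ [y [yo fy iy geny]]] := FE n h (fun i => nrm (om i)) _ _ fixed_ub fixed_lb.
- by move=> i _; apply: sg_nrm.
- exact: omega_norm_indep m0 xiP omP.
have gex i : exists g, (i < n)%N -> nrm g = y i /\ ((i < h)%N -> g = om i).
  have [ih|hi] := ltnP i h; first by exists (om i); rewrite yo.
  have [lti|_] := ltnP i n; last by exists 0.
  by have [g E] := nrm_surj (fy _ lti); exists g.
have [g gP] := choice gex.
have gE (i : 'I_n) : nrm (g i) = y i by have [] := gP i (ltn_ord i).
exists g, xi; split=> //.
- move=> a Ta; apply: iy; congr torsion: Ta.
  by apply: eq_bigr => i _; rewrite gE.
- by move=> z /geny[a Ta]; exists a; under eq_bigr do rewrite gE.
move=> i ih; have [_ ->//] := gP i (leq_trans ih hn); exact: omP.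
Qed.

(** * Generation and relations over the group ring *)

Section Generators.
Variables (g xi : nat -> A) (nb : norm_basis g xi).

Definition gen_family i := if (i < n)%N then g i else xi (i - n).
Local Notation G := gen_family.
Definition lc (P : nat -> {poly R}) := \sum_(i < n + h) pact (P i) (G i).

Lemma gen_split (F : nat -> A -> A) : \sum_(i < n + h) F i (G i) =
  \sum_(i < n) F i (g i) + \sum_(i < h) F (n + i)%N (xi i).
Proof.
rewrite big_split_ord /=; congr (_ + _); apply: eq_bigr => i _; rewrite /G.
  by rewrite ltn_ord.
by rewrite ltnNge leq_addr addKn.
Qed.

(** The norm of [x] is a combination of the norms of the [g i] and of torsion points [zeta i], which
    are the norms of the [xi i]. Subtracting the same combination of generators leaves an element of
    norm zero. *)
Lemma nrm_generation x : exists (c : nat -> R) z,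
  x = \sum_(i < n + h) c i *: G i + (sg z - z).
Proof.
have [_ gen _ xiP] := nb.
have [a /torsion_span[b Eb]] := gen _ (sg_nrm x).
pose c i := if (i < n)%N then a i else b (i - n)%N.
have cE : \sum_(i < n + h) c i *: G i =
    \sum_(i < n) a i *: g i + \sum_(i < h) b i *: xi i.
  rewrite (gen_split (fun i y => c i *: y)); congr (_ + _); apply: eq_bigr => i _.
    by rewrite /c ltn_ord.
  by rewrite /c ltnNge leq_addr addKn.
have [|z Ez] := nrm_ker (x := x - \sum_(i < n + h) c i *: G i); last first.
  by exists c, z; rewrite -Ez addrC subrK.
rewrite nrmE pact_add pact_opp cE pact_add opprD addrA !pact_sum -nrmE.
under eq_bigr do rewrite pact_scale -nrmE.
rewrite Eb -sumrB big1 // => i _; by rewrite pact_scale -nrmE xiP // subrr.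
Qed.

(** The conjugates of the generators under [sg], listed by a single index as [complete_generation]
    requires. *)
Let v j := iter (j %% Q) sg (G (j %/ Q)).
Let span x := exists a : nat -> R, x = \sum_(j < (n + h) * Q) a j *: v j.

Lemma submod_span : submod span.
Proof.
split=> [|c x y [a ->] [b ->]].
  by exists (fun=> 0); rewrite big1 // => i _; rewrite scale0r.
exists (fun i => c * a i + b i); rewrite scaler_sumr -big_split.
by apply: eq_bigr => i _; rewrite scalerDl scalerA.
Qed.

Lemma iter_modQ k x : iter k sg x = iter (k %% Q) sg x.
Proof.
rewrite {1}(divn_eq k Q) addnC iterD; congr iter; elim: (k %/ Q)%N => //= l IH.
by rewrite mulSn iterD IH sgQ.
Qed.

Lemma span_iter k i : (i < n + h)%N -> span (iter k sg (G i)).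
Proof.
move=> lti; have Q0 : (0 < Q)%N by rewrite expn_gt0 prime_gt0.
have kQ : (k %% Q < Q)%N by rewrite ltn_mod.
have jr : (i * Q + k %% Q < (n + h) * Q)%N.
  by rewrite (leq_trans (n := i.+1 * Q)) ?leq_mul2r ?lti ?orbT // mulSn addnC ltn_add2r.
exists (fun j => (j == i * Q + k %% Q)%N%:R).
rewrite (bigD1 (Ordinal jr)) //= eqxx scale1r big1 ?addr0 => [|j].
  by rewrite /v modnMDl modn_mod divnMDl // divn_small // addn0 -iter_modQ.
by rewrite -val_eqE /= => /negPf ->; rewrite scale0r.
Qed.

Lemma span_sg x : span x -> span (sg x).
Proof.
case=> a ->; rewrite linear_sum.
rewrite (eq_bigr (fun j : 'I_ _ => a j *: sg (v j))) => [|j _]; last by rewrite linearZ.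
apply: (submod_sum a (x := fun j => sg (v j)) submod_span) => j jr.
apply: (@span_iter (j %% Q).+1); rewrite ltn_divLR // expn_gt0 prime_gt0 //.
Qed.

Lemma span_pact P x : span x -> span (pact P x).
Proof.
move=> sx; apply: (submod_sum (fun i => P`_i) (x := fun i => iter i sg x) submod_span).
by move=> i _; elim: i => //= i; apply: span_sg.
Qed.

Lemma span_lpow k x : exists u z, span u /\ x = u + pact (('X - 1) ^+ k) z.
Proof.
elim: k => [|k [u [z [su ->]]]].
  by exists 0, x; split; [case: submod_span|rewrite pact1 add0r].
have [c [z' ->]] := nrm_generation z.
exists (u + pact (('X - 1) ^+ k) (\sum_(i < n + h) c i *: G i)), z'; split.
  apply: submodD => //; first exact: submod_span.
  apply: span_pact; apply: (submod_sum c submod_span) => i; exact: (@span_iter 0).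
by rewrite pact_add addrA -pactX1 -pactM -exprSr.
Qed.

(** On [A] the operator [(sg - 1) ^ Q] is a multiple of [p], hence of [w]. Generation modulo
    [sg - 1], iterated [Q] times, is therefore generation modulo [w]; completeness of [R] and
    separatedness of [A] do the rest. *)
Lemma span_all x : span x.
Proof.
have spanw z : exists u z', span u /\ z = u + w *: z'.
  have [u [z' [su ->]]] := span_lpow Q z; have [mu [nu [muE _]]] := nrm_frobenius.
  exists u, (- (r0 *: pact mu z')); split=> //; congr (_ + _).
  rewrite muE pactD pactN pactZ p_w pact_cyc ?add0r; last by exists 1; rewrite mulr1.
  by rewrite scalerN scalerA.
have [|a aP] := complete_generation cd (r := (n + h) * Q) (v := v)
  (Vf := fun k x => exists z, x = w ^+ k *: z) _ (ex_intro _ x (esym (scale1r x))).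
  move=> k _ [z ->]; have [u [z' [[a Ea] ->]]] := spanw z.
  exists a, z'; rewrite scalerDr Ea scaler_sumr exprSr scalerA addrAC -sumrB.
  by rewrite big1 ?add0r // => j _; rewrite scalerA mulrC subrr.
exists a; apply/eqP; rewrite -subr_eq0; apply/eqP/A_sep => k.
have [c [z E]] := aP k; exists (z - \sum_(j < (n + h) * Q) c j *: v j).
by rewrite scalerBr -E addrK.
Qed.

Lemma lcD (P S : nat -> {poly R}) : lc (fun i => P i + S i) = lc P + lc S.
Proof. by rewrite /lc -big_split; apply: eq_bigr => i _; rewrite pactD. Qed.

Lemma lcM S (P : nat -> {poly R}) : lc (fun i => S * P i) = pact S (lc P).
Proof. by rewrite /lc pact_sum; apply: eq_bigr => i _; rewrite pactM. Qed.

Lemma lc_eq (P S : nat -> {poly R}) : (forall i, (i < n + h)%N -> P i = S i) -> lc P = lc S.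
Proof. by move=> E; apply: eq_bigr => i _; rewrite E. Qed.

Lemma lc_generates x : exists P : nat -> {poly R}, x = lc P.
Proof.
have LS : submod (fun x => exists P : nat -> {poly R}, x = lc P).
  split; first by exists (fun=> 0); rewrite /lc big1 // => i _; rewrite pact0.
  move=> a y z [P ->] [S ->]; exists (fun i => a%:P * P i + S i).
  by rewrite lcD lcM pactC.
have [a ->] := span_all x.
apply: (submod_sum a (x := v) LS) => j jr.
have lti : (j %/ Q < n + h)%N by rewrite ltn_divLR // expn_gt0 prime_gt0.
exists (fun i => if i == (j %/ Q)%N then 'X^(j %% Q) else 0).
rewrite /lc (bigD1 (Ordinal lti)) //= eqxx pactXn big1 ?addr0 // => i.
by rewrite -val_eqE /= => /negPf ->; rewrite pact0.
Qed.

(** The coordinates of the combination with multipliers [D k] of the relations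
    [w ^ s e_(xi_k) - ('X - 1) e_(omega_k)], in the order of [gen_family]: [omega] below [h],
    [theta] from [h] to [n], [xi] from [n] on. *)
Definition relp (D : nat -> {poly R}) i : {poly R} :=
  if (i < h)%N then - (('X - 1) * D i)
  else if (i < n)%N then 0 else w ^+ s *: D (i - n)%N.

Lemma relpD D D' i : relp (fun i => D i + D' i) i = relp D i + relp D' i.
Proof.
rewrite /relp; case: ifP => _; first by rewrite mulrDr opprD.
by case: ifP => _; rewrite ?addr0 // scalerDr.
Qed.

Lemma relpM S D i : relp (fun i => S * D i) i = S * relp D i.
Proof.
rewrite /relp; case: ifP => _; first by rewrite mulrN mulrCA.
by case: ifP => _; rewrite ?mulr0 // scalerAr.
Qed.

Lemma lc_relp D : lc (relp D) = 0.
Proof.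
have [_ _ rel _] := nb.
rewrite /lc (gen_split (fun i => pact (relp D i))).
have -> : \sum_(i < n) pact (relp D i) (g i) = \sum_(i < h) pact (relp D i) (g i).
  rewrite [RHS](big_ord_widen _ (fun i => pact (relp D i) (g i)) hn) [RHS]big_mkcond.
  apply: eq_bigr => i _; case: ifP => // ih.
  by rewrite /relp ih ltn_ord pact0.
rewrite -big_split big1 // => i _ /=.
rewrite /relp ltn_ord ltnNge (leq_trans hn) ?leq_addr //= ltnNge leq_addr /= addKn.
by rewrite pactN mulrC pactM pactX1 -rel // pact_scale pactZ addrC subrr.
Qed.

(** The norm of a relation sees only the values at [1]: they vanish on the [g i] and are divisible
    by [w ^ s] on the [xi i]. Removing the known relations with these constant multipliers leaves
    [('X - 1) * C], where [lc C] is merely fixed by [sg]. But then [lc C] is a norm, and a multiple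
    of [nrmp] corrects [C] to a relation without changing [('X - 1) * C] modulo ['X^Q - 1]. *)
Lemma kernel_step (P : nat -> {poly R}) : lc P = 0 -> exists D Z, lc Z = 0 /\
  forall i, (i < n + h)%N -> cyc (P i - relp D i - ('X - 1) * Z i).
Proof.
move=> P0; have [ind _ _ xiP] := nb.
have E0 : \sum_(i < n) (P i).[1] *: nrm (g i) + \sum_(i < h) (P (n + i)%N).[1] *: zeta i = 0.
  have : nrm (lc P) = 0 by rewrite P0 nrmE pact_zero.
  rewrite nrmE /lc pact_sum (gen_split (fun i y => pact nrmp (pact (P i) y))) => {}P0.
  rewrite -[RHS]P0.
  congr (_ + _); apply: eq_bigr => i _; rewrite -nrmE nrm_pact //.
  by rewrite xiP.
have Tz (b : nat -> R) : torsion (\sum_(i < h) b i *: zeta i).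
  exists s; rewrite scaler_sumr big1 // => i _.
  by rewrite scalerA mulrC -scalerA zeta_ord ?scaler0.
have e1 i : (i < n)%N -> (P i).[1] = 0.
  apply: (ind (fun i => (P i).[1])); rewrite (_ : \sum_(_ < n) _ = - \sum_(i < h) (P (n + i)%N).[1] *: zeta i).
    by apply: submodN submod_torsion _; exact: (Tz (fun i => (P (n + i)%N).[1])).
  by apply/eqP; rewrite -addr_eq0 E0.
have e2 i : exists d, (i < h)%N -> (P (n + i)%N).[1] = w ^+ s * d.
  have [ih|_] := ltnP i h; last by exists 0.
  have [|d] := zeta_rel (b := fun i => (P (n + i)%N).[1]) _ ih; last by exists d.
  by move: E0; rewrite big1 ?add0r // => j _; rewrite e1 // scale0r.
have [d dP] := choice e2.
pose D i := (d i)%:P : {poly R}.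
have Cex i : exists C, (i < n + h)%N -> P i - relp D i = C * ('X - 1).
  have [lti|_] := ltnP i (n + h); last by exists 0.
  have /factor_theorem[C EC] : root (P i - relp D i) 1.
    rewrite /root hornerD hornerN /relp; case: ifP => ih.
      have x1 : ('X - 1 : {poly R}).[1] = 0 by rewrite !hornerE subrr.
      by rewrite e1 ?(leq_trans ih) // hornerN hornerM x1 mul0r oppr0 subr0.
    case: ifP => lin; first by rewrite e1 // horner0 subrr eqxx.
    rewrite -[in P i](@subnKC n i); last by rewrite leqNgt lin.
    rewrite dP; first by rewrite hornerZ hornerC subrr.
    by rewrite ltn_subLR // leqNgt lin.
  by exists C; rewrite EC.
have [C CP] := choice Cex.
have lC : sg (lc C) = lc C.
  apply/eqP; rewrite -subr_eq0 -pactX1 -lcM; apply/eqP.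
  rewrite (@lc_eq _ (fun i => P i - relp D i)) => [|i lti]; last by rewrite CP // mulrC.
  by rewrite lcD P0 add0r (@lc_eq _ (fun i => -1 * relp D i)) ?lcM ?lc_relp ?pact_zero // => i _; rewrite mulN1r.
have [y Ey] := nrm_surj lC; have [E EE] := lc_generates y.
exists D, (fun i => C i - nrmp * E i); split.
  rewrite lcD (@lc_eq (fun i => - (nrmp * E i)) (fun i => (- nrmp) * E i)) => [|i _];
    last by rewrite mulNr.
  rewrite lcM.
  by rewrite Ey EE nrmE pactN subrr.
move=> i lti; rewrite CP //; exists (E i); rewrite -nrmpM; ring.
Qed.

Lemma kernel_lpow k (P : nat -> {poly R}) : lc P = 0 -> exists D Z, lc Z = 0 /\
  forall i, (i < n + h)%N -> cyc (P i - relp D i - ('X - 1) ^+ k * Z i).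
Proof.
move=> P0; elim: k => [|k [D [Z [Z0 DZ]]]].
  exists (fun=> 0), P; split=> // i _.
  rewrite (_ : relp _ i = 0); first by rewrite mul1r subr0 subrr; apply: cyc0.
  by rewrite /relp mulr0 oppr0 scaler0; do 2?case: ifP.
have [D' [Z' [Z0' DZ']]] := kernel_step Z0.
exists (fun i => D i + ('X - 1) ^+ k * D' i), Z'; split=> // i lti.
rewrite relpD relpM.
have := cycD (DZ i lti) (cycM (('X - 1) ^+ k) (DZ' i lti)).
by congr cyc; rewrite exprSr; ring.
Qed.

(** Modulo ['X^Q - 1] the factor [('X - 1) ^ Q] is a multiple of [w], so [Q] steps in powers of
    ['X - 1] make one step in powers of [w]. *)
Lemma kernel_w k (P : nat -> {poly R}) : lc P = 0 -> exists D Z, lc Z = 0 /\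
  forall i, (i < n + h)%N -> cyc (P i - relp D i - w ^+ k *: Z i).
Proof.
move=> P0; elim: k => [|k [D [Z [Z0 DZ]]]].
  exists (fun=> 0), P; split=> // i _.
  rewrite (_ : relp _ i = 0); first by rewrite scale1r subr0 subrr; apply: cyc0.
  by rewrite /relp mulr0 oppr0 scaler0; do 2?case: ifP.
have [D' [Z' [Z0' DZ']]] := kernel_lpow Q Z0.
have [mu [nu [muE _]]] := nrm_frobenius.
exists (fun i => D i + (w ^+ k)%:P * D' i), (fun i => (- r0)%:P * mu * Z' i).
split=> [|i lti]; first by rewrite lcM Z0' pact_zero.
rewrite relpD relpM.
have := cycD (DZ i lti) (cycM (w ^+ k)%:P (DZ' i lti)).
have : cyc (('X^Q - 1) * ((w ^+ k)%:P * Z' i)) by exists ((w ^+ k)%:P * Z' i).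
move=> c1 c2; have := cycD c1 c2; congr cyc.
by rewrite muE p_w -!mul_polyC exprSr !polyCM polyCN; ring.
Qed.

(** No limit of multipliers is taken. The [xi]-coordinates force them to be [P (n + i)] divided by
    [w ^ s], and the approximation of order [s] already provides this quotient exactly. The
    [theta]-coordinates are then zero because they are divisible by every [w ^ k]; the
    [omega]-coordinates agree after multiplication by [w ^ s], which is cancelled by [cyc_reg]. *)
Lemma kernel_relations (P : nat -> {poly R}) : lc P = 0 -> exists D,
  forall i, (i < n + h)%N -> cyc (P i - relp D i).
Proof.
move=> P0; have [D [Z [_ DZ]]] := kernel_w s P0.
exists (fun i => D i + Z (n + i)%N) => i lti; rewrite relpD /relp.
case: ifP => ih; last first.
  case: ifP => lin.
    apply: cyc_sep => k; have [D' [Z' [_ DZ']]] := kernel_w k P0.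
    exists (Z' i); have := DZ' i lti; rewrite /relp ih lin !addr0 !subr0 //.
  have := DZ i lti; rewrite /relp ih lin subnKC; last by rewrite leqNgt lin.
  by congr cyc; rewrite opprD addrA.
apply: (@cyc_reg s); apply: cyc_sep => k; have [D' [Z' [_ DZ']]] := kernel_w k P0.
have lni : (n + i < n + h)%N by rewrite ltn_add2l.
exists (w ^+ s *: Z' i + ('X - 1) * Z' (n + i)%N).
have nih : ((n + i < h)%N = false) * ((n + i < n)%N = false).
  by split; apply/negbTE; rewrite -leqNgt ?(leq_trans hn) ?leq_addr.
have c1 := DZ' i lti; have c2 := DZ' _ lni; have c3 := DZ _ lni.
rewrite /relp ih in c1; rewrite /relp !nih addKn in c2 c3.
have := cycD (cycM (w ^+ s)%:P c1) (cycM ('X - 1) c2).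
move=> c4; have := cycD c4 (cycM (- ('X - 1)) c3); congr cyc.
rewrite -!mul_polyC; ring.
Qed.

End Generators.

End Cyclic.

(** * Integers in algebraic extensions of the p-adic numbers *)

Section PadicCdvr.
Variables (p : nat) (p_pr : prime p).
Local Notation Zp := (padic_int p_pr).
Implicit Types a b : Zp.

Lemma padic_addE a b n : (a + b) n = ((a n + b n) %% p ^ n)%N. Proof. by []. Qed.
Lemma padic_mulE a b n : (a * b) n = ((a n * b n) %% p ^ n)%N. Proof. by []. Qed.

Lemma padic_natE k n : (k%:R : Zp) n = (k %% p ^ n)%N.
Proof.
elim: k => [|k IH]; first by rewrite mulr0n.
by rewrite -addn1 natrD padic_addE IH modnDm.
Qed.

Lemma padic_sub_res a b n : a n = b n -> (a - b) n = 0%N.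
Proof.
move=> E; have : (a - b + b) n = b n by rewrite subrK.
rewrite padic_addE -{2}(padic_res_modn b n) => /eqP.
rewrite -{2}[b n]add0n eqn_modDr mod0n -[(a - b) n](padic_res_modn (a - b)).
by rewrite modn_mod => /eqP.
Qed.

Lemma padic_divp a : a 1%N = 0%N -> exists b, a = p%:R * b.
Proof.
move=> a1; have pa n : (p %| a n.+1)%N.
  by rewrite /dvdn -[X in (_ %% X)%N]expn1 -[n.+1]add1n padic_res_mod a1.
have co n : (a n.+1 %/ p = (a n.+2 %/ p) %% p ^ n)%N.
  by rewrite modn_divl -expnSr [a n.+1]padic_resP.
exists (PadicInt p_pr co); apply: padic_int_eq => n.
by rewrite padic_mulE padic_natE modnMml /= mulnC divnK // -padic_resP.
Qed.

Lemma padic_divpX k a : a k = 0%N -> exists b, a = p%:R ^+ k * b.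
Proof.
elim: k a => [|k IH] a ak; first by exists a; rewrite mul1r.
have [|b E] := padic_divp (a := a).
  by rewrite -(padic_res_mod a 1 k) add1n ak mod0n.
have [|c Ec] := IH b; last by exists c; rewrite exprS -mulrA -Ec.
have := ak; rewrite E padic_mulE padic_natE modnMml expnS -muln_modr.
by move/eqP; rewrite muln_eq0 (gtn_eqF (prime_gt0 p_pr)) /= -padic_resP => /eqP.
Qed.

(** Bezout gives an inverse modulo each [p ^ n]; uniqueness of inverses makes the residues
    compatible. *)
Lemma padic_unit_res a : a 1%N <> 0%N -> exists b, a * b = 1.
Proof.
move=> a1; have cop n : coprime (a n) (p ^ n).
  case: n => [|n]; first by rewrite expn0 coprimen1.
  rewrite coprime_sym coprime_pexpl // prime_coprime //; apply/negP => /eqP pa.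
  by apply: a1; rewrite -(padic_res_mod a 1 n) add1n expn1 pa.
have inv n : exists x, (a n * x = 1 %[mod p ^ n])%N.
  have [an0|an0] := posnP (a n).
    by exists 0%N; have := cop n; rewrite an0 /coprime gcd0n => /eqP ->; rewrite !modn1.
  have [x y E _] := egcdnP (p ^ n) an0; exists x.
  by rewrite mulnC E (eqP (cop n)) modnMDl.
have [x xP] := choice inv.
have co n : (x n %% p ^ n = (x n.+1 %% p ^ n.+1) %% p ^ n)%N.
  rewrite -modn_exp_step.
  have E1 : (a n * x n.+1 = 1 %[mod p ^ n])%N.
    rewrite -modnMml [a n]padic_resP modn_mod modnMml.
    by rewrite modn_exp_step xP -modn_exp_step.
  rewrite -[x n]muln1 -modnMmr -E1 modnMmr mulnA [(x n * _)%N]mulnC.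
  by rewrite -modnMml xP modnMml mul1n.
exists (PadicInt p_pr co); apply: padic_int_eq => n.
by rewrite padic_mulE /= modnMmr xP.
Qed.

Lemma padic_cdvr : cdvr (p%:R : Zp).
Proof.
split.
- move=> a; have [/padic_divp|/padic_unit_res] := pselect (a 1%N = 0%N); by [left|right].
- move=> a H; apply: padic_int_eq => n; have [b ->] := H n.
  by rewrite -natrX padic_mulE padic_natE modnn mul0n.
- move=> a; pose S k : Zp := \sum_(i < k) a i * p%:R ^+ i.
  have S1 n : S n.+1 n = S n n.
    have -> : S n.+1 = S n + a n * p%:R ^+ n by rewrite /S big_ord_recr.
    rewrite padic_addE padic_mulE -natrX padic_natE modnn muln0.
    by rewrite mod0n addn0 padic_res_modn.
  have co n : (S n n = S n.+1 n.+1 %% p ^ n)%N by rewrite -padic_resP S1.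
  exists (PadicInt p_pr co) => k.
  have [|b E] := @padic_divpX k (PadicInt p_pr co - S k); first exact: padic_sub_res.
  by exists b; rewrite -/(S k) -E addrC subrK.
- move=> a /eqP; rewrite mulf_eq0 => /orP[/eqP/(congr1 (fun a : Zp => a 2%N))|/eqP//].
  rewrite padic_natE modn_small /= ?mod0n => [p0|].
    by have := prime_gt0 p_pr => /lt0n_neq0/eqP.
  by rewrite -{1}(expn1 p) ltn_exp2l // prime_gt1.
- move=> b /(congr1 (fun a : Zp => a 1%N)).
  rewrite padic_mulE padic_natE expn1 modnn mul0n mod0n -[1]/(1%:R) padic_natE.
  by rewrite expn1 modn_small // prime_gt1.
Qed.

Lemma padic_frac (x : padic p_pr) : exists a b, b != 0 /\ x = tofrac a / tofrac b.
Proof.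
elim/quotW: x => r; exists (frac r).1, (frac r).2.
have d0 : (frac r).2 != 0 by case: r.
split=> //; apply: (canRL (mulfK _)); first by rewrite tofrac_eq0.
rewrite !piE; apply/eqP; rewrite piE /= FracField.equivfE /= /FracField.mulf.
by rewrite !numden_Ratio ?mulf_neq0 ?oner_eq0 // !mulr1 mulrC.
Qed.

End PadicCdvr.

Lemma rev_index s i : (i < s)%N ->
  [/\ (i <= s.-1)%N, (s.-1 - (s - i.+1) = i)%N & (s - i.+1 = s.-1 - i)%N].
Proof. by move=> lt; split; lia. Qed.

(* [P] of minimal degree with root [x], made primitive, is divisible by the
   distinguished factor given by Weierstrass preparation, which is therefore
   [1] or [P] up to a unit. *)
Section Valuation.
Variables (p : nat) (p_pr : prime p) (C : fieldType).
Local Notation Zp := (padic_int p_pr).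
Variable j : {rmorphism Zp -> C}.
Hypothesis j_inj : injective j.
Local Notation int := (integer j).
Let cd := padic_cdvr p_pr.

Lemma integer_sub x y : int x -> int y -> int (x - y).
Proof. exact: integral_sub. Qed.

Lemma integer_add x y : int x -> int y -> int (x + y).
Proof. exact: integral_add. Qed.

Lemma integer_mul x y : int x -> int y -> int (x * y).
Proof. exact: integral_mul. Qed.

Lemma integer_opp x : int x -> int (- x).
Proof. exact: integral_opp. Qed.

Lemma integer_one : int 1. Proof. exact: integral1. Qed.
Lemma integer_zero : int 0. Proof. exact: integral0. Qed.
Lemma integer_nat n : int n%:R. Proof. exact: integral_nat. Qed.
Lemma integer_j a : int (j a). Proof. exact: integral_id. Qed.

Lemma integer_exp x n : int x -> int (x ^+ n).
Proof.
move=> ix; elim: n => [|n IH]; first exact: integer_one.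
by rewrite exprS; apply: integer_mul.
Qed.

Lemma integer_sum (I : Type) (r : seq I) (F : I -> C) :
  (forall i, int (F i)) -> int (\sum_(i <- r) F i).
Proof.
move=> iF; elim/big_ind: _ => //; [exact: integer_zero|exact: integer_add].
Qed.

Lemma valuation_dichotomy x (P : {poly Zp}) : P != 0 -> root (map_poly j P) x ->
  int x^-1 \/ exists n y, [/\ (0 < n < size P)%N, int x, int y & x ^+ n = p%:R * y].
Proof.
move=> P0 rP.
pose ok s := exists P : {poly Zp}, [/\ P != 0, root (map_poly j P) x & size P = s].
have [|s /asboolP[P1 [P10 rP1 sP1]] smin] := ex_minnP (P := fun s => `[< ok s >]).
  by exists (size P); apply/asboolP; exists P.
have sle (S : {poly Zp}) : S != 0 -> root (map_poly j S) x -> (s <= size S)%N.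
  by move=> S0 rS; apply: smin; apply/asboolP; exists S.
have sP : (s <= size P)%N := sle P P0 rP.
have s0 : (s.-1 < s)%N by rewrite -sP1 prednK ?size_poly_gt0.
have lc0 : P1`_s.-1 <> 0 by apply/eqP; rewrite -sP1 lead_coef_eq0.
have [k [a' [aE [j0 [b [j0s j0b]]]]]] := cdvr_primitive cd (a := fun i => P1`_i) s0 lc0.
pose P2 := \poly_(i < s) a' i.
have P12 : P1 = (p%:R ^+ k)%:P * P2.
  apply/polyP => i; rewrite coefCM coef_poly; case: ltnP => [/aE //|si].
  by rewrite mulr0 nth_default // sP1.
have P20 : P2 != 0 by apply: contra P10 => /eqP E; rewrite P12 E mulr0.
have rP2 : root (map_poly j P2) x.
  move: rP1; rewrite P12 rmorphM /= rootM map_polyC /= rootC => /orP[/eqP E|//].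
  case: (negP P10); rewrite P12 (_ : p%:R ^+ k = 0) ?polyC0 ?mul0r //.
  by apply: j_inj; rewrite E rmorph0.
have sP2 : size P2 = s.
  by apply/eqP; rewrite eqn_leq size_poly sle.
have [|N /asboolP[v vN] Nmin] := ex_minnP (P := fun i => `[< exists b, P2`_i * b = 1 >]).
  by exists j0; apply/asboolP; exists b; rewrite coef_poly j0s.
have low i : (i < N)%N -> exists b, P2`_i = p%:R * b.
  move=> iN; have [//|u] := cdvr_dich cd P2`_i.
  by have := Nmin i (introT (asboolP _) u); rewrite leqNgt iN.
have [D [S [P2E mD sD lD]]] := weierstrass_factor cd low (ex_intro _ v vN).
have S0 : S != 0 by apply: contra P20 => /eqP E; rewrite P2E E mulr0.
have D0 := monic_neq0 mD.
have Ns : (N < s)%N.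
  rewrite ltnNge; apply/negP => sN; move: vN; rewrite nth_default ?sP2 // mul0r.
  by move/eqP; rewrite eq_sym oner_eq0.
move: (rP2); rewrite P2E rmorphM rootM => /orP[rD|rS].
  have sN := sle D D0 rD; right.
  have lex i : exists b, (i < N)%N -> D`_i = p%:R * b.
    by case: (ltnP i N) => [/lD[b' E]|_]; [exists b'|exists 0].
  have [l lP] := choice lex.
  have DN : D`_N = 1 by have := mD; rewrite monicE lead_coefE sD => /eqP.
  exists N, (- \sum_(i < N) j (l i) * x ^+ i); split.
  - rewrite (leq_trans _ sP) // andbT lt0n; apply/eqP => N0.
    have sD1 : (size D <= 1)%N by rewrite sD N0.
    have D1 : D = 1 by rewrite (size1_polyC sD1) -[0%N]N0 DN.
    by move: rD; rewrite D1 rmorph1 (negPf (root1 _)).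
  - by exists D.
  - apply: integer_opp; apply: integer_sum => i; apply: integer_mul; first exact: integer_j.
    by apply: integer_exp; exists D.
  move/rootP: rD; rewrite (@horner_coef_wide _ N.+1); last first.
    by rewrite (leq_trans (size_poly _ _)) // sD.
  rewrite big_ord_recr coef_map /= DN rmorph1 mul1r addrC => /eqP.
  rewrite addr_eq0 => /eqP ->; rewrite mulrN mulr_sumr; congr (- _).
  by apply: eq_bigr => i _; rewrite coef_map /= lP // rmorphM rmorph_nat mulrA.
left; have N0 : N = 0%N.
  have := sle S S0 rS; rewrite -sP2 P2E size_monicM // sD /=.
  by rewrite -{2}[size S]add0n leq_add2r leqn0 => /eqP.
have [->|x0] := eqVneq x 0; first by rewrite invr0; apply: integer_zero.
rewrite N0 in vN.
(* The reversal of [P2], normalised by the inverse [v] of its constant coefficient; it is monic with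
   root [x^-1]. *)
pose q := \poly_(i < s) (v * P2`_(s.-1 - i)).
have qs : q`_s.-1 = 1 by rewrite coef_poly s0 subnn mulrC.
have sq : size q = s.
  apply/eqP; rewrite eqn_leq size_poly /= leqNgt -(ltn_predK s0) ltnS; apply/negP.
  by move=> /(nth_default 0); rewrite qs => /eqP; rewrite oner_eq0.
exists q; first by rewrite monicE lead_coefE sq qs.
rewrite /root (@horner_coef_wide _ s); last by rewrite (leq_trans (size_poly _ _)) // sq.
have xn : x ^+ s.-1 != 0 by rewrite expf_neq0.
rewrite -(mulrI_eq0 _ (mulfI xn)) (_ : _ * _ = j v * (map_poly j P2).[x]).
  by move/rootP: rP2 => ->; rewrite mulr0.
rewrite (@horner_coef_wide _ s (map_poly j P2)); last first.
  by rewrite (leq_trans (size_poly _ _)) // sP2.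
rewrite (reindex_inj rev_ord_inj) !mulr_sumr; apply: eq_bigr => i _ /=.
rewrite !coef_map /= [q`_ _]coef_poly rev_ord_proof rmorphM /=.
have [is1 -> si] := rev_index (ltn_ord i).
rewrite -!mulrA mulrCA; congr (_ * _); rewrite mulrCA; congr (_ * _).
rewrite si.
by rewrite exprVn -[in x ^+ s.-1](subnKC is1) exprD mulfK ?expf_neq0.
Qed.

(** A monic equation for [1 / p], multiplied by the power of [p] of its degree, would express [1] as
    a multiple of [p] in [Z_p]. *)
Lemma integer_p_inv y : int y -> p%:R * y <> 1.
Proof.
case=> q mq rq py; have p0 : (p%:R : C) != 0.
  by apply/eqP => E; move/eqP: py; rewrite E mul0r eq_sym oner_eq0.
have yE : y = p%:R^-1 by apply: (mulfI p0); rewrite py divff.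
pose n := (size q).-1.
have E : \sum_(i < n.+1) q`_i * p%:R ^+ (n - i) = 0.
  apply: j_inj; rewrite rmorph0 rmorph_sum /=.
  move/rootP: rq; rewrite horner_coef => rq.
  transitivity (p%:R ^+ n * \sum_(i < size (map_poly j q)) (map_poly j q)`_i * y ^+ i);
    last first.
    by rewrite rq mulr0.
  have -> : size (map_poly j q) = n.+1.
    rewrite size_map_inj_poly ?rmorph0 // prednK // size_poly_gt0.
    exact: monic_neq0.
  rewrite mulr_sumr; apply: eq_bigr => i _; rewrite coef_map rmorphM rmorphXn rmorph_nat /=.
  rewrite mulrCA; congr (_ * _); rewrite yE exprVn; apply: (canRL (mulfK _)).
    by rewrite expf_neq0.
  by rewrite -exprD subnK // -ltnS.
rewrite big_ord_recr /= subnn expr0 mulr1 in E.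
have l1 : q`_n = 1 by apply/eqP; rewrite -monicE.
rewrite l1 in E.
apply: (cdvr_nonunit cd (b := - \sum_(i < n) q`_i * p%:R ^+ (n - i).-1)).
rewrite mulrN mulr_sumr -[RHS]opprK; congr (- _).
apply/eqP; rewrite -addr_eq0 -[X in _ == X]E; apply/eqP; congr (_ + _).
apply: eq_bigr => i _; rewrite mulrCA -exprS prednK // subn_gt0 //.
Qed.

Lemma integer_lead x (P : {poly Zp}) : P != 0 -> root (map_poly j P) x ->
  int (j (lead_coef P) * x).
Proof.
move=> P0 rP; pose c := lead_coef P; pose n := (size P).-1.
have sP : size P = n.+1 by rewrite prednK // size_poly_gt0.
pose q := \poly_(i < n.+1) (if i == n then 1 else P`_i * c ^+ (n.-1 - i)).
have qn : q`_n = 1 by rewrite coef_poly ltnSn eqxx.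
have sq : size q = n.+1.
  apply/eqP; rewrite eqn_leq size_poly /= ltnNge; apply/negP.
  by move=> /(nth_default 0); rewrite qn => /eqP; rewrite oner_eq0.
exists q; first by rewrite monicE lead_coefE sq qn.
have n0 : (0 < n)%N.
  rewrite lt0n; apply/eqP => n0; move: rP; rewrite /root.
  move: sP; rewrite n0 => sP; have := size1_polyC (eq_leq sP) => PC.
  rewrite PC map_polyC hornerC /= -(rmorph0 j) (inj_eq j_inj) => /eqP PC0.
  by case/eqP: P0; rewrite PC PC0.
rewrite /root (@horner_coef_wide _ n.+1); last by rewrite (leq_trans (size_poly _ _)) // sq.
have -> : \sum_(i < n.+1) (map_poly j q)`_i * (j c * x) ^+ i
    = j c ^+ n.-1 * \sum_(i < n.+1) (map_poly j P)`_i * x ^+ i.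
  rewrite mulr_sumr; apply: eq_bigr => i _; rewrite !coef_map /= coef_poly ltn_ord.
  rewrite exprMn mulrA [in RHS]mulrA; congr (_ * _).
  case: eqP => [->|/eqP ni].
    by rewrite rmorph1 mul1r -[in LHS](prednK n0) exprSr /c lead_coefE sP.
  have ltn : (i <= n.-1)%N by rewrite -ltnS prednK // ltn_neqAle ni -ltnS ltn_ord.
  by rewrite rmorphM rmorphXn -mulrA -exprD subnK // mulrC.
move/rootP: rP; rewrite (@horner_coef_wide _ n.+1) => [->|]; first by rewrite mulr0.
by rewrite (leq_trans (size_poly _ _)) // sP.
Qed.

Hypothesis alg : forall z : C, exists P : {poly Zp}, P != 0 /\ root (map_poly j P) z.

Lemma p_neq0C : (p%:R : C) != 0.
Proof.
rewrite -(rmorph_nat j) -(rmorph0 j) (inj_eq j_inj).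
apply/eqP => E; have := cdvr_reg cd (a := 1); rewrite E mul0r => /(_ erefl)/eqP.
by rewrite oner_eq0.
Qed.

(** If [x] is nonzero, an equation for [x^-1] makes [p ^ k / x] integral for some [k]. Divisibility
    of [x] by [p ^ k.+1] would then give an integral inverse of [p]. *)
Lemma integer_sep x : (forall N, exists2 z, int z & x = p%:R ^+ N * z) -> x = 0.
Proof.
move=> H; apply: contrapT => /eqP x0.
have [P [P0 rP]] := alg x^-1; have := integer_lead P0 rP.
have lc0 : lead_coef P <> 0 by apply/eqP; rewrite lead_coef_eq0.
have [k [u [v [-> uv]]]] := cdvr_factor cd lc0.
have [z iz Ez] := H k.+1 => it.
set t := _ * x^-1 in it.
apply: (integer_p_inv (y := z * t * j v)).
  by do 2?apply: integer_mul => //; apply: integer_j.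
have pk : (p%:R ^+ k : C) != 0 by rewrite expf_neq0 // p_neq0C.
apply: (mulfI pk); rewrite mulr1 !mulrA -exprSr -Ez /t rmorphM rmorphXn rmorph_nat.
by rewrite [x * _]mulrC mulfK // -mulrA -rmorphM uv rmorph1 mulr1.
Qed.

Lemma integer_total x : int x \/ int x^-1.
Proof.
have [P [P0 rP]] := alg x.
by have [|[n [y []]]] := valuation_dichotomy P0 rP; [right|left].
Qed.

Lemma maxideal_power x (P : {poly Zp}) : P != 0 -> root (map_poly j P) x ->
  maxideal j x -> exists n y, [/\ (0 < n < size P)%N, int y & x ^+ n = p%:R * y].
Proof.
move=> P0 rP [ix nu]; have [ixV|[n [y []]]] := valuation_dichotomy P0 rP; last by exists n, y.
have [x0|x0] := eqVneq x 0; last by case: nu; split=> //; exists x^-1; rewrite ?divff.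
exists 1%N, 0; split; [|exact: integer_zero|by rewrite x0 expr0n mulr0].
rewrite /= -(size_map_inj_poly j_inj (rmorph0 _)).
apply: root_size_gt1 rP.
by rewrite -size_poly_eq0 size_map_inj_poly ?rmorph0 // size_poly_eq0.
Qed.

(** The maximal ideal consists of the topologically nilpotent integers: from left to right by the
    dichotomy, from right to left because [p] has no integral inverse. In this form membership can
    be read off an equation. *)
Lemma maxidealP x : maxideal j x <->
  int x /\ exists n y, [/\ (0 < n)%N, int y & x ^+ n = p%:R * y].
Proof.
split=> [mx|[ix [n [y [n0 iy E]]]]].
  split; first by case: mx.
  have [P [P0 rP]] := alg x.
  by have [n [y [/andP[n0 _] iy E]]] := maxideal_power P0 rP mx; exists n, y.
split=> // -[_ [z iz xz]].
apply: (integer_p_inv (y := y * z ^+ n)); first by apply: integer_mul => //; apply: integer_exp.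
by rewrite mulrA -E -exprMn xz expr1n.
Qed.

Lemma padic_lim_eq (u : nat -> C) l : padic_cvg j u l -> padic_lim j u = l.
Proof.
move=> ul; rewrite /padic_lim; case: pselect => [ex|[]]; last by exists l.
case: cid => l' ul' /=; apply/eqP; rewrite -subr_eq0; apply/eqP/integer_sep => N.
have [k0 H] := ul N; have [k1 H'] := ul' N.
have [z iz Ez] := H (maxn k0 k1) (leq_maxl _ _).
have [z' iz' Ez'] := H' (maxn k0 k1) (leq_maxr _ _).
exists (z - z'); first exact: integer_sub.
by rewrite mulrBr -Ez -Ez'; ring.
Qed.

End Valuation.

(** * Rings of integers of finite extensions *)

Section PadicFractions.
Variables (p : nat) (p_pr : prime p).

Definition zfrac (a : padic_int p_pr) : padic p_pr := tofrac a.

Fact zfrac_zmod_morphism : zmod_morphism zfrac.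
Proof. exact: tofracB. Qed.
Fact zfrac_monoid_morphism : monoid_morphism zfrac.
Proof. by split; [exact: tofrac1|exact: tofracM]. Qed.

HB.instance Definition _ := GRing.isZmodMorphism.Build _ _ zfrac zfrac_zmod_morphism.
HB.instance Definition _ := GRing.isMonoidMorphism.Build _ _ zfrac zfrac_monoid_morphism.

Lemma zfracM a b : zfrac (a * b) = zfrac a * zfrac b.
Proof. exact: rmorphM. Qed.

Lemma zfrac_eq0 a : (zfrac a == 0) = (a == 0).
Proof. exact: tofrac_eq0. Qed.

End PadicFractions.

Lemma padic_poly_denominators p (p_pr : prime p) (P : {poly padic p_pr}) :
  exists (S : {poly padic_int p_pr}) c, c != 0 /\ map_poly (@zfrac _ _) S = zfrac c *: P.
Proof.
have [n sz] : exists n, (size P <= n)%N by exists (size P).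
have [a [c [c0 ac]]] : exists (a : nat -> padic_int p_pr) (c : padic_int p_pr), c != 0 /\ forall i, (i < n)%N ->
    zfrac (a i) = zfrac c * P`_i.
  elim: n {sz} => [|n [a [c [c0 ac]]]]; first by exists (fun=> 0), 1; rewrite oner_eq0.
  have [a' [b [b0 E]]] := padic_frac P`_n.
  exists (fun i => if i == n then a' * c else a i * b), (c * b); split.
    by rewrite mulf_neq0.
  move=> i; rewrite ltnS leq_eqVlt; case: eqP => [->|_] /= => [_|lt].
    rewrite E -/(zfrac a') -/(zfrac b) !zfracM mulrC -mulrA; congr (_ * _).
    by rewrite mulrC mulfVK ?zfrac_eq0.
  by rewrite !zfracM ac // mulrAC.
exists (\poly_(i < n) a i), c; split=> //; apply/polyP => i.
rewrite coef_map coefZ coef_poly; case: ltnP => [/ac //|ni].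
by rewrite nth_default ?mulr0 ?(leq_trans sz) // rmorph0.
Qed.

Lemma mulr_shuffle1 (S : comNzRingType) (x y z t u v : S) :
  x * (y * (z * t * u * v)) = t * (y * x * z * u) * v.
Proof. by ring. Qed.

Lemma mulr_shuffle2 (S : comNzRingType) (x y z t u : S) :
  x * (y * z) * (t * u) = x * (y * t * (z * u)).
Proof. by ring. Qed.

Lemma mulr_shuffle3 (S : comNzRingType) (x y z t : S) :
  x * (y * (z * t)) = z * (y * x * t).
Proof. by ring. Qed.

Section OmegaIntegers.
Variables (p : nat) (p_pr : prime p) (Omega : fieldExtType (padic p_pr)).
Local Notation Zp := (padic_int p_pr).
Local Notation O := (@padic_int_in p p_pr Omega).
Local Notation int := (integer O).

Fact padic_int_in_zmod_morphism : zmod_morphism O.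
Proof. by move=> a b; rewrite /padic_int_in tofracB scalerBl. Qed.

Fact padic_int_in_monoid_morphism : monoid_morphism O.
Proof.
split=> [|a b]; first by rewrite /padic_int_in tofrac1 scale1r.
by rewrite /padic_int_in tofracM -scalerAl mul1r scalerA.
Qed.

HB.instance Definition _ := GRing.isZmodMorphism.Build Zp Omega O
  padic_int_in_zmod_morphism.
HB.instance Definition _ := GRing.isMonoidMorphism.Build Zp Omega O
  padic_int_in_monoid_morphism.

Lemma padic_int_inM a b : O (a * b) = O a * O b.
Proof. exact: rmorphM. Qed.

Lemma padic_int_in_inj : injective O.
Proof.
move=> a b /eqP; rewrite -subr_eq0 -rmorphB /padic_int_in scaler_eq0 oner_eq0 orbF.
by rewrite tofrac_eq0 subr_eq0 => /eqP.
Qed.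

Lemma map_padic_int_in (S : {poly Zp}) :
  map_poly O S = map_poly (in_alg Omega) (map_poly (@zfrac _ _) S).
Proof. by apply/polyP => i; rewrite !coef_map. Qed.

(** The bound on the degree does not depend on [x]; it gives one exponent that works for the whole
    maximal ideal in [omega_maxideal_power]. *)
Lemma omega_algebraic_bound (x : Omega) : exists P : {poly Zp},
  [/\ P != 0, root (map_poly O P) x & (size P <= (\dim {:Omega}).+1)%N].
Proof.
have /polyOver1P[q Eq] : minPoly 1 x \is a polyOver 1%VS by apply: minPolyOver.
have [S [c [c0 SE]]] := padic_poly_denominators q.
have sS : size S = size q.
  rewrite -(size_scale q (_ : zfrac c != 0)) ?zfrac_eq0 // -SE.
  rewrite size_map_inj_poly ?rmorph0 // => a b /eqP.
  by rewrite -subr_eq0 -rmorphB zfrac_eq0 subr_eq0 => /eqP.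
have sq : size q = (adjoin_degree 1 x).+1.
  by rewrite -(size_minPoly 1 x) Eq size_map_poly.
exists S; split.
- by rewrite -size_poly_eq0 sS sq.
- rewrite map_padic_int_in SE map_polyZ /= -Eq rootZ ?root_minPoly //.
  by rewrite scaler_eq0 oner_eq0 orbF zfrac_eq0.
by rewrite sS sq ltnS adjoin_degreeE dimv1 divn1 dimvS // subvf.
Qed.

Lemma omega_algebraic (x : Omega) : exists P : {poly Zp},
  P != 0 /\ root (map_poly O P) x.
Proof. by have [P [P0 rP _]] := omega_algebraic_bound x; exists P. Qed.

Lemma omega_denominator (x : Omega) : exists k, int (p%:R ^+ k * x).
Proof.
have [P [P0 rP]] := omega_algebraic x; have := integer_lead padic_int_in_inj P0 rP.
have lc0 : lead_coef P <> 0 by apply/eqP; rewrite lead_coef_eq0.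
have [k [u [v [-> uv]]]] := cdvr_factor (padic_cdvr p_pr) lc0; exists k.
have -> : p%:R ^+ k * x = O v * (O (p%:R ^+ k * u) * x).
  rewrite padic_int_inM mulrA [O v * _]mulrCA -padic_int_inM [v * u]mulrC uv.
  by rewrite rmorph1 mulr1 rmorphXn rmorph_nat.
by apply: integer_mul => //; apply: integer_j.
Qed.

Lemma omega_sep x : (forall N, exists2 z, int z & x = p%:R ^+ N * z) -> x = 0.
Proof. exact: (integer_sep padic_int_in_inj omega_algebraic). Qed.

Lemma omega_total x : int x \/ int x^-1.
Proof. exact: (integer_total padic_int_in_inj omega_algebraic). Qed.

Lemma omega_maxidealP x : maxideal O x <->
  int x /\ exists n y, [/\ (0 < n)%N, int y & x ^+ n = p%:R * y].
Proof. exact: (maxidealP padic_int_in_inj omega_algebraic). Qed.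

Lemma omega_maxideal_power x : maxideal O x ->
  exists2 y, int y & x ^+ \dim {:Omega} = p%:R * y.
Proof.
move=> mx; have [P [P0 rP sP]] := omega_algebraic_bound x.
have [n [y [/andP[_ nP] iy E]]] := maxideal_power padic_int_in_inj P0 rP mx.
have nd : (n <= \dim {:Omega})%N by rewrite -ltnS (leq_trans nP).
exists (y * x ^+ (\dim {:Omega} - n)).
  by apply: integer_mul => //; apply: integer_exp; case: mx.
by rewrite mulrA -E -exprD subnKC.
Qed.

Lemma omega_p_inv y : int y -> p%:R * y <> 1 :> Omega.
Proof. exact: (integer_p_inv padic_int_in_inj). Qed.

Lemma omega_p_neq0 : p%:R != 0 :> Omega.
Proof. exact: (p_neq0C padic_int_in_inj). Qed.

Implicit Types E : {subfield Omega}.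

Lemma p_maxideal_of E : maxideal_of E p%:R.
Proof.
split; first exact: rpred_nat.
apply/omega_maxidealP; split; first exact: integer_nat.
by exists 1%N, 1; split=> //; [exact: integer_one|rewrite mulr1 expr1].
Qed.

Definition ints E : {pred Omega} := fun x => `[< integer_of E x >].

Fact ints_subring E : subring_closed (ints E).
Proof.
split=> [|x y /asboolP[xE ix] /asboolP[yE iy]|x y /asboolP[xE ix] /asboolP[yE iy]];
  apply/asboolP; split; rewrite ?rpred1 ?rpredB ?rpredM //.
- exact: integer_one.
- exact: integer_sub.
- exact: integer_mul.
Qed.

HB.instance Definition _ E := GRing.isSubringClosed.Build Omega (ints E) (ints_subring E).

Definition OE E := {x : Omega | x \in ints E}.
HB.instance Definition _ E := SubChoice.on (OE E).
HB.instance Definition _ E := [SubChoice_isSubComNzRing of OE E by <:].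

Definition toOE E x (ix : integer_of E x) : OE E := exist _ x (introT (asboolP _) ix).

Lemma val_OEP E (a : OE E) : integer_of E (val a).
Proof. by case: a => x /= /asboolP. Qed.

Lemma toOEK E x (ix : integer_of E x) : val (toOE ix) = x. Proof. by []. Qed.

Lemma valOE_D E (a b : OE E) : val (a + b) = val a + val b. Proof. exact: rmorphD. Qed.
Lemma valOE_M E (a b : OE E) : val (a * b) = val a * val b. Proof. exact: rmorphM. Qed.

Lemma valOE_X E (a : OE E) n : val (a ^+ n) = val a ^+ n. Proof. exact: rmorphXn. Qed.

(** An alias of [Omega], which is already a vector space over the [p]-adic numbers, made to carry
    its structure of module over the integers of [E]. *)
Definition OmegaOver E : Type := Omega.
HB.instance Definition _ E := GRing.Zmodule.on (OmegaOver E).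
Definition OmegaOver_scale E (a : OE E) (x : OmegaOver E) : OmegaOver E := val a * x.
Fact OmegaOver_scaleA E a b (x : OmegaOver E) :
  OmegaOver_scale a (OmegaOver_scale b x) = OmegaOver_scale (a * b) x.
Proof. by rewrite /OmegaOver_scale valOE_M mulrA. Qed.
Fact OmegaOver_scale1 E : left_id 1 (@OmegaOver_scale E).
Proof. by move=> x; rewrite /OmegaOver_scale rmorph1 mul1r. Qed.
Fact OmegaOver_scaleDr E : right_distributive (@OmegaOver_scale E) +%R.
Proof. by move=> a x y; rewrite /OmegaOver_scale mulrDr. Qed.
Fact OmegaOver_scaleDl E (x : OmegaOver E) :
  {morph (@OmegaOver_scale E)^~ x : a b / a + b}.
Proof. by move=> a b; rewrite /OmegaOver_scale valOE_D mulrDl. Qed.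
HB.instance Definition _ E := GRing.Zmodule_isLmodule.Build (OE E) (OmegaOver E)
  (@OmegaOver_scaleA E) (@OmegaOver_scale1 E) (@OmegaOver_scaleDr E)
  (@OmegaOver_scaleDl E).

Lemma OmegaOver_scaleE E (a : OE E) (x : OmegaOver E) : a *: x = val a * x.
Proof. by []. Qed.

Lemma unit_integer_of E x : x \in E -> integer_unit O x -> exists2 y, integer_of E y & x * y = 1.
Proof.
move=> xE [ix [y iy xy]]; exists y => //; split=> //.
have x0 : x != 0 by apply/eqP => x0; move/eqP: xy; rewrite x0 mul0r eq_sym oner_eq0.
by have -> : y = x^-1; [apply: (mulfI x0); rewrite xy divff | rewrite rpredV].
Qed.

Lemma integer_of_dich E x : integer_of E x ->
  maxideal_of E x \/ exists2 y, integer_of E y & x * y = 1.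
Proof.
case=> xE ix; have [ux|nu] := pselect (integer_unit O x).
  by right; apply: unit_integer_of.
by left.
Qed.

Lemma maxideal_ofM E x y : maxideal_of E x -> integer_of E y -> maxideal_of E (x * y).
Proof.
case=> xE [ix nux] [yE iy]; split; first by rewrite rpredM.
split; first exact: integer_mul.
case=> _ [z iz E1]; apply: nux; split=> //; exists (y * z); rewrite ?mulrA //.
exact: integer_mul.
Qed.

Lemma maxideal_of_int E x : maxideal_of E x -> integer_of E x.
Proof. by case=> xE [ix _]. Qed.

Lemma integer_ofM E x y : integer_of E x -> integer_of E y -> integer_of E (x * y).
Proof. by case=> xE ix [yE iy]; split; [rewrite rpredM|apply: integer_mul]. Qed.
Lemma integer_ofD E x y : integer_of E x -> integer_of E y -> integer_of E (x + y).
Proof. by case=> xE ix [yE iy]; split; [rewrite rpredD|apply: integer_add]. Qed.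
Lemma integer_ofB E x y : integer_of E x -> integer_of E y -> integer_of E (x - y).
Proof. by case=> xE ix [yE iy]; split; [rewrite rpredB|apply: integer_sub]. Qed.
Lemma integer_of1 E : integer_of E 1.
Proof. by split; [rewrite rpred1|apply: integer_one]. Qed.
Lemma integer_of0 E : integer_of E 0.
Proof. by split; [rewrite rpred0|apply: integer_zero]. Qed.
Lemma integer_ofX E x n : integer_of E x -> integer_of E (x ^+ n).
Proof.
move=> ix; elim: n => [|n IH]; first exact: integer_of1.
by rewrite exprS; apply: integer_ofM.
Qed.
Lemma integer_of_sum E (I : Type) (r : seq I) (P : pred I) (F : I -> Omega) :
  (forall i, P i -> integer_of E (F i)) -> integer_of E (\sum_(i <- r | P i) F i).
Proof.
by move=> H; elim/big_ind: _ => //; [apply: integer_of0|apply: integer_ofD].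
Qed.
Lemma integer_ofS E E' x : (E <= E')%VS -> integer_of E x -> integer_of E' x.
Proof. by move=> /subvP s [xE ix]; split=> //; apply: s. Qed.

(* If no element generated the maximal ideal, [p] would be a product of
   arbitrarily many elements of the maximal ideal, each of which has a bounded
   power divisible by [p]. *)
Lemma exists_uniformizer E : exists t, is_uniformizer E t.
Proof.
apply: contrapT => nex; pose d := \dim {:Omega}.
have split_max x : maxideal_of E x -> exists y z,
    [/\ maxideal_of E y, maxideal_of E z & x = y * z].
  move=> mx; have [H|H] := pselect (forall y, maxideal_of E y ->
      exists2 z, integer_of E z & y = x * z).
    case: nex; exists x => y; split; first exact: H.
    by case=> z iz ->; apply: maxideal_ofM.
  have [y [my nxy]] : exists y, maxideal_of E y /\
      ~ exists2 z, integer_of E z & y = x * z.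
    apply: contrapT => H'; apply: H => y my; apply: contrapT => nxy.
    by apply: H'; exists y.
  have [xE _] := mx; have [yE _] := my.
  have y0 : y != 0.
    apply/eqP => y0; apply: nxy; exists 0; rewrite ?mulr0 //; exact: integer_of0.
  exists y, (x / y); split=> //; last by rewrite mulrC mulfVK.
  have xyE : x / y \in E by rewrite rpred_div.
  have ixy : integer O (x / y).
    have [//|iyx] := omega_total (x / y).
    have [x0|x0] := eqVneq x 0; first by rewrite x0 mul0r; apply: integer_zero.
    case: nxy; exists (y / x); last by rewrite mulrC mulfVK.
    by split; [rewrite rpred_div|rewrite -invf_div].
  split=> //; split=> // -[_ [z iz xyz]].
  have [|z' iz' E1] := unit_integer_of xyE; first by split=> //; exists z.
  by case: nxy; exists z' => //; rewrite -[LHS]mulr1 -E1 mulrA [y * _]mulrC mulfVK.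
(* Each splitting of the current factor removes some [y'] from the maximal ideal, and [y' ^ d]
   contributes one more factor [p] on the right. *)
have H k : exists x z, [/\ maxideal_of E x, integer O z &
    p%:R ^+ d = x ^+ d * (p%:R ^+ k * z) :> Omega].
  elim: k => [|k [x [z [mx iz E1]]]].
    exists p%:R, 1; split; [exact: p_maxideal_of|exact: integer_one|by rewrite !mulr1].
  have [y [y' [my [_ my'] xE]]] := split_max x mx.
  have [z' iz' E2] := omega_maxideal_power my'.
  exists y, (z' * z); split=> //; first exact: integer_mul.
  by rewrite E1 xE exprMn E2 exprS; exact: mulr_shuffle2.
have [x [z [[_ [ix _]] iz E1]]] := H d.+1.
apply: (omega_p_inv (y := x ^+ d * z)).
  by apply: integer_mul => //; apply: integer_exp.
have pd : p%:R ^+ d != 0 :> Omega by rewrite expf_neq0 // omega_p_neq0.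
by apply: (mulfI pd); rewrite mulr1 [RHS]E1 exprS mulr_shuffle3.
Qed.

Lemma uniformizer_max E t : is_uniformizer E t -> maxideal_of E t.
Proof. by move=> ut; apply/ut; exists 1; rewrite ?mulr1 //; apply: integer_of1. Qed.

Lemma uniformizer_neq0 E t : is_uniformizer E t -> t != 0.
Proof.
move=> ut; have /ut[y _ E1] := p_maxideal_of E.
by apply: contra omega_p_neq0 => /eqP t0; rewrite E1 t0 mul0r.
Qed.

(** [Z_p] is integrally closed: a fraction of negative valuation, multiplied by suitable integers,
    would be an integral inverse of [p]. *)
Lemma padic_subfield_integer (x : Omega) : integer_of 1%AS x -> exists a, x = O a.
Proof.
case=> /vlineP[c ->] ic; have [a [b [b0 cE]]] := padic_frac c.
have [a0|/eqP a0] := eqVneq a 0.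
  by exists 0; rewrite cE a0 tofrac0 mul0r scale0r rmorph0.
have [k [u [v [aE uv]]]] := cdvr_factor (padic_cdvr p_pr) a0.
have [l [u' [v' [bE uv']]]] := cdvr_factor (padic_cdvr p_pr) (elimN eqP b0).
have xb : c%:A * O b = O a.
  by rewrite /padic_int_in -scalerAl mul1r scalerA cE mulfVK // tofrac_eq0.
have p0 := omega_p_neq0.
have [lk|kl] := leqP l k.
  exists (p%:R ^+ (k - l) * u * v').
  have Ob : O b != 0 by rewrite -(rmorph0 O) (inj_eq padic_int_in_inj).
  apply: (mulIf Ob); rewrite xb -rmorphM aE bE; congr (O _).
  rewrite -{1}(subnK lk) exprD; have -> : p%:R ^+ (k - l) * u * v' * (p%:R ^+ l * u') =
    p%:R ^+ (k - l) * p%:R ^+ l * u * (u' * v') by ring.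
  by rewrite uv' mulr1.
have [e le] : exists e, l = (k.+1 + e)%N by exists (l - k.+1)%N; rewrite subnKC.
case: (omega_p_inv (y := p%:R ^+ e * c%:A * O u' * O v)).
  do 3?apply: integer_mul => //; try exact: integer_j.
  exact/integer_exp/integer_nat.
have pk : p%:R ^+ k != 0 :> Omega by rewrite expf_neq0.
apply: (mulfI pk); rewrite mulr1.
transitivity (c%:A * O b * O v).
  have -> : O b = p%:R * p%:R ^+ k * p%:R ^+ e * O u'.
    by rewrite bE padic_int_inM rmorphXn rmorph_nat le exprD exprS.
  by rewrite mulr_shuffle1.
by rewrite xb aE -padic_int_inM -mulrA uv mulr1 rmorphXn rmorph_nat.
Qed.

Definition pOE E : OE E := p%:R.
Lemma val_pOE E : val (pOE E) = p%:R. Proof. exact: rmorph_nat. Qed.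

Lemma OE_eq E (a b : OE E) : val a = val b -> a = b. Proof. exact: val_inj. Qed.

Lemma padic_OE_cdvr : cdvr (pOE 1%AS).
Proof.
have Oint a : integer_of 1%AS (O a).
  by split; [rewrite /padic_int_in rpredZ // rpred1|apply: integer_j].
have ex (x : OE 1%AS) : exists a, x = toOE (Oint a).
  by have [a E] := padic_subfield_integer (val_OEP x); exists a; apply: val_inj.
have pcd := padic_cdvr p_pr; split.
- move=> x; have [a ->] := ex x; have [[b E]|[b E]] := cdvr_dich pcd a; [left|right];
    exists (toOE (Oint b)); apply: val_inj; rewrite valOE_M !toOEK ?val_pOE.
    by rewrite E rmorphM rmorph_nat.
  by rewrite -rmorphM E !rmorph1.
- move=> x H; apply: val_inj; apply: omega_sep => N; have [b ->] := H N.
  exists (val b); first by case: (val_OEP b).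
  by rewrite valOE_M valOE_X val_pOE.
- move=> x; have [a aE] := choice (fun i => ex (x i)).
  have [l lP] := cdvr_lim pcd a; exists (toOE (Oint l)) => k; have [b E] := lP k.
  exists (toOE (Oint b)); apply: val_inj.
  rewrite valOE_D valOE_M valOE_X val_pOE !toOEK E rmorphD rmorphM rmorphXn rmorph_nat.
  congr (_ + _); rewrite !rmorph_sum; apply: eq_bigr => i _ /=.
  by rewrite -/(val (x i)) -/(val (pOE 1%AS ^+ i)) aE valOE_X val_pOE toOEK padic_int_inM rmorphXn rmorph_nat.
- move=> a /(congr1 val); rewrite valOE_M val_pOE => /eqP.
  by rewrite mulf_eq0 (negPf omega_p_neq0) => /eqP a0; apply: val_inj.
- move=> b /(congr1 val); rewrite valOE_M val_pOE rmorph1.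
  by apply: omega_p_inv; case: (val_OEP b).
Qed.

End OmegaIntegers.

Lemma mulr_shuffle4 (S : comNzRingType) (x y z t : S) :
  x * y * z * t = x * (t * z * y).
Proof. by ring. Qed.

Lemma sum_ord_split (V : nmodType) (F : nat -> V) k m : (k <= m)%N ->
  \sum_(i < m) F i = \sum_(i < k) F i + \sum_(i < m - k) F (k + i)%N.
Proof. by move=> /subnKC <-; rewrite big_split_ord addKn. Qed.

(** * Integral bases and completeness of rings of integers *)

Section Lattice.
Variables (p : nat) (p_pr : prime p) (Omega : fieldExtType (padic p_pr)).
Local Notation O := (@padic_int_in p p_pr Omega).
Local Notation int := (integer O).
Implicit Types E K : {subfield Omega}.

Lemma valOE_sum E n (F : 'I_n -> OE E) : val (\sum_i F i) = \sum_i val (F i).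
Proof. exact: rmorph_sum. Qed.

Lemma valOE_nat E n : val (n%:R : OE E) = n%:R. Proof. exact: rmorph_nat. Qed.

Lemma subfield_basis K E (n := \dim_K E) : (K <= E)%VS ->
  exists X : nat -> Omega, [/\ forall i, (i < n)%N -> X i \in E,
    forall x, x \in E -> exists2 a : nat -> Omega, (forall i, a i \in K) &
      x = \sum_(i < n) a i * X i &
    forall a : nat -> Omega, (forall i, a i \in K) -> \sum_(i < n) a i * X i = 0 ->
      forall i, (i < n)%N -> a i = 0].
Proof.
rewrite -sup_field_module => sKE.
have [X [XE X0] [defE dxE]] := field_module_semisimple sKE.
exists (fun i => X`_i); split=> [i lti|x|a aK a0 i lti].
- by apply: XE; rewrite mem_nth // size_tuple.
- move=> xE; have : x \in (\sum_(i < \dim_K E) K * <[X`_i]>)%VS by rewrite defE.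
  move=> /memv_sumP[y yP ->].
  have ex i : exists a, a \in K /\ forall lti : (i < n)%N, y (Ordinal lti) = a * X`_i.
    have [lti|ge] := pselect ((i < n)%N : Prop); last by exists 0; rewrite rpred0.
    have /memv_cosetP[a aK E1] := yP (Ordinal lti) isT.
    exists a; split=> // lti'; rewrite -E1; congr y; exact: val_inj.
  have [a aP] := choice ex; exists a => [i|]; first by have [] := aP i.
  apply: eq_bigr => -[i lti] _; by have [_ ->] := aP i.
have /eqP : a i * X`_i = 0.
  move: (directv_sum_independent dxE) => /(_ (fun i : 'I_n => a i * X`_i)) H.
  by apply: (H _ a0 (Ordinal lti)) => // k _; rewrite memv_mul ?memv_line.
rewrite mulf_eq0 => /orP[/eqP //|/eqP Xi].
by case/negP: X0; rewrite -Xi mem_nth // size_tuple.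
Qed.

Lemma common_denominator (x : nat -> Omega) n : exists k,
  forall i, (i < n)%N -> int (p%:R ^+ k * x i).
Proof.
have [k kP] := choice (fun i => omega_denominator (x i)).
exists (\sum_(i < n) k i)%N => i lti; rewrite (bigD1 (Ordinal lti)) //= addnC exprD -mulrA.
by apply: integer_mul => //; apply: integer_exp; apply: integer_nat.
Qed.

Section OverK.
Variables (K : {subfield Omega}) (w : OE K) (cd : cdvr w).

Lemma cdvr_maxideal_of : maxideal_of K (val w).
Proof.
have iw := val_OEP w; have [wK iw'] := iw; split=> //; split=> // uw.
have [y iy E1] := unit_integer_of wK uw.
apply: (cdvr_nonunit cd (b := toOE iy)); apply: val_inj.
by rewrite valOE_M toOEK E1 rmorph1.
Qed.

(** A vector space basis scaled by a power of [p] bounds the rank of the integers from below, and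
    coordinates cleared of denominators bound it from above; [free_extension] with an empty starting
    family gives the basis. The upper bound is kept as the last clause, to be applied to the powers
    of a uniformizer. *)
Lemma lattice_basis E (n := \dim_K E) : (K <= E)%VS ->
  exists e : nat -> Omega, [/\ forall i, (i < n)%N -> integer_of E (e i),
    forall x, integer_of E x -> exists a : nat -> OE K, x = \sum_(i < n) val (a i) * e i,
    forall a : nat -> OE K, \sum_(i < n) val (a i) * e i = 0 ->
      forall i, (i < n)%N -> a i = 0 &
    forall y : nat -> Omega, (forall i, (i <= n)%N -> integer_of E (y i)) ->
      exists (a : nat -> OE K) i, [/\ (i <= n)%N, a i <> 0 &
        \sum_(i < n.+1) val (a i) * y i = 0]].
Proof.
move=> sKE; have [X [XE gen ind]] := subfield_basis sKE.
pose V := OmegaOver K; pose B (x : V) := integer_of E (x : Omega); pose T (x : V) := x = 0.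
have w0 : val w != 0.
  apply/eqP => w0; apply: (cdvr_nonunit cd (b := 0)).
  have -> : w = 0 by apply: val_inj; rewrite w0.
  by have := cdvr_reg cd (a := 1); rewrite mulr1 mulr0 => H; apply/esym/H/val_inj.
have BS : submod B.
  split=> [|a x y Bx By]; first exact: integer_of0.
  rewrite OmegaOver_scaleE; apply: integer_ofD => //; apply: integer_ofM => //.
  by apply: integer_ofS sKE _; apply: val_OEP.
have TS : submod T by split=> // a x y -> ->; rewrite scaler0 addr0.
have Ttf x : B x -> T (w *: x) -> T x.
  by move=> _ /eqP; rewrite /T OmegaOver_scaleE mulf_eq0 (negPf w0) => /eqP.
have Tsep x : B x -> (forall k, exists2 y, B y & T (x - w ^+ k *: y)) -> T x.
  move=> _ H; apply: omega_sep => N.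
  have [_ /omega_maxidealP[_ [k [z [k0 iz E1]]]]] := cdvr_maxideal_of.
  have [y [_ iy] /eqP] := H (k * N)%N; rewrite subr_eq0 => /eqP ->.
  exists (z ^+ N * y); first by apply: integer_mul => //; apply: integer_exp.
  by rewrite OmegaOver_scaleE valOE_X exprM E1 exprMn mulrA.
have ub' (y : nat -> Omega) : (forall i, (i <= n)%N -> integer_of E (y i)) ->
      exists (a : nat -> OE K) i, [/\ (i <= n)%N, a i <> 0 &
        \sum_(i < n.+1) val (a i) * y i = 0].
  move=> By.
  have ex i : exists a : nat -> Omega, (i <= n)%N ->
      (forall j, a j \in K) /\ y i = \sum_(j < n) a j * X j.
    have [lti|_] := leqP i n; last by exists (fun=> 0).
    by have [yE _] := By i lti; have [a aK E1] := gen _ yE; exists a.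
  have [a aP] := choice ex.
  have [k kP] := choice (fun i => common_denominator (a i) n).
  pose D := (\sum_(i < n.+1) k i)%N.
  have vex i : exists v : nat -> OE K, forall j, (i <= n)%N -> (j < n)%N ->
      val (v j) = p%:R ^+ D * a i j.
    suff vex' j : exists v : OE K, (i <= n)%N -> (j < n)%N -> val v = p%:R ^+ D * a i j.
      by have [v vP] := choice vex'; exists v.
    have [lti|_] := leqP i n; last by exists 0.
    have [ltj|_] := ltnP j n; last by exists 0.
    have ia : integer_of K (p%:R ^+ D * a i j).
      have [aK _] := aP i lti; split; first by rewrite rpredM ?rpredX ?rpred_nat ?aK.
      rewrite /D (bigD1 (inord i)) //= inordK // addnC exprD -mulrA.
      by apply: integer_mul; [apply: integer_exp; apply: integer_nat|apply: kP].
    by exists (toOE ia).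
  have [v vP] := choice vex.
  have [c [[i [lei ci]] cP]] := cdvr_dependence cd n v.
  exists c, i; split=> //.
  have pD : p%:R ^+ D != 0 :> Omega by rewrite expf_neq0 // omega_p_neq0.
  apply: (mulfI pD); rewrite mulr0 mulr_sumr.
  have -> : \sum_(i < n.+1) p%:R ^+ D * (val (c i) * y i) =
      \sum_(i < n.+1) \sum_(j < n) val (c i * v i j) * X j.
    apply: eq_bigr => l _; have [_ ->] := aP l (ltn_ord l).
    rewrite !mulr_sumr; apply: eq_bigr => j _.
    by rewrite valOE_M (vP _ _ (ltn_ord l) (ltn_ord j)) mulrCA -mulrA -mulrA.
  rewrite exchange_big big1 // => j _.
  by rewrite -mulr_suml -valOE_sum cP // rmorph0 mul0r.
have ub (y : nat -> V) : (forall i, (i <= n)%N -> B (y i)) -> ~ indep_mod T n.+1 y.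
  move=> By iy; have [c [i [lei ci E0]]] := ub' y By.
  by apply: ci; apply: (iy c) => //; rewrite /T -[RHS]E0.
have lb : exists2 y : nat -> V, forall i, (i < n)%N -> B (y i) & indep_mod T n y.
  have [k kP] := common_denominator X n.
  exists (fun i => p%:R ^+ k * X i) => [i lti|a Ta i lti].
    by split; [rewrite rpredM ?rpredX ?rpred_nat // XE|apply: kP].
  have pk : p%:R ^+ k != 0 :> Omega by rewrite expf_neq0 // omega_p_neq0.
  apply: val_inj; rewrite rmorph0; apply: (mulfI pk); rewrite mulr0.
  apply: (ind (fun i => p%:R ^+ k * val (a i))) => // [j|].
    by rewrite rpredM ?rpredX ?rpred_nat //; case: (val_OEP (a j)).
  rewrite -[RHS]Ta; apply: eq_bigr => j _.
  by rewrite OmegaOver_scaleE mulrCA mulrA.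
have [||_ [e [_ Be ie gene]]] := free_extension cd BS TS Ttf Tsep (n := n)
  (h := 0) (x := fun=> 0) _ _ ub lb.
- by [].
- by [].
exists e; split=> //.
by move=> x ix; have [a /eqP] := gene x ix; rewrite subr_eq0 => /eqP ->; exists a.
Qed.

End OverK.

(** Limits are taken coordinate by coordinate on an integral basis over the prime field, whose
    integers are [Z_p]. *)
Lemma OE_p_complete E (a : nat -> OE E) : exists l : OE E, forall k, exists b,
  l = \sum_(i < k) a i * p%:R ^+ i + p%:R ^+ k * b.
Proof.
have s1E : (1%AS <= E)%VS by rewrite sub1v.
have [e [Be gen _ _]] := lattice_basis (padic_OE_cdvr Omega) s1E.
set n := \dim_1%AS E in Be gen.
have [c cP] := choice (fun i => gen _ (val_OEP (a i))).
have [l lP] := choice (fun j => cdvr_lim (padic_OE_cdvr Omega) (fun i => c i j)).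
have comb (x : nat -> OE 1%AS) : integer_of E (\sum_(j < n) val (x j) * e j).
  apply: integer_of_sum => j _; apply: integer_ofM; last exact: Be.
  by apply: integer_ofS s1E _; apply: val_OEP.
exists (toOE (comb l)) => k; have [b bP] := choice (fun j => lP j k).
exists (toOE (comb b)); apply: val_inj.
rewrite valOE_D valOE_M valOE_X valOE_nat !toOEK valOE_sum.
rewrite (eq_bigr (fun j : 'I_n => \sum_(i < k) val (c i j) * p%:R ^+ i * e j +
   p%:R ^+ k * (val (b j) * e j))) => [|j _]; last first.
  rewrite bP valOE_D valOE_M valOE_X val_pOE mulrDl -mulrA valOE_sum mulr_suml.
  by congr (_ + _); apply: eq_bigr => i _; rewrite valOE_M valOE_X val_pOE.
rewrite big_split -mulr_sumr exchange_big; congr (_ + _).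
apply: eq_bigr => i _; rewrite valOE_M valOE_X valOE_nat cP mulr_suml.
by apply: eq_bigr => j _; rewrite mulrAC.
Qed.

(** Some power of [t] is divisible by [p], so separatedness follows from the [p]-adic one. With this
    lemma [lattice_basis] applies over every subfield and no longer only over the prime field. *)
Lemma uniformizer_cdvr E (t : OE E) : is_uniformizer E (val t) -> cdvr t.
Proof.
move=> ut; have t0 := uniformizer_neq0 ut; have mt := uniformizer_max ut.
have [_ /omega_maxidealP[_ [n [y [n0 iy tn]]]]] := mt.
have yE : integer_of E y.
  split=> //; have -> : y = val t ^+ n / p%:R.
    by rewrite tn mulrC mulKf // omega_p_neq0.
  by rewrite rpred_div ?rpredX ?rpred_nat //; case: mt.
have [z zE pz] : exists2 z, integer_of E z & p%:R = val t * z.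
  by apply/ut; apply: p_maxideal_of.
pose Y := toOE yE; pose Z := toOE zE.
have tnE : t ^+ n = p%:R * Y by apply: val_inj; rewrite valOE_M valOE_X valOE_nat tn.
have pE : p%:R = t * Z by apply: val_inj; rewrite valOE_M valOE_nat.
split.
- move=> a; have [/ut[b ib E1]|[b ib E1]] := integer_of_dich (val_OEP a); [left|right];
    by exists (toOE ib); apply: val_inj; rewrite valOE_M toOEK ?rmorph1.
- move=> a H; apply: val_inj; apply: omega_sep => N; have [b ->] := H (n * N)%N.
  exists (y ^+ N * val b).
    by apply: integer_mul; [apply: integer_exp|case: (val_OEP b)].
  by rewrite exprM tnE exprMn !valOE_M !valOE_X valOE_nat mulrA.
- move=> a.
  (* As [t ^ n = p * Y], a [t]-adic series regroups, in blocks of [n] consecutive terms, into a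
     [p]-adic series. *)
  have [l lP] := OE_p_complete (fun k => (\sum_(i < n) a (n * k + i)%N * t ^+ i) * Y ^+ k).
  exists l => k; have [b E1] := lP k.
  have S (K : nat) : \sum_(i < K) (\sum_(i0 < n) a (n * i + i0)%N * t ^+ i0) * Y ^+ i * p%:R ^+ i
      = \sum_(i < n * K) a i * t ^+ i.
    elim: K => [|K IH]; first by rewrite muln0 !big_ord0.
    rewrite big_ord_recr IH mulnS addnC big_split_ord /=; congr (_ + _).
    rewrite !mulr_suml; apply: eq_bigr => i _; rewrite exprD exprM tnE exprMn.
    exact: mulr_shuffle4.
  rewrite S in E1.
  have kn : (k <= n * k)%N by rewrite leq_pmull.
  exists (\sum_(i < n * k - k) a (k + i)%N * t ^+ i + Z ^+ k * b).
  rewrite E1 (sum_ord_split (fun i => a i * t ^+ i) kn) -addrA mulrDr mulr_sumr.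
  congr (_ + (_ + _)); last by rewrite pE exprMn mulrA.
  by apply: eq_bigr => i _; rewrite exprD mulrCA.
- move=> a /(congr1 val); rewrite valOE_M rmorph0 => /eqP.
  by rewrite mulf_eq0 (negPf t0) => /eqP a0; apply: val_inj.
- move=> b /(congr1 val); rewrite valOE_M rmorph1 => E1.
  have [_ [it]] := mt; apply; split=> //; exists (val b) => //.
  by case: (val_OEP b).
Qed.

End Lattice.

(** * Substitution of power series in filtered rings *)

(** [I 0] plays the role of a ring of integers and need not be the whole ring. The instances include
    the order of vanishing of polynomials in one or several variables and the powers of a maximal
    ideal inside a field, so the same lemmas serve formal substitution and convergence at points. *)
Record filtration (S : comNzRingType) (I : nat -> S -> Prop) : Prop := Filtration {
  fil0 : forall d, I d 0;
  filB : forall d x y, I d x -> I d y -> I d (x - y);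
  filM : forall a b x y, I a x -> I b y -> I (a + b)%N (x * y);
  filS : forall d x, I d.+1 x -> I d x;
  fil1 : I 0%N 1 }.

Section Filtration.
Variables (S : comNzRingType) (I : nat -> S -> Prop) (fI : filtration I).

Lemma filN d x : I d x -> I d (- x).
Proof. by move=> Ix; rewrite -sub0r; apply: filB => //; apply: fil0. Qed.

Lemma filD d x y : I d x -> I d y -> I d (x + y).
Proof. by move=> Ix Iy; rewrite -[y]opprK; apply: filB => //; apply: filN. Qed.

Lemma fil_le d e x : (d <= e)%N -> I e x -> I d x.
Proof.
move=> /subnKC <-; elim: (e - d)%N => [|k IH]; first by rewrite addn0.
by rewrite addnS => /(filS fI).
Qed.

Lemma filMr d x y : I d x -> I 0%N y -> I d (x * y).
Proof. by move=> Ix Iy; rewrite -[d]addn0; apply: filM. Qed.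

Lemma filMl d x y : I 0%N x -> I d y -> I d (x * y).
Proof. by move=> Ix Iy; rewrite mulrC; apply: filMr. Qed.

Lemma filX e x n : I e x -> I (n * e)%N (x ^+ n).
Proof.
move=> Ix; elim: n => [|n IH]; first exact: fil1.
by rewrite exprS mulSn; apply: filM.
Qed.

Lemma filX0 x n : I 0%N x -> I 0%N (x ^+ n).
Proof. by move=> /(@filX _ _ n); rewrite muln0. Qed.

Lemma filX1 x n : I 1%N x -> I n (x ^+ n).
Proof. by move=> /(@filX _ _ n); rewrite muln1. Qed.

Lemma fil_sum d (T : Type) (r : seq T) (P : pred T) (F : T -> S) :
  (forall i, P i -> I d (F i)) -> I d (\sum_(i <- r | P i) F i).
Proof. by move=> H; elim/big_ind: _ => //; [apply: fil0|apply: filD]. Qed.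

Lemma fil_sum_seq d (T : eqType) (r : seq T) (F : T -> S) :
  (forall i, i \in r -> I d (F i)) -> I d (\sum_(i <- r) F i).
Proof. by move=> H; rewrite big_seq; apply: fil_sum. Qed.

Lemma fil_subX d x y n : I 0%N x -> I 0%N y -> I d (x - y) -> I d (x ^+ n - y ^+ n).
Proof.
move=> Ix Iy Ixy; rewrite subrXX; apply: filMr => //; apply: fil_sum => i _.
by apply: filMl; apply: filX0.
Qed.

Lemma fil_trans d y x z : I d (x - y) -> I d (y - z) -> I d (x - z).
Proof. by move=> H1 H2; have := filD H1 H2; rewrite addrA subrK. Qed.

Lemma fil_sym d x y : I d (x - y) -> I d (y - x).
Proof. by move=> /filN; rewrite opprB. Qed.

Lemma fil_add_trans d a b0 b1 c0 c1 : I d (a - (b0 + b1)) -> I d (c0 - b0) ->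
  I d (c1 - b1) -> I d (a - (c0 + c1)).
Proof.
move=> H H0 H1; have := filB fI H (filD H0 H1).
by congr (I d _); ring.
Qed.

Section Poly.
Variables (R0 : comNzRingType) (c : {rmorphism R0 -> S}).

Definition pev (P : {poly R0}) (s : S) := (map_poly c P).[s].

Lemma pevE P s : pev P s = \sum_(i < size P) c P`_i * s ^+ i.
Proof.
rewrite /pev (@horner_coef_wide _ (size P)) ?size_poly //.
by apply: eq_bigr => i _; rewrite coef_map.
Qed.

Lemma pevB P Q s : pev (P - Q) s = pev P s - pev Q s.
Proof. by rewrite /pev rmorphB hornerD hornerN. Qed.

Lemma pev_comp P Q s : pev (P \Po Q) s = pev P (pev Q s).
Proof. by rewrite /pev map_comp_poly horner_comp. Qed.

Lemma pev_high e (P : {poly R0}) s : (forall i, I 0%N (c P`_i)) ->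
  (forall i, (i < e)%N -> P`_i = 0) -> I 1%N s -> I e (pev P s).
Proof.
move=> cP P0 Is; rewrite pevE; apply: fil_sum => i _.
have [lt|ge] := ltnP i e; first by rewrite P0 // rmorph0 mul0r; apply: fil0.
by apply: filMl => //; apply: fil_le ge _; apply: filX1.
Qed.

Lemma pev_arg e (P : {poly R0}) s s' : (forall i, I 0%N (c P`_i)) ->
  I 0%N s -> I 0%N s' -> I e (s - s') -> I e (pev P s - pev P s').
Proof.
move=> cP Is Is' Iss; rewrite !pevE -sumrB; apply: fil_sum => i _.
by rewrite -mulrBr; apply: filMl => //; apply: fil_subX.
Qed.

Lemma mmap_high n e (P : {mpoly R0[n]}) (h : 'I_n -> S) :
    (forall m, I 0%N (c P@_m)) -> (forall m, (mdeg m < e)%N -> P@_m = 0) ->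
    (forall i, I 1%N (h i)) -> I e (mmap c h P).
Proof.
move=> cP P0 Ih; apply: fil_sum_seq => m _.
have [lt|ge] := ltnP (mdeg m) e; first by rewrite P0 // rmorph0 mul0r; apply: fil0.
apply: filMl => //; apply: fil_le ge _; rewrite mdegE /mmap1.
elim/big_ind2: _ => [|a x b y Ia Ib|i _]; [exact: fil1|exact: filM|exact: filX1].
Qed.

Lemma mmap1_int n (h : 'I_n -> S) m : (forall i, I 0%N (h i)) -> I 0%N (mmap1 h m).
Proof.
move=> Ih; rewrite /mmap1; elim/big_ind: _ => [|x y|i _]; first exact: fil1.
  exact: (@filM _ _ fI 0 0).
exact: filX0.
Qed.

Lemma mmap_arg n e (P : {mpoly R0[n]}) (h h' : 'I_n -> S) :
    (forall m, I 0%N (c P@_m)) -> (forall i, I 0%N (h i)) -> (forall i, I 0%N (h' i)) ->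
    (forall i, I e (h i - h' i)) -> I e (mmap c h P - mmap c h' P).
Proof.
move=> cP Ih Ih' Ihh; rewrite /mmap -sumrB; apply: fil_sum => m _.
rewrite -mulrBr; apply: filMl => //; rewrite /mmap1.
elim: (index_enum _) => [|i r IH]; first by rewrite !big_nil subrr; apply: fil0.
rewrite !big_cons.
set A := h i ^+ m i; set A' := h' i ^+ m i; set B := \prod_(j <- r) _.
set B' := \prod_(j <- r) _ in IH *.
have -> : A * B - A' * B' = (A - A') * B + A' * (B - B') by ring.
have IB : I 0%N B.
  rewrite /B; elim: r {IH B B'} => [|j r IHr]; first by rewrite big_nil; apply: fil1.
  by rewrite big_cons; apply: filMl => //; apply: filX0.
apply: filD; first by apply: filMr => //; apply: fil_subX.
by apply: filMl => //; apply: filX0.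
Qed.

Lemma mmap_comp n k (P : {mpoly R0[n]}) (Q : n.-tuple {mpoly R0[k]}) (h : 'I_k -> S) :
  mmap c h (P \mPo Q) = mmap c (fun i => mmap c h (tnth Q i)) P.
Proof.
rewrite comp_mpolyE rmorph_sum; apply: eq_bigr => m _ /=.
rewrite mmapZ rmorph_prod; congr (_ * _); apply: eq_bigr => i _ /=.
by rewrite rmorphXn.
Qed.

End Poly.
End Filtration.

Section Truncation.
Variable R0 : comNzRingType.

Lemma coef_fps_trunc d (g : fps R0) i : (fps_trunc d g)`_i = if (i < d)%N then g i else 0.
Proof. exact: coef_poly. Qed.

Lemma mcoeff_mfps_trunc k d (G : mfps k R0) m :
  (mfps_trunc d G)@_m = if (mdeg m < d)%N then G m else 0.
Proof.
rewrite /mfps_trunc raddf_sum /=; under eq_bigr do rewrite mcoeffZ mcoeffX.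
case: ifP => [lt|ge].
  rewrite (bigD1 (BMultinom lt)) //= eqxx mulr1 big1 ?addr0 // => m' ne.
  rewrite (_ : (_ == m) = false) ?mulr0 //; apply: contraNF ne => /eqP E.
  by apply/eqP/val_inj.
rewrite big1 // => m' _; rewrite (_ : (_ == m) = false) ?mulr0 //.
by apply/eqP => E; move: (bmdeg m'); rewrite E ge.
Qed.

Lemma mfps_trunc_add k d (G G1 G2 : mfps k R0) : (forall m, G m = G1 m + G2 m) ->
  mfps_trunc d G = mfps_trunc d G1 + mfps_trunc d G2.
Proof.
move=> E; apply/mpolyP => m; rewrite mcoeffD !mcoeff_mfps_trunc.
by case: ifP => _; [exact: E|rewrite addr0].
Qed.

Definition Xadic d (P : {poly R0}) := forall i, (i < d)%N -> P`_i = 0.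

Lemma poly_filtration : filtration Xadic.
Proof.
split=> //.
- by move=> d i _; rewrite coef0.
- by move=> d P Q HP HQ i lt; rewrite coefB HP // HQ // subrr.
- move=> a b P Q HP HQ i lt; rewrite coefM big1 // => j _.
  have [ja|aj] := ltnP j a; first by rewrite HP // mul0r.
  rewrite HQ ?mulr0 // ltn_subLR; last by rewrite -ltnS; apply: ltn_ord.
  by rewrite (leq_trans lt) // leq_add2r.
by move=> d P HP i lt; apply: HP; apply: ltnW.
Qed.

Lemma mpoly_filtration k :
  filtration (fun d (P : {mpoly R0[k]}) => forall m, (mdeg m < d)%N -> P@_m = 0).
Proof.
split=> //.
- by move=> d m _; rewrite mcoeff0.
- by move=> d P Q HP HQ m lt; rewrite mcoeffB HP // HQ // subrr.
- move=> a b P Q HP HQ m lt; rewrite mcoeffM big1 // => -[m1 m2] /= /eqP Em.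
  have [ja|aj] := ltnP (mdeg m1) a; first by rewrite HP // mul0r.
  rewrite HQ ?mulr0 // -(ltn_add2l (mdeg m1)) -mdegD -Em.
  by rewrite (leq_trans lt) // leq_add2r.
by move=> d P HP m lt; apply: HP; apply: ltnW.
Qed.

(** [mfps_comp] truncates each coefficient at its own degree. Since inner series without constant
    term raise the order, every longer truncation gives the same coefficient, and one truncation
    serves all degrees below [d]. *)
Lemma mfps_comp_trunc n k d (G : mfps n R0) (H : n.-tuple (mfps k R0)) m :
    (forall i, tnth H i 0%MM = 0) -> (mdeg m < d)%N ->
  (mfps_trunc d G \mPo [tuple of map (mfps_trunc d) H])@_m = mfps_comp G H m.
Proof.
move=> H0 lt; rewrite /mfps_comp; set e := (mdeg m).+1.
have fM := mpoly_filtration k.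
pose TH d i : {mpoly R0[k]} := mfps_trunc d (tnth H i).
have compE d' : mfps_trunc d' G \mPo [tuple of map (mfps_trunc d') H]
    = mmap (@mpolyC k R0) (TH d') (mfps_trunc d' G).
  rewrite /comp_mpoly; congr (mmap _ _ _); apply/funext => i.
  by rewrite tnth_map.
have TH1 d' i m' : (mdeg m' < 1)%N -> (TH d' i)@_m' = 0.
  by rewrite ltnS leqn0 mdeg_eq0 => /eqP ->; rewrite mcoeff_mfps_trunc mdeg0 H0 if_same.
apply/eqP; rewrite -subr_eq0 -mcoeffB !compE; apply/eqP.
set X := mmap _ _ _; set Y := mmap _ _ _.
have : forall m', (mdeg m' < e)%N -> (X - Y)@_m' = 0; last by apply.
apply: (fil_trans fM (y := mmap (@mpolyC k R0) (TH d) (mfps_trunc e G))).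
  rewrite -mmapB; apply: (mmap_high fM) => // m' lt'; last exact: TH1.
  by rewrite mcoeffB !mcoeff_mfps_trunc lt' (leq_trans lt') // subrr.
apply: (mmap_arg fM) => // i m' lt'.
by rewrite mcoeffB !mcoeff_mfps_trunc lt' (leq_trans lt') // subrr.
Qed.

Lemma fps_comp_trunc d (f g : fps R0) i : g 0%N = 0 -> (i < d)%N ->
  (fps_trunc d f \Po fps_trunc d g)`_i = fps_comp f g i.
Proof.
move=> g0 lt; rewrite /fps_comp; have fP := poly_filtration.
have compE d' : fps_trunc d' f \Po fps_trunc d' g = pev (@polyC R0) (fps_trunc d' f) (fps_trunc d' g).
  by rewrite /comp_poly.
have g1 d' i' : (i' < 1)%N -> (fps_trunc d' g)`_i' = 0.
  by rewrite ltnS leqn0 => /eqP ->; rewrite coef_fps_trunc g0 if_same.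
apply/eqP; rewrite -subr_eq0 -coefB !compE; apply/eqP.
set X := pev _ _ _; set Y := pev _ _ _.
have : forall i', (i' < i.+1)%N -> (X - Y)`_i' = 0; last by apply.
apply: (fil_trans fP (y := pev (@polyC R0) (fps_trunc i.+1 f) (fps_trunc d g))).
  rewrite -pevB; apply: (pev_high fP) => // i' lt'; last exact: g1.
  by rewrite coefB !coef_fps_trunc lt' (leq_trans lt') // subrr.
apply: (pev_arg fP) => // i' lt'.
by rewrite coefB !coef_fps_trunc lt' (leq_trans lt') // subrr.
Qed.

Lemma mfps_trunc1 d (f : fps R0) :
  mfps_trunc d (fun m : 'X_{1..1} => f (mdeg m)) = \sum_(i < d) f i *: 'X_0 ^+ i.
Proof.
apply/mpolyP => m; rewrite mcoeff_mfps_trunc raddf_sum /=.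
have Em i : ('X_0 ^+ i : {mpoly R0[1]})@_m = (i == mdeg m)%:R.
  rewrite mpolyXn mcoeffX; congr (nat_of_bool _)%:R; apply/eqP/eqP => [<-|->].
    by rewrite mdegMn mdeg1 mul1n.
  apply/mnmP => j; rewrite mulmnE mnm1E !ord1 eqxx mul1n mdegE big_ord1.
  by congr (m _); apply: val_inj.
under eq_bigr do rewrite mcoeffZ Em.
case: ifP => [lt|ge].
  rewrite (bigD1 (Ordinal lt)) //= eqxx mulr1 big1 ?addr0 // => i ne.
  by rewrite (_ : (_ == _) = false) ?mulr0 //; apply: contraNF ne.
rewrite big1 // => i _; rewrite (_ : (_ == _) = false) ?mulr0 //.
by apply/eqP => E; move: (ltn_ord i); rewrite E ge.
Qed.

End Truncation.

Section Transfer.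
Variables (S R0 : comNzRingType) (I : nat -> S -> Prop) (fI : filtration I).
Variable (c : {rmorphism R0 -> S}).
Local Notation ev d g s := (pev c (fps_trunc d g) s).
Local Notation mev d G h := (mmap c h (mfps_trunc d G)).

Lemma pev_trunc (d : nat) (g : fps R0) s : ev d g s = \sum_(i < d) c (g i) * s ^+ i.
Proof.
rewrite /pev (@horner_coef_wide _ d).
  by apply: eq_bigr => i _; rewrite coef_map coef_fps_trunc ltn_ord.
by rewrite (leq_trans (size_poly _ _)) // size_poly.
Qed.

Lemma trunc_coef_int d (g : fps R0) : (forall i, I 0%N (c (g i))) ->
  forall i, I 0%N (c (fps_trunc d g)`_i).
Proof.
by move=> cg i; rewrite coef_fps_trunc; case: ifP => // _; rewrite rmorph0; apply: fil0.
Qed.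

Lemma mtrunc_coef_int k d (G : mfps k R0) : (forall m, I 0%N (c (G m))) ->
  forall m, I 0%N (c (mfps_trunc d G)@_m).
Proof.
by move=> cG m; rewrite mcoeff_mfps_trunc; case: ifP => // _; rewrite rmorph0; apply: fil0.
Qed.

Lemma mpoly_coef_int k (P Q : {mpoly R0[k]}) : (forall m, I 0%N (c P@_m)) ->
  (forall m, I 0%N (c Q@_m)) -> forall m, I 0%N (c (P * Q)@_m).
Proof.
move=> cP cQ m; rewrite mcoeffM rmorph_sum; apply: fil_sum => // i _ /=.
by rewrite rmorphM; apply: filMl.
Qed.

Lemma comp_trunc_int n k d (G : mfps n R0) (H : n.-tuple (mfps k R0)) m :
    (forall m, I 0%N (c (G m))) -> (forall i m, I 0%N (c (tnth H i m))) ->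
  I 0%N (c (mfps_trunc d G \mPo [tuple of map (mfps_trunc d) H])@_m).
Proof.
move=> cG cH.
rewrite comp_mpolyE raddf_sum rmorph_sum; apply: fil_sum => // m1 _ /=.
rewrite mcoeffZ rmorphM; apply: filMl => //; first exact: mtrunc_coef_int.
elim: (index_enum _) m => [|i r IH] m.
  by rewrite big_nil mcoeff1 rmorph_nat; case: (m == _); [apply: fil1|apply: fil0].
rewrite big_cons; apply: mpoly_coef_int => // {}m.
elim: (m1 i) m => [|l IHl] m.
  by rewrite expr0 mcoeff1 rmorph_nat; case: (m == _); [apply: fil1|apply: fil0].
rewrite exprS; apply: mpoly_coef_int => // m'; rewrite tnth_map.
exact: mtrunc_coef_int.
Qed.

Lemma mfps_comp_int n k (G : mfps n R0) (H : n.-tuple (mfps k R0)) m :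
    (forall m, I 0%N (c (G m))) -> (forall i m, I 0%N (c (tnth H i m))) ->
  I 0%N (c (mfps_comp G H m)).
Proof. exact: comp_trunc_int. Qed.

Lemma mmap_int n (P : {mpoly R0[n]}) h : (forall m, I 0%N (c P@_m)) ->
  (forall i, I 0%N (h i)) -> I 0%N (mmap c h P).
Proof.
move=> cP Ih; apply: (fil_sum fI) => m _; apply: (filMl fI) => //.
exact: mmap1_int.
Qed.

Lemma pev_int (P : {poly R0}) s : (forall i, I 0%N (c P`_i)) -> I 0%N s -> I 0%N (pev c P s).
Proof.
move=> cP Is; rewrite pevE; apply: (fil_sum fI) => i _; apply: (filMl fI) => //.
exact: filX0.
Qed.

(** The composite of the truncations and the truncation of the composite coincide below degree [d],
    and their difference has coefficients in [I 0]; on arguments in [I 1] its value is therefore in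
    [I d]. *)
Lemma mfps_comp_eval n k (G : mfps n R0) (H : n.-tuple (mfps k R0)) (h : 'I_k -> S) d :
    (forall m, I 0%N (c (G m))) -> (forall i m, I 0%N (c (tnth H i m))) ->
    (forall i, tnth H i 0%MM = 0) -> (forall i, I 1%N (h i)) ->
  I d (mev d G (fun i => mev d (tnth H i) h) - mev d (mfps_comp G H) h).
Proof.
move=> cG cH H0 Ih; set Q := mfps_trunc d G \mPo [tuple of map (mfps_trunc d) H].
have -> : mev d G (fun i => mev d (tnth H i) h) = mmap c h Q.
  by rewrite mmap_comp; congr (mmap _ _ _); apply/funext => i; rewrite tnth_map.
have cQ m : I 0%N (c Q@_m) by apply: comp_trunc_int.
rewrite -mmapB; apply: mmap_high => // m; last first.
  by move=> lt; rewrite mcoeffB mfps_comp_trunc // mcoeff_mfps_trunc lt subrr.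
rewrite mcoeffB rmorphB; apply: filB => //.
rewrite mcoeff_mfps_trunc; case: ifP => lt; last by rewrite rmorph0; apply: fil0.
by rewrite -(mfps_comp_trunc G H0 lt).
Qed.

Lemma fps_comp_eval (f g : fps R0) s d :
    (forall i, I 0%N (c (f i))) -> (forall i, I 0%N (c (g i))) ->
    (forall i, I 0%N (c (fps_comp f g i))) -> g 0%N = 0 -> I 1%N s ->
  I d (ev d f (ev d g s) - ev d (fps_comp f g) s).
Proof.
move=> cf cg cfg g0 Is.
have polyM (P Q : {poly R0}) : (forall i, I 0%N (c P`_i)) -> (forall i, I 0%N (c Q`_i)) ->
    forall i, I 0%N (c (P * Q)`_i).
  move=> cP cQ i; rewrite coefM rmorph_sum; apply: fil_sum => // k _ /=.
  by rewrite rmorphM; apply: filMl.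
rewrite -pev_comp -pevB; apply: pev_high => // i; last first.
  by move=> lt; rewrite coefB fps_comp_trunc // coef_fps_trunc lt subrr.
rewrite coefB rmorphB; apply: filB; [exact: fI| |exact: trunc_coef_int].
rewrite comp_polyE coef_sum rmorph_sum; apply: fil_sum => // k _ /=.
rewrite coefZ rmorphM; apply: filMl => //; first exact: trunc_coef_int.
elim: (val k) i => [|l IHl] i.
  by rewrite expr0 coef1 rmorph_nat; case: (i == _); [apply: fil1|apply: fil0].
by rewrite exprS; apply: polyM => // i'; apply: trunc_coef_int.
Qed.

Lemma ev_cong d e (g : fps R0) s s' : (forall i, I 0%N (c (g i))) ->
  I 1%N s -> I 1%N s' -> I e (s - s') -> (e <= d)%N ->
  I e (ev d g s - ev e g s').
Proof.
move=> cg Is Is' Iss ed; apply: (fil_trans fI (y := ev e g s)).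
  rewrite -pevB; apply: pev_high => // i => [|lt].
    by rewrite coefB rmorphB; apply: filB => //; apply: trunc_coef_int.
  by rewrite coefB !coef_fps_trunc lt (leq_trans lt) // subrr.
by apply: pev_arg => //; [exact: trunc_coef_int|apply: fil_le Is|apply: fil_le Is'].
Qed.

Lemma mev_cong k d e (G : mfps k R0) (h h' : 'I_k -> S) : (forall m, I 0%N (c (G m))) ->
  (forall i, I 1%N (h i)) -> (forall i, I 1%N (h' i)) ->
  (forall i, I e (h i - h' i)) -> (e <= d)%N ->
  I e (mev d G h - mev e G h').
Proof.
move=> cg Is Is' Iss ed; apply: (fil_trans fI (y := mev e G h)).
  rewrite -mmapB; apply: mmap_high => // m => [|lt].
    by rewrite mcoeffB rmorphB; apply: filB => //; apply: mtrunc_coef_int.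
  by rewrite mcoeffB !mcoeff_mfps_trunc lt (leq_trans lt) // subrr.
apply: mmap_arg => //; first exact: mtrunc_coef_int.
  by move=> i; apply: fil_le (Is i).
by move=> i; apply: fil_le (Is' i).
Qed.

Lemma mev_fps d (f : fps R0) (s : S) :
  mev d (fun m : 'X_{1..1} => f (mdeg m)) (fun=> s) = ev d f s.
Proof.
rewrite mfps_trunc1 rmorph_sum pev_trunc; apply: eq_bigr => i _ /=.
by rewrite mmapZ rmorphXn /= mmapX mmap1U.
Qed.

Lemma mev_X k d (i : 'I_k) (h : 'I_k -> S) : (1 < d)%N -> mev d (mfpsX R0 i) h = h i.
Proof.
move=> d1; have -> : mfps_trunc d (mfpsX R0 i) = 'X_i.
  apply/mpolyP => m; rewrite mcoeff_mfps_trunc mcoeffX /mfpsX eq_sym.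
  by case: eqP => [<-|_]; rewrite ?mdeg1 ?d1 ?if_same.
by rewrite mmapX mmap1U.
Qed.

Lemma mev_0 k d (h : 'I_k -> S) : mev d (@mfps0 R0 k) h = 0.
Proof.
have -> : mfps_trunc d (@mfps0 R0 k) = 0; last exact: mmap0.
by apply/mpolyP => m; rewrite mcoeff_mfps_trunc mcoeff0 if_same.
Qed.

End Transfer.

Definition vec2 (T : Type) (x y : T) (i : 'I_2) : T := if i == 0 then x else y.
Definition vec3 (T : Type) (x y z : T) (i : 'I_3) : T :=
  if i == 0 then x else if i == 1 then y else z.

(** * Formal logarithms *)

Section FormalLog.
Variables (R0 : comNzRingType) (f : fps R0).
Hypotheses (f0 : f 0%N = 0) (f1 : f 1%N = 1).
Local Notation XF := (@Xadic R0).
Local Notation cR := (@polyC R0).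
Let fX := @poly_filtration R0.

Lemma comp_trunc d (g : fps R0) P : fps_trunc d g \Po P = \sum_(i < d) g i *: P ^+ i.
Proof.
rewrite -[LHS]/(pev cR (fps_trunc d g) P) pev_trunc.
by apply: eq_bigr => i _; rewrite mul_polyC.
Qed.

Lemma fps_inv_trunc_size d : (size (fps_inv_trunc f d) <= d)%N.
Proof.
elim: d => [|d IH] /=; first by rewrite size_poly0.
rewrite (leq_trans (size_polyD _ _)) // geq_max (leq_trans IH) //=.
by rewrite mul_polyC (leq_trans (size_scale_leq _ _)) // size_polyXn.
Qed.

Lemma fps_inv_truncE d : fps_inv_trunc f d = fps_trunc d (fps_inv f).
Proof.
apply/polyP => i; rewrite coef_fps_trunc /fps_inv.
case: ltnP => [|di]; last by rewrite nth_default // (leq_trans (fps_inv_trunc_size _)).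
elim: d => // d IH; rewrite ltnS leq_eqVlt => /orP[/eqP-> //|lt].
rewrite [fps_inv_trunc f d.+1]/= coefD coefCM coefXn (ltn_eqF lt) mulr0 addr0.
exact: IH.
Qed.

Lemma fps_inv0 : fps_inv f 0%N = 0.
Proof.
by rewrite /fps_inv /= comp_trunc big_ord1 f0 scale0r coefX !coef0 subrr add0r mul0r coef0.
Qed.

Lemma XF1 (P : {poly R0}) : P`_0 = 0 -> XF 1%N P.
Proof. by move=> P0 i; rewrite ltnS leqn0 => /eqP ->. Qed.

Lemma XF1_trunc d (g : fps R0) : g 0%N = 0 -> XF 1%N (fps_trunc d g).
Proof. by move=> g0; apply: XF1; rewrite coef_fps_trunc g0 if_same. Qed.

Lemma XF_powB d k (P Q : {poly R0}) : XF 1%N P -> XF 1%N Q -> XF d (P - Q) ->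
  XF d.+1 (P ^+ k.+2 - Q ^+ k.+2).
Proof.
move=> P1 Q1 PQ; rewrite subrXX -addn1; apply: (filM fX) => //.
apply: (fil_sum fX) => i _; case: (val i) => [|i'].
  by rewrite expr0 mulr1 subn0; apply: (fil_le fX (e := k.+1)) => //; apply: (filX1 fX).
by rewrite exprS mulrCA; apply: (filMr fX).
Qed.

(** As [f = X + ...], the top coefficient of [P] enters with coefficient one. This drives the
    recursions for the inverse of [f], for the injectivity of composition with [f], and for the
    coefficients of [[a]]. *)
Lemma comp_coef_top d (P : {poly R0}) : (0 < d)%N ->
  (fps_trunc d.+1 f \Po P)`_d = P`_d + (\sum_(k < d.-1) f k.+2 *: P ^+ k.+2)`_d.
Proof.
case: d => // d _; rewrite comp_trunc 2!big_ord_recl /= f0 scale0r add0r.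
by rewrite /bump /= f1 scale1r expr1 coefD.
Qed.

Lemma comp_coef_top_sub d (P Q : {poly R0}) : (0 < d)%N -> XF 1%N P -> XF 1%N Q ->
  XF d (P - Q) ->
  (fps_trunc d.+1 f \Po P)`_d - (fps_trunc d.+1 f \Po Q)`_d = (P - Q)`_d.
Proof.
move=> d0 P1 Q1 PQ; rewrite !comp_coef_top // coefB opprD addrACA -[RHS]addr0; congr (_ + _).
rewrite -coefB -sumrB coef_sum big1 // => k _; rewrite -scalerBr coefZ.
by rewrite (XF_powB k P1 Q1 PQ) ?mulr0.
Qed.

Lemma fps_comp_inv i : fps_comp f (fps_inv f) i = (i == 1)%N%:R.
Proof.
rewrite /fps_comp -fps_inv_truncE; case: i => [|i].
  by rewrite comp_trunc big_ord1 f0 scale0r coef0.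
set g := fps_inv_trunc f i.+1; set T := fps_trunc i.+2 f.
have -> : fps_inv_trunc f i.+2 = g + ('X`_i.+1 - (T \Po g)`_i.+1)%:P * 'X^(i.+1) by [].
set c := _ - _.
have g1 : XF 1%N g by rewrite /g fps_inv_truncE; apply/XF1_trunc/fps_inv0.
have cX : XF i.+1 (c%:P * 'X^(i.+1)).
  by move=> k lt; rewrite coefCM coefXn (ltn_eqF lt) mulr0.
have := @comp_coef_top_sub i.+1 (g + c%:P * 'X^(i.+1)) g isT.
rewrite [g + _]addrC addrK coefCM coefXn eqxx mulr1 => /(_ _ g1 cX) H.
rewrite -[LHS](subrK (T \Po g)`_i.+1) H; last first.
  by apply: (filD fX) => //; apply: (fil_le fX _ cX).
by rewrite /c subrK coefX.
Qed.

Definition scale_fps (a : R0) (g : fps R0) : fps R0 := fun d => a * g d.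

Lemma fg_mul0 a : fg_mul f a 0%N = 0.
Proof. by rewrite /fg_mul /fps_comp comp_trunc big_ord1 fps_inv0 scale0r coef0. Qed.

Lemma trunc_scale d a g : fps_trunc d (scale_fps a g) = a *: fps_trunc d g.
Proof.
by apply/polyP => i; rewrite coefZ !coef_fps_trunc; case: ifP; rewrite ?mulr0.
Qed.

Lemma trunc_X d (Y : {poly R0}) : XF 1%N Y ->
  XF d ((fps_trunc d (fun i => (i == 1)%N%:R) \Po Y) - Y).
Proof.
move=> Y1; case: d => [|[|d]] //.
  by move=> i lt; rewrite coefB comp_trunc big_ord1 scale0r coef0 Y1 // subrr.
suff -> : fps_trunc d.+2 (fun i => (i == 1)%N%:R) = 'X :> {poly R0}.
  by move=> i _; rewrite comp_polyX subrr coef0.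
by apply/polyP => i; rewrite coef_fps_trunc coefX; case: i => [|[|i]] //=; rewrite if_same.
Qed.

Lemma comp_eval_poly (g k : fps R0) (P : {poly R0}) d : k 0%N = 0 -> XF 1%N P ->
  XF d ((fps_trunc d g \Po (fps_trunc d k \Po P)) - (fps_trunc d (fps_comp g k) \Po P)).
Proof. by move=> k0 P1; apply: (@fps_comp_eval _ _ _ fX cR). Qed.

Lemma comp_cong_poly (g : fps R0) (P Q : {poly R0}) d : XF d (P - Q) ->
  XF d ((fps_trunc d g \Po P) - (fps_trunc d g \Po Q)).
Proof. by move=> PQ; apply: (@pev_arg _ _ fX _ cR). Qed.

Lemma trunc_comp_poly (g k : fps R0) d : k 0%N = 0 ->
  XF d ((fps_trunc d g \Po fps_trunc d k) - fps_trunc d (fps_comp g k)).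
Proof.
by move=> k0 i lt; rewrite coefB fps_comp_trunc // coef_fps_trunc lt subrr.
Qed.

Lemma XF1_comp (g : fps R0) d P : g 0%N = 0 -> XF 1%N P -> XF 1%N (fps_trunc d g \Po P).
Proof.
move=> g0 P1; rewrite comp_trunc; apply: (fil_sum fX) => -[[|i] lt] _ /=.
  by rewrite g0 scale0r; apply: (fil0 fX).
rewrite -mul_polyC; apply: (filMl fX) => //.
by apply: (fil_le fX (e := i.+1)) => //; apply: (filX1 fX).
Qed.

Lemma fps_comp_mul a i : fps_comp f (fg_mul f a) i = a * f i.
Proof.
set d := i.+1; set b := fg_mul f a; set Y := fps_trunc d (scale_fps a f).
have af0 : scale_fps a f 0%N = 0 by rewrite /scale_fps f0 mulr0.
have Y1 : XF 1%N Y by apply: XF1_trunc.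
have H1 := comp_eval_poly (d := d) f fps_inv0 Y1.
have H2 : XF d ((fps_trunc d (fps_inv f) \Po Y) - fps_trunc d b) by apply: trunc_comp_poly.
have H3 := comp_cong_poly f H2.
have H4 := trunc_X (d := d) Y1.
have E : fps_comp f (fps_inv f) = (fun i => (i == 1)%N%:R).
  by apply/funext => k; rewrite fps_comp_inv.
rewrite E in H1.
have := fil_trans fX (fil_trans fX (fil_sym fX H3) H1) H4.
move=> /(_ i (ltnSn i)); rewrite coefB fps_comp_trunc //; last exact: fg_mul0.
move=> /eqP.
by rewrite subr_eq0 /Y coef_fps_trunc ltnSn => /eqP.
Qed.

(** The formal identities are stated for polynomials without constant term modulo [X ^ d], and not
    for series, so that they can be evaluated at points once integrality is known. *)
Lemma log_mul_poly a (P : {poly R0}) d : XF 1%N P ->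
  XF d ((fps_trunc d f \Po (fps_trunc d (fg_mul f a) \Po P)) - a *: (fps_trunc d f \Po P)).
Proof.
move=> P1; have := comp_eval_poly (d := d) f (fg_mul0 a) P1.
have -> : fps_comp f (fg_mul f a) = scale_fps a f by apply/funext => i; rewrite fps_comp_mul.
by rewrite trunc_scale linearZ.
Qed.

(** Coefficient by coefficient, [f] composed with [P] determines [P]. The properties of [[a]] that
    follow are all obtained by applying [f] to both sides, where they become additive. *)
Lemma log_inj_poly (P Q : {poly R0}) d : XF 1%N P -> XF 1%N Q ->
  XF d ((fps_trunc d f \Po P) - (fps_trunc d f \Po Q)) -> XF d (P - Q).
Proof.
move=> P1 Q1 H; suff He e : (e <= d)%N -> XF e (P - Q) by apply: He.
elim: e => [//|[|e] IH] led.
  by move=> i lt; rewrite coefB P1 // Q1 // subrr.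
have PQ := IH (ltnW led); move=> i; rewrite ltnS leq_eqVlt => /orP[/eqP->|]; last exact: PQ.
have := H _ led; rewrite coefB.
have tr (Z : {poly R0}) : XF 1%N Z ->
    (fps_trunc d f \Po Z)`_e.+1 = (fps_trunc e.+2 f \Po Z)`_e.+1.
  move=> Z1; apply/eqP; rewrite -subr_eq0 -coefB; apply/eqP.
  suff : XF e.+2 ((fps_trunc d f \Po Z) - (fps_trunc e.+2 f \Po Z)) by apply.
  apply: (@ev_cong _ _ _ fX cR) => //.
  by rewrite subrr; apply: (fil0 fX).
by rewrite !tr // => {}H; have := comp_coef_top_sub (ltn0Sn e) P1 Q1 PQ; rewrite H.
Qed.

Section Group.
Variable F : mfps 2 R0.
Hypothesis F_group : is_formal_group F.
Hypothesis F_log : is_logarithm F f.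
Local Notation FP d P Q := (mmap cR (vec2 P Q) (mfps_trunc d F)).

Lemma formal_group0 : F 0%MM = 0.
Proof.
have [/(_ 0%MM) E _ _ _] := F_group; move: E; rewrite /mfps_comp mdeg0.
have -> : mfps_trunc 1 F = (F 0%MM)%:MP.
  apply/mpolyP => m; rewrite mcoeff_mfps_trunc mcoeffC ltnS leqn0 mdeg_eq0 eq_sym.
  by case: eqP => [->|_]; rewrite ?mulr1 ?mulr0.
rewrite comp_mpolyC mcoeffC eqxx mulr1 => ->; rewrite /mfpsX.
by case: eqP => // /(congr1 (@mdeg _)); rewrite mdeg0 mdeg1.
Qed.

Lemma XF1_FP d (P Q : {poly R0}) : XF 1%N P -> XF 1%N Q -> XF 1%N (FP d P Q).
Proof.
move=> P1 Q1; apply: (mmap_high fX) => //.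
  move=> m; rewrite ltnS leqn0 mdeg_eq0 => /eqP ->.
  by rewrite mcoeff_mfps_trunc formal_group0 if_same.
by move=> i; rewrite /vec2; case: ifP.
Qed.

Lemma log_group_poly (P Q : {poly R0}) d : XF 1%N P -> XF 1%N Q ->
  XF d ((fps_trunc d f \Po FP d P Q) - ((fps_trunc d f \Po P) + (fps_trunc d f \Po Q))).
Proof.
move=> P1 Q1.
have [d1|d1] := leqP d 1.
  apply: (fil_le fX d1); apply: (filB fX).
    by apply: XF1_comp => //; apply: XF1_FP.
  by apply: (filD fX); apply: XF1_comp.
have vec1 i : XF 1%N (vec2 P Q i) by rewrite /vec2; case: ifP.
have H (Gs : mfps 2 R0) : Gs 0%MM = 0 ->
    XF d ((fps_trunc d f \Po mmap cR (vec2 P Q) (mfps_trunc d Gs)) -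
          mmap cR (vec2 P Q) (mfps_trunc d (fps_mcomp f Gs))).
  move=> G0; have := @mfps_comp_eval _ _ _ fX cR _ _ (fun m : 'X_{1..1} => f (mdeg m))
    [tuple Gs] (vec2 P Q) d (fun m i => _) (fun i m j => _) _ vec1.
  rewrite (_ : (fun i => _) = (fun=> mmap cR (vec2 P Q) (mfps_trunc d Gs))).
    by rewrite mev_fps; apply=> // i; rewrite !ord1.
  by apply/funext => i; rewrite !ord1.
have [_ _ Elog] := F_log.
have E : mfps_trunc d (fps_mcomp f F) =
    mfps_trunc d (fps_mcomp f (mfpsX R0 0)) + mfps_trunc d (fps_mcomp f (mfpsX R0 1)).
  exact: mfps_trunc_add.
have X0 i : mfpsX R0 i (0%MM : 'X_{1..2}) = 0.
  rewrite /mfpsX; case: eqP => // /(congr1 (@mdeg _)).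
  by rewrite mdeg0 mdeg1.
have H0 := H _ (X0 0); have H1 := H _ (X0 1); have HF := H _ formal_group0.
rewrite !mev_X // in H0 H1; rewrite E mmapD in HF.
exact: (fil_add_trans fX HF H0 H1).
Qed.

Lemma mul_add_poly a b (P : {poly R0}) d : XF 1%N P ->
  XF d (FP d (fps_trunc d (fg_mul f a) \Po P) (fps_trunc d (fg_mul f b) \Po P)
        - (fps_trunc d (fg_mul f (a + b)) \Po P)).
Proof.
move=> P1; have m1 c := XF1_comp d (fg_mul0 c) P1.
apply: log_inj_poly => //; first exact: XF1_FP.
apply: (fil_trans fX (log_group_poly (d := d) (m1 a) (m1 b))).
apply: (fil_sym fX); apply: (fil_trans fX (log_mul_poly _ P1)).
rewrite scalerDl; apply: (fil_sym fX).
rewrite opprD addrACA; apply: (filD fX); exact: log_mul_poly.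
Qed.

Lemma mul_mul_poly a b (P : {poly R0}) d : XF 1%N P ->
  XF d ((fps_trunc d (fg_mul f a) \Po (fps_trunc d (fg_mul f b) \Po P))
        - (fps_trunc d (fg_mul f (a * b)) \Po P)).
Proof.
move=> P1; have m1 c := XF1_comp d (fg_mul0 c) P1.
apply: log_inj_poly => //; first exact: (XF1_comp d (fg_mul0 a) (m1 b)).
have H1 := log_mul_poly a (d := d) (m1 b).
have H2 : XF d (a *: (fps_trunc d f \Po (fps_trunc d (fg_mul f b) \Po P)) -
    a *: (b *: (fps_trunc d f \Po P))).
  rewrite -scalerBr -mul_polyC; apply: (filMl fX) => //; exact: log_mul_poly.
apply: (fil_trans fX H1); apply: (fil_trans fX H2).
by rewrite scalerA; apply: (fil_sym fX); apply: log_mul_poly.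
Qed.

Lemma mul_group_poly a (P Q : {poly R0}) d : XF 1%N P -> XF 1%N Q ->
  XF d ((fps_trunc d (fg_mul f a) \Po FP d P Q)
        - FP d (fps_trunc d (fg_mul f a) \Po P) (fps_trunc d (fg_mul f a) \Po Q)).
Proof.
move=> P1 Q1; have m1 c (Z : {poly R0}) Z1 := @XF1_comp _ d Z (fg_mul0 c) Z1.
have F1 := XF1_FP d P1 Q1.
apply: log_inj_poly; [exact: m1|apply: XF1_FP; exact: m1|].
apply: (fil_trans fX (log_mul_poly a (d := d) F1)).
have H2 : XF d (a *: (fps_trunc d f \Po FP d P Q) -
    a *: ((fps_trunc d f \Po P) + (fps_trunc d f \Po Q))).
  rewrite -scalerBr -mul_polyC; apply: (filMl fX) => //; exact: log_group_poly.
apply: (fil_trans fX H2); apply: (fil_sym fX).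
apply: (fil_trans fX (log_group_poly (d := d) (m1 a _ P1) (m1 a _ Q1))).
rewrite scalerDr opprD addrACA; apply: (filD fX); exact: log_mul_poly.
Qed.

Lemma mul1_poly (P : {poly R0}) d : XF 1%N P -> XF d ((fps_trunc d (fg_mul f 1) \Po P) - P).
Proof.
move=> P1; have m1 := XF1_comp d (fg_mul0 1) P1.
apply: log_inj_poly => //; have := log_mul_poly 1 (d := d) P1.
by rewrite scale1r.
Qed.

Lemma fg_mul1 a : fg_mul f a 1%N = a.
Proof.
have P1 : XF 1%N ('X : {poly R0}) by apply: XF1; rewrite coefX.
have := log_mul_poly a (d := 2) P1 => /(_ 1%N isT).
rewrite comp_polyXr comp_polyXr coefB coefZ coef_fps_trunc f1 mulr1 => /eqP.
rewrite subr_eq0 comp_coef_top // big_ord0 coef0 addr0 coef_fps_trunc => /eqP.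
by [].
Qed.

End Group.
End FormalLog.

(** * Integrality of Honda formal groups *)

Section FiltrationFrobenius.
Variables (S : comNzRingType) (I : nat -> S -> Prop) (fI : filtration I).

Lemma fil_nat n : I 0%N n%:R.
Proof.
elim: n => [|n IH]; first exact: fil0.
by rewrite -natr1; apply: filD => //; apply: fil1.
Qed.

Definition coef_fil d (P : {poly S}) := forall i, I d P`_i.

Lemma coef_filtration : filtration coef_fil.
Proof.
split=> [d i|d P Q HP HQ i|a b P Q HP HQ i|d P HP i|i].
- by rewrite coef0; apply: fil0.
- by rewrite coefB; apply: filB.
- by rewrite coefM; apply: fil_sum => // j _; apply: filM.
- by apply: filS.
by rewrite coef1; apply: fil_nat.
Qed.

Lemma fil_frobenius p m x y : prime p -> I 1%N p%:R -> I 0%N x -> I 0%N y ->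
  I 1%N ((x + y) ^+ (p ^ m) - (x ^+ (p ^ m) + y ^+ (p ^ m))).
Proof.
move=> p_pr Ip.
have base a b : I 0%N a -> I 0%N b -> I 1%N ((a + b) ^+ p - (a ^+ p + b ^+ p)).
  move=> Ia Ib; case: p p_pr Ip => // q q_pr Iq.
  rewrite exprDn big_ord_recl big_ord_recr /= /bump /=.
  rewrite subn0 bin0 expr0 mulr1 mulr1n add1n subnn expr0 mul1r binn mulr1n.
  set s := \sum_(i < q) _; rewrite (_ : _ - _ = s); last by ring.
  apply: fil_sum => // i _; rewrite -mulr_natr; apply: filMl => //.
    by rewrite -[0%N]/(0 + 0)%N; apply: filM => //; apply: filX0.
  have /dvdnP[k ->] : (q.+1 %| 'C(q.+1, 1 + i))%N by rewrite prime_dvd_bin //= ltnS.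
  by rewrite natrM; apply: filMl => //; apply: fil_nat.
move=> Ix Iy; elim: m => [|m IH]; first by rewrite !expr1 subrr; apply: fil0.
rewrite expnSr !exprM; apply: (fil_trans fI (y := (x ^+ (p ^ m) + y ^+ (p ^ m)) ^+ p)).
  apply: fil_subX => //; first by apply: filX0 => //; apply: filD.
  by apply: filD => //; apply: filX0.
by apply: base; apply: filX0.
Qed.

(** In [x ^ q - y ^ q] the cofactor of [x - y] is [q * y ^ q.-1] plus terms divisible by differences
    of powers, hence in [I 1]: one step of the filtration is gained. *)
Lemma fil_expq q r x y : I 1%N q%:R -> (0 < r)%N -> I 0%N x -> I 0%N y ->
  I r (x - y) -> I r.+1 (x ^+ q - y ^+ q).
Proof.
move=> Iq r0 Ix Iy Ixy; rewrite subrXX -addn1; apply: filM => //.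
have -> : \sum_(i < q) x ^+ (q.-1 - i) * y ^+ i =
  \sum_(i < q) (x ^+ (q.-1 - i) - y ^+ (q.-1 - i)) * y ^+ i + q%:R * y ^+ q.-1.
  have -> : q%:R * y ^+ q.-1 = \sum_(i < q) y ^+ q.-1 by rewrite sumr_const card_ord mulr_natl.
  rewrite -big_split /=; apply: eq_bigr => i _.
  have iq : (i <= q.-1)%N by rewrite -ltnS prednK // (leq_ltn_trans _ (ltn_ord i)).
  by rewrite mulrBl -exprD subnK ?subrK.
apply: filD => //; last by apply: filMr => //; apply: filX0.
apply: fil_sum => // i _; apply: filMr => //; last exact: filX0.
by apply: (fil_le fI r0); apply: fil_subX.
Qed.

Lemma fil_exp_iter q j x y : I 1%N q%:R -> I 0%N x -> I 0%N y ->
  I 1%N (x - y) -> I j.+1 (x ^+ (q ^ j) - y ^+ (q ^ j)).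
Proof.
move=> Iq Ix Iy Ixy; elim: j => [|j IH]; first by rewrite !expr1.
by rewrite expnSr !exprM; apply: fil_expq => //; apply: filX0.
Qed.

End FiltrationFrobenius.

Definition ideal_power (C : comNzRingType) (O : C -> Prop) (w : C) (d : nat) (x : C) :=
  exists2 y, O y & x = w ^+ d * y.

Lemma ideal_power_filtration (C : comNzRingType) (O : C -> Prop) (w : C) :
  O w -> O 1 -> (forall x y, O x -> O y -> O (x - y)) ->
  (forall x y, O x -> O y -> O (x * y)) -> filtration (ideal_power O w).
Proof.
move=> Ow O1 OB OM.
have O0 : O 0 by rewrite -(subrr 1); apply: OB.
split=> [d|d x y [a Oa ->] [b Ob ->]|m n x y [a Oa ->] [b Ob ->]|d x [a Oa ->]|].
- by exists 0; rewrite ?mulr0.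
- by exists (a - b); [apply: OB|rewrite mulrBr].
- by exists (a * b); [apply: OM|rewrite exprD; ring].
- by exists (w * a); [apply: OM|rewrite exprSr mulrA].
by exists 1; rewrite ?mulr1.
Qed.

Section HondaIntegrality.
Variables (C : fieldType) (OK : C -> Prop) (pi : C) (phi : {rmorphism C -> C}).
Variables (p e q : nat) (f u : fps C).
Hypotheses (OK1 : OK 1) (OKB : forall x y, OK x -> OK y -> OK (x - y)).
Hypotheses (OKM : forall x y, OK x -> OK y -> OK (x * y)).
Hypotheses (OKpi : OK pi) (pi0 : pi != 0) (phi_pi : phi pi = pi).
Hypothesis (phiO : forall x, OK x -> OK (phi x)).
Hypotheses (p_pr : prime p) (qE : q = (p ^ e)%N) (q1 : (1 < q)%N).
Local Notation I := (ideal_power OK pi).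
Hypothesis (Ip : I 1%N p%:R).
Hypothesis (phi_frob : forall x, OK x -> I 1%N (phi x - x ^+ q)).
Hypotheses (f0 : f 0%N = 0) (f1 : f 1%N = 1).
Hypotheses (u0 : u 0%N = pi) (uO : forall i, (0 < i)%N -> OK (u i)).
Hypothesis (honda : forall d, I 1%N (honda_act q phi u f d)).
Let fI : filtration I := ideal_power_filtration OKpi OK1 OKB OKM.
Local Notation J := (coef_fil I).
Let fJ : filtration J := coef_filtration fI.
Local Notation phin i := (iter i phi).
Local Notation HT := (honda_T q phi).
Local Notation XF := (@Xadic C).
Let fX := @poly_filtration C.

Let I0P x : I 0%N x <-> OK x.
Proof. by split=> [[y Oy ->]|Ox]; [rewrite mul1r|exists x; rewrite ?mul1r]. Qed.

Let q0 : (0 < q)%N. Proof. exact: ltnW. Qed.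

Lemma ideal_power_cancel d n x : I (d + n)%N (pi ^+ d * x) -> I n x.
Proof.
by move=> [y Oy E]; exists y => //; apply: (mulfI (expf_neq0 d pi0)); rewrite E exprD mulrA.
Qed.

Lemma ideal_power_qR : (0 < e)%N -> I 1%N q%:R.
Proof.
case: e qE => // k -> _; rewrite expnS natrM; apply: (filMr fI) => //.
exact: fil_nat.
Qed.

Let e0 : (0 < e)%N. Proof. by case: e qE q1 => // ->. Qed.
Let Iq := ideal_power_qR e0.

Lemma phin_I i d x : I d x -> I d (phin i x).
Proof.
elim: i => // i IH /IH [y Oy /= ->]; exists (phi y); first exact: phiO.
by rewrite rmorphM rmorphXn /= phi_pi.
Qed.

Lemma phinM i x y : phin i (x * y) = phin i x * phin i y.
Proof. by elim: i => //= i ->; rewrite rmorphM. Qed.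

Lemma phin0 i : phin i 0 = 0.
Proof. by elim: i => //= i ->; rewrite rmorph0. Qed.

Lemma phin1 i : phin i 1 = 1.
Proof. by elim: i => //= i ->; rewrite rmorph1. Qed.

Lemma phin_fix i a : phi a = a -> phin i a = a.
Proof. by move=> E; elim: i => //= i ->. Qed.

Lemma honda_T_iter i g d :
  iter i HT g d = if (q ^ i %| d)%N then phin i (g (d %/ q ^ i)%N) else 0.
Proof.
elim: i d => [|i IH] d; first by rewrite dvd1n divn1.
rewrite /= /honda_T IH expnS.
case: (boolP (q %| d)%N) => [qd|nqd]; last first.
  by case: ifP => // dv; rewrite (dvdn_trans _ dv) ?dvdn_mulr in nqd.
rewrite dvdn_divRL // [(q ^ i * q)%N]mulnC.
by case: ifP => // _; rewrite ?rmorph0 // -divnMA.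
Qed.

Lemma honda_T_iter_large i d : (d < i)%N -> iter i HT f d = 0.
Proof.
move=> di; rewrite honda_T_iter; case: ifP => // dv.
case: d di dv => [|d] di dv; first by rewrite div0n f0 phin0.
have /(leq_trans (ltn_expl i q1)) := dvdn_leq (ltn0Sn d) dv.
by move=> /ltn_trans /(_ di); rewrite ltnn.
Qed.

(** The terms with [i > d] vanish, so the sum can run to a bound [N] common to all degrees; this is
    what lets the congruence be summed over the degrees in a composite. *)
Lemma honda_expand N d : (d <= N)%N ->
  I 1%N (pi * f d + \sum_(1 <= i < N.+1) u i * iter i HT f d).
Proof.
move=> dN; have := honda d; rewrite /honda_act -(big_mkord xpredT (fun i => u i * iter i HT f d)).
rewrite big_nat_recl // -[X in I _ (X + _)]/(u 0%N * f d) u0.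
have -> : \sum_(1 <= i < N.+1) u i * iter i HT f d = \sum_(1 <= i < d.+1) u i * iter i HT f d.
  rewrite (big_cat_nat (n := d.+1)) //= [X in _ + X]big_nat_cond [X in _ + X]big1 ?addr0 // => i.
  by rewrite andbT => /andP[di _]; rewrite honda_T_iter_large ?mulr0.
by rewrite [in X in _ -> X]big_add1.
Qed.

(** Each use of the congruence [u * f = 0] divides the index by some [q ^ i] with [i > 0] and costs
    a single factor [pi], so the denominator grows no faster than the power of [q] in the index. *)
Lemma log_denominator j k : ~~ (q ^ j.+1 %| k)%N -> OK (pi ^+ j * f k).
Proof.
elim/ltn_ind: k j => k IH j nd; apply/I0P.
have k0 : (0 < k)%N by case: k nd {IH} => //; rewrite dvdn0.
apply: (@ideal_power_cancel 1).
have := filMr fI (honda_expand (leqnn k)) (filX0 fI j (proj2 (I0P pi) OKpi)).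
set s := \sum_(_ <= i < _) _ => H.
rewrite (_ : _ * _ = (pi * f k + s) * pi ^+ j - s * pi ^+ j); last by ring.
apply: filB => //; rewrite /s mulr_suml big_nat_cond; apply: (fil_sum fI) => i.
rewrite andbT => /andP[i0 ik]; rewrite honda_T_iter; case: ifP => dv; last first.
  by rewrite mulr0 mul0r; apply: fil0.
have [ij|ji] := leqP i j; last first.
  by move: nd; rewrite (dvdn_trans _ dv) // dvdn_exp2l.
rewrite -mulrA; apply: (filMl fI); first by apply/I0P/uO.
have -> : phin i (f (k %/ q ^ i)%N) * pi ^+ j = pi ^+ i * phin i (pi ^+ (j - i) * f (k %/ q ^ i)%N).
  rewrite phinM [phin i (pi ^+ _)]phin_fix; last by rewrite rmorphXn /= phi_pi.
  by rewrite mulrA -exprD subnKC // mulrC.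
rewrite -(prednK i0) exprS -mulrA mulrC.
apply: (filMl fI); last by exists 1; rewrite ?mulr1.
apply: (filMr fI); first by apply: filX0 => //; apply/I0P.
rewrite prednK //; apply: phin_I; apply/I0P; apply: IH.
  by rewrite ltn_Pdiv // (leq_ltn_trans i0) // ltn_expl.
rewrite -subSn //; apply: contra nd; rewrite dvdn_divRL // -expnD subnK //.
exact: leqW.
Qed.

(** The action of [T] on polynomials. It sends a composite [f o P] to the [phi]-conjugate of [f]
    composed with [Phi P], and on integral polynomials it is the [q]-th power modulo [pi]. *)
Definition Phi (P : {poly C}) : {poly C} := map_poly phi P \Po 'X^q.

Lemma coef_Phi P k : (Phi P)`_k = HT (fun i => P`_i) k.
Proof.
by rewrite /Phi coef_comp_poly_Xn // /honda_T; case: ifP => // _; rewrite coef_map.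
Qed.

Lemma coef_Phi_iter i P k : (iter i Phi P)`_k = iter i HT (fun i => P`_i) k.
Proof.
elim: i k => //= i IH k; rewrite coef_Phi; congr (HT _ _).
by apply/funext => l.
Qed.

Lemma Phi_sum n (c : nat -> C) P :
  Phi (\sum_(l < n) c l *: P ^+ l) = \sum_(l < n) phi (c l) *: Phi P ^+ l.
Proof.
rewrite /Phi rmorph_sum /= rmorph_sum /=; apply: eq_bigr => l _.
by rewrite map_polyZ /= comp_polyZ rmorphXn /= rmorphXn.
Qed.

Lemma Phi_iter_sum i n (c : nat -> C) P :
  iter i Phi (\sum_(l < n) c l *: P ^+ l) =
  \sum_(l < n) phin i (c l) *: (iter i Phi P) ^+ l.
Proof.
elim: i => //= i ->.
by rewrite (@Phi_sum _ (fun l => phin i (c l))).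
Qed.

Lemma Phi_iterX i : iter i Phi 'X = 'X^(q ^ i).
Proof.
elim: i => [|i IH] //=; rewrite IH /Phi map_polyXn comp_Xn_poly -exprM -expnS //.
Qed.

Lemma Phi_frobenius P : J 0%N P -> J 1%N (P ^+ q - Phi P).
Proof.
elim/poly_ind: P => [|P c IH] IP.
  have -> : Phi 0 = 0.
    by apply/polyP => i; rewrite coef_Phi /honda_T !coef0 rmorph0 if_same.
  by rewrite expr0n eqn0Ngt q0 subrr; apply: (fil0 fJ).
have IP' : J 0%N P by move=> i; have := IP i.+1; rewrite coefD coefMX coefC addr0.
have Ic : I 0%N c by have := IP 0%N; rewrite coefD coefMX coefC add0r.
have JC d z : I d z -> J d z%:P by move=> Iz i; rewrite coefC; case: eqP => // _; apply: fil0.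
have JX : J 0%N 'X by move=> i; rewrite coefX; apply: fil_nat.
apply: (fil_trans fJ (y := (P * 'X) ^+ q + c%:P ^+ q)).
  rewrite [in X in _ ^+ X]qE [in X in (_ * _) ^+ X]qE [in X in _%:P ^+ X]qE.
  apply: (fil_frobenius fJ) => //; first by rewrite -polyC_natr; apply: JC.
    by apply: (filMr fJ).
  exact: JC.
have -> : Phi (P * 'X + c%:P) = Phi P * 'X^q + (phi c)%:P.
  by rewrite /Phi rmorphD rmorphM /= map_polyX map_polyC /= comp_polyD comp_polyM comp_polyX comp_polyC.
rewrite opprD addrACA; apply: (filD fJ).
  rewrite exprMn -mulrBl; apply: (filMr fJ); first exact: IH.
  exact: (filX0 fJ).
rewrite -polyC_exp -polyCB; apply: JC; apply: fil_sym => //.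
by apply: phi_frob; apply/I0P.
Qed.

Lemma Phi_J P d : J d P -> J d (Phi P).
Proof.
move=> JP i; rewrite coef_Phi /honda_T; case: ifP => _; last exact: fil0.
exact: (@phin_I 1).
Qed.

Lemma Phi_iter_J i P d : J d P -> J d (iter i Phi P).
Proof. by elim: i => //= i IH /IH; apply: Phi_J. Qed.

Lemma Phi_iter_frobenius i P : J 0%N P -> J 1%N (iter i Phi P - P ^+ (q ^ i)).
Proof.
move=> JP; elim: i => [|i IH]; first by rewrite expr1 subrr; apply: (fil0 fJ).
apply: (fil_trans fJ (y := (iter i Phi P) ^+ q)).
  by apply: (fil_sym fJ); apply: Phi_frobenius; apply: Phi_iter_J.
rewrite expnSr exprM; apply: (fil_subX fJ) => //; first exact: Phi_iter_J.
exact: (filX0 fJ).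
Qed.

(** Let [q ^ v] be the largest power of [q] dividing [l]. The congruence between [P] and [Q], raised
    to the power [q ^ v], holds modulo [pi ^ v.+1], while the denominator of [f l] is at most
    [pi ^ v]. *)
Lemma log_power_cong i l P Q : J 0%N P -> J 0%N Q -> J 1%N (P - Q) -> (0 < l)%N ->
  J 1%N (phin i (f l) *: (P ^+ l - Q ^+ l)).
Proof.
move=> JP JQ JPQ l0.
have [v ndv [k lE]] : exists2 v, ~~ (q ^ v.+1 %| l)%N & exists k, l = (q ^ v * k)%N.
  elim/ltn_ind: l l0 => l IH l0; case: (boolP (q %| l)%N) => [/dvdnP[l' E]|ndl]; last first.
    by exists 0%N; rewrite ?expn1 //; exists l; rewrite mul1n.
  have l'0 : (0 < l')%N by case: l' E l0 => // ->; rewrite mul0n.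
  have [|v nv [k Ek]] := IH l' _ l'0; first by rewrite E ltn_Pmulr.
  exists v.+1; first by rewrite E expnSr dvdn_pmul2r.
  by exists k; rewrite E Ek expnS; lia.
have := fil_exp_iter fJ v _ JP JQ JPQ.
move=> H; have /H{}H : J 1%N q%:R.
  by move=> j; rewrite -polyC_natr coefC; case: eqP => // _; apply: fil0.
have := fil_subX fJ k (filX0 fJ _ JP) (filX0 fJ _ JQ) H; rewrite -!exprM -lE => {}H j.
rewrite coefZ; have [z Oz ->] := H j.
have Iv := phin_I i (proj2 (I0P _) (log_denominator ndv)).
rewrite phinM [phin i (pi ^+ _)]phin_fix in Iv; last by rewrite rmorphXn /= phi_pi.
rewrite exprSr (_ : _ * _ = pi ^+ v * phin i (f l) * (pi * z)); last by ring.
by apply: (filMl fI) => //; exists z; rewrite ?expr1.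
Qed.

Lemma fg_mul_coef a d : (0 < d)%N ->
  fg_mul f a d = a * f d - (fps_trunc d.+1 f \Po fps_trunc d (fg_mul f a))`_d.
Proof.
move=> d0; set b := fg_mul f a.
have b0 : b 0%N = 0 by apply: fg_mul0.
have H1 : XF d (fps_trunc d.+1 b - fps_trunc d b).
  by move=> i lt; rewrite coefB !coef_fps_trunc lt ltnS ltnW // subrr.
have := comp_coef_top_sub f0 f1 d0 (XF1_trunc d.+1 b0) (XF1_trunc d b0) H1.
rewrite coefB !coef_fps_trunc ltnSn ltnn subr0 => <-.
by rewrite -(fps_comp_mul f0 f1 a d).
Qed.

(** By induction the part [B] of [[a]] below degree [d] is integral, and the coefficient sought is
    that of [a f - f o B]. After multiplication by [pi], the congruence [u * f = 0] is used once in
    degree [d] and once with [B] substituted. What remains are the terms with [T ^ i], [i > 0]: they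
    involve only degrees where [f o B] is already [a f], up to replacing [Phi ^ i B] by
    [B ^ (q ^ i)]. *)
Theorem honda_integral a d : OK a -> phi a = a -> OK (fg_mul f a d).
Proof.
move=> Oa phia; elim/ltn_ind: d => d IH.
set b := fg_mul f a.
have b0 : b 0%N = 0 by apply: fg_mul0.
have OK0 : OK 0 by rewrite -(subrr 1); apply: OKB.
case: (posnP d) => [->|d0]; first by rewrite b0.
rewrite /b fg_mul_coef // -/b; set B := fps_trunc d b; set T := fps_trunc d.+1 f.
have JB : J 0%N B.
  by move=> i; rewrite coef_fps_trunc; case: ifP => [lt|_]; apply/I0P => //; apply: IH.
have B1 : XF 1%N B by apply: XF1_trunc.
have TB k : (k < d)%N -> (T \Po B)`_k = a * f k.
  move=> kd; rewrite -(fps_comp_mul f0 f1 a k) -/b -(@fps_comp_trunc _ d f b k) //.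
  apply/eqP; rewrite -subr_eq0 -coefB; apply/eqP.
  suff : XF d ((T \Po B) - (fps_trunc d f \Po B)) by apply.
  apply: (@ev_cong _ _ _ fX (@polyC C)) => //.
  by rewrite subrr; apply: (fil0 fX).
have TBE : T \Po B = \sum_(l < d.+1) f l *: B ^+ l by rewrite comp_trunc.
(* The left side is the coefficient of [T ^ i] applied to [f o B], which comes from degree
   [d / q ^ i < d]; there [f o B] is [a f], and [phi] fixes [a]. *)
have E2 i : (0 < i)%N ->
    (\sum_(l < d.+1) phin i (f l) *: (iter i Phi B) ^+ l)`_d = a * iter i HT f d.
  move=> i0; rewrite -Phi_iter_sum -TBE coef_Phi_iter !honda_T_iter.
  case: ifP => dv; last by rewrite mulr0.
  rewrite TB ?phinM ?(phin_fix _ phia) //.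
  by rewrite ltn_Pdiv // (leq_ltn_trans i0) // ltn_expl.
(* Below the truncation, [(T ^ i * f) o B] is the conjugate of [f] evaluated at [B ^ (q ^ i)]. *)
have E1 i : (\sum_(l < d.+1) phin i (f l) *: (B ^+ (q ^ i)) ^+ l)`_d =
    (\sum_(k < d.+1) iter i HT f k *: B ^+ k)`_d.
  have -> : \sum_(l < d.+1) phin i (f l) *: (B ^+ (q ^ i)) ^+ l = iter i Phi T \Po B.
    have -> : T = \sum_(l < d.+1) f l *: 'X ^+ l by rewrite -comp_trunc comp_polyXr.
    rewrite Phi_iter_sum Phi_iterX rmorph_sum /=; apply: eq_bigr => l _.
    by rewrite comp_polyZ rmorphXn /= comp_Xn_poly.
  have -> : \sum_(k < d.+1) iter i HT f k *: B ^+ k = fps_trunc d.+1 (iter i HT f) \Po B.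
    by rewrite comp_trunc.
  apply/eqP; rewrite -subr_eq0 -coefB -comp_polyB; apply/eqP.
  have : XF d.+1 ((iter i Phi T - fps_trunc d.+1 (iter i HT f)) \Po B); last by apply.
  apply: (@pev_high _ _ fX _ (@polyC C)) => // k lt.
  rewrite coefB coef_fps_trunc lt coef_Phi_iter !honda_T_iter.
  case: ifP => // _; last by rewrite subrr.
  rewrite coef_fps_trunc (_ : (_ < _)%N) ?subrr //.
  by rewrite (leq_ltn_trans (leq_div _ _)).
apply/I0P; apply: (@ideal_power_cancel 1); rewrite expr1 addn0 mulrBr TBE.
have Hd := honda_expand (leqnn d).
have HB : I 1%N (pi * (\sum_(l < d.+1) f l *: B ^+ l)`_d +
    \sum_(1 <= i < d.+1) u i * (\sum_(k < d.+1) iter i HT f k *: B ^+ k)`_d).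
  rewrite coef_sum mulr_sumr.
  under [X in _ + X]eq_bigr do rewrite coef_sum mulr_sumr.
  rewrite exchange_big -big_split /=; apply: (fil_sum fI) => k _.
  under eq_bigr do rewrite coefZ mulrA.
  rewrite coefZ mulrA -mulr_suml -mulrDl; apply: (filMr fI).
    by apply: honda_expand; rewrite -ltnS.
  exact: (filX0 fJ _ JB).
have HU : I 1%N (\sum_(1 <= i < d.+1) u i * (a * iter i HT f d -
    (\sum_(k < d.+1) iter i HT f k *: B ^+ k)`_d)).
  rewrite big_nat_cond; apply: (fil_sum fI) => i; rewrite andbT => /andP[i0 _].
  apply: (filMl fI); first by apply/I0P/uO.
  rewrite -E1 -(E2 _ i0) -coefB -sumrB; apply: (fil_sum fJ) => -[l ll] _ /=.
  case: l ll => [|l] ll; first by rewrite !expr0 subrr; apply: (fil0 fJ).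
  rewrite -scalerBr; apply: log_power_cong => //; first exact: Phi_iter_J.
    exact: (filX0 fJ).
  exact: Phi_iter_frobenius.
have := filB fI (filB fI (filMl fI (proj2 (I0P a) Oa) Hd) HB) HU.
congr (I _ _); set X := \sum_(1 <= i < d.+1) _; set Y := \sum_(1 <= i < d.+1) _.
set Z := \sum_(1 <= i < d.+1) _.
have -> : Z = a * X - Y.
  by rewrite /Z /X /Y mulr_sumr -sumrB; apply: eq_bigr => i _; rewrite mulrBr mulrCA.
ring.
Qed.

Section Height.
Variable h : nat.
Hypotheses (h0 : (0 < h)%N) (u_low : forall i, (0 < i < h)%N -> I 1%N (u i)).

Lemma log_integral_low d : (d < q ^ h)%N -> OK (f d).
Proof.
elim/ltn_ind: d => d IH lt; apply/I0P; apply: (@ideal_power_cancel 1).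
rewrite expr1 addn0; have := honda_expand (leqnn d); set s := \sum_(_ <= i < _) _ => H.
rewrite (_ : _ * _ = (pi * f d + s) - s); last by rewrite addrK.
apply: filB => //; rewrite /s big_nat_cond; apply: (fil_sum fI) => i.
rewrite andbT => /andP[i0 id1]; rewrite honda_T_iter; case: ifP => dv; last first.
  by rewrite mulr0; apply: fil0.
case: (posnP d) => [->|d0]; first by rewrite div0n f0 phin0 mulr0; apply: fil0.
apply: (filMr fI).
  apply: u_low; rewrite i0 -(ltn_exp2l _ _ q1).
  by apply: leq_ltn_trans lt; apply: dvdn_leq.
apply: phin_I; apply/I0P/IH.
  by rewrite ltn_Pdiv // (leq_ltn_trans i0) // ltn_expl.
by apply: leq_ltn_trans lt; apply: leq_div.
Qed.

(** In degree [q ^ h] the term [i = h] is [u h * f 1]. The terms [i < h] have [u i] divisible by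
    [pi] and an integral logarithm coefficient; for [i > h] the power [q ^ i] does not divide the
    degree. *)
Lemma log_height_coef : I 1%N (pi * f (q ^ h)%N + u h).
Proof.
have hq : (h <= q ^ h)%N by apply: ltnW; rewrite ltn_expl.
have := honda_expand (leqnn (q ^ h)); set s := \sum_(_ <= i < _) _ => H.
suff Hs : I 1%N (s - u h).
  by have := filB fI H Hs; congr (I _ _); ring.
rewrite /s (bigD1_seq h) ?mem_index_iota ?h0 ?ltnS ?iota_uniq //=.
have -> : u h * iter h HT f (q ^ h)%N = u h.
  by rewrite honda_T_iter dvdnn divnn expn_gt0 q0 f1 phin1 mulr1.
rewrite addrAC subrr add0r big_seq_cond; apply: (fil_sum fI) => i.
rewrite mem_index_iota => /andP[/andP[i0 _] ih]; rewrite honda_T_iter.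
have [lt|ge] := ltnP i h; last first.
  rewrite (_ : (_ %| _)%N = false) ?mulr0; first exact: fil0.
  by apply/negbTE; rewrite gtnNdvd ?expn_gt0 ?q0 // ltn_exp2l // ltn_neqAle eq_sym ih.
apply: (filMr fI); first by apply: u_low; rewrite i0.
case: ifP => _; last exact: (fil0 fI).
apply: phin_I; apply/I0P; apply: log_integral_low.
rewrite ltn_Pdiv ?expn_gt0 ?q0 //.
by rewrite (leq_ltn_trans i0) // ltn_expl.
Qed.

Lemma honda_mul_low d : (d < q ^ h)%N -> I 1%N (fg_mul f pi d).
Proof.
elim/ltn_ind: d => d IH lt.
case: (posnP d) => [->|d0]; first by rewrite fg_mul0 //; apply: fil0.
rewrite fg_mul_coef //; apply: filB => //.
  by exists (f d); [exact: log_integral_low|rewrite expr1].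
suff H : J 1%N (fps_trunc d.+1 f \Po fps_trunc d (fg_mul f pi)) by exact: H.
rewrite comp_trunc; apply: (fil_sum fJ) => -[[|k] kd] _ /=.
  by rewrite f0 scale0r; apply: (fil0 fJ).
move=> i; rewrite coefZ; apply: (filMl fI).
  apply/I0P/log_integral_low; apply: leq_ltn_trans lt; exact: kd.
suff H : J 1%N (fps_trunc d (fg_mul f pi) ^+ k.+1) by exact: H.
apply: (fil_le fJ (e := k.+1)) => //; apply: (filX1 fJ).
move=> {}i; rewrite coef_fps_trunc; case: ifP => [id|_]; last exact: (fil0 fI).
by apply: IH => //; apply: ltn_trans lt.
Qed.

(** As [u h] is a unit in the applications, the reduction of [[pi](X)] modulo [pi] starts exactly in
    degree [q ^ h], as preparation requires. *)
Theorem honda_mul_height : exists2 z, OK z & fg_mul f pi (q ^ h)%N = - u h + pi * z.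
Proof.
set d := (q ^ h)%N.
have d1 : (1 < d)%N by rewrite -(expn0 q) ltn_exp2l.
suff [z Oz Ez] : I 1%N (fg_mul f pi d + u h).
  by exists z => //; rewrite -[LHS](addrK (u h)) Ez addrC expr1.
rewrite fg_mul_coef ?(ltnW d1) //.
suff H : I 1%N (fps_trunc d.+1 f \Po fps_trunc d (fg_mul f pi))`_d.
  by have := filB fI log_height_coef H; congr (I _ _); rewrite -/d; ring.
have JB : J 1%N (fps_trunc d (fg_mul f pi)).
  move=> i; rewrite coef_fps_trunc; case: ifP => [id|_]; last exact: (fil0 fI).
  exact: honda_mul_low.
have JBk k : J k ((fps_trunc d (fg_mul f pi)) ^+ k) by apply: (filX1 fJ).
rewrite comp_trunc big_ord_recr /= coefD; apply: (filD fI).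
  suff H : J 1%N (\sum_(i < d) f i *: fps_trunc d (fg_mul f pi) ^+ i) by exact: H.
  apply: (fil_sum fJ) => -[[|k] kd] _ /=.
    by rewrite f0 scale0r; apply: (fil0 fJ).
  move=> i; rewrite coefZ; apply: (filMl fI); first exact/I0P/log_integral_low.
  by apply: (fil_le fI (e := k.+1)) => //; apply: JBk.
(* [f d] need not be integral, but [pi * f d] is, and the power [d] of a polynomial divisible by
   [pi] absorbs the denominator with a factor to spare, as [d >= 2]. *)
have [z Oz Ez] := JBk d d; rewrite coefZ Ez.
have Hp : I 0%N (pi * f d).
  have := filB fI log_height_coef (y := 0) (fil0 fI 1) => /(filS fI).
  by rewrite subr0 => /(filB fI)/(_ (proj2 (I0P _) (uO h0))); rewrite addrK.
rewrite (_ : f d * _ = (pi * f d) * (pi ^+ d.-1 * z)); last first.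
  by rewrite -{2}(prednK (ltnW d1)) exprS; ring.
apply: (filMl fI) => //; apply: (fil_le fI (e := d.-1)); last by exists z.
by rewrite -ltnS prednK // ltnW.
Qed.

End Height.
End HondaIntegrality.

(** * The points of a formal group as a filtered module *)

Lemma tnth_pair (T : Type) (a b : T) : tnth [tuple a; b] = vec2 a b.
Proof. by apply/funext => -[[|[|//]] lt]. Qed.

Lemma vec2_comp (T U : Type) (g : T -> U) a b : (fun i => g (vec2 a b i)) = vec2 (g a) (g b).
Proof. by apply/funext => i; rewrite /vec2; case: ifP. Qed.

Lemma vec2_all (T : Type) (P : T -> Prop) a b : P a -> P b -> forall i, P (vec2 a b i).
Proof. by move=> Pa Pb i; rewrite /vec2; case: ifP. Qed.

Lemma vec3_2 (T : Type) (a b c : T) : vec3 a b c (inord 2) = c.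
Proof. by rewrite /vec3 -!val_eqE /= inordK. Qed.

Lemma vec3_all (T : Type) (P : T -> Prop) a b c : P a -> P b -> P c -> forall i, P (vec3 a b c i).
Proof. by move=> Pa Pb Pc i; rewrite /vec3; case: ifP => // _; case: ifP. Qed.

Lemma horner_mmap (C : comNzRingType) n (h : 'I_n -> {poly C}) (P : {mpoly C[n]}) x :
  (mmap (@polyC C) h P).[x] = mmap (@idfun C) (fun i => (h i).[x]) P.
Proof.
rewrite /mmap horner_sum; apply: eq_bigr => m _; rewrite hornerCM /mmap1 horner_prod.
by congr (_ * _); apply: eq_bigr => i _; rewrite horner_exp.
Qed.

Lemma mfpsX0 (C : comNzRingType) k (i : 'I_k) : mfpsX C i 0%MM = 0.
Proof. by rewrite /mfpsX; case: eqP => // /(congr1 (@mdeg _)); rewrite mdeg0 mdeg1. Qed.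

Section LinearCoefficients.
Variables (C : comNzRingType) (F : mfps 2 C).
Hypothesis F_group : is_formal_group F.

Lemma mfps_trunc2 : mfps_trunc 2 F = F U_((0 : 'I_2)%R)%MM *: 'X_0 + F U_((1 : 'I_2)%R)%MM *: 'X_1.
Proof.
apply/mpolyP => m; rewrite mcoeff_mfps_trunc mcoeffD !mcoeffZ !mcoeffX.
have [lt|ge] := ltnP (mdeg m) 2; last first.
  have ne i : (U_(i)%MM == m) = false by apply/eqP => E; move: ge; rewrite -E mdeg1.
  by rewrite !ne !mulr0 addr0.
move: lt; rewrite ltnS leq_eqVlt ltnS leqn0 => /orP[/eqP|]; last first.
  rewrite mdeg_eq0 => /eqP ->; rewrite (formal_group0 F_group).
  have ne (i : 'I_2) : (U_(i)%MM == 0%MM) = false.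
    by apply/eqP => /(congr1 (@mdeg _)); rewrite mdeg0 mdeg1.
  by rewrite !ne !mulr0 addr0.
move=> /eqP /mdeg1P[i /eqP ->].
have Uinj (a b : 'I_2) : (U_(a)%MM == U_(b)%MM) = (a == b).
  by apply/eqP/eqP => [/mnmP/(_ a)|-> //]; rewrite !mnm1E eqxx; case: eqP.
rewrite !Uinj; case: i => [[|[|//]] lt].
  rewrite (_ : Ordinal lt = 0); last exact: val_inj.
  by rewrite eqxx mulr1 mulr0 addr0.
rewrite (_ : Ordinal lt = 1); last exact: val_inj.
by rewrite eqxx mulr1 mulr0 add0r.
Qed.

Lemma formal_group_lin0 : F U_((0 : 'I_2)%R)%MM = 1.
Proof.
have [/(_ U_((0 : 'I_1)%R)%MM) E _ _ _] := F_group; move: E; rewrite /mfps_comp mdeg1 mfps_trunc2.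
rewrite comp_mpolyD !comp_mpolyZ !comp_mpolyXU -!tnth_nth !tnth_map tnth_pair /vec2 /=.
rewrite mcoeffD !mcoeffZ !mcoeff_mfps_trunc mdeg1 /= /mfpsX eqxx mulr1.
by rewrite /mfps0 mulr0 addr0.
Qed.

Lemma formal_group_lin1 : F U_((1 : 'I_2)%R)%MM = 1.
Proof.
have [_ /(_ U_((0 : 'I_1)%R)%MM) E _ _] := F_group; move: E; rewrite /mfps_comp mdeg1 mfps_trunc2.
rewrite comp_mpolyD !comp_mpolyZ !comp_mpolyXU -!tnth_nth !tnth_map tnth_pair /vec2 /=.
rewrite mcoeffD !mcoeffZ !mcoeff_mfps_trunc mdeg1 /= /mfpsX eqxx mulr1.
by rewrite /mfps0 mulr0 add0r.
Qed.

End LinearCoefficients.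

Section Setting.
Variables (C : fieldType) (R : comNzRingType) (v : {rmorphism R -> C}).
Variables (I : nat -> C -> Prop) (F : mfps 2 C) (f : fps C) (add act : C -> C -> C).
Local Notation ev d g x := ((fps_trunc d g).[x]).
Local Notation mev d G h := (mmap (@idfun C) h (mfps_trunc d G)).

(** The operations [add] and [act] are known only through congruences of every order with truncated
    series, which is how limits enter. [fm_total] lets an identity in two variables be tested on
    polynomials in one. *)
Record formal_module : Prop := FormalModule {
  fm_fil : filtration I;
  fm_sep : forall x, (forall d, I d x) -> x = 0;
  fm_complete : forall S : nat -> C, (forall d, I d (S d.+1 - S d)) ->
    exists l, forall d, I d (l - S d);
  fm_total : forall x y, I 1%N x -> I 1%N y ->
    (exists2 c, I 0%N c & y = c * x) \/ (exists2 c, I 0%N c & x = c * y);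
  fm_coef : forall m, I 0%N (F m);
  fm_group : is_formal_group F;
  fm_log : is_logarithm F f;
  fm_mul : forall a d, I 0%N (fg_mul f (v a) d);
  fm_add : forall d x y, I 1%N x -> I 1%N y -> I d (add x y - mev d F (vec2 x y));
  fm_act : forall d a x, I 1%N x -> I d (act (v a) x - ev d (fg_mul f (v a)) x) }.

Variable fm : formal_module.
Let fI := fm_fil fm.
Let fJ := coef_filtration fI.
Local Notation J := (coef_fil I).
Let f0 : f 0%N = 0. Proof. by have [] := fm_log fm. Qed.
Let f1 : f 1%N = 1. Proof. by have [] := fm_log fm. Qed.
Let F0 := formal_group0 (fm_group fm).

Lemma evE d g x : ev d g x = pev (@idfun C) (fps_trunc d g) x.
Proof. by rewrite /pev map_poly_id. Qed.

Lemma fm_eq x y : (forall d, I d.+2 (x - y)) -> x = y.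
Proof.
move=> H; apply/eqP; rewrite -subr_eq0; apply/eqP; apply: (fm_sep fm) => d.
by apply: (fil_le fI (e := d.+2)) => //; rewrite -addn2 leq_addr.
Qed.

Lemma fil_near d e x y : (d <= e)%N -> I d x -> I e (x - y) -> I d y.
Proof.
move=> de Ix /(fil_le fI de) Ixy.
by rewrite -[y](subKr x); apply: (filB fI).
Qed.

Lemma mev_F_I1 d h : (forall i, I 1%N (h i)) -> I 1%N (mev d F h).
Proof.
move=> Ih; apply: (mmap_high fI) => //.
  exact: (mtrunc_coef_int fI (c := idfun) d (fm_coef fm)).
move=> m; rewrite ltnS leqn0 mdeg_eq0 => /eqP ->.
by rewrite mcoeff_mfps_trunc F0 if_same.
Qed.

Lemma fm_scalar a : I 0%N (v a).
Proof. by rewrite -(fg_mul1 f0 f1 (v a)); apply: fm_mul. Qed.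

Lemma add_I1 x y : I 1%N x -> I 1%N y -> I 1%N (add x y).
Proof.
move=> Ix Iy; rewrite -[add x y](subrK (mev 1 F (vec2 x y))).
by apply: (filD fI); [exact: (fm_add fm)|apply: mev_F_I1; apply: vec2_all].
Qed.

Lemma ev_mul_I1 d a x : I 1%N x -> I 1%N (ev d (fg_mul f (v a)) x).
Proof.
move=> Ix; rewrite evE; apply: (pev_high fI) => //.
  exact: (trunc_coef_int fI (c := idfun) d (fm_mul fm a)).
by move=> i; rewrite ltnS leqn0 => /eqP ->; rewrite coef_fps_trunc fg_mul0 // if_same.
Qed.

Lemma act_I1 a x : I 1%N x -> I 1%N (act (v a) x).
Proof.
move=> Ix; rewrite -[act _ x](subrK (ev 1 (fg_mul f (v a)) x)).
by apply: (filD fI); [exact: (fm_act fm)|apply: ev_mul_I1].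
Qed.

Lemma mev_F_cong d x y x' y' : I 1%N x -> I 1%N y -> I 1%N x' -> I 1%N y' ->
  I d (x - x') -> I d (y - y') -> I d (mev d F (vec2 x y) - mev d F (vec2 x' y')).
Proof.
move=> Ix Iy Ix' Iy' Hx Hy; apply: (mev_cong fI (c := idfun)) => //.
- exact: (fm_coef fm).
- exact: vec2_all.
- exact: vec2_all.
by move=> i; rewrite /vec2; case: ifP.
Qed.

Lemma add_cong d x y x' y' : I 1%N x -> I 1%N y -> I 1%N x' -> I 1%N y' ->
  I d (x - x') -> I d (y - y') -> I d (add x y - add x' y').
Proof.
move=> Ix Iy Ix' Iy' Hx Hy.
apply: (fil_trans fI (fm_add fm d Ix Iy)).
apply: (fil_trans fI (mev_F_cong Ix Iy Ix' Iy' Hx Hy)).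
by apply: (fil_sym fI); apply: (fm_add fm).
Qed.

Lemma add_eval d x y x' y' : I 1%N x -> I 1%N y -> I 1%N x' -> I 1%N y' ->
  I d (x - x') -> I d (y - y') -> I d (add x y - mev d F (vec2 x' y')).
Proof.
move=> Ix Iy Ix' Iy' Hx Hy.
by apply: (fil_trans fI (fm_add fm d Ix Iy)); apply: mev_F_cong.
Qed.

Lemma act_eval d a x x' : I 1%N x -> I 1%N x' -> I d (x - x') ->
  I d (act (v a) x - ev d (fg_mul f (v a)) x').
Proof.
move=> Ix Ix' H; apply: (fil_trans fI (fm_act fm d a Ix)).
rewrite !evE; apply: (ev_cong fI (c := idfun)) => //.
exact: (fm_mul fm).
Qed.

Lemma comp2_eval k d (A B : mfps k C) h :
    (forall m, I 0%N (A m)) -> (forall m, I 0%N (B m)) -> A 0%MM = 0 -> B 0%MM = 0 ->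
    (forall i, I 1%N (h i)) ->
  I d (mev d F (vec2 (mev d A h) (mev d B h)) - mev d (mfps_comp F [tuple A; B]) h).
Proof.
move=> IA IB A0 B0 Ih.
have := @mfps_comp_eval _ _ _ fI idfun _ _ F [tuple A; B] h d (fm_coef fm).
rewrite tnth_pair (vec2_comp (fun A : mfps k C => mev d A h)); apply=> //.
  by move=> i m; move: i; apply: (vec2_all (P := fun A : mfps k C => I 0%N (A m))).
exact: (vec2_all (P := fun A : mfps k C => A 0%MM = 0)).
Qed.

Lemma mfpsX_int k (i : 'I_k) m : I 0%N (mfpsX C i m).
Proof. exact: fil_nat. Qed.

Lemma addC x y : I 1%N x -> I 1%N y -> add x y = add y x.
Proof.
move=> Ix Iy; apply: fm_eq => d; have [_ _ EC _] := fm_group fm.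
have := @comp2_eval 2 d.+2 (mfpsX C 1) (mfpsX C 0) (vec2 x y) (@mfpsX_int _ _)
  (@mfpsX_int _ _) (mfpsX0 _ _) (mfpsX0 _ _) (vec2_all Ix Iy).
rewrite !mev_X // (funext EC) /vec2 /= -!/(vec2 _ _) => H.
apply: (fil_trans fI (fm_add fm _ Ix Iy)); apply: (fil_sym fI).
exact: (fil_trans fI (fm_add fm _ Iy Ix)).
Qed.

Lemma fm0 d : I d 0. Proof. exact: fil0. Qed.

Lemma add0 x : I 1%N x -> add 0 x = x.
Proof.
move=> Ix; apply: fm_eq => d; have [_ E0 _ _] := fm_group fm.
have := @comp2_eval 1 d.+2 (@mfps0 C 1) (mfpsX C 0) (fun=> x) (fun=> fm0 0)
  (@mfpsX_int _ _) erefl (mfpsX0 _ _) (fun=> Ix).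
rewrite !mev_X // mev_0 (funext E0) mev_X // => H.
exact: (fil_trans fI (fm_add fm _ (fm0 1) Ix)).
Qed.

Lemma addA x y z : I 1%N x -> I 1%N y -> I 1%N z -> add x (add y z) = add (add x y) z.
Proof.
move=> Ix Iy Iz; apply: fm_eq => d; have [_ _ _ EA] := fm_group fm.
set e := d.+2; set h := vec3 x y z.
have Ih : forall i, I 1%N (h i) by apply: vec3_all.
pose Y i := mfpsX C (i : 'I_3).
have h2 : h (inord 2) = z by apply: vec3_2.
have YI i := @mfpsX_int 3 i; have Y0 i := mfpsX0 C (i : 'I_3).
have G0 i j : mfps_comp F [tuple Y i; Y j] 0%MM = 0.
  rewrite /mfps_comp mdeg0.
  have -> : mfps_trunc 1 F = 0.
    apply/mpolyP => m; rewrite mcoeff_mfps_trunc mcoeff0 ltnS leqn0 mdeg_eq0.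
    by case: eqP => // ->.
  by rewrite comp_mpoly0 mcoeff0.
have GI i j m : I 0%N (mfps_comp F [tuple Y i; Y j] m).
  apply: (mfps_comp_int fI (c := idfun)); first exact: (fm_coef fm).
  move=> k m'; rewrite tnth_pair; move: k.
  by apply: (vec2_all (P := fun A : mfps 3 C => I 0%N (A m'))).
have H1 := comp2_eval e (GI 0 1) (YI (inord 2)) (G0 0 1) (Y0 _) Ih.
have H2 := comp2_eval e (YI 0) (GI 1 (inord 2)) (Y0 _) (G0 _ _) Ih.
have H3 := comp2_eval e (YI 0) (YI 1) (Y0 _) (Y0 _) Ih.
have H4 := comp2_eval e (YI 1) (YI (inord 2)) (Y0 _) (Y0 _) Ih.
rewrite !mev_X // h2 in H1 H2 H3 H4; rewrite (funext EA) in H1.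
rewrite -[h 0]/x -[h 1]/y in H1 H2 H3 H4.
have [M1 M2] : I 1%N (mev e F (vec2 x y)) /\ I 1%N (mev e F (vec2 y z)).
  by split; apply: mev_F_I1; apply: vec2_all.
have [N1 N2] : I 1%N (mev e (mfps_comp F [tuple Y 0; Y 1]) h) /\
    I 1%N (mev e (mfps_comp F [tuple Y 1; Y (inord 2)]) h).
  by split; [apply: (fil_near _ M1 H3)|apply: (fil_near _ M2 H4)].
have A1 := add_I1 Ix Iy; have A2 := add_I1 Iy Iz.
have K1 : I e (add (add x y) z - mev e F (vec2 (mev e (mfps_comp F [tuple Y 0; Y 1]) h) z)).
  apply: (add_eval A1 Iz N1 Iz); last by rewrite subrr; apply: fm0.
  exact: (fil_trans fI (fm_add fm e Ix Iy) H3).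
have K2 : I e (add x (add y z) - mev e F (vec2 x (mev e (mfps_comp F [tuple Y 1; Y (inord 2)]) h))).
  apply: (add_eval Ix A2 Ix N2); first by rewrite subrr; apply: fm0.
  exact: (fil_trans fI (fm_add fm e Iy Iz) H4).
apply: (fil_trans fI (fil_trans fI K2 H2)); apply: (fil_sym fI).
exact: (fil_trans fI K1 H1).
Qed.

(** The passage from formal identities to points: vanishing modulo [X ^ d] becomes smallness of
    order [d], provided that the coefficients are integral. *)
Lemma eval_Xadic d (P : {poly C}) x : J 0%N P -> Xadic d P -> I 1%N x -> I d P.[x].
Proof.
move=> JP XP Ix; have := @pev_high _ _ fI _ idfun d P x JP XP Ix.
by rewrite /pev map_poly_id.
Qed.

Let JX : J 0%N 'X. Proof. by move=> i; rewrite coefX; apply: fil_nat. Qed.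
Let X1 : Xadic 1 ('X : {poly C}). Proof. by apply: XF1; rewrite coefX. Qed.

Let JC z : I 0%N z -> J 0%N z%:P.
Proof. by move=> Iz i; rewrite coefC; case: eqP => // _; apply: fm0. Qed.

Lemma J_mul d a P : J 0%N P -> J 0%N (fps_trunc d (fg_mul f (v a)) \Po P).
Proof.
move=> JP; apply: (@pev_int _ _ _ fJ (@polyC C)) => // i; apply: JC.
exact: (trunc_coef_int fI (c := idfun) d (fm_mul fm a)).
Qed.

Lemma J_F d P Q : J 0%N P -> J 0%N Q -> J 0%N (mmap (@polyC C) (vec2 P Q) (mfps_trunc d F)).
Proof.
move=> JP JQ; apply: (@mmap_int _ _ _ fJ (@polyC C)); last exact: vec2_all.
move=> m; apply: JC; exact: (mtrunc_coef_int fI (c := idfun) d (fm_coef fm)).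
Qed.

Lemma horner_F d P Q x : (mmap (@polyC C) (vec2 P Q) (mfps_trunc d F)).[x] =
  mev d F (vec2 P.[x] Q.[x]).
Proof. by rewrite horner_mmap (vec2_comp (fun P : {poly C} => P.[x])). Qed.

Lemma act_addl a b x : I 1%N x -> act (v (a + b)) x = add (act (v a) x) (act (v b) x).
Proof.
move=> Ix; apply: fm_eq => d; set e := d.+2; rewrite rmorphD.
have H := mul_add_poly f0 f1 (fm_group fm) (fm_log fm) (v a) (v b) X1 (d := e).
rewrite -rmorphD in H.
have {H} := eval_Xadic _ H Ix; rewrite !comp_polyXr hornerD hornerN horner_F => H.
apply: (fil_sym fI); rewrite -rmorphD.
apply: (fil_trans fI (y := ev e (fg_mul f (v (a + b))) x)); last first.
  by apply: (fil_sym fI); apply: (fm_act fm).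
apply: (fil_trans fI _ (H _)); last first.
  apply: (filB fJ); last first.
    exact: (trunc_coef_int fI (c := idfun) e (fm_mul fm (a + b))).
  by apply: J_F; exact: (trunc_coef_int fI (c := idfun) e (fm_mul fm _)).
apply: add_eval; try exact: act_I1; try exact: ev_mul_I1; exact: (fm_act fm).
Qed.

Lemma act_mul a b x : I 1%N x -> act (v a) (act (v b) x) = act (v (a * b)) x.
Proof.
move=> Ix; apply: fm_eq => d; set e := d.+2.
have H := mul_mul_poly f0 f1 (v a) (v b) X1 (d := e).
rewrite -rmorphM in H.
have {H} := eval_Xadic _ H Ix; rewrite !comp_polyXr hornerD hornerN horner_comp => H.
apply: (fil_trans fI (y := ev e (fg_mul f (v (a * b))) x)); last first.
  by apply: (fil_sym fI); apply: (fm_act fm).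
apply: (fil_trans fI _ (H _)); last first.
  apply: (filB fJ); last first.
    exact: (trunc_coef_int fI (c := idfun) e (fm_mul fm (a * b))).
  by apply: J_mul; exact: (trunc_coef_int fI (c := idfun) e (fm_mul fm _)).
by apply: act_eval; [exact: act_I1|exact: ev_mul_I1|exact: (fm_act fm)].
Qed.

Lemma act1 x : I 1%N x -> act (v 1) x = x.
Proof.
move=> Ix; apply: fm_eq => d; set e := d.+2.
have H := mul1_poly f0 f1 X1 (d := e); rewrite -(rmorph1 v) in H.
have {H} := eval_Xadic _ H Ix; rewrite comp_polyXr hornerD hornerN hornerX => H.
apply: (fil_trans fI (fm_act fm e 1 Ix)); apply: H; apply: (filB fJ) => //.
exact: (trunc_coef_int fI (c := idfun) e (fm_mul fm _)).
Qed.

Lemma fg_mul_0 d : fg_mul f 0 d = 0.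
Proof.
rewrite /fg_mul /fps_comp (_ : fps_trunc d.+1 (fun d => 0 * f d) = 0).
  by rewrite comp_poly0r coefC coef_fps_trunc fps_inv0 // if_same.
by apply/polyP => i; rewrite coef_fps_trunc mul0r coef0 if_same.
Qed.

Lemma act0 x : I 1%N x -> act (v 0) x = 0.
Proof.
move=> Ix; apply: fm_eq => d; have := fm_act fm d.+2 0 Ix; rewrite rmorph0.
rewrite (_ : fps_trunc _ (fg_mul f 0) = 0) ?horner0 //.
by apply/polyP => i; rewrite coef_fps_trunc fg_mul_0 coef0 if_same.
Qed.

(** The formal identity is available for pairs of polynomials in one variable. Since one of the two
    points divides the other, say [y = c * x], both are values at the same point, of [X] and of
    [c X]. *)
Lemma act_addr a x y : I 1%N x -> I 1%N y ->
  act (v a) (add x y) = add (act (v a) x) (act (v a) y).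
Proof.
have main x' c : I 1%N x' -> I 1%N (c * x') -> I 0%N c ->
    act (v a) (add x' (c * x')) = add (act (v a) x') (act (v a) (c * x')).
  move=> Ix Iy Ic; apply: fm_eq => d; set e := d.+2.
  have cX1 : Xadic 1 (c%:P * 'X) by apply: XF1; rewrite coefMX.
  have H := mul_group_poly f0 f1 (fm_group fm) (fm_log fm) (v a) X1 cX1 (d := e).
  have JcX : J 0%N (c%:P * 'X) by apply: (filMr fJ) => //; apply: JC.
  have {H} := eval_Xadic _ H Ix; rewrite hornerD hornerN horner_F !horner_comp horner_F.
  rewrite hornerCM hornerX => H.
  apply: (fil_trans fI (y := ev e (fg_mul f (v a)) (mev e F (vec2 x' (c * x'))))).
    apply: act_eval; [exact: add_I1| |exact: (fm_add fm)].
    by apply: mev_F_I1; apply: vec2_all.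
  apply: (fil_trans fI (H _)).
    apply: (filB fJ); first by apply: J_mul; apply: J_F.
    by apply: J_F; apply: J_mul.
  apply: (fil_sym fI); apply: add_eval; try exact: act_I1; try exact: ev_mul_I1.
    exact: (fm_act fm).
  exact: (fm_act fm).
move=> Ix Iy; have [[c Ic E]|[c Ic E]] := fm_total fm Ix Iy.
  by rewrite E in Iy *; apply: main.
rewrite addC // [RHS]addC; try exact: act_I1.
by rewrite E in Ix *; apply: main.
Qed.

Definition points : {pred C} := fun x => `[< I 1%N x >].
(** The record is a phantom argument: the module structure declared on this type depends on it. *)
Definition FM of formal_module : Type := {x : C | x \in points}.
HB.instance Definition _ := Choice.on (FM fm).
Local Notation A := (FM fm).
Definition fmval (x : A) : C := sval x.
Definition toFM x (Ix : I 1%N x) : A := exist _ x (introT (asboolP _) Ix).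

Lemma fmvalP x : I 1%N (fmval x). Proof. exact/asboolP/(svalP x). Qed.
Lemma toFMK x (Ix : I 1%N x) : fmval (toFM Ix) = x. Proof. by []. Qed.
Lemma fmval_inj : injective fmval. Proof. exact: val_inj. Qed.

Definition fmadd (x y : A) : A := toFM (add_I1 (fmvalP x) (fmvalP y)).
Definition fmscale (a : R) (x : A) : A := toFM (act_I1 a (fmvalP x)).

Fact fmaddA : associative fmadd.
Proof. by move=> x y z; apply: fmval_inj; apply: addA; apply: fmvalP. Qed.
Fact fmaddC : commutative fmadd.
Proof. by move=> x y; apply: fmval_inj; apply: addC; apply: fmvalP. Qed.
Fact fmadd0 : left_id (toFM (fm0 1)) fmadd.
Proof. by move=> x; apply: fmval_inj; apply: add0; apply: fmvalP. Qed.
Fact fmaddN : left_inverse (toFM (fm0 1)) (fmscale (-1)) fmadd.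
Proof.
move=> x; apply: fmval_inj; rewrite /= -[X in add _ X](act1 (fmvalP x)) -act_addl; last exact: fmvalP.
by rewrite addNr; apply: act0; apply: fmvalP.
Qed.
HB.instance Definition _ := GRing.isZmodule.Build A fmaddA fmaddC fmadd0 fmaddN.

Fact fmscaleA a b x : fmscale a (fmscale b x) = fmscale (a * b) x.
Proof. by apply: fmval_inj; apply: act_mul; apply: fmvalP. Qed.
Fact fmscale1 : left_id 1 fmscale.
Proof. by move=> x; apply: fmval_inj; apply: act1; apply: fmvalP. Qed.
Fact fmscaleDr : right_distributive fmscale +%R.
Proof. by move=> a x y; apply: fmval_inj; apply: act_addr; apply: fmvalP. Qed.
Fact fmscaleDl x : {morph fmscale^~ x : a b / a + b}.
Proof. by move=> a b; apply: fmval_inj; apply: act_addl; apply: fmvalP. Qed.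
HB.instance Definition _ := GRing.Zmodule_isLmodule.Build R A
  fmscaleA fmscale1 fmscaleDr fmscaleDl.

Lemma fmvalD (x y : A) : fmval (x + y) = add (fmval x) (fmval y). Proof. by []. Qed.
Lemma fmvalZ a (x : A) : fmval (a *: x) = act (v a) (fmval x). Proof. by []. Qed.
Lemma fmval0 : fmval 0 = 0. Proof. by []. Qed.
Lemma fmval_eq0 x : fmval x = 0 -> x = 0. Proof. by move=> E; apply: fmval_inj. Qed.

Definition level d (x : A) := I d (fmval x).

Lemma fil_scaled i : filtration (fun d => I (d * i)%N).
Proof.
split=> [d|d x y|a b x y Ix Iy|d x|]; first exact: fm0.
- exact: (filB fI).
- by rewrite mulnDl; apply: (filM fI).
- by apply: (fil_le fI); rewrite leq_mul.
by rewrite mul0n; apply: fil1.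
Qed.

(** [F - X - Y] starts in degree two. On arguments of order [i] it is estimated with the filtration
    rescaled by [i], which turns degree two into order [2 i]. *)
Lemma add_approx i x y : (0 < i)%N -> I i x -> I i y -> I (2 * i)%N (add x y - (x + y)).
Proof.
move=> i0 Ix Iy; set d := (2 * i)%N.
have I1 z : I i z -> I 1%N z by apply: (fil_le fI).
apply: (fil_trans fI (fm_add fm d (I1 _ Ix) (I1 _ Iy))).
pose P := mfps_trunc d F - ('X_0 + 'X_1).
have -> : mev d F (vec2 x y) - (x + y) = mmap idfun (vec2 x y) P.
  by rewrite /P mmapB mmapD !mmapX !mmap1U.
have fS := fil_scaled i; apply: (mmap_high fS).
- move=> m; rewrite mul0n /P mcoeffB mcoeffD !mcoeffX; apply: (filB fI).
    exact: (mtrunc_coef_int fI (c := idfun) d (fm_coef fm)).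
  by apply: (filD fI); apply: fil_nat.
- move=> m lt; rewrite /P mcoeffB mcoeff_mfps_trunc (leq_trans lt) ?leq_pmulr //.
  have := congr1 (fun Q : {mpoly C[2]} => Q@_m) (mfps_trunc2 (fm_group fm)).
  rewrite mcoeff_mfps_trunc lt => ->.
  rewrite (formal_group_lin0 (fm_group fm)) (formal_group_lin1 (fm_group fm)) !scale1r.
  by rewrite subrr.
by apply: vec2_all; rewrite mul1n.
Qed.

Lemma act_approx i a x : (0 < i)%N -> I i x -> I (2 * i)%N (act (v a) x - v a * x).
Proof.
move=> i0 Ix; set d := (2 * i)%N.
have Ix1 : I 1%N x by apply: (fil_le fI i0).
apply: (fil_trans fI (fm_act fm d a Ix1)).
pose P := fps_trunc d (fg_mul f (v a)) - (v a)%:P * 'X.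
have -> : ev d (fg_mul f (v a)) x - v a * x = pev idfun P x.
  by rewrite /pev map_poly_id // /P hornerD hornerN hornerCM hornerX.
have fS := fil_scaled i; apply: (pev_high fS).
- move=> k; rewrite mul0n /P coefB; apply: (filB fI).
    exact: (trunc_coef_int fI (c := idfun) d (fm_mul fm a)).
  move: k; apply: (filMr fJ) => //; apply: JC; exact: fm_scalar.
- move=> k lt; rewrite /P coefB coef_fps_trunc (leq_trans lt) ?leq_pmulr // coefCM coefX.
  case: k lt => [|[|]] // _; first by rewrite fg_mul0 // mulr0 subrr.
  by rewrite fg_mul1 // mulr1 subrr.
by rewrite mul1n.
Qed.

Lemma levelD d x y : level d x -> level d y -> level d (x + y).
Proof.
move=> Lx Ly; case: d Lx Ly => [|d] Lx Ly.
  by apply: (fil_le fI (e := 1)) => //; apply: fmvalP.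
rewrite /level -[fmval _](subrK (fmval x + fmval y)); apply: (filD fI); last exact: filD.
by apply: (fil_le fI (e := (2 * d.+1)%N)); [rewrite leq_pmull|apply: add_approx].
Qed.

Lemma levelZ d a x : level d x -> level d (a *: x).
Proof.
move=> Lx; case: d Lx => [|d] Lx.
  by apply: (fil_le fI (e := 1)) => //; apply: fmvalP.
rewrite /level -[fmval _](subrK (v a * fmval x)); apply: (filD fI).
  by apply: (fil_le fI (e := (2 * d.+1)%N)); [rewrite leq_pmull|apply: act_approx].
by apply: (filMl fI) => //; apply: fm_scalar.
Qed.

Lemma level0 d : level d 0. Proof. exact: fm0. Qed.

Lemma levelN d x : level d x -> level d (- x).
Proof. by rewrite -scaleN1r; apply: levelZ. Qed.

Lemma levelB d x y : level d x -> level d y -> level d (x - y).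
Proof. by move=> Lx Ly; apply: levelD => //; apply: levelN. Qed.

Lemma level_le d e x : (d <= e)%N -> level e x -> level d x.
Proof. exact: (fil_le fI). Qed.

Lemma level1 x : level 1 x. Proof. exact: fmvalP. Qed.

Lemma level_sum d n (F' : 'I_n -> A) : (forall i, level d (F' i)) -> level d (\sum_i F' i).
Proof. by move=> H; elim/big_ind: _ => // [|x y]; [apply: level0|apply: levelD]. Qed.

Lemma level_sub d x y : level d (x - y) <-> I d (fmval x - fmval y).
Proof.
split=> H.
  rewrite -[in fmval x](subrK y x) fmvalD -[X in _ - X](add0 (fmvalP y)).
  apply: add_cong; try exact: fmvalP; try exact: fm0; last by rewrite subrr; apply: fm0.
  by rewrite subr0.
rewrite /level fmvalD -[X in I _ X]subr0 -[X in _ - X]fmval0 -[in X in _ - X](subrr y) fmvalD.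
by apply: add_cong; try exact: fmvalP; rewrite ?subrr //; apply: fm0.
Qed.

Lemma level_sep x : (forall d, level d x) -> x = 0.
Proof. by move=> H; apply: fmval_eq0; apply: (fm_sep fm). Qed.

Lemma level_complete (a : nat -> A) : (forall i, level i (a i)) ->
  exists l, forall d, level d (l - \sum_(i < d) a i).
Proof.
move=> Ha; have [d|l Hl] := fm_complete fm (S := fun d => fmval (\sum_(i < d) a i)).
  apply/level_sub; rewrite big_ord_recr /= addrAC subrr add0r; exact: Ha.
have Il : I 1%N l.
  by rewrite -(subrK (fmval (\sum_(i < 1) a i)) l); apply: (filD fI) => //; apply: fmvalP.
by exists (toFM Il) => d; apply/level_sub.
Qed.

(** [Y] singles out the admissible right-hand sides and is stable under subtracting values of [T].
    Each is solved up to the next level; the corrections are summable by completeness, and [T]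
    respects levels. *)
Lemma solve_by_approximation (T : A -> A) (Y : A -> Prop) :
    (forall x y, T (x - y) = T x - T y) -> (forall d x, level d x -> level d (T x)) -> (forall x y, Y x -> Y (x - T y)) ->
    (forall i x, (0 < i)%N -> Y x -> level i x ->
       exists2 z, level i z & level i.+1 (x - T z)) ->
  forall x, Y x -> exists y, x = T y.
Proof.
move=> TB TL YT step x Yx.
have T0 : T 0 = 0 by have := TB 0 0; rewrite !subrr.
have TN z : T (- z) = - T z by rewrite -sub0r TB T0 sub0r.
have TD y z : T (y + z) = T y + T z by rewrite -{1}[z]opprK TB TN opprK.
have /choice[st stP] : forall ix : nat * A, exists z,
    (0 < ix.1)%N -> Y ix.2 -> level ix.1 ix.2 -> level ix.1 z /\ level ix.1.+1 (ix.2 - T z).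
  move=> [i y]; case: (pselect [/\ (0 < i)%N, Y y & level i y]) => [[i0 Yy Ly]|H].
    by have [z Lz Lyz] := step _ _ i0 Yy Ly; exists z.
  by exists 0 => i0 Yy Ly; case: H.
pose xs := fix xs i := if i is i'.+1 then xs i' - T (st (i'.+1, xs i')) else x.
have xsP i : Y (xs i) /\ level i.+1 (xs i).
  elim: i => [|i [Yi Li]] /=; first by split=> //; apply: level1.
  by split; [apply: YT|have [] := stP (i.+1, xs i) isT Yi Li].
pose a i := if i is i'.+1 then st (i, xs i') else 0.
have aL i : level i (a i).
  case: i => [|i]; first exact: level0.
  by have [Yi Li] := xsP i; have [] := stP (i.+1, xs i) isT Yi Li.
have [l Hl] := level_complete aL; exists l; apply/eqP; rewrite -subr_eq0; apply/eqP.
have xsE d : xs d = x - T (\sum_(i < d.+1) a i).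
  elim: d => [|d IH] /=; first by rewrite big_ord1 T0 subr0.
  by rewrite big_ord_recr TD opprD addrA -IH.
apply: level_sep => d; apply: (level_le (leqnSn d)).
have -> : x - T l = xs d - T (l - \sum_(i < d.+1) a i) by rewrite xsE TB opprB addrA subrK.
by apply: levelB; [have [] := xsP d|apply: TL].
Qed.

End Setting.

(** The partial traces [S i = \sum_(j < i) sg^j x] satisfy [sg (S i) = S i.+1 - x]. Weighting them
    by the conjugates of an element of trace one makes the sum telescope, and it closes up because
    [S Q] is the trace of [x], which is zero. *)
Lemma additive_hilbert90 (C : comNzRingType) (sg : {rmorphism C -> C}) Q (tr x : C) :
    \sum_(i < Q) iter i sg tr = 1 -> iter Q sg tr = tr ->
    \sum_(i < Q) iter i sg x = 0 ->
  let z := \sum_(i < Q) (\sum_(j < i) iter j sg x) * iter i sg tr in x = z - sg z.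
Proof.
move=> tr1 trQ trx z; pose S i := \sum_(j < i) iter j sg x.
have sgS i : sg (S i) = S i.+1 - x.
  rewrite /S rmorph_sum big_ord_recl /= addrC addKr.
  by apply: eq_bigr => j _; rewrite /bump.
have E : sg z = \sum_(i < Q) S i.+1 * iter i.+1 sg tr - x * \sum_(i < Q) iter i.+1 sg tr.
  rewrite /z rmorph_sum mulr_sumr -sumrB; apply: eq_bigr => i _ /=.
  by rewrite rmorphM -/(S i) sgS mulrBl.
have sh (G : nat -> C) : G Q = G 0%N -> \sum_(i < Q) G i.+1 = \sum_(i < Q) G i.
  move=> GQ; apply: (addrI (G 0%N)).
  have -> : G 0%N + \sum_(i < Q) G i.+1 = \sum_(i < Q.+1) G i by rewrite big_ord_recl.
  by rewrite big_ord_recr /= GQ addrC.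
rewrite E (sh (fun i => S i * iter i sg tr)); last by rewrite /S trx big_ord0 !mul0r.
rewrite (sh (fun i => iter i sg tr)) // tr1 mulr1.
by rewrite opprB addrCA subrr addr0.
Qed.

Lemma mulr_swap4 (C : comNzRingType) (a b c d : C) : a * b * (c * d) = c * (a * (b * d)).
Proof. by ring. Qed.

(** * Norms of points under a cyclic group *)

Section CyclicAction.
Variables (C : fieldType) (R : comNzRingType) (v : {rmorphism R -> C}).
Variables (I : nat -> C -> Prop) (F : mfps 2 C) (f : fps C) (add act : C -> C -> C).
Variable fm : formal_module v I F f add act.
Variables (sg : {rmorphism C -> C}) (p m : nat) (tr : C).
Local Notation Q := (p ^ m)%N.
Hypothesis sgI : forall d x, I d x -> I d (sg x).
Hypothesis sgF : forall m, sg (F m) = F m.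
Hypothesis sgM : forall a d, sg (fg_mul f (v a) d) = fg_mul f (v a) d.
Hypothesis sgQ : forall x, I 0%N x -> iter Q sg x = x.
Hypotheses (trI : I 0%N tr) (tr1 : \sum_(i < Q) iter i sg tr = 1).
Let fI := fm_fil fm.
Local Notation A := (FM fm).
Local Notation mev d G h := (mmap (@idfun C) h (mfps_trunc d G)).
Implicit Types x y z : A.

Lemma sg_mev d h : sg (mev d F h) = mev d F (fun i => sg (h i)).
Proof.
rewrite /mmap rmorph_sum; apply: eq_bigr => k _ /=; rewrite rmorphM; congr (_ * _).
  by rewrite mcoeff_mfps_trunc; case: ifP => // _; rewrite rmorph0.
by rewrite /mmap1 rmorph_prod; apply: eq_bigr => i _; rewrite rmorphXn.
Qed.

Lemma sg_add a b : I 1%N a -> I 1%N b -> sg (add a b) = add (sg a) (sg b).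
Proof.
move=> Ia Ib; apply: (fm_eq fm) => d.
have := sgI (fm_add fm d.+2 Ia Ib); rewrite rmorphB sg_mev (vec2_comp sg) => H.
apply: (fil_trans fI H); apply: (fil_sym fI).
by apply: (fm_add fm); apply: sgI.
Qed.

Lemma sg_act r a : I 1%N a -> sg (act (v r) a) = act (v r) (sg a).
Proof.
move=> Ia; apply: (fm_eq fm) => d.
have := sgI (fm_act fm d.+2 r Ia); rewrite rmorphB.
have -> : sg (fps_trunc d.+2 (fg_mul f (v r))).[a] = (fps_trunc d.+2 (fg_mul f (v r))).[sg a].
  rewrite -horner_map; congr (_.[_]); apply/polyP => i; rewrite coef_map coef_fps_trunc /=.
  by case: ifP => // _; rewrite rmorph0.
move=> H; apply: (fil_trans fI H); apply: (fil_sym fI).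
by apply: (fm_act fm); apply: sgI.
Qed.

Lemma sg_scalar r : sg (v r) = v r.
Proof.
have [f0 f1 _] := fm_log fm.
by have := sgM r 1; rewrite fg_mul1.
Qed.

Definition sgFM x : A := toFM fm (sgI (fmvalP x)).

Fact sgFM_linear : linear sgFM.
Proof.
move=> a x y; apply: fmval_inj; rewrite /sgFM toFMK !fmvalD !fmvalZ !toFMK.
by rewrite (sg_add (act_I1 fm a (fmvalP x)) (fmvalP y)) (sg_act a (fmvalP x)).
Qed.

HB.instance Definition _ := GRing.isLinear.Build R A A *:%R sgFM sgFM_linear.
Definition sgL : {linear A -> A} := sgFM.

Lemma fmval_sg x : fmval (sgL x) = sg (fmval x). Proof. by []. Qed.

Lemma fmval_iter k x : fmval (iter k sgL x) = iter k sg (fmval x).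
Proof. by elim: k => //= k IH; rewrite IH. Qed.

Lemma sgL_order x : iter Q sgL x = x.
Proof.
apply: fmval_inj; rewrite fmval_iter sgQ //.
by apply: (fil_le fI (e := 1)) => //; apply: fmvalP.
Qed.

Lemma fixedP x : fixed sgL x <-> sg (fmval x) = fmval x.
Proof. by split=> [/(congr1 (@fmval _ _ _ _ _ _ _ _ _))|E] //; apply: fmval_inj. Qed.

Lemma level_sg d x : level d x -> level d (sgL x). Proof. exact: sgI. Qed.

Lemma level_iter d k x : level d x -> level d (iter k sgL x).
Proof. by elim: k => //= k IH /IH; apply: level_sg. Qed.

Lemma sum_approx i n (a : 'I_n -> A) : (0 < i)%N -> (forall k, level i (a k)) ->
  I (2 * i)%N (fmval (\sum_k a k) - \sum_k fmval (a k)).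
Proof.
move=> i0; elim: n a => [|n IH] a La; first by rewrite !big_ord0 subrr; apply: fil0.
rewrite !big_ord_recr /=.
set s := \sum_(k < n) _; set t := \sum_(k < n) _.
have Hs : I (2 * i)%N (fmval s - t) by apply: IH.
apply: (fil_trans fI (y := fmval s + fmval (a ord_max))).
  by apply: (add_approx fm) => //; [apply: level_sum|apply: La].
by rewrite opprD addrACA subrr addr0.
Qed.

Lemma sub_approx i x y : (0 < i)%N -> level i x -> level i y ->
  I (2 * i)%N (fmval (x - y) - (fmval x - fmval y)).
Proof.
move=> i0 Lx Ly; have := add_approx fm i0 (levelB Lx Ly) Ly.
rewrite -fmvalD subrK => /(filN fI); congr (I _ _); ring.
Qed.

Lemma iter_sg_I k d a : I d a -> I d (iter k sg a).
Proof. by elim: k => //= k IH /IH; apply: sgI. Qed.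

Lemma iter_sgM k a b : iter k sg (a * b) = iter k sg a * iter k sg b.
Proof. by elim: k => //= k ->; rewrite rmorphM. Qed.

Lemma iter_sgB k a b : iter k sg (a - b) = iter k sg a - iter k sg b.
Proof. by elim: k => //= k ->; rewrite rmorphB. Qed.

Lemma iter_sg_fix k a : sg a = a -> iter k sg a = a.
Proof. by move=> E; elim: k => //= k ->. Qed.

Let succ_le i : (0 < i)%N -> (i.+1 <= 2 * i)%N.
Proof. by move=> i0; rewrite mul2n -addnn -addn1 leq_add2l. Qed.

Lemma nrm_sub x y : nrm sgL p m (x - y) = nrm sgL p m x - nrm sgL p m y.
Proof.
rewrite /nrm -sumrB; apply: eq_bigr => i _.
by elim: (val i) => //= k ->; rewrite linearB.
Qed.

Lemma nrm_surj x : sgL x = x -> exists y, x = nrm sgL p m y.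
Proof.
apply: (solve_by_approximation (Y := fun x => sgL x = x)).
- exact: nrm_sub.
- by move=> d y Ly; apply: level_sum => i; apply: level_iter.
- by move=> y z Ey; rewrite linearB Ey (sg_nrm sgL_order).
move=> i y i0 Ey Ly.
(* On points of level [i] the norm is the trace up to order [2 i], and the trace of [tr] times a
   fixed element is that element. *)
have Iz : I i (tr * fmval y) by apply: (filMl fI).
exists (toFM fm (fil_le fI i0 Iz)) => //.
apply/level_sub; apply: (fil_le fI (succ_le i0)); apply: (fil_sym fI).
set z := toFM _ _.
have := @sum_approx i Q (fun k => iter k sgL z) i0 (fun k => level_iter k (Iz : level i z)).
rewrite (_ : \sum_k _ = fmval y) //.
under eq_bigr => k _ do rewrite fmval_iter toFMK iter_sgM (iter_sg_fix _ (proj1 (fixedP y) Ey)).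
by rewrite -mulr_suml tr1 mul1r.
Qed.

Lemma nrm_ker x : nrm sgL p m x = 0 -> exists y, x = sgL y - y.
Proof.
apply: (solve_by_approximation (T := fun y => sgL y - y) (Y := fun x => nrm sgL p m x = 0)).
- by move=> y z; rewrite linearB; apply: subrACA.
- by move=> d y Ly; apply: levelB => //; apply: level_sg.
- by move=> y z Ey; rewrite !nrm_sub Ey (nrm_sg sgL_order) subrr subr0.
move=> i y i0 Ny Ly; pose X := fmval y; pose t := \sum_(k < Q) iter k sg X.
have It : I (2 * i)%N t.
  have := @sum_approx i Q (fun k => iter k sgL y) i0 (fun k => level_iter k Ly).
  rewrite -/(nrm sgL p m y) Ny fmval0 sub0r => /(filN fI); rewrite opprK.
  by congr (I _ _); apply: eq_bigr => k _; rewrite fmval_iter.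
have IX0 : I 0%N X by apply: (fil_le fI (e := i)).
have sgt : sg t = t.
  rewrite /t rmorph_sum /=; have := sgQ IX0.
  case: (Q) => [|q] E; first by rewrite !big_ord0.
  rewrite big_ord_recr [RHS]big_ord_recl [RHS]addrC /=; congr (_ + _).
  by rewrite -iterS E.
(* Vanishing of the norm only makes the trace [t] small, of order [2 i]. Subtracting [tr * t] makes
   the trace exactly zero, at a cost beyond level [i]. *)
pose X' := X - tr * t.
have trX' : \sum_(k < Q) iter k sg X' = 0.
  under eq_bigr => k _ do rewrite iter_sgB iter_sgM (iter_sg_fix _ sgt).
  by rewrite sumrB -mulr_suml tr1 mul1r subrr.
have := additive_hilbert90 tr1 (sgQ trI) trX'; set z := \sum_(k < Q) _ => Ez.
have It' : I i t by apply: (fil_le fI (e := (2 * i)%N)) => //; rewrite leq_pmull.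
have IX' : I i X' by apply: (filB fI) => //; apply: (filMl fI).
have Iz : I i (- z).
  apply: (filN fI); apply: (fil_sum fI) => k _; apply: (filMr fI).
    by apply: (fil_sum fI) => l _; apply: iter_sg_I.
  exact: iter_sg_I.
exists (toFM fm (fil_le fI i0 Iz)) => //; set Z := toFM _ _.
apply/level_sub; apply: (fil_le fI (succ_le i0)); apply: (fil_sym fI).
have LZ : level i Z by [].
apply: (fil_trans fI (sub_approx i0 (level_sg LZ) LZ)).
rewrite fmval_sg toFMK rmorphN opprK addrC.
have {}Ez : X' = z - sg z := Ez.
rewrite [- sg z + z]addrC -Ez /X' addrA addNr add0r.
by apply: (filN fI); apply: (filMl fI).
Qed.

(** * The rank of the fixed points *)

Section Rank.
Variables (w : R) (cd : cdvr w) (e n : nat) (eb : nat -> C).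
Local Notation pi := (v w).
Hypotheses (e0 : (0 < e)%N) (pi0 : pi != 0).
Hypothesis pi_div : forall d (x : C), I (e + d)%N x <-> exists2 y : C, I d y & x = pi * y.
Hypotheses (ebI : forall j, I 0%N (eb j)) (eb_fix : forall j, sg (eb j) = eb j).
Hypothesis eb_gen : forall x : C, I 0%N x -> sg x = x ->
  exists a : nat -> R, x = \sum_(j < n) v (a j) * eb j.
Hypothesis eb_indep : forall a : nat -> R, \sum_(j < n) v (a j) * eb j = 0 ->
  forall j, (j < n)%N -> a j = 0.

Lemma pi_divX k d a : I (k * e + d)%N a <-> exists2 y, I d y & a = pi ^+ k * y.
Proof.
elim: k a => [|k IH] a.
  by split=> [Ia|[y Iy ->]]; [exists a; rewrite ?mul1r|rewrite mul1r].
rewrite mulSn -addnA; split=> [/pi_div[b /IH[y Iy ->] ->]|[y Iy ->]].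
  by exists y => //; rewrite exprS mulrA.
by apply/pi_div; exists (pi ^+ k * y); [apply/IH; exists y|rewrite exprS mulrA].
Qed.

Lemma pi_X k : I (k * e)%N (pi ^+ k).
Proof.
rewrite -[(k * e)%N]addn0; apply/pi_divX; exists 1; rewrite ?mulr1 //.
exact: fil1.
Qed.

Lemma level_w d x : (0 < d)%N -> level d x -> level d.+1 (w *: x).
Proof.
move=> d0 Lx; rewrite /level -[fmval _](subrK (pi * fmval x)); apply: (filD fI).
  apply: (fil_le fI (e := (2 * d)%N)); first exact: succ_le.
  exact: (act_approx fm).
apply: (fil_le fI (e := (1 * e + d)%N)); first by rewrite mul1n -addn1 addnC leq_add2r.
by apply: (filM fI) => //; have := pi_X 1; rewrite expr1.
Qed.

Lemma level_wX k x : level k.+1 (w ^+ k *: x).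
Proof.
elim: k => [|k IH]; first by rewrite scale1r; apply: level1.
by rewrite exprS -scalerA; apply: level_w.
Qed.

Lemma A_sep x : (forall k, exists y, x = w ^+ k *: y) -> x = 0.
Proof.
move=> H; apply: level_sep => d; have [y ->] := H d.
by apply: (level_le (leqnSn d)); apply: level_wX.
Qed.

Let le2 a : (2 <= a)%N -> ((a + 2) * e <= 2 * (a * e))%N.
Proof. by move=> a2; rewrite mulnA leq_mul2r mul2n -addnn leq_add2l a2 orbT. Qed.

(** The error has order [2 a e], at least [(a + 2) e] once [a >= 2]. From level [2 e] on, [w] thus
    acts like multiplication by [pi] and raises the level by exactly [e]; this is why the points
    [vv j] start from [pi ^ 2]. *)
Lemma w_approx a x : (2 <= a)%N -> level (a * e) x ->
  I ((a + 2) * e)%N (fmval (w *: x) - pi * fmval x).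
Proof.
move=> a2 Lx; apply: (fil_le fI (le2 a2)); apply: (act_approx fm) => //.
by rewrite muln_gt0 e0 andbT; apply: leq_trans a2.
Qed.

Lemma w_level a x : (2 <= a)%N -> level (a * e) x -> level (a.+1 * e) (w *: x).
Proof.
move=> a2 Lx; apply: (fil_near fm (x := pi * fmval x) (e := ((a + 2) * e)%N)).
- by rewrite leq_mul2r addn2 leqnSn orbT.
- by rewrite mulSn; apply/pi_div; exists (fmval x).
by apply: (fil_sym fI); apply: w_approx.
Qed.

Lemma w_level_not a x : (2 <= a)%N -> level (a * e) x -> ~ level (a.+1 * e) x ->
  ~ level (a.+2 * e) (w *: x).
Proof.
move=> a2 Lx nLx Lw; apply: nLx.
have : I (a.+2 * e)%N (pi * fmval x).
  apply: (fil_near fm (x := fmval (w *: x)) (e := ((a + 2) * e)%N)) => //.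
    by rewrite addn2.
  exact: w_approx.
by rewrite mulSn => /pi_div[y Iy /(mulfI pi0)]; rewrite /level => ->.
Qed.

Lemma wX_neq0 N x : level (2 * e) x -> ~ level (3 * e) x -> w ^+ N *: x <> 0.
Proof.
move=> L2 nL3.
have [_ H] : level ((N + 2) * e) (w ^+ N *: x) /\ ~ level ((N + 3) * e) (w ^+ N *: x).
  elim: N => [|N [LN nLN]]; first by rewrite scale1r.
  rewrite exprS -scalerA; split; first by apply: w_level; rewrite ?leq_addl.
  by rewrite addSn [(N + 3)%N]addnS; apply: w_level_not; rewrite ?leq_addl // -addnS.
by move=> E; apply: H; rewrite E; apply: level0.
Qed.

Lemma v_I1 j : I 1%N (pi ^+ 2 * eb j).
Proof.
apply: (fil_le fI (e := (2 * e)%N)); first by rewrite muln_gt0 e0.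
by apply: (filMr fI) => //; apply: pi_X.
Qed.

Definition vv j : A := toFM fm (v_I1 j).

Lemma vv_level j : level (2 * e) (vv j).
Proof. by rewrite /level toFMK; apply: (filMr fI) => //; apply: pi_X. Qed.

Lemma vv_fixed j : fixed sgL (vv j).
Proof. by apply/fixedP; rewrite toFMK rmorphM rmorphXn /= sg_scalar eb_fix. Qed.

Lemma sg_pi_cancel k a : sg (pi ^+ k * a) = pi ^+ k * a -> sg a = a.
Proof. by rewrite rmorphM rmorphXn /= sg_scalar => /(mulfI (expf_neq0 k pi0)). Qed.

(** A torsion relation, made primitive, gives a combination of the [vv j] that is killed by a power
    of [w], so it must lie at level [3 e]. Divided by [pi ^ 2], it says that the same combination of
    the [eb j] is [pi] times a fixed integer, against the unit coefficient. *)
Lemma fixed_lb : exists2 y, forall i, (i < n)%N -> fixed sgL (y i) &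
  indep_mod (torsion w (A := A)) n y.
Proof.
exists vv => [i _|r [N rN] i lt]; first exact: vv_fixed.
apply: contrapT => ri.
have [k [r' [Er [j [b [jn rb]]]]]] := cdvr_primitive cd lt ri.
pose z := \sum_(j < n) r' j *: vv j.
have Ez : \sum_(i < n) r i *: vv i = w ^+ k *: z.
  by rewrite scaler_sumr; apply: eq_bigr => l _; rewrite Er // scalerA.
have L2 : level (2 * e) z by apply: level_sum => l; apply: levelZ; apply: vv_level.
apply: (@wX_neq0 (N + k) z) => //; last by rewrite exprD -scalerA -Ez.
have e20 : (0 < 2 * e)%N by rewrite muln_gt0 e0.
have H1 : I (2 * (2 * e))%N (fmval z - pi ^+ 2 * \sum_(l < n) v (r' l) * eb l).
  apply: (fil_trans fI (y := \sum_(l < n) fmval (r' l *: vv l))).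
    by apply: sum_approx => // l; apply: levelZ; apply: vv_level.
  rewrite mulr_sumr -sumrB; apply: (fil_sum fI) => l _; rewrite mulrCA.
  by have := act_approx fm (r' l) e20 (vv_level l); rewrite fmvalZ toFMK.
move=> L3; have : I (2 * e + e)%N (pi ^+ 2 * \sum_(l < n) v (r' l) * eb l).
  rewrite -mulSnr; apply: (fil_near fm (e := (2 * (2 * e))%N) _ L3 H1).
  by rewrite mulnA leq_mul2r orbT.
move=> /pi_divX[y Iy /(mulfI (expf_neq0 2 pi0)) Ey].
move: Iy; rewrite -[e]addn0 => /pi_div[y0 Iy0 Ey0].
have sgy0 : sg y0 = y0.
  apply: (@sg_pi_cancel 1); rewrite expr1 -Ey0 -Ey rmorph_sum; apply: eq_bigr => l _ /=.
  by rewrite rmorphM /= sg_scalar eb_fix.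
have [s Es] := eb_gen Iy0 sgy0.
have E0 : \sum_(l < n) v (r' l - w * s l) * eb l = 0.
  under eq_bigr => l _ do rewrite rmorphB rmorphM /= mulrBl -mulrA.
  by rewrite sumrB -mulr_sumr -Es Ey Ey0 subrr.
have /eqP := eb_indep (a := fun l => r' l - w * s l) E0 jn.
by rewrite subr_eq0 => /eqP; apply: (cdvr_unitN cd rb).
Qed.

Lemma wX_approx k x : level (2 * e) x ->
  level ((k + 2) * e) (w ^+ k *: x) /\
  I ((k + 3) * e)%N (fmval (w ^+ k *: x) - pi ^+ k * fmval x).
Proof.
move=> Lx; elim: k => [|k [Lk Ik]].
  by rewrite scale1r mul1r subrr; split=> //; apply: fil0.
rewrite exprS -scalerA; split; first by apply: w_level; rewrite ?leq_addl.
apply: (fil_trans fI (y := pi * fmval (w ^+ k *: x))).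
  apply: (fil_le fI (e := ((k + 2 + 2) * e)%N)); last by apply: w_approx; rewrite ?leq_addl.
  by rewrite leq_mul2r -addnA addSnnS leqnn orbT.
rewrite [pi ^+ k.+1]exprS -mulrA -mulrBr addSn mulSn; apply/pi_div.
by exists (fmval (w ^+ k *: x) - pi ^+ k * fmval x).
Qed.

(** A fixed point at level [(k + 2) e] is [pi ^ (k + 2)] times a fixed integer. Its coordinates on
    the [eb j] supply the next digits, because [w ^ k *: vv j] is [pi ^ (k + 2) * eb j] to higher
    order. *)
Lemma fixed_generation x : fixed sgL x -> level (2 * e) x ->
  exists a : nat -> R, x = \sum_(j < n) a j *: vv j.
Proof.
move=> fx Lx.
pose Vf k y := fixed sgL y /\ level ((k + 2) * e) y.
have step k y : Vf k y -> exists a : nat -> R,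
    Vf k.+1 (y - \sum_(j < n) (a j * w ^+ k) *: vv j).
  move=> [fy]; rewrite /level -[((k + 2) * e)%N]addn0 => Ly'.
  have [z Iz Ez] := proj1 (pi_divX _ _ _) Ly'; rewrite addn0 in Ly'.
  have sz : sg z = z by apply: (@sg_pi_cancel (k + 2)); rewrite -Ez; apply/fixedP.
  have [a Ea] := eb_gen Iz sz; exists a; split.
    apply: (submodB (submod_fixed sgL)) => //.
    apply: (submod_sum (fun j => a j * w ^+ k) (submod_fixed sgL)) => j _.
    exact: vv_fixed.
  apply/level_sub; apply: (fil_sym fI).
  have k20 : (0 < (k + 2) * e)%N by rewrite muln_gt0 addn2 e0.
  have le3 : ((k + 3) * e <= 2 * ((k + 2) * e))%N.
    by apply: leq_trans (le2 (leq_addl k 2)); rewrite leq_mul2r -addnA leq_add2l orbT.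
  rewrite addSnnS; apply: (fil_trans fI (y := \sum_(j < n) fmval ((a j * w ^+ k) *: vv j))).
    apply: (fil_le fI le3); apply: sum_approx => // j; rewrite -scalerA; apply: levelZ.
    by have [] := wX_approx k (vv_level j).
  have -> : fmval y = \sum_(j < n) v (a j) * (pi ^+ k * fmval (vv j)).
    rewrite Ez Ea mulr_sumr; apply: eq_bigr => j _.
    by rewrite -[fmval (vv j)]/(pi ^+ 2 * eb j) exprD; apply: mulr_swap4.
  rewrite -sumrB; apply: (fil_sum fI) => j _; rewrite -scalerA.
  have [Lj Ij] := wX_approx k (vv_level j).
  apply: (fil_trans fI (fil_le fI le3 (act_approx fm (a j) k20 Lj))).
  by rewrite -mulrBr; exact: (filMl fI (fm_scalar fm (a j)) Ij).
have [a Ha] := complete_generation cd step (conj fx Lx : Vf 0%N x).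
exists a; apply/eqP; rewrite -subr_eq0; apply/eqP; apply: level_sep => d.
have [c [_ Hc]] := Ha d; set s := \sum_(j < n) c j *: vv j in Hc.
rewrite -[x - _](addrK (w ^+ d *: s)); apply: levelB.
  by apply: level_le Hc; rewrite (leq_trans _ (leq_pmulr _ e0)) // leq_addr.
by apply: (level_le (leqnSn d)); apply: level_wX.
Qed.

Lemma fixed_ub (y : nat -> A) : (forall i, (i <= n)%N -> fixed sgL (y i)) ->
  ~ indep_mod (torsion w (A := A)) n.+1 y.
Proof.
(* Multiplication by [w] raises the level by at least one, so the exponent [2 e] brings every fixed
   point into the span of the [vv j], where [n + 1] elements are dependent. *)
move=> fy ind; pose k := (2 * e)%N.
have /choice[r Hr] : forall i, exists a : nat -> R, (i <= n)%N ->
    w ^+ k *: y i = \sum_(j < n) a j *: vv j.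
  move=> i; case: (leqP i n) => [le|_]; last by exists (fun=> 0).
  have [||a Ea] := @fixed_generation (w ^+ k *: y i); last by exists a.
    by apply: (submodZ _ (submod_fixed sgL)); apply: fy.
  by apply: (level_le (leqnSn _)); apply: level_wX.
have [a [[i [le ai]] Ha]] := cdvr_dependence cd n r.
apply: ai; apply: (cdvr_regX cd (k := k)); rewrite mulrC.
have := ind (fun i => a i * w ^+ k); apply=> //; exists 0%N; rewrite scale1r.
transitivity (\sum_(l < n.+1) \sum_(j < n) (a l * r l j) *: vv j).
  apply: eq_bigr => l _; rewrite -scalerA Hr -1?ltnS // scaler_sumr.
  by apply: eq_bigr => j _; rewrite scalerA.
by rewrite exchange_big big1 // => j _; rewrite -scaler_suml Ha // scale0r.
Qed.

End Rank.
End CyclicAction.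

(** * Torsion *)

Section TorsionStructure.
Variables (R : comNzRingType) (w : R) (cd : cdvr w) (A : lmodType R).
Variables (q h s : nat) (rho : nat -> R).
Hypotheses (q1 : (1 < q)%N) (s0 : (0 < s)%N).
Hypothesis rho_repr : forall a, exists i b, (i < q)%N /\ a - rho i = w * b.
Hypothesis rho_inj : forall i j b, (i < q)%N -> (j < q)%N -> rho i - rho j = w * b -> i = j.
Hypothesis tors_kill : forall x : A, torsion w x -> w ^+ s *: x = 0.
Hypothesis fibers : forall y : A, w ^+ s.-1 *: y = 0 -> exists z : nat -> A,
  [/\ forall i, (i < q ^ h)%N -> w *: z i = y,
      forall i j, (i < q ^ h)%N -> (j < q ^ h)%N -> z i = z j -> i = j &
      forall x, w *: x = y -> exists2 i, (i < q ^ h)%N & x = z i].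

(** The fiber over [0] has [q ^ h] points, so those killed by [w] have dimension [h] over the
    residue field. Since the fibers are nonempty, each of them is [w ^ s.-1] times a point; the
    [zeta i] are such preimages of a basis. They span the torsion by induction on the exponent, and
    their relations are found digit by digit. *)
Lemma torsion_structure : exists zeta : nat -> A, [/\
  forall i, (i < h)%N -> w ^+ s *: zeta i = 0,
  forall x, torsion w x -> exists b : nat -> R, x = \sum_(i < h) b i *: zeta i &
  forall b : nat -> R, \sum_(i < h) b i *: zeta i = 0 ->
    forall i, (i < h)%N -> exists c, b i = w ^+ s * c].
Proof.
have [|z [zw zinj zall]] := @fibers 0; first by rewrite scaler0.
pose B (x : A) := w *: x = 0; pose D (x : A) := x = 0.
have [r [eta [Er etaB etaI etaG]]] : exists r y, [/\ (q ^ h = q ^ r)%N,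
    forall i, (i < r)%N -> B (y i), pi_indep w D r y &
    forall x, B x -> exists a : nat -> R, D (x - \sum_(i < r) a i *: y i)].
  apply: (class_count cd (z := z) _ _ _ q1 rho_repr rho_inj) => //.
  - split=> [|a x y Bx By]; first by rewrite /B scaler0.
    by rewrite /B scalerDr scalerA mulrC -scalerA Bx By scaler0 addr0.
  - by split=> // a x y -> ->; rewrite scaler0 addr0.
  - by move=> x /zall[i lt ->]; exists i => //; rewrite /D subrr.
  by move=> i j li lj /eqP; rewrite subr_eq0 => /eqP; apply: zinj.
have {Er} Er : r = h by apply/eqP; rewrite -(eqn_exp2l _ _ q1) -Er.
rewrite {r}Er in etaB etaI etaG.
have lift k (x : A) : (k < s)%N -> w *: x = 0 -> exists y, w ^+ k *: y = x.
  move=> ks wx; elim: k ks => [|k IH] ks; first by exists x; rewrite scale1r.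
  have [y Ey] := IH (ltnW ks).
  have [|t [tw _ _]] := @fibers y.
    have -> : s.-1 = (s.-1 - k.+1 + k.+1)%N by rewrite subnK // -ltnS prednK.
    by rewrite exprD -scalerA exprS -[in X in _ *: X]scalerA Ey wx scaler0.
  exists (t 0%N); rewrite exprSr -scalerA tw // expn_gt0.
  by rewrite (ltnW q1).
have /choice[zeta Hz] : forall i, exists y : A, (i < h)%N -> w ^+ s.-1 *: y = eta i.
  move=> i; case: (ltnP i h) => [lt|_]; last by exists 0.
  by have [|y Ey] := lift s.-1 (eta i) _ (etaB _ lt); [rewrite prednK|exists y].
have ws (y : A) : w ^+ s *: y = w *: (w ^+ s.-1 *: y) by rewrite scalerA -exprS prednK.
exists zeta; split=> [i lt|x tx|b Eb].
- by rewrite ws Hz //; apply: etaB.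
- have : w ^+ s *: x = 0 by apply: tors_kill.
  move: (leqnn s); elim: {1 3}s x {tx} => [|k IH] x ks wx.
    exists (fun=> 0); rewrite big1 => [|i _]; last by rewrite scale0r.
    by rewrite -wx scale1r.
  have [a Ea] : exists a : nat -> R, D (w ^+ k *: x - \sum_(i < h) a i *: eta i).
    by apply: etaG; rewrite /B scalerA -exprS.
  pose c i := a i * w ^+ (s.-1 - k).
  have [|b Eb] := IH (x - \sum_(i < h) c i *: zeta i) (ltnW ks).
    rewrite scalerBr -[RHS]Ea; congr (_ - _); rewrite scaler_sumr; apply: eq_bigr => i _.
    rewrite -Hz // !scalerA /c mulrCA -exprD subnKC //.
    by rewrite -ltnS prednK.
  exists (fun i => b i + c i); under eq_bigr do rewrite scalerDl.
  by rewrite big_split /= -Eb subrK.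
have : forall k, (k <= s)%N -> forall i, (i < h)%N -> exists c, b i = w ^+ k * c.
  elim=> [|k IH] ks i lt; first by exists (b i); rewrite mul1r.
  have /choice[c Hc] : forall i, exists c, (i < h)%N -> b i = w ^+ k * c.
    move=> j; case: (ltnP j h) => [jh|_]; last by exists 0.
    by have [c Ec] := IH (ltnW ks) j jh; exists c.
  have /etaI/(_ i lt)[d Ed] : D (\sum_(i < h) c i *: eta i).
    have E0 : w ^+ (s.-1 - k) *: \sum_(i < h) b i *: zeta i = 0 by rewrite Eb scaler0.
    rewrite /D -[RHS]E0 scaler_sumr; apply: eq_bigr => j _.
    have ks' : (k <= s.-1)%N by rewrite -ltnS prednK.
    by rewrite -Hz // Hc // !scalerA mulrA -exprD subnK // mulrC.
  by exists d; rewrite Hc // Ed exprSr mulrA.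
by apply.
Qed.

End TorsionStructure.

(** * Elements of trace one *)

Section TraceOne.
Variables (C : comNzRingType) (O : C -> Prop) (t : C) (sg : {rmorphism C -> C}).
Variables (p Q N : nat) (code : C -> 'I_N).
Hypotheses (O1 : O 1) (OB : forall x y, O x -> O y -> O (x - y)).
Hypotheses (OM : forall x y, O x -> O y -> O (x * y)) (Ot : O t).
Local Notation I := (ideal_power O t).
Hypothesis I_sep : forall x, (forall d, I d x) -> x = 0.
Hypothesis O_dich : forall x, O x -> I 1%N x \/ exists2 y, O y & x * y = 1.
Hypotheses (I1 : ~ I 1%N 1) (p_pr : prime p) (Ip : I 1%N p%:R).
Hypotheses (sgO : forall x, O x -> O (sg x)) (sgt : sg t = t).
Hypothesis codeP : forall x y, O x -> O y -> code x = code y -> I 1%N (x - y).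
Hypotheses (Q0 : (0 < Q)%N) (sgQ : forall x, O x -> iter Q sg x = x).
Hypothesis sg_faithful : forall k, (0 < k < Q)%N -> exists2 x, O x & iter k sg x <> x.
Let fI : filtration I := ideal_power_filtration Ot O1 OB OM.
Let I0P x : I 0%N x <-> O x.
Proof. by split=> [[y Oy ->]|Ox]; [rewrite mul1r|exists x; rewrite ?mul1r]. Qed.
Lemma residue_prime x y : O x -> O y -> I 1%N (x * y) -> I 1%N x \/ I 1%N y.
Proof.
move=> Ox Oy Ixy; have [|[x' Ox' xx']] := O_dich Ox; [by left|right].
by rewrite -[y]mul1r -xx' mulrAC; apply: (filMr fI) => //; apply/I0P.
Qed.

Lemma residue_frobenius_inj x y : O x -> O y -> I 1%N (x ^+ p - y ^+ p) -> I 1%N (x - y).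
Proof.
move=> Ox Oy Ixy; have OBxy := OB Ox Oy.
have := fil_frobenius fI 1 p_pr Ip (proj2 (I0P _) OBxy) (proj2 (I0P _) Oy).
rewrite subrK !expn1 => H.
have Ip' : I 1%N ((x - y) ^+ p) by have := filB fI Ixy H; congr (I _ _); ring.
have [//|[z Oz Ez]] := O_dich OBxy; case: I1.
rewrite -(expr1n _ p) -Ez exprMn; apply: (filMr fI) => //.
by apply: (filX0 fI); apply/I0P.
Qed.

Lemma O_exp x k : O x -> O (x ^+ k).
Proof. by move=> Ox; apply/I0P/(filX0 fI)/I0P. Qed.

(** With finitely many codes, two of the powers [x ^ (p ^ k)] are congruent modulo [t]. Injectivity
    of Frobenius cancels the common exponent and leaves [x] congruent to a [p]-th power. *)
Lemma residue_perfect x : O x -> exists2 y, O y & I 1%N (x - y ^+ p).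
Proof.
move=> Ox; pose u k := x ^+ (p ^ k).
have [a [b [ab E]]] : exists a b, (a < b)%N /\ code (u a) = code (u b).
  apply: contrapT => H.
  have inj : injective (fun k : 'I_N.+1 => code (u k)).
    move=> a b E; apply: contrapT => ne; apply: H.
    have [lt|lt|eq] := ltngtP a b; first by exists a, b.
      by exists b, a.
    by case: ne; apply: val_inj.
  have := leq_card _ inj; rewrite !card_ord ltnn //.
have Ou k : O (u k) by apply: O_exp.
have := codeP (Ou a) (Ou b) E; rewrite -(subnKC ab) addSnnS.
have : (0 < (b - a.+1).+1)%N by []; move: (b - a.+1).+1 => c; case: c => // c _.
elim: a {b ab E} => [|a IH].
  rewrite add0n /u expn0 expr1 expnSr exprM => H; exists (x ^+ (p ^ c)) => //.
  exact: O_exp.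
have uS k : u k.+1 = u k ^+ p by rewrite /u expnSr exprM.
rewrite addSn !uS => H; apply: IH; apply: residue_frobenius_inj H; exact: Ou.
Qed.

Let iterO k x : O x -> O (iter k sg x).
Proof. by elim: k => //= k IH /IH; apply: sgO. Qed.

Let iterI k d x : I d x -> I d (iter k sg x).
Proof.
move=> [y Oy ->]; exists (iter k sg y); first exact: iterO.
by elim: k => //= k ->; rewrite rmorphM rmorphXn /= sgt.
Qed.

Lemma iter_sgD k x y : iter k sg (x + y) = iter k sg x + iter k sg y.
Proof. by elim: k => //= k ->; rewrite rmorphD. Qed.
Lemma iter_sg_mul k x y : iter k sg (x * y) = iter k sg x * iter k sg y.
Proof. by elim: k => //= k ->; rewrite rmorphM. Qed.
Lemma iter_sgX k x n : iter k sg (x ^+ n) = iter k sg x ^+ n.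
Proof. by elim: k => //= k ->; rewrite rmorphXn. Qed.
Lemma iter_sg_sub k x y : iter k sg (x - y) = iter k sg x - iter k sg y.
Proof. by elim: k => //= k ->; rewrite rmorphB. Qed.

(* An automorphism that is trivial modulo t is trivial, because O is generated
   modulo t by p-th powers. *)
Lemma inertia_trivial k : (forall x, O x -> I 1%N (iter k sg x - x)) ->
  forall x, O x -> iter k sg x = x.
Proof.
move=> triv x Ox; apply/eqP; rewrite -subr_eq0; apply/eqP; apply: I_sep => d.
apply: (filS fI); elim: d x Ox => [|d IH] x Ox; first exact: triv.
have [y Oy [z Oz Ez]] := residue_perfect Ox.
have -> : x = y ^+ p + t * z by rewrite expr1 in Ez; rewrite -Ez addrC subrK.
rewrite iter_sgD iter_sgX iter_sg_mul (_ : iter k sg t = t); last by elim: (k) => //= l ->.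
rewrite opprD addrACA -mulrBr; apply: (filD fI).
  apply: (fil_expq fI) => //; [apply/I0P|apply/I0P|apply: IH] => //.
  exact: iterO.
rewrite -add1n; apply: (filM fI); last exact: IH.
by exists 1; rewrite ?mulr1.
Qed.

Lemma residue_separated i j : (i < j < Q)%N ->
  exists2 x, O x & ~ I 1%N (iter i sg x - iter j sg x).
Proof.
move=> /andP[ij jQ]; apply: contrapT => H.
have Hx x : O x -> I 1%N (iter i sg x - iter j sg x).
  by move=> Ox; apply: contrapT => nI; apply: H; exists x.
have [|x Ox] := @sg_faithful (j - i).
  by rewrite subn_gt0 ij (leq_ltn_trans (leq_subr _ _)).
apply; apply: inertia_trivial => // y Oy.
have := iterI (Q - i) (Hx y Oy); rewrite iter_sg_sub -!iterD subnK; last by rewrite ltnW // (ltn_trans ij).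
have -> : (Q - i + j = (j - i) + Q)%N.
  by rewrite addnC addnBA ?(ltnW (ltn_trans ij jQ)) // addnBAC ?(ltnW ij).
by rewrite iterD !sgQ // => /(fil_sym fI).
Qed.

(** Dedekind's independence of characters modulo [t]: the relation at [x * y] minus [iter n sg y]
    times the relation at [x] has one term fewer, and [y] is chosen so that the surviving factor is
    a unit. *)
Lemma residue_independence n (a : nat -> C) : (n <= Q)%N -> (forall i, O (a i)) ->
    (forall x, O x -> I 1%N (\sum_(i < n) a i * iter i sg x)) ->
  forall i, (i < n)%N -> I 1%N (a i).
Proof.
elim: n a => // n IH a nQ Oa H.
have low i : (i < n)%N -> I 1%N (a i).
  move=> lt; have [|y Oy nI] := @residue_separated i n; first by rewrite lt.
  have Od : O (iter i sg y - iter n sg y) by apply: OB; apply: iterO.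
  suff Ha : I 1%N (a i * (iter i sg y - iter n sg y)).
    by have [] := residue_prime (Oa i) Od Ha.
  apply: (IH (fun i => a i * (iter i sg y - iter n sg y))) => //; first exact: ltnW.
    by move=> k; apply: OM => //; apply: OB; apply: iterO.
  move=> x Ox; have H1 := H _ (OM Ox Oy).
  have H2 := filMr fI (H _ Ox) (proj2 (I0P _) (iterO n Oy)).
  have := filB fI H1 H2; congr (I _ _).
  rewrite !big_ord_recr /= mulrDl iter_sg_mul mulr_suml -!mulrA opprD addrACA subrr addr0.
  rewrite -sumrB; apply: eq_bigr => k _; rewrite iter_sg_mul; ring.
move=> i; rewrite ltnS leq_eqVlt => /orP[/eqP->|]; last exact: low.
have := H 1 O1; rewrite big_ord_recr /= => Hs.
have i1 k : iter k sg 1 = 1 by elim: k => //= k ->; rewrite rmorph1.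
rewrite i1 mulr1 in Hs.
rewrite -[a n](addKr (\sum_(k < n) a k * iter k sg 1)) addrC; apply: (filB fI) => //.
apply: (fil_sum fI) => k _; rewrite i1 mulr1; exact: low.
Qed.

(** By independence some trace is nonzero modulo [t], hence a unit. It is fixed by [sg], and so is
    its inverse, by which the element can be divided. *)
Lemma exists_trace_one : exists2 c, O c & \sum_(i < Q) iter i sg c = 1.
Proof.
have [x Ox nIx] : exists2 x, O x & ~ I 1%N (\sum_(i < Q) iter i sg x).
  apply: contrapT => H; apply: I1.
  apply: (@residue_independence Q (fun=> 1) (leqnn Q) _ _ 0%N) => // x Ox.
  under eq_bigr do rewrite mul1r.
  by apply: contrapT => nI; apply: H; exists x.
set T := \sum_(i < Q) iter i sg x in nIx.
have OT : O T by apply/I0P; apply: (fil_sum fI) => i _; apply/I0P/iterO.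
have sgT : sg T = T.
  rewrite /T rmorph_sum /=; have := sgQ Ox; case: (Q) Q0 => // q' _ E.
  rewrite big_ord_recr [RHS]big_ord_recl [RHS]addrC /=; congr (_ + _).
  by rewrite -iterS E.
have [//|[y Oy Ty]] := O_dich OT.
have sgy : sg y = y.
  by rewrite -[LHS]mul1r -Ty mulrAC -{1}sgT -rmorphM /= Ty rmorph1 mul1r.
exists (x * y); first exact: OM.
have fy k : iter k sg y = y by elim: k => //= k ->.
by under eq_bigr do rewrite iter_sg_mul fy; rewrite -mulr_suml.
Qed.

End TraceOne.

(** * Residue fields *)

Section Residue.
Variables (p : nat) (p_pr : prime p) (Omega : fieldExtType (padic p_pr)).
Local Notation O := (@padic_int_in p p_pr Omega).
Implicit Types E : {subfield Omega}.

Local Notation W := (pOE (Omega := Omega) 1%AS).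
Local Notation V1 := (OmegaOver (Omega := Omega) 1%AS).

Lemma valOE_B E (a b : OE E) : val (a - b) = val a - val b. Proof. by []. Qed.

Lemma integer_of_val1 E (a : OE (Omega := Omega) 1%AS) : integer_of E (val a).
Proof. by have [a1 ai] := val_OEP a; split=> //; apply: (subvP (sub1v E)). Qed.

Lemma padic_residue (a : OE (Omega := Omega) 1%AS) : exists (i : 'I_p) b, a - i%:R = W * b.
Proof.
have [al Eal] := padic_subfield_integer (val_OEP a).
have lt : (al 1%N < p)%N.
  by rewrite -(padic_res_modn al 1) expn1 ltn_mod prime_gt0.
have [|be Ebe] := @padic_divp _ p_pr (al - (al 1%N)%:R).
  by apply: padic_sub_res; rewrite padic_natE expn1 modn_small.
have ib : integer_of 1%AS (O be).
  by split; [rewrite /padic_int_in rpredZ // mem1v|apply: integer_j].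
exists (Ordinal lt), (toOE ib); apply: OE_eq.
rewrite valOE_M val_pOE toOEK valOE_B valOE_nat Eal.
have -> : O al - (al 1%N)%:R = O (al - (al 1%N)%:R) by rewrite rmorphB rmorph_nat.
by rewrite Ebe rmorphM rmorph_nat.
Qed.

Lemma padic_residue_inj i j (b : OE (Omega := Omega) 1%AS) : (i < p)%N -> (j < p)%N ->
  i%:R - j%:R = W * b -> i = j.
Proof.
move=> ip jp /(congr1 val); rewrite valOE_M val_pOE valOE_B !valOE_nat => E.
have [be Eb] := padic_subfield_integer (val_OEP b).
have {}E : (i%:R : padic_int p_pr) = j%:R + p%:R * be.
  apply: (@padic_int_in_inj p p_pr Omega).
  rewrite rmorphD rmorphM !rmorph_nat /= -Eb -E.
  by rewrite addrC subrK.
have := congr1 (fun a : padic_int p_pr => a 1%N) E.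
rewrite padic_addE padic_mulE !padic_natE expn1 modnn mul0n mod0n addn0 modn_mod.
by rewrite !modn_small.
Qed.

Lemma uniformizer_submod E t : is_uniformizer E t ->
  submod (V := V1) (maxideal_of E).
Proof.
move=> ut; split.
  by apply/ut; exists 0; [apply: integer_of0|rewrite mulr0].
move=> a x y /ut[x' ix ->] /ut[y' iy ->]; apply/ut.
exists (val a * x' + y'); last by rewrite OmegaOver_scaleE mulrDr mulrCA.
apply: integer_ofD => //; apply: integer_ofM => //.
exact: integer_of_val1.
Qed.

Lemma one_not_maxideal E : ~ maxideal_of E 1.
Proof.
move=> [_ [_ nu]]; apply: nu; split; first exact: integer_one.
by exists 1; rewrite ?mulr1 //; apply: integer_one.
Qed.

(** The count of classes over [Z_p], applied to the integers of [E] modulo the maximal ideal. The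
    exponent is positive because [0] and [1] are not congruent. *)
Lemma residue_card_power E q : residue_card E q -> exists2 k, q = (p ^ k)%N & (0 < k)%N.
Proof.
move=> [r [ri rP]]; have [t ut] := exists_uniformizer E.
have sm := uniformizer_submod ut.
have [i0 [Hi0 _]] := rP 0 (integer_of0 E).
pose z k : V1 := if insub k is Some i then r i else 0.
have zE (i : 'I_q) : z i = r i by rewrite /z valK.
have [k [y [Eq _ _ _]]] : exists k (y : nat -> V1),
    [/\ q = (p ^ k)%N, forall i, (i < k)%N -> integer_of E (y i),
      pi_indep (V := V1) W (maxideal_of E) k y &
      forall x, integer_of E x -> exists a : nat -> OE (Omega := Omega) 1%AS,
        maxideal_of E (x - \sum_(i < k) a i *: y i)].
  apply: (class_count (@padic_OE_cdvr p p_pr Omega) (rho := fun i => i%:R) (z := z)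
    _ sm _ (prime_gt1 p_pr)).
  - split; first exact: integer_of0.
    move=> a x y ix iy; rewrite OmegaOver_scaleE; apply: integer_ofD => //.
    by apply: integer_ofM => //; exact: integer_of_val1.
  - move=> y iy; rewrite OmegaOver_scaleE val_pOE.
    by apply: maxideal_ofM => //; apply: p_maxideal_of.
  - by move=> a; have [i [b Eb]] := padic_residue a; exists i, b.
  - by move=> i j b; apply: padic_residue_inj.
  - by move=> i lt; rewrite (zE (Ordinal lt)).
  - move=> x /rP[i [Hi _]]; exists i => //; rewrite zE //.
  move=> i j li lj; rewrite (zE (Ordinal li)) (zE (Ordinal lj)) => H.
  have [k [_ ku]] := rP _ (ri (Ordinal li)).
  have E1 := ku _ H; have /ku E2 : maxideal_of E (r (Ordinal li) - r (Ordinal li)).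
    by rewrite subrr; have [] := sm.
  by have := congr1 val (etrans (esym E1) E2).
exists k => //; case: k Eq {y} => // Eq.
have [i1 [Hi1 _]] := rP 1 (integer_of1 E).
have q1 : q = 1%N by rewrite Eq.
have z0 (l : 'I_q) : val l = 0%N.
  have : (l < 1)%N by rewrite -q1.
  by rewrite ltnS leqn0 => /eqP.
have Ei : i0 = i1 by apply: val_inj; rewrite !z0.
case: (@one_not_maxideal E); rewrite Ei in Hi0.
by have := submodB sm Hi1 Hi0; rewrite opprB addrA subrK subr0.
Qed.

(** Finiteness of the residue field without a count: the code reduces modulo [p] the coordinates on
    an integral basis over [Z_p]. *)
Lemma residue_code E t : is_uniformizer E t -> exists N (code : Omega -> 'I_N),
  forall x y, integer_of E x -> integer_of E y -> code x = code y -> maxideal_of E (x - y).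
Proof.
move=> ut; have [e [ei eg _ _]] := lattice_basis (@padic_OE_cdvr p p_pr Omega) (sub1v E).
set n := (\dim_ _ _)%N in ei eg.
have /choice[c cP] : forall x, exists a : nat -> OE (Omega := Omega) 1%AS,
    integer_of E x -> x = \sum_(i < n) val (a i) * e i.
  move=> x; case: (pselect (integer_of E x)) => [/eg[a Ea]|nx]; first by exists a.
  by exists (fun=> 0).
have /choice[rs rsP] := padic_residue.
pose T := {ffun 'I_n -> 'I_p}; pose code x : T := [ffun i => rs (c x (val i))].
exists #|T|, (fun x => enum_rank (code x)) => x y ix iy /enum_rank_inj /ffunP Ec.
have -> : x - y = \sum_(i < n) (val (c x i) - val (c y i)) * e i.
  by rewrite {1}(cP x ix) {1}(cP y iy) -sumrB; apply: eq_bigr => i _; rewrite mulrBl.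
have sm := uniformizer_submod ut.
elim/big_ind: _ => [|a b|i _]; [by have [] := sm|exact: (submodD sm)|].
have [b1 E1] := rsP (c x i); have [b2 E2] := rsP (c y i).
have := Ec i; rewrite !ffunE => Ei; rewrite Ei in E1.
have -> : val (c x i) - val (c y i) = p%:R * val (b1 - b2).
  have EE : c x i - c y i = W * (b1 - b2).
    by rewrite mulrBr -E1 -E2 opprB addrA subrK.
  by rewrite -valOE_B EE valOE_M val_pOE.
rewrite -mulrA; apply: maxideal_ofM; first exact: p_maxideal_of.
by apply: integer_ofM (ei _ (ltn_ord i)); apply: integer_of_val1.
Qed.

End Residue.

(** * Evaluation on the maximal ideal *)

Lemma mulr_insert_inverse (C : comNzRingType) (x y z b b' : C) : b * b' = 1 ->
  x * (y * z) = x * b * (y * (b' * z)).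
Proof. by move=> bb; rewrite -[z in LHS]mul1r -bb; ring. Qed.

Section Adic.
Variables (p : nat) (p_pr : prime p) (Omega : fieldExtType (padic p_pr)).
Local Notation O := (@padic_int_in p p_pr Omega).
Variables (E : {subfield Omega}) (t : Omega).
Hypothesis ut : is_uniformizer E t.
Local Notation I := (ideal_power (integer_of E) t).

Lemma adic_I0 x : I 0%N x <-> integer_of E x.
Proof. by split=> [[y iy ->]|ix]; [rewrite mul1r|exists x; rewrite ?mul1r]. Qed.

Lemma adic_I1 x : I 1%N x <-> maxideal_of E x.
Proof.
split=> [[y iy ->]|/ut[y iy ->]]; last by exists y; rewrite ?expr1.
by rewrite expr1; apply/ut; exists y.
Qed.

Lemma adic_filtration : filtration I.
Proof.
apply: ideal_power_filtration.
- exact: maxideal_of_int (uniformizer_max ut).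
- exact: integer_of1.
- exact: integer_ofB.
exact: integer_ofM.
Qed.
Let fI := adic_filtration.

Lemma adic_padic N x : I (\dim {:Omega} * N)%N x -> exists2 z, integer O z & x = p%:R ^+ N * z.
Proof.
move=> [y [_ iy] ->]; have [_ mt] := uniformizer_max ut.
have [z iz Ez] := omega_maxideal_power mt.
exists (z ^+ N * y); last by rewrite exprM Ez exprMn mulrA.
by apply: integer_mul => //; apply: integer_exp.
Qed.

Lemma adic_sep x : (forall d, I d x) -> x = 0.
Proof. by move=> H; apply: omega_sep => N; apply: adic_padic. Qed.

Lemma adic_complete (S : nat -> Omega) : (forall d, I d (S d.+1 - S d)) ->
  exists l, forall d, I d (l - S d).
Proof.
move=> HS; have it := maxideal_of_int (uniformizer_max ut).
have cd : cdvr (toOE it) by apply: uniformizer_cdvr; rewrite toOEK.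
have /choice[a Ha] : forall d, exists a : OE E, S d.+1 - S d = t ^+ d * val a.
  by move=> d; have [y iy Ey] := HS d; exists (toOE iy); rewrite toOEK.
have [l Hl] := cdvr_lim cd a; exists (S 0%N + val l) => d.
have [b Eb] := Hl d; exists (val b); first exact: val_OEP.
have SE : S d = S 0%N + \sum_(i < d) val (a i) * t ^+ i.
  elim: d {b Eb} => [|d IH]; first by rewrite big_ord0 addr0.
  by rewrite big_ord_recr /= addrA -IH [X in _ + X]mulrC -Ha addrC subrK.
have -> : val l = \sum_(i < d) val (a i) * t ^+ i + t ^+ d * val b.
  rewrite Eb valOE_D valOE_M valOE_X toOEK valOE_sum; congr (_ + _).
  by apply: eq_bigr => i _; rewrite valOE_M valOE_X toOEK.
by rewrite SE addrA [_ + t ^+ d * _]addrC addrK.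
Qed.

Lemma adic_lim (S : nat -> Omega) l : (forall d, I d (l - S d)) -> padic_lim O S = l.
Proof.
move=> H; apply: padic_lim_eq; [exact: padic_int_in_inj|exact: omega_algebraic|].
move=> N; exists (\dim {:Omega} * N)%N => k kN; apply: adic_padic.
exact: (fil_le fI kN (fil_sym fI (H k))).
Qed.

Lemma adic_total x y : I 1%N x -> I 1%N y ->
  (exists2 c, I 0%N c & y = c * x) \/ (exists2 c, I 0%N c & x = c * y).
Proof.
move=> /adic_I1[xE _] /adic_I1[yE _].
have [x0|x0] := eqVneq x 0.
  by right; exists 0; [apply: (fil0 fI)|rewrite x0 mul0r].
have [y0|y0] := eqVneq y 0.
  by left; exists 0; [apply: (fil0 fI)|rewrite y0 mul0r].
have [iy|ix] := omega_total (y / x).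
  left; exists (y / x); last by rewrite mulfVK.
  by apply/adic_I0; split=> //; apply: rpred_div.
right; exists (x / y); last by rewrite mulfVK.
by apply/adic_I0; split; [apply: rpred_div|rewrite -invf_div].
Qed.

(** [e] is the exponent of [t] in [c]; for [c = pi] it is the ramification index. *)
Lemma adic_ramification c : integer_of E c -> c != 0 ->
  exists2 e, maxideal_of E c -> (0 < e)%N &
    forall d x, I (e + d)%N x <-> exists2 y, I d y & x = c * y.
Proof.
move=> ic c0; have it := maxideal_of_int (uniformizer_max ut).
have cd : cdvr (toOE it) by apply: uniformizer_cdvr; rewrite toOEK.
have cn0 : toOE ic <> 0.
  by move=> /(congr1 val); rewrite toOEK => E0; rewrite E0 eqxx in c0.
have [e [b [b' [Eb bb']]]] := cdvr_factor cd cn0.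
have Ec : c = t ^+ e * val b by rewrite -(toOEK ic) Eb valOE_M valOE_X toOEK.
have bbv : val b * val b' = 1 by rewrite -valOE_M bb'.
have [ib ib'] := (val_OEP b, val_OEP b').
move: (val b) (val b') Ec bbv ib ib' => {b b' Eb bb'} b b' Ec bb' ib ib'.
exists e => [[_ [ci nu]]|d x].
  case: e Ec => // Ec; rewrite mul1r in Ec.
  by case: nu; split=> //; exists b'; [have [] := ib'|rewrite Ec].
split=> [[y iy ->]|[y [z iz ->] ->]].
  exists (t ^+ d * (b' * y)); first by exists (b' * y) => //; apply: integer_ofM.
  by rewrite Ec exprD -[t ^+ e * t ^+ d * y]mulrA; apply: mulr_insert_inverse.
exists (b * z); first exact: integer_ofM.
by rewrite Ec exprD -!mulrA; congr (_ * _); rewrite mulrCA.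
Qed.

Variables (F : mfps 2 Omega).
Hypothesis FO : forall m, integer_of E (F m).

(** The value is by definition a [p]-adic limit if one exists. The truncations form a [t]-adic
    Cauchy sequence, whose limit is that value, with the error bound needed by [formal_module]. *)
Lemma mfps_eval_approx d x y : I 1%N x -> I 1%N y ->
  I d (mfps_eval O F [tuple x; y] - mmap (@idfun Omega) (vec2 x y) (mfps_trunc d F)).
Proof.
move=> Ix Iy; pose S d := mmap (@idfun Omega) (vec2 x y) (mfps_trunc d F).
have HS k : I k (S k.+1 - S k).
  rewrite /S -mmapB; apply: (mmap_high fI) => [m|m lt|]; last exact: vec2_all.
    rewrite mcoeffB; apply: (filB fI); rewrite mcoeff_mfps_trunc; case: ifP => _ //=;
    by [apply/adic_I0/FO|apply: (fil0 fI)].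
  by rewrite mcoeffB !mcoeff_mfps_trunc lt leqW // subrr.
have [l Hl] := adic_complete HS.
suff -> : mfps_eval O F [tuple x; y] = l by apply: Hl.
rewrite /mfps_eval -(adic_lim Hl); congr padic_lim; apply/funext => k.
by rewrite /meval tnth_pair.
Qed.

Lemma fps_eval_approx (g : fps Omega) d x : (forall i, integer_of E (g i)) -> I 1%N x ->
  I d (fps_eval O g x - (fps_trunc d g).[x]).
Proof.
move=> gO Ix; pose S d := (fps_trunc d g).[x].
have SE k : S k = pev (@idfun Omega) (fps_trunc k g) x by rewrite /pev map_poly_id.
have HS k : I k (S k.+1 - S k).
  rewrite !SE -pevB; apply: (pev_high fI) => // i.
    rewrite coefB; apply: (filB fI); rewrite coef_fps_trunc; case: ifP => _ //=;
    by [apply/adic_I0/gO|apply: (fil0 fI)].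
  by move=> lt; rewrite coefB !coef_fps_trunc lt leqW // subrr.
have [l Hl] := adic_complete HS.
suff -> : fps_eval O g x = l by apply: Hl.
exact: adic_lim.
Qed.

End Adic.

Section UniformizerUnramified.
Variables (p : nat) (p_pr : prime p) (Omega : fieldExtType (padic p_pr)).
Variables (E E' : {subfield Omega}) (t : Omega).

Lemma uniformizer_unram : unramified E E' -> (E <= E')%VS ->
  is_uniformizer E t -> is_uniformizer E' t.
Proof.
move=> un sE ut x; split=> [/un[y [z [/ut[y' iy' ->] iz ->]]]|[y iy ->]].
  exists (y' * z); rewrite ?mulrA //; apply: integer_ofM iz.
  exact: integer_ofS iy'.
by apply/un; exists t, y; split=> //; apply: uniformizer_max.
Qed.

End UniformizerUnramified.

(** * Integrality for the given Honda formal group *)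

Section Concrete.
Variables (p : nat) (p_pr : prime p) (Omega : splittingFieldType (padic p_pr)).
Local Notation O := (@padic_int_in p p_pr Omega).
Variables (K0 K : {subfield Omega}) (pi : Omega) (q : nat) (phi : gal_of K).
Variables (F : mfps 2 Omega) (f u : fps Omega) (h : nat).
Hypotheses (sK0K : (K0 <= K)%VS) (pi_unif : is_uniformizer K0 pi).
Hypotheses (K_unram : unramified K0 K) (k0_card : residue_card K0 q).
Hypotheses (phi_frob : is_frobenius K0 q phi) (u_type : is_honda_type K pi u).
Hypotheses (u_height : type_height K u h) (F_honda : is_honda_group pi q phi u F f).

Let piK0 : pi \in K0. Proof. by have [] := uniformizer_max pi_unif. Qed.
Let pi_int : integer_of K0 pi. Proof. exact: maxideal_of_int (uniformizer_max pi_unif). Qed.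

Lemma pi_unifK : is_uniformizer K pi.
Proof. exact: uniformizer_unram K_unram sK0K pi_unif. Qed.

Lemma phi_integer x : integer O x -> integer O (phi x).
Proof.
move=> [P mP rP]; exists P => //.
have EO : map_poly O P = map_poly phi (map_poly O P).
  apply/polyP => i; rewrite !coef_map /= /padic_int_in linearZ /= rmorph1 //.
by rewrite EO fmorph_root.
Qed.

Let q1 : (1 < q)%N.
Proof.
have [k -> k0] := residue_card_power k0_card.
by rewrite -(expn0 p) ltn_exp2l // prime_gt1.
Qed.

Lemma honda_data : exists e, [/\ q = (p ^ e)%N, (1 < q)%N,
  ideal_power (integer_of K) pi 1 p%:R,
  (forall x, integer_of K x -> ideal_power (integer_of K) pi 1 (phi x - x ^+ q)) &
  [/\ (forall x, integer_of K x -> integer_of K (phi x)), phi pi = pi,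
   forall d, ideal_power (integer_of K) pi 1 (honda_act q phi u f d) &
   forall i, (0 < i < h)%N -> ideal_power (integer_of K) pi 1 (u i)]].
Proof.
have [e qE _] := residue_card_power k0_card; exists e.
have I1 := adic_I1 pi_unifK; have [phiG frob] := phi_frob.
split=> //; [by apply/I1/p_maxideal_of|by move=> x /frob /I1|split].
- by move=> x [xK ix]; split; [apply: memv_gal|apply: phi_integer].
- exact: fixed_gal sK0K phiG piK0.
- by have [_ _ _ _ H] := F_honda; move=> d; have [y iy ->] := H d; exists y; rewrite ?expr1.
move=> i ih; have [_ _ nu] := u_height; have [_ uO] := u_type.
have /andP[i0 _] := ih; have [/I1 //|[y iy Ey]] := integer_of_dich (uO i i0).
case: (nu i ih); have [uK ui] := uO i i0; split=> //; split=> //.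
by exists y => //; have [] := iy.
Qed.

Lemma fg_mul_integer a d : integer_of K0 a -> integer_of K (fg_mul f a d).
Proof.
move=> ia; have [e [qE q1' Ip fr [phiO phipi hon _]]] := honda_data.
have [[f0 f1 _] [u0 uO]] := (let: And5 _ _ x _ _ := F_honda in x, u_type).
have [phiG _] := phi_frob.
have pi0 := uniformizer_neq0 pi_unif.
apply: (honda_integral (integer_of1 K) (@integer_ofB _ _ _ K) (@integer_ofM _ _ _ K)
  (integer_ofS sK0K pi_int) pi0 phipi phiO p_pr qE q1' Ip fr f0 f1 u0 uO hon).
  exact: integer_ofS ia.
by have [aK _] := ia; apply: fixed_gal sK0K phiG aK.
Qed.

Lemma fg_mul_pi : (forall d, (d < q ^ h)%N -> maxideal_of K (fg_mul f pi d)) /\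
  exists2 b, integer_of K b & fg_mul f pi (q ^ h)%N * b = 1.
Proof.
have [e [qE q1' Ip fr [phiO phipi hon ul]]] := honda_data.
have [[f0 f1 _] [u0 uO]] := (let: And5 _ _ x _ _ := F_honda in x, u_type).
have pi0 := uniformizer_neq0 pi_unif; have [h0 uh _] := u_height.
have iK := integer_ofS sK0K pi_int.
have I1 := adic_I1 pi_unifK; split=> [d dl|].
  apply/I1; exact: (honda_mul_low (integer_of1 K) (@integer_ofB _ _ _ K) (@integer_ofM _ _ _ K)
    iK pi0 phipi phiO q1' f0 f1 u0 hon ul dl).
have [z iz Ez] := honda_mul_height (integer_of1 K) (@integer_ofB _ _ _ K) (@integer_ofM _ _ _ K)
    iK pi0 phipi phiO q1' f0 f1 u0 uO hon h0 ul.
have ic := fg_mul_integer (q ^ h)%N pi_int.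
(* If this coefficient were in the maximal ideal, so would be [u h], which is a unit by definition
   of the height. *)
have [mx|//] := integer_of_dich ic; case: (@one_not_maxideal _ _ _ K).
have [uK uu] := uh; have [y iy uy] := unit_integer_of uK uu.
have /pi_unifK[c ic' Ec] := mx.
apply/pi_unifK; exists ((z - c) * y).
  by apply: integer_ofM iy; apply: integer_ofB.
have -> : 1 = u h * y by rewrite uy.
by rewrite mulrA mulrBr -Ec Ez opprD opprK addrA [pi * z + u h]addrC addrK.
Qed.

Section Module.
Variables (M : {subfield Omega}) (sKM : (K <= M)%VS) (t : Omega).
Hypothesis ut : is_uniformizer M t.
Variables (R : comNzRingType) (v : {rmorphism R -> Omega}).
Hypothesis vO : forall a, integer_of K0 (v a).
Local Notation I := (ideal_power (integer_of M) t).

Lemma honda_formal_module :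
  formal_module v I F f (fg_add F) (fg_act f).
Proof.
have [Fg FO Fl _ _] := F_honda.
have FM' m : integer_of M (F m) by apply: integer_ofS (FO m).
split=> //; [exact: adic_filtration|exact: adic_sep|exact: adic_complete|exact: adic_total
  | | | |].
- by move=> m; apply/adic_I0.
- by move=> a d; apply/adic_I0; apply: (integer_ofS sKM); apply: fg_mul_integer; apply: vO.
- by move=> d x y; apply: mfps_eval_approx.
move=> d a x Ix; apply: fps_eval_approx => // i.
by apply: (integer_ofS sKM); apply: fg_mul_integer; apply: vO.
Qed.

Lemma pi_ramification : exists2 e, (0 < e)%N & forall d x,
  I (e + d)%N x <-> exists2 y, I d y & x = pi * y.
Proof.
have ipi : integer_of M pi by apply: integer_ofS pi_int; apply: subv_trans sKM.
have [e e0 H] := adic_ramification ut ipi (uniformizer_neq0 pi_unif).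
exists e => //; apply: e0; have [_ [_ nu]] := uniformizer_max pi_unif.
by have [piM ii] := ipi; split.
Qed.

End Module.
End Concrete.

(** * The Galois action on the integers of [M] *)

Section GaloisData.
Variables (p : nat) (p_pr : prime p) (Omega : splittingFieldType (padic p_pr)).
Local Notation O := (@padic_int_in p p_pr Omega).
Variables (L M : {subfield Omega}) (m : nat) (sigma : gal_of M) (t : Omega).
Hypotheses (sLM : (L <= M)%VS) (M_galois : galois L M).
Hypotheses (G_order : #|'Gal(M / L)%g| = (p ^ m)%N) (G_gen : 'Gal(M / L)%g = <[sigma]>%g).
Hypotheses (utL : is_uniformizer L t) (utM : is_uniformizer M t).
Local Notation I := (ideal_power (integer_of M) t).

Lemma gal_integer (g : gal_of M) x : integer_of M x -> integer_of M (g x).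
Proof.
move=> [xM [P mP rP]]; split; first exact: memv_gal.
exists P => //.
have EO : map_poly O P = map_poly g (map_poly O P).
  by apply/polyP => i; rewrite !coef_map /= /padic_int_in linearZ /= rmorph1.
by rewrite EO fmorph_root.
Qed.

Lemma sigma_gal : sigma \in 'Gal(M / L)%g. Proof. by rewrite G_gen cycle_id. Qed.

Lemma sigma_fix x : x \in L -> sigma x = x.
Proof. exact: fixed_gal sLM sigma_gal. Qed.

Lemma sigma_I d x : I d x -> I d (sigma x).
Proof.
move=> [y iy ->]; exists (sigma y); first exact: gal_integer.
by rewrite rmorphM rmorphXn /= (sigma_fix (proj1 (uniformizer_max utL))).
Qed.

Lemma iter_sigma k x : x \in M -> iter k sigma x = (sigma ^+ k)%g x.
Proof.
move=> xM; elim: k => [|k IH]; first by rewrite expg0 gal_id.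
by rewrite expgSr galM //= IH.
Qed.

Lemma sigma_order : #[sigma]%g = (p ^ m)%N.
Proof. by rewrite -G_order G_gen. Qed.

Lemma iter_sigma_order x : x \in M -> iter (p ^ m) sigma x = x.
Proof. by move=> xM; rewrite iter_sigma // -sigma_order expg_order gal_id. Qed.

Lemma sigma_fixed x : x \in M -> sigma x = x -> x \in L.
Proof.
move=> xM sx; have /galois_fixedField EL := M_galois; rewrite -EL.
apply/fixedFieldP => // g.
rewrite G_gen => /cycleP[k ->]; rewrite -iter_sigma //.
by elim: k => //= k ->.
Qed.

Lemma sigma_trace_one : exists2 c, I 0%N c & \sum_(i < p ^ m) iter i sigma c = 1.
Proof.
have [N [code codeP]] := residue_code utM.
suff [c ic Ec] : exists2 c, integer_of M c & \sum_(i < p ^ m) iter i sigma c = 1.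
  by exists c => //; apply/adic_I0.
have I1 := adic_I1 utM.
apply: (@exists_trace_one _ (integer_of M) t sigma p (p ^ m) N code).
- exact: integer_of1.
- exact: integer_ofB.
- exact: integer_ofM.
- exact: maxideal_of_int (uniformizer_max utM).
- exact: adic_sep.
- by move=> x ix; have [mx|ux] := integer_of_dich ix; [left; apply/I1|right].
- by move=> /I1; apply: one_not_maxideal.
- exact: p_pr.
- by apply/I1/p_maxideal_of.
- exact: gal_integer.
- exact: (sigma_fix (proj1 (uniformizer_max utL))).
- by move=> x y ix iy /codeP H; apply/I1/H.
- by rewrite expn_gt0 prime_gt0.
- by move=> x [xM _]; apply: iter_sigma_order.
(* A power of [sigma] fixing all integers fixes every element of [M] after clearing denominators, so
   it is trivial, against the order of [sigma]. *)
move=> k /andP[k0 kQ]; apply: contrapT => H.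
have : (sigma ^+ k)%g = 1%g.
  apply/eqP/gal_eqP => x xM; rewrite gal_id -iter_sigma //.
  have [d id'] := omega_denominator x; apply: contrapT => nx; apply: H.
  have pM : p%:R ^+ d \in M by rewrite rpredX // rpred_nat.
  exists (p%:R ^+ d * x); first by split=> //; rewrite rpredM.
  have fp : iter k sigma (p%:R ^+ d * x) = p%:R ^+ d * iter k sigma x.
    by elim: (k) => //= l ->; rewrite rmorphM rmorphXn rmorph_nat.
  by rewrite fp => /(mulfI (expf_neq0 d (@omega_p_neq0 _ p_pr Omega))).
move=> /eqP; rewrite -order_dvdn sigma_order => /(dvdn_leq k0).
by rewrite leqNgt kQ.
Qed.

End GaloisData.

(** * Distinguished polynomials and evaluation *)

Section WeierstrassSeries.
Variables (R : comNzRingType) (w : R) (cd : cdvr w) (g : nat -> R) (N : nat).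
Hypothesis g_low : forall i, (i < N)%N -> exists b, g i = w * b.
Hypothesis g_unit : exists v, g N * v = 1.
Let fX := @poly_filtration R.

Lemma Xadic_cauchy e (a b c : fps R) :
    (forall d, (d < e)%N -> a d = \sum_(i < d.+1) b i * c (d - i)%N) ->
  Xadic e (fps_trunc e a - fps_trunc e b * fps_trunc e c).
Proof.
move=> H d lt; rewrite coefB coefM coef_fps_trunc lt H // -sumrB big1 // => i _.
have id : (i <= d)%N by rewrite -ltnS.
by rewrite !coef_fps_trunc (leq_ltn_trans id lt) (leq_ltn_trans (leq_subr i d) lt) subrr.
Qed.

(** [Q] is the unit series with [D = Q g], and [Q'] its inverse, obtained from [triangular_solve]
    with [N = 0]. Both products are stated modulo powers of [X], ready for evaluation at points. *)
Lemma weierstrass_series : exists D : {poly R}, exists Q Q' : fps R,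
  [/\ D \is monic, size D = N.+1, forall i, (i < N)%N -> exists b, D`_i = w * b,
      forall e, (N < e)%N -> Xadic e (D - fps_trunc e Q * fps_trunc e g) &
      forall e, (N < e)%N -> Xadic e (fps_trunc e g - fps_trunc e Q' * D)].
Proof.
have [Q [D [Dm Ds Dl DQ Q0]]] := weierstrass_preparation cd g_low g_unit.
have [Q' HQ'] := triangular_solve (g := Q) (N := 0%N) Q0 (fun i => (i == 0)%N%:R).
exists D, Q, Q'.
have DT e : (N < e)%N -> fps_trunc e (fun i => D`_i) = D.
  move=> Ne; apply/polyP => i; rewrite coef_fps_trunc; case: ifP => // /negbT.
  by rewrite -leqNgt => ei; rewrite nth_default // Ds (leq_trans Ne).
have H1 e : (N < e)%N -> Xadic e (D - fps_trunc e Q * fps_trunc e g).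
  by move=> Ne; rewrite -{1}(DT e Ne); apply: Xadic_cauchy.
have H2 e : Xadic e (1 - fps_trunc e Q' * fps_trunc e Q).
  have := @Xadic_cauchy e (fun i => (i == 0)%N%:R) Q' Q (fun d _ => esym (HQ' d)).
  move=> H d lt; have := H d lt; rewrite !coefB coef_fps_trunc lt coef1; exact.
split=> // e Ne.
have -> : fps_trunc e g - fps_trunc e Q' * D =
    (1 - fps_trunc e Q' * fps_trunc e Q) * fps_trunc e g
    - fps_trunc e Q' * (D - fps_trunc e Q * fps_trunc e g) by ring.
apply: (filB fX); first by apply: (filMr fX).
by apply: (filMl fX) => //; apply: H1.
Qed.

Lemma pevM (S : comNzRingType) (c : {rmorphism R -> S}) P Q x :
  pev c (P * Q) x = pev c P x * pev c Q x.
Proof. by rewrite /pev rmorphM hornerM. Qed.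

Lemma Xadic_eval (S : comNzRingType) (I : nat -> S -> Prop) (c : {rmorphism R -> S})
    e (P : {poly R}) x : filtration I -> (forall a, I 0%N (c a)) -> Xadic e P ->
  I 1%N x -> I e (pev c P x).
Proof. by move=> fI Ic XP Ix; apply: (pev_high fI). Qed.

End WeierstrassSeries.

(** * Two bounds on the ramification index *)

Section Ramification.
Variables (C : fieldType) (O : C -> Prop) (t : C).
Hypotheses (O1 : O 1) (OB : forall x y, O x -> O y -> O (x - y)).
Hypotheses (OM : forall x y, O x -> O y -> O (x * y)) (Ot : O t) (t0 : t != 0).
Local Notation I := (ideal_power O t).
Hypotheses (I1 : ~ I 1%N 1) (I_sep : forall x, (forall d, I d x) -> x = 0).
Variables (pi : C) (e : nat).
Hypotheses (e0 : (0 < e)%N) (pi0 : pi != 0).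
Hypothesis pi_div : forall d x, I (e + d)%N x <-> exists2 y, I d y & x = pi * y.
Let fI : filtration I := ideal_power_filtration Ot O1 OB OM.
Let I0P x : I 0%N x <-> O x.
Proof. by split=> [[y Oy ->]|Ox]; [rewrite mul1r|exists x; rewrite ?mul1r]. Qed.
Let pi_e : I e pi.
Proof. by rewrite -[e]addn0; apply/pi_div; exists 1; rewrite ?mulr1 //; apply/I0P. Qed.

(** Make the relation primitive and let [l] be the least index with a unit coefficient. If [n < e],
    every other term lies in [I l.+1]: the earlier ones are divisible by [pi], the later ones by
    [t ^ l.+1]. So would be [t ^ l]. *)
Lemma ramification_le_rank (R : comNzRingType) (v : {rmorphism R -> C}) (w : R) n
    (a : nat -> R) i : cdvr w -> v w = pi -> (forall a, O (v a)) -> (i <= n)%N -> a i <> 0 ->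
  \sum_(i < n.+1) v (a i) * t ^+ i = 0 -> (e <= n)%N.
Proof.
move=> cd vw vO le ai sum0; rewrite leqNgt; apply/negP => ne.
have [k [a' [Ea [j [b [jn ab]]]]]] := cdvr_primitive cd (le : (i < n.+1)%N) ai.
have {}sum0 : \sum_(i < n.+1) v (a' i) * t ^+ i = 0.
  apply: (mulfI (expf_neq0 k pi0)); rewrite mulr0 mulr_sumr -[RHS]sum0.
  by apply: eq_bigr => l _; rewrite Ea // rmorphM rmorphXn /= vw mulrA.
pose P l := `[< exists c, a' l * c = 1 >].
have exP : exists l, P l by exists j; apply/asboolP; exists b.
have := ex_minnP exP => -[l /asboolP[c lc] lmin].
have lj : (l <= j)%N by apply: lmin; apply/asboolP; exists b.
have ln : (l < n.+1)%N by apply: leq_ltn_trans jn.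
have tI k' : I k' (t ^+ k') by exists 1; rewrite ?mulr1.
have Il : I l.+1 (v (a' l) * t ^+ l).
  have -> : v (a' l) * t ^+ l = - \sum_(i < n.+1 | i != Ordinal ln) v (a' i) * t ^+ i.
    by move: sum0; rewrite (bigD1 (Ordinal ln)) //= => /eqP; rewrite addr_eq0 => /eqP.
  apply: (filN fI); apply: (fil_sum fI) => r rl.
  have [lt|gt|eq] := ltngtP r l; last first.
  - by case/eqP: rl; apply: val_inj.
  - by apply: (filMl fI); [apply/I0P|apply: (fil_le fI gt)].
  have [[d Ed]|[d Ed]] := cdvr_dich cd (a' r); last first.
    by have := lmin r; rewrite leqNgt lt => H; have // := H (introT (asboolP _) (ex_intro _ d Ed)).
  rewrite Ed rmorphM /= vw -mulrA; apply: (filMr fI).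
    exact: (fil_le fI (leq_trans ln ne) pi_e).
  by apply/I0P; apply: OM => //; have [y Oy ->] := tI r; apply: OM => //; apply/I0P/(filX0 fI)/I0P.
have : I l.+1 (t ^+ l * 1).
  have -> : t ^+ l * 1 = v c * (v (a' l) * t ^+ l).
    by rewrite mulr1 mulrA -rmorphM [c * _]mulrC lc rmorph1 mul1r.
  by apply: (filMl fI) => //; apply/I0P.
move=> [y Oy]; rewrite exprSr -mulrA => /(mulfI (expf_neq0 l t0)) E.
by apply: I1; exists y; rewrite ?expr1.
Qed.

(** Let [a] be the exact order of [x]. In [g(x) = 0] the linear term has order [e + a], while the
    terms of degree from [2] to [N - 1] have larger order because [pi] divides their coefficients.
    Terms of order at least [N a] must compensate, hence [N a <= e + a]. *)
Lemma height_le_ramification (g : fps C) N x : (1 < N)%N -> g 0%N = 0 -> g 1%N = pi ->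
    (forall i, O (g i)) -> (forall i, (i < N)%N -> exists2 c, O c & g i = pi * c) ->
    I 1%N x -> x <> 0 -> (forall d, I d (\sum_(i < d) g i * x ^+ i)) ->
  (N.-1 <= e)%N.
Proof.
move=> N1 g0 g1 gO glow Ix x0 gx.
have [a a1 [Ia nIa]] : exists2 a, (0 < a)%N & I a x /\ ~ I a.+1 x.
  apply: contrapT => H; apply: x0; apply: I_sep; elim=> [|[|d] IH] //.
    exact: (fil_le fI (e := 1)).
  by apply: contrapT => nI; apply: H; exists d.+1.
have : (N * a <= e + a)%N.
  rewrite leqNgt; apply/negP => lt; apply: nIa.
  suff : I (e + a.+1)%N (pi * x) by move=> /pi_div[y Iy /(mulfI pi0) ->].
  pose d := (e + a).+2.
  have := gx d; rewrite 2!big_ord_recl /= g0 mul0r add0r /bump /= g1 expr1.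
  set s := \sum_(i < _) _ => /(fil_le fI (leqnSn _)) H.
  rewrite -[pi * x](addrK s); apply: (filB fI); first by rewrite addnS.
  apply: (fil_sum fI) => i _; rewrite !add1n; have Ii := filX fI i.+2 Ia.
  have [lo|hi] := ltnP i.+2 N; last first.
    apply: (filMl fI); first by apply/I0P.
    by apply: (fil_le fI _ Ii); rewrite addnS (leq_trans lt) // leq_mul2r hi orbT.
  have [c Oc ->] := glow _ lo; rewrite mulrAC; apply: (filMr fI); last by apply/I0P.
  apply: (fil_le fI (e := (e + i.+2 * a)%N)); last by apply: (filM fI).
  by rewrite leq_add2l !mulSn -addn1 leq_add2l (leq_trans a1) // leq_addr.
have -> : (N * a = N.-1 * a + a)%N by rewrite -mulSnr prednK // ltnW.
by rewrite leq_add2r; apply: leq_trans; rewrite leq_pmulr.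
Qed.

End Ramification.

(** * Torsion points in the algebraic closure *)

Section Closure.
Variables (p : nat) (p_pr : prime p) (Omega : fieldExtType (padic p_pr)).
Variables (Kalg : fieldType) (iota : {rmorphism Omega -> Kalg}).
Local Notation O := (@padic_int_in p p_pr Omega).
Local Notation j := (iota \o O).

Lemma map_poly_iota (P : {poly padic_int p_pr}) : map_poly j P = map_poly iota (map_poly O P).
Proof. by apply/polyP => i; rewrite !coef_map. Qed.

Lemma iota_j_inj : injective j.
Proof. by move=> a b /= /fmorph_inj /padic_int_in_inj. Qed.

Lemma integer_iota c : integer j (iota c) <-> integer O c.
Proof.
by split=> -[P mP rP]; exists P => //; move: rP; rewrite map_poly_iota fmorph_root.
Qed.

Lemma maxideal_iota c : maxideal O c -> maxideal j (iota c).
Proof.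
move=> [ic nc]; split=> [|[_ [y iy Ey]]]; first exact/integer_iota.
apply: nc; split=> //; have c0 : c != 0.
  by apply/eqP => c0; move/eqP: Ey; rewrite c0 rmorph0 mul0r eq_sym oner_eq0.
exists c^-1; last by rewrite mulfV.
apply/integer_iota; rewrite fmorphV -[X in integer _ X]mulr1 -Ey mulKf //.
by rewrite fmorph_eq0.
Qed.

(** Transitivity: the coefficients of [P] are themselves algebraic over the [p]-adic numbers.
    Denominators are cleared at the end. *)
Lemma closure_algebraic (z : Kalg) (P : {poly Omega}) : P != 0 ->
  root (map_poly iota P) z ->
  exists S : {poly padic_int p_pr}, S != 0 /\ root (map_poly j S) z.
Proof.
move=> P0 rP; pose k : {rmorphism padic p_pr -> Kalg} := iota \o in_alg Omega.
have zfE (S : {poly padic_int p_pr}) : map_poly j S = map_poly k (map_poly (@zfrac _ _) S).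
  by apply/polyP => i; rewrite !coef_map.
have [S mS rS] : integralOver k z.
  apply: (integral_root _ rP); first by rewrite map_poly_eq0.
  move=> c /(nthP 0)[i _ <-]; rewrite coef_map.
  have [S [S0 rS]] := omega_algebraic P`_i.
  apply/integral_algebraic; exists (map_poly (@zfrac _ _) S).
    by rewrite map_poly_eq0_id0 // zfrac_eq0 lead_coef_eq0.
  by rewrite -zfE map_poly_iota fmorph_root.
have [S' [c [c0 ES]]] := padic_poly_denominators S.
have c0' : zfrac c != 0 by rewrite zfrac_eq0.
exists S'; split.
  apply/eqP => S'0; move/eqP: ES; rewrite S'0 rmorph0 eq_sym scaler_eq0 (negPf c0') /=.
  by apply/negP/monic_neq0.
by rewrite zfE ES map_polyZ rootE hornerZ (rootP rS) mulr0.
Qed.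

Hypothesis alg : forall z : Kalg, exists P : {poly padic_int p_pr},
  P != 0 /\ root (map_poly j P) z.

Definition small N (z : Kalg) := exists2 a, integer j a & z = p%:R ^+ N * a.

Lemma smallD N y z : small N y -> small N z -> small N (y + z).
Proof.
by move=> [a ia ->] [b ib ->]; exists (a + b); [apply: integer_add|rewrite mulrDr].
Qed.

Lemma smallN N y : small N y -> small N (- y).
Proof. by move=> [a ia ->]; exists (- a); [apply: integer_opp|rewrite mulrN]. Qed.

Lemma small_sep z : (forall N, small N z) -> z = 0.
Proof. by move=> H; apply: (integer_sep iota_j_inj alg). Qed.

Lemma small_power z N : maxideal j z -> exists k, forall e a, (k <= e)%N -> integer j a ->
  small N (z ^+ e * a).
Proof.
move=> mz; have [iz [n [y [n0 iy Ez]]]] := proj1 (maxidealP iota_j_inj alg z) mz.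
exists (n * N)%N => e a le ia; rewrite -(subnKC le) exprD exprM Ez exprMn.
exists (y ^+ N * z ^+ (e - n * N) * a); last by rewrite !mulrA.
by do 2![apply: integer_mul => //]; apply: integer_exp.
Qed.

Lemma small_iota N c : integer O c -> small N (iota (p%:R ^+ N * c)).
Proof.
move=> ic; exists (iota c); first exact/integer_iota.
by rewrite rmorphM rmorphXn rmorph_nat.
Qed.

Lemma closure_lim (u : nat -> Kalg) l :
    (forall N, exists k, forall d, (k <= d)%N -> small N (u d - l)) ->
  padic_lim j u = l.
Proof. by move=> H; apply: (padic_lim_eq iota_j_inj alg). Qed.

(** As [D] is distinguished, [z ^ N] is a multiple of [t], and a power of [t] is a multiple of
    [p]. *)
Lemma monic_root_maxideal (D : {poly Kalg}) (t z : Kalg) N : D \is monic -> size D = N.+1 ->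
    maxideal j t -> (forall i, (i < N)%N -> exists2 b, integer j b & D`_i = t * b) ->
  root D z -> maxideal j z.
Proof.
move=> mD sD mt Dlow rD.
have DN : D`_N = 1 by move/monicP: mD; rewrite /lead_coef sD.
have [it [n [y [n0 iy Ey]]]] := proj1 (maxidealP iota_j_inj alg t) mt.
have iD i : integer j D`_i.
  have [lt|gt|->] := ltngtP i N; first by have [b ib ->] := Dlow i lt; apply: integer_mul.
    by rewrite nth_default ?sD //; apply: integer_zero.
  by rewrite DN; apply: integer_one.
have iz : integer j z.
  apply: (integral_root_monic mD rD) => c /(nthP 0)[i _ <-]; exact: iD.
have N0 : (0 < N)%N.
  rewrite lt0n; apply/eqP => N0; rewrite N0 in sD DN.
  have E : D = (D`_0)%:P by apply: size1_polyC; rewrite sD.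
  by move: rD; rewrite E rootE hornerC DN oner_eq0.
have [c ic Ec] : exists2 c, integer j c & z ^+ N = t * c.
  have /choice[b Hb] : forall i, exists b, (i < N)%N -> integer j b /\ D`_i = t * b.
    move=> i; case: (ltnP i N) => [/Dlow[b ib Eb]|_]; last by exists 0.
    by exists b.
  exists (- \sum_(i < N) b i * z ^+ i).
    apply: integer_opp; elim/big_ind: _ => [|x1 x2|i _]; first exact: integer_zero.
      exact: integer_add.
    by apply: integer_mul; [have [] := Hb i (ltn_ord i)|apply: integer_exp].
  move/rootP: rD; rewrite horner_coef sD big_ord_recr /= DN mul1r => /eqP.
  rewrite addrC addr_eq0 => /eqP ->; rewrite mulrN mulr_sumr; congr (- _).
  by apply: eq_bigr => i _; have [_ ->] := Hb i (ltn_ord i); rewrite mulrA.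
apply/(maxidealP iota_j_inj alg); split=> //; exists (N * n)%N, (y * c ^+ n).
split; [by rewrite muln_gt0 N0|by apply: integer_mul => //; apply: integer_exp|].
by rewrite exprM Ec exprMn Ey mulrA.
Qed.

End Closure.

(** * The fibers of multiplication by the uniformizer *)

Section Fibers.
Variables (C : fieldType) (R OL : comNzRingType).
Variables (v : {rmorphism R -> C}) (vL : {rmorphism OL -> C}).
Variables (I : nat -> C -> Prop) (F : mfps 2 C) (f : fps C) (add act : C -> C -> C).
Variable fm : formal_module v I F f add act.
Variables (w : R) (t : OL) (cdL : cdvr t) (N s e : nat).
Local Notation A := (FM fm).
Local Notation pi := (v w).
Hypotheses (N0 : (0 < N)%N) (s0 : (0 < s)%N) (e0 : (0 < e)%N) (pi0 : pi != 0).
Hypothesis pi_div : forall d x, I (e + d)%N x <-> exists2 y, I d y & x = pi * y.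
Hypotheses (I1 : ~ I 1%N 1) (vLI : forall a, I 0%N (vL a)).
Variable aL : nat -> OL.
Hypothesis aLE : forall i, vL (aL i) = fg_mul f pi i.
Hypothesis aL_low : forall i, (i < N)%N -> exists b, aL i = t * b.
Hypothesis aL_unit : exists b, aL N * b = 1.

Variables (Kal : closedFieldType) (iota : {rmorphism C -> Kal}).
Variables (intK maxK : Kal -> Prop) (smallK : nat -> Kal -> Prop).
Hypotheses (intK1 : intK 1) (intKB : forall x y, intK x -> intK y -> intK (x - y)).
Hypothesis intKM : forall x y, intK x -> intK y -> intK (x * y).
Hypothesis smallKD : forall n x y, smallK n x -> smallK n y -> smallK n (x + y).
Hypothesis smallKN : forall n x, smallK n x -> smallK n (- x).
Hypothesis smallK_sep : forall x, (forall n, smallK n x) -> x = 0.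
Hypothesis maxK_int : forall z, maxK z -> intK z.
Hypothesis iota_int : forall c, I 0%N c -> intK (iota c).
Hypothesis iota_small : forall n, exists k, forall d c, (k <= d)%N -> I d c ->
  smallK n (iota c).
Hypothesis maxK_small : forall z n, maxK z -> exists k, forall d a, (k <= d)%N ->
  intK a -> smallK n (z ^+ d * a).
Hypothesis root_maxK : forall (D : {poly Kal}) z, D \is monic -> size D = N.+1 ->
  (forall i, (i < N)%N -> exists2 b, intK b & D`_i = iota (vL t) * b) ->
  root D z -> maxK z.
Hypothesis torsion_points : forall z, maxK z ->
  (forall n, exists k, forall d, (k <= d)%N ->
     smallK n (pev iota (fps_trunc d (fg_mul f (v (w ^+ s)))) z)) ->
  exists x : A, iota (fmval x) = z.

Let fI := fm_fil fm.
Let f0 : f 0%N = 0. Proof. by have [] := fm_log fm. Qed.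
Let f1 : f 1%N = 1. Proof. by have [] := fm_log fm. Qed.

Section Fiber.
Variables (y : A) (b : OL).
Hypotheses (Eb : vL b = fmval y) (b_low : exists c, b = t * c).
Hypothesis y_tors : w ^+ s.-1 *: y = 0.

(** The series [[pi](X) - y]. Only its constant term differs from that of [[pi](X)], and [b] is
    divisible by [t], so preparation still applies with degree [N]. *)
Let g i : OL := aL i - (i == 0%N)%:R * b.

Let g_low i : (i < N)%N -> exists c, g i = t * c.
Proof.
move=> /aL_low[c Ec]; have [d Ed] := b_low; exists (c - (i == 0%N)%:R * d).
by rewrite /g Ec Ed mulrBr mulrCA.
Qed.

Let g_unit : exists c, g N * c = 1.
Proof.
by have [c Ec] := aL_unit; exists c; rewrite /g eqn0Ngt N0 mul0r subr0.
Qed.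

Let g_trunc d : (0 < d)%N -> fps_trunc d g = fps_trunc d aL - b%:P.
Proof.
move=> d0; apply/polyP => i; rewrite coefB !coef_fps_trunc coefC /g.
by case: eqP => [->|_]; rewrite ?d0 ?mul1r // mul0r !subr0.
Qed.

Let aL_trunc d : map_poly vL (fps_trunc d aL) = fps_trunc d (fg_mul f pi).
Proof.
apply/polyP => i; rewrite coef_map !coef_fps_trunc; case: ifP => _; last exact: rmorph0.
exact: aLE.
Qed.

Let pev_g d x : (0 < d)%N -> pev vL (fps_trunc d g) x = (fps_trunc d (fg_mul f pi)).[x] - fmval y.
Proof.
by move=> d0; rewrite g_trunc // pevB /pev map_polyC /= hornerC Eb aL_trunc.
Qed.

Let iL : {rmorphism OL -> Kal} := iota \o vL.

Let map_iL (P : {poly OL}) : map_poly iL P = map_poly iota (map_poly vL P).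
Proof. by apply/polyP => i; rewrite !coef_map. Qed.

Let pev_ig d z : (0 < d)%N ->
  pev iL (fps_trunc d g) z = pev iota (fps_trunc d (fg_mul f pi)) z - iota (fmval y).
Proof.
move=> d0; rewrite g_trunc // pevB /pev !map_iL map_polyC /= Eb aL_trunc.
by rewrite map_polyC hornerC.
Qed.

(* A root of the distinguished polynomial satisfies [pi](z) = y, hence it is a
   torsion point. *)
Let root_torsion z : maxK z ->
    (forall d, (N < d)%N -> ideal_power intK z d
       (pev iota (fps_trunc d (fg_mul f pi)) z - iota (fmval y))) ->
  exists2 x : A, iota (fmval x) = z & w *: x = y.
Proof.
move=> mz Hz; have iz := maxK_int mz.
(* No uniformizer is available in the closure; the powers of the point [z] itself provide the
   filtration. *)
have fz := ideal_power_filtration iz intK1 intKB intKM.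
have int0 c : ideal_power intK z 0 c <-> intK c.
  by split=> [[a ia ->]|ic]; [rewrite mul1r|exists c; rewrite ?mul1r].
have z1 : ideal_power intK z 1 z by exists 1; rewrite ?mulr1.
have small_z n : exists k, forall d c, (k <= d)%N -> ideal_power intK z d c -> smallK n c.
  have [k Hk] := maxK_small n mz; exists k => d c kd [a ia ->]; exact: Hk.
have [||x Ex] := @torsion_points z.
- exact: mz.
(* [[pi ^ s](z)] is compared with [[pi ^ (s - 1)]] at [[pi](z)], then with [[pi ^ (s - 1)](y)],
   which is zero; each comparison holds up to arbitrarily small terms. *)
- move=> n; have [k1 H1] := small_z n; have [k2 H2] := iota_small n.
  exists (maxn N.+1 (maxn k1 k2)) => d; rewrite !geq_max => /and3P[Nd k1d k2d].
  have X1 : Xadic 1 ('X : {poly C}) by apply: XF1; rewrite coefX.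
  have JX : coef_fil I 0%N ('X : {poly C}) by move=> i; rewrite coefX; apply: fil_nat.
  have Hm := mul_mul_poly f0 f1 (v (w ^+ s.-1)) pi X1 (d := d).
  rewrite !comp_polyXr -rmorphM -exprSr prednK // in Hm.
  set T := fps_trunc d (fg_mul f (v (w ^+ s.-1))) in Hm.
  set T1 := fps_trunc d (fg_mul f pi) in Hm.
  set T2 := fps_trunc d (fg_mul f (v (w ^+ s))) in Hm *.
  have JT1 : coef_fil I 0%N T1.
    by have := J_mul fm (P := 'X) d w JX; rewrite comp_polyXr.
  have JT2 : coef_fil I 0%N T2.
    by have := J_mul fm (P := 'X) d (w ^+ s) JX; rewrite comp_polyXr.
  have JT : coef_fil I 0%N T.
    by have := J_mul fm (P := 'X) d (w ^+ s.-1) JX; rewrite comp_polyXr.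
  have JTT : coef_fil I 0%N ((T \Po T1) - T2).
    by apply: (filB (coef_filtration fI)) => //; apply: (J_mul fm).
  have K1 : ideal_power intK z d (pev iota ((T \Po T1) - T2) z).
    by apply: (pev_high fz) => // i; apply/int0/iota_int/JTT.
  rewrite pevB pev_comp in K1.
  have K2 : ideal_power intK z d (pev iota T (pev iota T1 z) - pev iota T (iota (fmval y))).
    apply: (pev_arg fz) => [i| | |]; last exact: Hz.
    - by apply/int0/iota_int/JT.
    - by apply: (pev_int fz) => [i|]; apply/int0 => //; apply: iota_int; apply: JT1.
    by apply/int0/iota_int; apply: (fil_le fI (e := 1)) => //; apply: fmvalP.
  have K3 : smallK n (pev iota T (iota (fmval y))).
    rewrite /pev horner_map /=; apply: (H2 d) => //.
    have := fm_act fm d (w ^+ s.-1) (fmvalP y); rewrite -fmvalZ y_tors fmval0 sub0r.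
    by move=> /(filN fI); rewrite opprK.
  rewrite (_ : pev iota T2 z = - (pev iota T (pev iota T1 z) - pev iota T2 z)
    + (pev iota T (pev iota T1 z) - pev iota T (iota (fmval y)))
    + pev iota T (iota (fmval y))); last by ring.
  by apply: smallKD => //; apply: smallKD; [apply: smallKN|]; apply: (H1 d).
exists x => //; apply: fmval_inj; rewrite fmvalZ.
apply: (fmorph_inj iota); apply/eqP; rewrite -subr_eq0; apply/eqP; apply: smallK_sep => n.
have [k1 H1] := small_z n; have [k2 H2] := iota_small n.
pose d := maxn N.+1 (maxn k1 k2); have := leqnn d; rewrite {1}/d !geq_max.
move=> /and3P[Nd k1d k2d].
have S1 := H1 d _ k1d (Hz d Nd); rewrite -Ex /pev horner_map /= in S1.
have := H2 _ _ k2d (fm_act fm d w (fmvalP x)); rewrite rmorphB => S2.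
have := smallKD S2 S1; congr (smallK n _).
by rewrite addrA subrK.
Qed.

(** The distinguished polynomial splits in the closure with [N] roots, and [root_torsion] brings
    them all into [A]. Conversely [D = Q g] shows that every point of the fiber is a root. *)
Lemma fiber_points : exists z : nat -> A,
  [/\ forall i, (i < N)%N -> w *: z i = y,
      forall i j, (i < N)%N -> (j < N)%N -> z i = z j -> i = j &
      forall x, w *: x = y -> exists2 i, (i < N)%N & x = z i].
Proof.
have [D [Q [Q' [Dm Ds Dl HD Hg]]]] := weierstrass_series cdL g_low g_unit.
pose D' := map_poly iL D.
have D'm : D' \is monic by apply: monic_map.
have D's : size D' = N.+1.
  by rewrite /D' size_map_poly_id0 // (monicP Dm) rmorph1 oner_neq0.
have [r Er] := closed_field_poly_normal D'.
rewrite (monicP D'm) scale1r in Er.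
have sr : size r = N by have := congr1 (fun P : {poly Kal} => size P) Er; rewrite size_prod_XsubC D's => -[].
have rootD z : z \in r -> exists2 x : A, iota (fmval x) = z & w *: x = y.
  move=> zr; have rz : root D' z by rewrite Er root_prod_XsubC.
  have mz : maxK z.
    apply: (root_maxK D'm D's _ rz) => i /Dl[c Ec]; exists (iota (vL c)).
      exact: iota_int.
    by rewrite /D' coef_map Ec /= !rmorphM.
  apply: root_torsion => // d Nd.
  have fz := ideal_power_filtration (maxK_int mz) intK1 intKB intKM.
  have := @Xadic_eval _ _ (ideal_power intK z) iL d _ z fz _ (Hg d Nd).
  rewrite pevB pevM pev_ig ?(leq_trans _ Nd) // [pev iL D z](rootP rz) mulr0 subr0; apply.
    by move=> a; exists (iota (vL a)); rewrite ?mul1r //; apply: iota_int.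
  by exists 1; rewrite ?mulr1.
have /choice[z Hz] : forall i, exists x : A, (i < N)%N -> iota (fmval x) = r`_i /\ w *: x = y.
  move=> i; case: (ltnP i N) => [lt|_]; last by exists 0.
  by have [|x Ex wx] := rootD r`_i; [rewrite mem_nth ?sr|exists x].
have D'E x : iota (pev vL D x) = \prod_(i < N) (iota x - iota (fmval (z i))).
  rewrite /pev -horner_map /= -map_iL -/D' Er (big_nth 0) big_mkord sr horner_prod.
  by apply: eq_bigr => i _; rewrite hornerXsubC; have [->] := Hz i (ltn_ord i).
exists z; split=> [i lt|i j li lj Ez|x wx].
- by have [] := Hz i lt.
(* A double root is excluded by perturbation. Move [z i] by [y0 = pi ^ 2] in the group: the
   polynomial then has order at least [4 e] there, and so has [[pi](y0)]; but [y0] is not at level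
   [3 e], so [[pi](y0)] is not at level [4 e]. *)
- apply: contrapT => ne.
  have y0I : I (2 * e)%N (pi ^+ 2) by apply: (pi_X fm pi_div).
  have y0I1 : I 1%N (pi ^+ 2) by apply: (fil_le fI _ y0I); rewrite muln_gt0.
  pose y0 := toFM fm y0I1.
  have L2 : level (2 * e) y0 by [].
  have nL3 : ~ level (3 * e) y0.
    rewrite /level toFMK mulSn addnC => /(pi_divX pi_div)[c Ic Ec]; apply: I1.
    have /eqP := Ec; rewrite -{1}[pi ^+ 2]mulr1 (inj_eq (mulfI (expf_neq0 2 pi0))) => /eqP ->.
    exact: (fil_le fI e0).
  apply: (w_level_not e0 pi0 pi_div (leqnn 2) L2 nL3).
  pose x' := z i + y0; pose X := fmval x'.
  have -> : w *: y0 = w *: x' - y by have [_ <-] := Hz i li; rewrite scalerDr addrAC subrr add0r.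
  have dI k : I 0%N (X - fmval (z k)).
    by apply: (filB fI); apply: (fil_le fI (e := 1)) => //; apply: fmvalP.
  have d2 : I (2 * e)%N (X - fmval (z i)) by apply/level_sub; rewrite /x' addrAC subrr add0r.
  have DX : pev vL D X = \prod_(k < N) (X - fmval (z k)).
    by apply: (fmorph_inj iota); rewrite D'E rmorph_prod; apply: eq_bigr => k _; rewrite rmorphB.
  have D4 : I (4 * e)%N (pev vL D X).
    have ij : Ordinal lj != Ordinal li by apply/eqP => /(congr1 val) /= E; apply: ne.
    rewrite DX (bigD1 (Ordinal li)) //= (bigD1 (Ordinal lj)) //= -Ez mulrA.
    have -> : (4 * e = 2 * e + 2 * e)%N by rewrite -mulnDl.
    apply: (filMr fI); first exact: (filM fI d2 d2).
    elim/big_ind: _ => [|c1 c2 H1 H2|k _]; [exact: fil1| |exact: dI].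
    by rewrite -[0%N]/(0 + 0)%N; apply: (filM fI).
  apply/level_sub; rewrite fmvalZ; pose d := maxn N.+1 (4 * e).
  have := leqnn d; rewrite {1}/d geq_max => /andP[Nd ed].
  have IX : I 1%N X by apply: fmvalP.
  apply: (fil_trans fI (fil_le fI ed (fm_act fm d w IX))).
  rewrite -pev_g ?(leq_trans _ Nd) //.
  have := @Xadic_eval _ _ I vL d _ X fI vLI (Hg d Nd) IX; rewrite pevB pevM.
  move=> /(fil_le fI ed) K; rewrite -[pev vL (fps_trunc d g) X](subrK (pev vL (fps_trunc d Q') X * pev vL D X)).
  apply: (filD fI K); apply: (filMl fI) => //; apply: (pev_int fI) => //.
  by apply: (fil_le fI (e := 1)).
have Dx : pev vL D (fmval x) = 0.
  apply: (fm_sep fm) => d; pose k := maxn N.+1 d.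
  have := leqnn k; rewrite {1}/k geq_max => /andP[Nk dk].
  have IX := fmvalP x.
  have := @Xadic_eval _ _ I vL k _ _ fI vLI (HD k Nk) IX; rewrite pevB pevM => K.
  apply: (fil_le fI dk); rewrite -[pev vL D _](subrK (pev vL (fps_trunc k Q) (fmval x) * pev vL (fps_trunc k g) (fmval x))).
  apply: (filD fI K); apply: (filMl fI).
    by apply: (pev_int fI) => //; apply: (fil_le fI (e := 1)).
  rewrite pev_g ?(leq_trans _ Nk) // -wx fmvalZ; apply: (fil_sym fI).
  exact: (fm_act fm).
have : root D' (iota (fmval x)).
  by rewrite /D' map_iL rootE horner_map /= -/(pev vL D _) Dx rmorph0.
rewrite Er root_prod_XsubC => /(nthP 0)[i lt Ei]; rewrite sr in lt.
exists i => //; apply: fmval_inj; apply: (fmorph_inj iota).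
by have [-> _] := Hz i lt.
Qed.

End Fiber.
End Fibers.

(** * Group rings of cyclic groups *)

Section GroupRingPoly.
Variables (R : comNzRingType) (gT : finGroupType) (sigma : gT).
Local Notation V := {ffun gT -> R^o}.
Implicit Types (a : V) (P D : {poly R}).

(** Right multiplication by [sigma]. With it the group ring is acted on by polynomials through the
    same [pact] as the points, and [gr_poly] is evaluation at [sigma]. *)
Definition gr_shift a : V := [ffun g => a (g * sigma^-1)%g].

Fact gr_shift_linear : linear gr_shift.
Proof. by move=> c a b; apply/ffunP => g; rewrite !ffunE. Qed.
HB.instance Definition _ := GRing.isLinear.Build R V V *:%R
  gr_shift gr_shift_linear.

Definition gr_delta : V := [ffun g => (g == 1%g)%:R].

Definition gr_poly P : V := pact gr_shift P gr_delta.

Lemma iter_gr_shift l a g : iter l gr_shift a g = a (g * (sigma ^+ l)^-1)%g.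
Proof.
elim: l g => [|l IH] g; first by rewrite expg0 invg1 mulg1.
by rewrite /= ffunE IH expgSr invMg mulgA.
Qed.

Lemma gr_polyE n P g : (size P <= n)%N ->
  gr_poly P g = \sum_(l < n) P`_l * (g == sigma ^+ l)%g%:R.
Proof.
move=> sP; rewrite /gr_poly (pactE _ _ sP) sum_ffunE; apply: eq_bigr => l _.
rewrite ffunE /= iter_gr_shift ffunE; congr (_ * (nat_of_bool _)%:R).
by rewrite -eq_mulgV1.
Qed.

Lemma gr_poly_supp P g : g \notin <[sigma]>%g -> gr_poly P g = 0.
Proof.
move=> ng; rewrite (gr_polyE _ (leqnn _)) big1 // => l _.
by case: eqP => [E|_]; [rewrite E mem_cycle in ng|rewrite mulr0].
Qed.

Lemma gr_poly_surj a : (forall g, g \notin <[sigma]>%g -> a g = 0) -> exists P, a = gr_poly P.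
Proof.
move=> supp; exists (\poly_(l < #[sigma]%g) a (sigma ^+ l)%g); apply/ffunP => g.
rewrite (gr_polyE _ (size_poly _ _)).
case: (boolP (g \in <[sigma]>%g)) => [/cyclePmin[k lt ->]|ng]; last first.
  by rewrite supp // big1 // => l _; case: eqP => [E|_]; [rewrite E mem_cycle in ng|rewrite mulr0].
rewrite (bigD1 (Ordinal lt)) //= eqxx mulr1 coef_poly lt big1 ?addr0 // => l nl.
rewrite eq_expg_mod_order !modn_small //; case: eqP => [E|_]; last by rewrite mulr0.
by case/eqP: nl; apply: val_inj.
Qed.

Lemma gr_shift_order a : iter #[sigma]%g gr_shift a = a.
Proof. by apply/ffunP => g; rewrite iter_gr_shift expg_order invg1 mulg1. Qed.

Lemma gr_poly_cyc p m P D : #[sigma]%g = (p ^ m)%N -> cyc p m (P - D) ->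
  gr_poly P = gr_poly D.
Proof.
move=> Em cPD; apply/eqP; rewrite -subr_eq0 -[X in _ - X]scale1r -scaleNr /gr_poly.
rewrite -pactZ scaleN1r -pactD (pact_cyc _ _ cPD) // => a.
by rewrite -Em gr_shift_order.
Qed.

Lemma gr_polyM1 D g : gr_poly ('X * D) g = gr_poly D (g * sigma^-1)%g.
Proof. by rewrite mulrC /gr_poly pactMX ffunE. Qed.

Lemma gr_pact (A : lmodType R) (sg : {linear A -> A}) (gA : gT -> A) P x :
    (forall l, gA (sigma ^+ l)%g = iter l sg x) ->
  \sum_(g in <[sigma]>%g) gr_poly P g *: gA g = pact sg P x.
Proof.
move=> H; rewrite /pact.
transitivity (\sum_(g in <[sigma]>%g) \sum_(l < size P)
   (P`_l * (g == sigma ^+ l)%g%:R) *: gA g).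
  by apply: eq_bigr => g _; rewrite (gr_polyE _ (leqnn _)) scaler_suml.
rewrite exchange_big; apply: eq_bigr => l _ /=.
rewrite (bigD1 (sigma ^+ l)%g) ?mem_cycle //= eqxx mulr1 H big1 ?addr0 // => g /andP[_ /negPf->].
by rewrite mulr0 scale0r.
Qed.

Section Values.
Variables (C : comNzRingType) (v : {rmorphism R -> C}).

(** The elements of the group ring in the statement take their values in the field; this embeds
    those with coefficients in [R]. *)
Definition gr_val P : {ffun gT -> C} := [ffun g => v (gr_poly P g)].

Lemma gr_mul_monom (a : {ffun gT -> C}) c k g :
  gr_mul a (gr_monom c k) g = a (g * k^-1)%g * c.
Proof.
rewrite ffunE (bigD1 (g * k^-1)%g) //= ffunE invMg invgK -mulgA mulVg mulg1 eqxx.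
rewrite big1 ?addr0 // => t nt; rewrite ffunE; case: eqP => [E|_]; last by rewrite mulr0.
by case/eqP: nt; rewrite -E invMg invgK mulgA mulgV mul1g.
Qed.

Lemma gr_mulB (a b c : {ffun gT -> C}) : gr_mul a (b - c) = gr_mul a b - gr_mul a c.
Proof.
apply/ffunP => g; rewrite !ffunE -sumrB; apply: eq_bigr => t _.
by rewrite !ffunE mulrBr.
Qed.

Lemma gr_mul0 (a : {ffun gT -> C}) : gr_mul a 0 = 0.
Proof. by apply/ffunP => g; rewrite !ffunE big1 // => t _; rewrite ffunE mulr0. Qed.

Lemma gr_val0 : gr_val 0 = 0.
Proof. by apply/ffunP => g; rewrite !ffunE /gr_poly pact0 ffunE rmorph0. Qed.

Lemma gr_val_scale c D : gr_mul (gr_val D) (gr_monom (v c) 1%g) = gr_val (c *: D).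
Proof.
apply/ffunP => g; rewrite gr_mul_monom invg1 mulg1 !ffunE /gr_poly pactZ ffunE.
by rewrite rmorphM /= mulrC.
Qed.

Lemma gr_val_X1 D : gr_mul (gr_val D) (gr_monom 1 sigma - gr_monom 1 1%g)
  = gr_val (('X - 1) * D).
Proof.
apply/ffunP => g; rewrite gr_mulB [LHS]ffunE [X in _ + X]ffunE !gr_mul_monom !mulr1 !ffunE.
rewrite invg1 mulg1 -gr_polyM1 -rmorphB; congr (v _).
by rewrite mulrBl mul1r /gr_poly pactD pactN !ffunE.
Qed.

Lemma gr_valN D : gr_val (- D) = - gr_val D.
Proof. by apply/ffunP => g; rewrite !ffunE /gr_poly pactN ffunE rmorphN. Qed.

End Values.
End GroupRingPoly.

(** * Generators and relations *)

Section Indices.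
Variables (n h : nat) (hn : (h <= n)%N).

(** Matches the three families of the statement with the order of [gen_family], in which [omega]
    comes first, as the initial part of a basis, then [theta], then [xi]. *)
Definition gen_rank (i : gen_index (n - h) h) : nat :=
  match i with inl k => h + k | inr (inl k) => n + k | inr (inr k) => k end.

Lemma gen_rank_lt i : (gen_rank i < n + h)%N.
Proof.
case: i => [k|[k|k]] /=; last by rewrite (leq_trans (ltn_ord k)) // leq_addl.
  by rewrite (leq_trans (n := n)) ?leq_addr // -[X in (_ < X)%N](subnKC hn) ltn_add2l.
by rewrite ltn_add2l.
Qed.

Lemma gen_rank_inj : injective gen_rank.
Proof.
have lt1 (k : 'I_(n - h)) : (h + k < n)%N by rewrite -[X in (_ < X)%N](subnKC hn) ltn_add2l.
have lt2 (k : 'I_h) : (k < n)%N by apply: leq_trans hn.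
move=> [k|[k|k]] [l|[l|l]] /= E.
- by congr inl; apply: val_inj; apply: (addnI E).
- by have := lt1 k; rewrite E ltnNge leq_addr.
- by have := ltn_ord l; rewrite -E ltnNge leq_addr.
- by have := lt1 l; rewrite -E ltnNge leq_addr.
- by congr (inr (inl _)); apply: val_inj; apply: (addnI E).
- by have := lt2 l; rewrite -E ltnNge leq_addr.
- by have := ltn_ord k; rewrite E ltnNge leq_addr.
- by have := lt2 k; rewrite E ltnNge leq_addr.
by congr (inr (inr _)); apply: val_inj.
Qed.

Lemma gen_rank_choice (T : Type) (x0 : T) (phi : gen_index (n - h) h -> T) :
  exists P : nat -> T, forall i, P (gen_rank i) = phi i.
Proof.
exists (fun k => if [pick i | gen_rank i == k] is Some i then phi i else x0) => i.
case: pickP => [l /eqP /gen_rank_inj -> //|/(_ i)].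
by rewrite eqxx.
Qed.

Lemma gen_rank_sum (V : zmodType) (T : nat -> V) :
  \sum_(i : gen_index (n - h) h) T (gen_rank i) = \sum_(k < n + h) T k.
Proof.
rewrite big_sumType big_sumType /= (sum_ord_split _ (leq_addr h n)) addKn.
rewrite (sum_ord_split T hn) [RHS]addrAC [RHS]addrC.
by congr (_ + _); rewrite addrC.
Qed.

End Indices.

Section FormalSums.
Variables (C : fieldType) (R : comNzRingType) (v : {rmorphism R -> C}).
Variables (I : nat -> C -> Prop) (F : mfps 2 C) (f : fps C) (add act : C -> C -> C).
Variable fm : formal_module v I F f add act.

Lemma big_fmval (J : Type) (r : seq J) (P : pred J) (T : J -> FM fm) (x : J -> C) :
    (forall i, P i -> x i = fmval (T i)) ->
  \big[add/0]_(i <- r | P i) x i = fmval (\sum_(i <- r | P i) T i).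
Proof.
move=> H; apply: (big_ind2 (fun a (b : FM fm) => a = fmval b)) => //.
by move=> a1 b1 a2 b2 -> ->.
Qed.

End FormalSums.

Section Presentation.
Variables (C : fieldType) (R : comNzRingType) (v : {rmorphism R -> C}).
Variables (I : nat -> C -> Prop) (F : mfps 2 C) (f : fps C) (add act : C -> C -> C).
Variable fm : formal_module v I F f add act.
Variables (sg : {linear FM fm -> FM fm}) (gT : finGroupType) (sigma : gT).
Variables (ga : gT -> C -> C) (p m n h s : nat) (w : R) (gb xb : nat -> FM fm).
Hypotheses (hn : (h <= n)%N) (sigma_ord : #[sigma]%g = (p ^ m)%N) (v_inj : injective v).
Hypothesis gaE : forall l (x : FM fm), ga (sigma ^+ l)%g (fmval x) = fmval (iter l sg x).
Hypothesis gen : forall x, exists P, x = lc sg h n gb xb P.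
Hypothesis ker : forall P, lc sg h n gb xb P = 0 ->
  exists D, forall i, (i < n + h)%N -> cyc p m (P i - relp w h n s D i).
Hypothesis rel : forall D, lc sg h n gb xb (relp w h n s D) = 0.
Local Notation G := <[sigma]>%g.
Local Notation J := (gen_index (n - h) h).

Definition theta (k : 'I_(n - h)) := fmval (gb (h + k)%N).
Definition xi (k : 'I_h) := fmval (xb k).
Definition omega (k : 'I_h) := fmval (gb k).
Definition generators := gens theta xi omega.
Definition lincomb (c : {ffun J -> {ffun gT -> C}}) :=
  \big[add/0]_i \big[add/0]_(g in G) act (c i g) (ga g (generators i)).
Definition scalars (x : C) := exists a, x = v a.

Lemma generatorsE i : generators i = fmval (gen_family n gb xb (gen_rank i)).
Proof.
case: i => [k|[k|k]]; rewrite /gen_family /=.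
- by rewrite -[X in (_ < X)%N](subnKC hn) ltn_add2l ltn_ord.
- by rewrite ltnNge leq_addr /= addKn.
by rewrite (leq_trans (ltn_ord k) hn).
Qed.

Lemma lincombE (P : nat -> {poly R}) (c : {ffun J -> {ffun gT -> C}}) :
    (forall i, c i = gr_val sigma v (P (gen_rank i))) ->
  lincomb c = fmval (lc sg h n gb xb P).
Proof.
move=> Ec; rewrite /lc -(gen_rank_sum hn (fun k => pact sg (P k) (gen_family n gb xb k))).
apply: big_fmval => i _; rewrite generatorsE Ec; set x := gen_family _ _ _ _.
(* [lg] is a discrete logarithm on [G]: the action [ga] is described only on powers of [sigma]. *)
have /choice[lg Hlg] : forall g, exists l, g \in G -> g = (sigma ^+ l)%g.
  move=> g; case: (boolP (g \in G)) => [/cycleP[l ->]|_]; last by exists 0%N.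
  by exists l.
rewrite -(gr_pact (gA := fun g => iter (lg g) sg x) (sigma := sigma)); last first.
  by move=> l; apply: fmval_inj; rewrite -!gaE -Hlg ?mem_cycle.
apply: big_fmval => g gG; rewrite fmvalZ ffunE; congr act.
by rewrite {1}(Hlg g gG) gaE.
Qed.

Lemma scalars_poly (a : {ffun gT -> C}) : in_group_ring scalars G a ->
  exists P, a = gr_val sigma v P.
Proof.
move=> Ha; have /choice[b Hb] : forall g, exists b, a g = v b.
  by move=> g; have [[b ->]] := Ha g; exists b.
have [|P EP] := @gr_poly_surj R gT sigma [ffun g => b g].
  move=> g ng; rewrite ffunE; apply: v_inj; rewrite rmorph0 -Hb.
  by have [_ ->] := Ha g.
by exists P; apply/ffunP => g; rewrite ffunE -EP ffunE.
Qed.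

Lemma gr_val_scalars P : in_group_ring scalars G (gr_val sigma v P).
Proof.
move=> g; split=> [|ng]; first by exists (gr_poly sigma P g); rewrite ffunE.
by rewrite ffunE gr_poly_supp // rmorph0.
Qed.

(** At each index at most one [k] contributes, which identifies the submodule generated by the
    stated relations with the vectors [relp]. *)
Lemma gen_rel_val (D : nat -> {poly R}) (i : J) :
  \sum_(k < h) gr_mul (gr_val sigma v (D k)) (gen_rel (n - h) (v w) s sigma k i)
  = gr_val sigma v (relp w h n s D (gen_rank i)).
Proof.
have relE k : gen_rel (n - h) (v w) s sigma k i =
    (if i == xi_index (n - h) k then gr_monom (v (w ^+ s)) 1%g else 0)
    - (if i == omega_index (n - h) k then gr_monom 1 sigma - gr_monom 1 1%g else 0).
  by rewrite /gen_rel !ffunE rmorphXn.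
under eq_bigr => k _ do rewrite relE gr_mulB.
case: i {relE} => [k|[k|k]]; rewrite /relp /=.
- rewrite big1 => [|l _]; last by rewrite !gr_mul0 subrr.
  rewrite ltnNge leq_addr /= -[X in (_ < X)%N](subnKC hn) ltn_add2l ltn_ord.
  by rewrite gr_val0.
- rewrite (bigD1 k) //= eqxx gr_mul0 subr0 big1 ?addr0 => [|l nl]; last first.
    rewrite (_ : (_ == _) = false) ?gr_mul0 ?subr0 //.
    by apply/eqP => -[E]; rewrite E eqxx in nl.
  have nk : (n + k < h)%N = false by rewrite ltnNge (leq_trans hn) ?leq_addr.
  by rewrite nk ltnNge leq_addr /= addKn gr_val_scale.
rewrite (bigD1 k) //= eqxx gr_mul0 sub0r big1 ?addr0 => [|l nl]; last first.
  rewrite (_ : (_ == _) = false) ?gr_mul0 ?subr0 //.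
  by apply/eqP => -[E]; rewrite E eqxx in nl.
by rewrite ltn_ord gr_val_X1 gr_valN.
Qed.

(** Coefficients are lifted from the group ring to polynomials, where generation and relations are
    known; polynomials congruent modulo ['X^Q - 1] have the same image, so the ambiguity of the
    lifts disappears. *)
Theorem module_presentation :
  [/\ forall i, I 1%N (generators i),
      forall x, I 1%N x -> exists2 c : {ffun J -> {ffun gT -> C}},
        forall i, in_group_ring scalars G (c i) & x = lincomb c &
      forall c : {ffun J -> {ffun gT -> C}}, (forall i, in_group_ring scalars G (c i)) ->
        (lincomb c = 0 <-> exists2 d : 'I_h -> {ffun gT -> C},
           forall k, in_group_ring scalars G (d k) &
           c = [ffun i => \sum_(k < h) gr_mul (d k) (gen_rel (n - h) (v w) s sigma k i)])].
Proof.
split=> [i|x Ix|c Hc]; first by rewrite generatorsE; apply: fmvalP.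
  have [P EP] := gen (toFM fm Ix).
  exists [ffun i => gr_val sigma v (P (gen_rank i))].
    by move=> i; rewrite ffunE; apply: gr_val_scalars.
  by rewrite (@lincombE P) ?(esym EP) // => i; rewrite ffunE.
have /choice[Pi HPi] : forall i, exists P, c i = gr_val sigma v P.
  by move=> i; apply: scalars_poly.
have [P HP] := gen_rank_choice hn 0 Pi.
have cP i : c i = gr_val sigma v (P (gen_rank i)) by rewrite HP.
split=> [|[d Hd ->]].
  rewrite (lincombE cP) => /fmval_eq0 /ker[D HD].
  exists (fun k => gr_val sigma v (D k)); first by move=> k; apply: gr_val_scalars.
  apply/ffunP => i; rewrite [RHS]ffunE gen_rel_val cP; apply/ffunP => g; rewrite !ffunE.
  by rewrite (gr_poly_cyc sigma_ord (HD _ (gen_rank_lt hn i))).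
have /choice[D' HD'] : forall k, exists P, d k = gr_val sigma v P.
  by move=> k; apply: scalars_poly.
pose D k : {poly R} := if insub k is Some k' then D' k' else 0.
have DE (k : 'I_h) : d k = gr_val sigma v (D k) by rewrite /D valK.
rewrite (@lincombE (relp w h n s D)) ?rel // => i; rewrite ffunE -gen_rel_val.
by apply: eq_bigr => k _; rewrite DE.
Qed.

End Presentation.

(** * The module of points over an unramified p-extension *)

Section AbstractMain.
Variables (C : fieldType) (R OL : comNzRingType).
Variables (v : {rmorphism R -> C}) (vL : {rmorphism OL -> C}) (O : C -> Prop).
Variables (w : R) (t : OL) (F : mfps 2 C) (f : fps C) (add act : C -> C -> C).
Local Notation I := (ideal_power O (vL t)).
Local Notation pi := (v w).
Variable fm : formal_module v I F f add act.
Variables (p m q h s e n : nat) (rho : nat -> R) (aL : nat -> OL) (eb : nat -> C).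
Hypotheses (cd : cdvr w) (cdL : cdvr t) (pi0 : pi != 0) (t0 : vL t != 0).
Hypotheses (O1 : O 1) (OB : forall x y, O x -> O y -> O (x - y)).
Hypotheses (OM : forall x y, O x -> O y -> O (x * y)) (vLO : forall a, O (vL a)).
Hypotheses (I1 : ~ I 1%N 1) (v_inj : injective v).
Hypotheses (p_pr : prime p) (p_w : exists r, p%:R = w * r) (p_neq0 : p%:R <> 0 :> R).
Hypotheses (q1 : (1 < q)%N) (h0 : (0 < h)%N) (s0 : (0 < s)%N) (e0 : (0 < e)%N).
Hypothesis pi_div : forall d x, I (e + d)%N x <-> exists2 y, I d y & x = pi * y.
Hypothesis rho_repr : forall a, exists i b, (i < q)%N /\ a - rho i = w * b.
Hypothesis rho_inj : forall i j b, (i < q)%N -> (j < q)%N -> rho i - rho j = w * b -> i = j.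

Hypothesis aLE : forall i, vL (aL i) = fg_mul f pi i.
Hypothesis aL_low : forall i, (i < q ^ h)%N -> exists b, aL i = t * b.
Hypothesis aL_unit : exists b, aL (q ^ h)%N * b = 1.
Hypothesis pi_low : forall i, (i < q ^ h)%N -> exists2 c, O c & fg_mul f pi i = pi * c.

Variables (Kal : closedFieldType) (iota : {rmorphism C -> Kal}).
Variables (intK maxK : Kal -> Prop) (smallK : nat -> Kal -> Prop).
Hypotheses (intK1 : intK 1) (intKB : forall x y, intK x -> intK y -> intK (x - y)).
Hypothesis intKM : forall x y, intK x -> intK y -> intK (x * y).
Hypothesis smallKD : forall n x y, smallK n x -> smallK n y -> smallK n (x + y).
Hypothesis smallKN : forall n x, smallK n x -> smallK n (- x).
Hypothesis smallK_sep : forall x, (forall n, smallK n x) -> x = 0.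
Hypothesis maxK_int : forall z, maxK z -> intK z.
Hypothesis iota_int : forall c, O c -> intK (iota c).
Hypothesis iota_small : forall n, exists k, forall d c, (k <= d)%N -> I d c ->
  smallK n (iota c).
Hypothesis maxK_small : forall z n, maxK z -> exists k, forall d a, (k <= d)%N ->
  intK a -> smallK n (z ^+ d * a).
Hypothesis root_maxK : forall (D : {poly Kal}) z, D \is monic -> size D = (q ^ h).+1 ->
  (forall i, (i < q ^ h)%N -> exists2 b, intK b & D`_i = iota (vL t) * b) ->
  root D z -> maxK z.
(** This and the next hypothesis carry the assumption on [W_F]: points of the closure killed by
    [pi ^ s] already lie in the module, and torsion of the module has exponent [pi ^ s] and comes
    from the smaller field. *)
Hypothesis torsion_points : forall z, maxK z ->
  (forall n, exists k, forall d, (k <= d)%N ->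
     smallK n (pev iota (fps_trunc d (fg_mul f (v (w ^+ s)))) z)) ->
  exists2 x, I 1%N x & iota x = z.
Hypothesis torsion_kill : forall k x, I 1%N x -> act (v (w ^+ k.+1)) x = 0 ->
  act (v (w ^+ s)) x = 0 /\ exists b, vL (t * b) = x.

Variables (sg : {rmorphism C -> C}) (tr : C).
Hypothesis sgI : forall d x, I d x -> I d (sg x).
Hypothesis sgF : forall m, sg (F m) = F m.
Hypothesis sgM : forall a d, sg (fg_mul f (v a) d) = fg_mul f (v a) d.
Hypothesis sg_vL : forall a, sg (vL a) = vL a.
Hypothesis sgQ : forall x, O x -> iter (p ^ m) sg x = x.
Hypotheses (trO : O tr) (tr1 : \sum_(i < p ^ m) iter i sg tr = 1).
Hypotheses (ebO : forall j, O (eb j)) (eb_fix : forall j, sg (eb j) = eb j).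
Hypothesis eb_gen : forall x, O x -> sg x = x ->
  exists a : nat -> R, x = \sum_(j < n) v (a j) * eb j.
Hypothesis eb_indep : forall a : nat -> R, \sum_(j < n) v (a j) * eb j = 0 ->
  forall j, (j < n)%N -> a j = 0.
Hypothesis t_dep : exists (a : nat -> R) i, [/\ (i <= n)%N, a i <> 0 &
  \sum_(i < n.+1) v (a i) * vL t ^+ i = 0].

Variables (gT : finGroupType) (sigma : gT) (ga : gT -> C -> C).
Hypothesis sigma_ord : #[sigma]%g = (p ^ m)%N.
Hypothesis gaE : forall l x, I 1%N x -> ga (sigma ^+ l)%g x = iter l sg x.

Local Notation A := (FM fm).
Let fI := fm_fil fm.
Let f0 : f 0%N = 0. Proof. by have [] := fm_log fm. Qed.
Let f1 : f 1%N = 1. Proof. by have [] := fm_log fm. Qed.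
Let I0P x : I 0%N x <-> O x.
Proof. by split=> [[y Oy ->]|Ox]; [rewrite mul1r|exists x; rewrite ?mul1r]. Qed.
Let sgQ' x : I 0%N x -> iter (p ^ m) sg x = x. Proof. by move=> /I0P; apply: sgQ. Qed.

Lemma torsion_points_fixed (x : A) : torsion w x ->
  w ^+ s *: x = 0 /\ exists b, vL (t * b) = fmval x.
Proof.
move=> [k wk]; have [|H1 H2] := torsion_kill (k := k) (fmvalP x).
  by rewrite -fmvalZ exprS -scalerA wk scaler0.
by split=> //; apply: fmval_eq0; rewrite fmvalZ.
Qed.

Lemma uniformizer_fibers (y : A) : w ^+ s.-1 *: y = 0 -> exists z : nat -> A,
  [/\ forall i, (i < q ^ h)%N -> w *: z i = y,
      forall i j, (i < q ^ h)%N -> (j < q ^ h)%N -> z i = z j -> i = j &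
      forall x, w *: x = y -> exists2 i, (i < q ^ h)%N & x = z i].
Proof.
move=> wy; have [|_ [b Eb]] := @torsion_points_fixed y; first by exists s.-1.
apply: (@fiber_points _ _ _ _ vL _ _ _ _ _ fm w t cdL (q ^ h) s e _ s0 e0 pi0 pi_div I1 _
  aL aLE aL_low aL_unit Kal iota intK maxK smallK intK1 intKB intKM smallKD smallKN smallK_sep
  maxK_int _ iota_small maxK_small root_maxK _ y (t * b) Eb _ wy).
- by rewrite expn_gt0 (ltnW q1).
- by move=> a; apply/I0P.
- by move=> c /I0P; apply: iota_int.
- by move=> z mz Hz; have [x Ix Ex] := torsion_points mz Hz; exists (toFM fm Ix).
by exists b.
Qed.

(** The fiber over [0] has more than one point, so a nonzero point is killed by [w]; it bounds
    [q ^ h - 1] by the ramification index. The dependence of the powers of the uniformizer bounds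
    that index by [n]. *)
Lemma height_le_rank : (h <= n)%N.
Proof.
have [|z [zw zinj _]] := @uniformizer_fibers 0; first by rewrite scaler0.
have qh1 : (1 < q ^ h)%N by rewrite -(expn0 q) ltn_exp2l.
have [x wx x0] : exists2 x : A, w *: x = 0 & x <> 0.
  case: (pselect (z 0%N = 0)) => [z0|nz]; last first.
    by exists (z 0%N) => //; apply: zw; apply: ltnW.
  exists (z 1%N); first exact: zw.
  by rewrite -z0 => E; have := zinj 1%N 0%N qh1 (ltnW qh1) E.
have bound1 : ((q ^ h).-1 <= e)%N.
  apply: (@height_le_ramification _ O (vL t) O1 OB OM (vLO t) (fm_sep fm) pi e pi0 pi_div
    (fg_mul f pi) (q ^ h) (fmval x)) => //.
  - exact: fg_mul0.
  - exact: fg_mul1.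
  - by move=> i; rewrite -aLE.
  - exact: fmvalP.
  - by move=> /fmval_eq0.
  move=> d; have := fm_act fm d w (fmvalP x); rewrite -fmvalZ wx fmval0 sub0r.
  by move=> /(filN fI); rewrite opprK horner_poly.
have [a [i [le ai sum0]]] := t_dep.
have bound2 : (e <= n)%N.
  apply: (@ramification_le_rank _ O (vL t) O1 OB OM (vLO t) t0 I1 pi e pi0 pi_div
    R v w n a i cd erefl _ le ai sum0).
  by move=> r; apply/I0P; apply: (fm_scalar fm).
apply: leq_trans bound2; apply: leq_trans bound1.
by rewrite -ltnS prednK ?(ltnW qh1) // ltn_expl.
Qed.

Theorem points_presentation : (h <= n)%N /\
  exists (theta : 'I_(n - h) -> C) (xi omega : 'I_h -> C),
    let gen := gens theta xi omega in
    let comb (c : {ffun gen_index (n - h) h -> {ffun gT -> C}}) :=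
      \big[add/0]_i \big[add/0]_(g in <[sigma]>%g) act (c i g) (ga g (gen i)) in
    let RG := in_group_ring (scalars v) <[sigma]>%g in
    [/\ forall i, I 1%N (gen i),
        forall x, I 1%N x ->
          exists2 c : {ffun gen_index (n - h) h -> {ffun gT -> C}},
            forall i, RG (c i) & x = comb c &
        forall c : {ffun gen_index (n - h) h -> {ffun gT -> C}}, (forall i, RG (c i)) ->
          (comb c = 0 <-> exists2 d : 'I_h -> {ffun gT -> C}, forall k, RG (d k) &
             c = [ffun i => \sum_(k < h) gr_mul (d k) (gen_rel (n - h) pi s sigma k i)])].
Proof.
have hn := height_le_rank; split=> //.
pose sgA : {linear A -> A} := sgL fm sgI sgF sgM.
have [zeta [zord zspan zrel]] := torsion_structure cd (rho := rho) q1 s0 rho_repr rho_inj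
  (fun x tx => proj1 (torsion_points_fixed tx)) uniformizer_fibers.
have zfix i : (i < h)%N -> sgA (zeta i) = zeta i.
  move=> lt; apply/fixedP; have [|_ [b <-]] := @torsion_points_fixed (zeta i); last exact: sg_vL.
  by exists s; apply: zord.
have [r0 pw] := p_w.
have ordA x : iter (p ^ m) sgA x = x by apply: sgL_order.
have trI : I 0%N tr by apply/I0P.
have surj x : sgA x = x -> exists y, x = nrm sgA p m y by apply: (nrm_surj sgQ' trI tr1).
have kern x : nrm sgA p m x = 0 -> exists y, x = sgA y - y by apply: (nrm_ker sgQ' trI tr1).
have sep (x : A) : (forall k, exists y, x = w ^+ k *: y) -> x = 0 by apply: (A_sep e0 pi_div).
have ebI j : I 0%N (eb j) by apply/I0P.
have eb_gen' x : I 0%N x -> sg x = x -> exists a : nat -> R, x = \sum_(j < n) v (a j) * eb j.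
  by move=> /I0P; apply: eb_gen.
have ub y := @fixed_ub _ _ _ _ _ _ _ _ fm sg sgI sgF sgM w cd e n eb e0 pi0 pi_div ebI eb_fix eb_gen' y.
have lb := @fixed_lb _ _ _ _ _ _ _ _ fm sg sgI sgF sgM w cd e n eb e0 pi0 pi_div ebI eb_fix eb_gen' eb_indep.
have [g [xi nb]] := exists_norm_basis cd p_pr pw p_neq0 ordA s0 hn surj kern sep zfix
  zspan zrel zord ub lb.
have gen := lc_generates cd p_pr pw p_neq0 ordA kern sep zspan nb.
have ker := kernel_relations cd p_pr pw p_neq0 ordA hn surj kern sep zspan zrel zord nb.
have rel := lc_relp hn nb.
have gaE' l (x : A) : ga (sigma ^+ l)%g (fmval x) = fmval (iter l sgA x).
  by rewrite gaE ?fmval_iter //; apply: fmvalP.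
have P := module_presentation hn sigma_ord v_inj gaE' gen ker rel.
exists (fun k => fmval (g (h + k)%N)), (fun k => fmval (xi k)), (fun k => fmval (g k)).
exact: P.
Qed.

End AbstractMain.

(** * Specialisation to the fields of the statement *)

Section ClosureEvaluation.
Variables (p : nat) (p_pr : prime p) (Omega : fieldExtType (padic p_pr)).
Variables (Kalg : fieldType) (iota : {rmorphism Omega -> Kalg}).
Local Notation O := (@padic_int_in p p_pr Omega).
Local Notation j := (iota \o O).
Hypothesis alg : forall z : Kalg, exists P : {poly padic_int p_pr},
  P != 0 /\ root (map_poly j P) z.
Variables (E : {subfield Omega}) (t : Omega).
Hypothesis ut : is_uniformizer E t.
Local Notation I := (ideal_power (integer_of E) t).

Lemma small_adic n : exists k, forall d c, (k <= d)%N -> I d c -> small iota n (iota c).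
Proof.
exists (\dim {:Omega} * n)%N => d c le /(fil_le (adic_filtration ut) le) /(adic_padic ut)[z iz ->].
exact: small_iota.
Qed.

Lemma fps_trunc_iota d (g : fps Omega) z :
  (fps_trunc d (iota \o g)).[z] = pev iota (fps_trunc d g) z.
Proof.
rewrite /pev; congr (_.[_]); apply/polyP => i; rewrite coef_map !coef_fps_trunc /=.
by case: ifP => // _; rewrite rmorph0.
Qed.

Lemma fps_eval_iota (g : fps Omega) x : (forall i, integer_of E (g i)) -> I 1%N x ->
  fps_eval j (iota \o g) (iota x) = iota (fps_eval O g x).
Proof.
move=> gO Ix; apply: closure_lim => // n; have [k Hk] := small_adic n.
exists k => d kd; rewrite fps_trunc_iota /pev horner_map -rmorphB /=.
apply: (Hk d) => //; apply: (fil_sym (adic_filtration ut)); exact: fps_eval_approx.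
Qed.

End ClosureEvaluation.

Section IntegerModel.
Variables (p : nat) (p_pr : prime p) (Omega : fieldExtType (padic p_pr)).
Variables (E : {subfield Omega}).

(** The ring of integers is handed over as an abstract ring with an embedding; the existential
    leaves visible only the properties that the final assembly relies on. *)
Lemma integer_model : exists (R : comNzRingType) (v : {rmorphism R -> Omega}),
  [/\ injective v, forall x, integer_of E x <-> exists a, x = v a,
      forall a, is_uniformizer E (v a) -> cdvr a &
      forall a (E' : {subfield Omega}), is_uniformizer E (v a) -> (E <= E')%VS -> let n := (\dim_E E')%N in
        exists e : nat -> Omega, [/\ forall i, (i < n)%N -> integer_of E' (e i),
          forall x, integer_of E' x -> exists a : nat -> R, x = \sum_(i < n) v (a i) * e i,
          forall a : nat -> R, \sum_(i < n) v (a i) * e i = 0 ->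
            forall i, (i < n)%N -> a i = 0 &
          forall y : nat -> Omega, (forall i, (i <= n)%N -> integer_of E' (y i)) ->
            exists (a : nat -> R) i, [/\ (i <= n)%N, a i <> 0 &
              \sum_(i < n.+1) v (a i) * y i = 0]]].
Proof.
exists (OE E), (val : {rmorphism OE E -> Omega}); split.
- exact: val_inj.
- by move=> x; split=> [ix|[a ->]]; [exists (toOE ix)|apply: val_OEP].
- by move=> a; apply: uniformizer_cdvr.
move=> a E' ua sE n; exact: (lattice_basis (uniformizer_cdvr ua) sE).
Qed.

Variables (pi : Omega) (q : nat) (R : comNzRingType) (v : {rmorphism R -> Omega}) (w : R).
Hypotheses (pi_unif : is_uniformizer E pi) (card : residue_card E q).
Hypotheses (v_inj : injective v) (vP : forall x, integer_of E x <-> exists a, x = v a).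
Hypothesis vw : v w = pi.

Lemma residue_representatives : exists rho : nat -> R,
  (forall a, exists i b, (i < q)%N /\ a - rho i = w * b) /\
  (forall i j b, (i < q)%N -> (j < q)%N -> rho i - rho j = w * b -> i = j).
Proof.
have [r [ri rP]] := card.
have /choice[rho0 rhoE] : forall k, exists a, r k = v a by move=> k; apply/vP.
pose rho i : R := if insub i is Some k then rho0 k else 0.
have rhoK k : v (rho (val k)) = r k by rewrite /rho valK -rhoE.
exists rho; split=> [a|i j b li lj Eb].
  have [k [mk _]] := rP _ (proj2 (vP (v a)) (ex_intro _ a erefl)).
  have [b ib Eb] := proj1 (pi_unif _) mk; have [b' Eb'] := proj1 (vP b) ib.
  exists (val k), b'; split; first exact: ltn_ord.
  by apply: v_inj; rewrite rmorphB rmorphM /= rhoK vw -Eb'.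
have [k [_ ku]] := rP _ (ri (Ordinal li)).
have Erho : r (Ordinal li) - r (Ordinal lj) = pi * v b.
  by rewrite -!rhoK -vw -rmorphB -rmorphM /= Eb.
have E1 : k = Ordinal lj.
  by apply: ku; apply/pi_unif; exists (v b); [apply/vP; exists b|exact: Erho].
have E2 : k = Ordinal li.
  by apply: ku; rewrite subrr; apply/pi_unif; exists 0; [apply: integer_of0|rewrite mulr0].
by have := congr1 val (etrans (esym E2) E1).
Qed.

Lemma uniformizer_p : (exists r, p%:R = w * r) /\ p%:R <> 0 :> R.
Proof.
split.
  have [b ib Eb] := proj1 (pi_unif _) (p_maxideal_of E).
  have [b' Eb'] := proj1 (vP b) ib; exists b'; apply: v_inj.
  by rewrite rmorph_nat rmorphM /= vw -Eb'.
move=> /(congr1 v); rewrite rmorph_nat rmorph0; apply/eqP.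
exact: omega_p_neq0.
Qed.

End IntegerModel.

Section Main.
Variables (p : nat) (p_pr : prime p) (Omega : splittingFieldType (padic p_pr)).
Variables (K0 K L M : {subfield Omega}) (Kalg : closedFieldType).
Variables (iota : {rmorphism Omega -> Kalg}) (pi : Omega) (q : nat) (phi : gal_of K).
Variables (m : nat) (sigma : gal_of M) (F : mfps 2 Omega) (f u : fps Omega) (h s : nat).
Hypotheses (sK0K : (K0 <= K)%VS) (sKL : (K <= L)%VS) (sLM : (L <= M)%VS).
Hypothesis (Kalg_algebraic : forall z : Kalg, exists P : {poly Omega},
       [/\ P != 0, P \is a polyOver K & root (map_poly iota P) z]).
Hypotheses (pi_unif : is_uniformizer K0 pi) (K_unram : unramified K0 K).
Hypotheses (k0_card : residue_card K0 q) (phi_frob : is_frobenius K0 q phi).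
Hypotheses (M_unram : unramified L M) (M_galois : galois L M).
Hypotheses (G_order : #|'Gal(M / L)%g| = (p ^ m)%N) (G_gen : 'Gal(M / L)%g = <[sigma]>%g).
Hypotheses (u_type : is_honda_type K pi u) (u_height : type_height K u h).
Hypotheses (F_honda : is_honda_group pi q phi u F f) (s_ge1 : (1 <= s)%N).
Hypothesis W_L : forall z : Kalg,
       (fg_torsion_all iota f pi z /\ exists2 x, maxideal_of L x & z = iota x)
       <-> fg_torsion iota f pi s z.
Hypothesis W_M : forall z : Kalg,
       (fg_torsion_all iota f pi z /\ exists2 x, maxideal_of M x & z = iota x)
       <-> fg_torsion iota f pi s z.
Local Notation O := (@padic_int_in p p_pr Omega).
Local Notation n := (\dim_K0 L)%N.

Variables (t : Omega) (utL : is_uniformizer L t).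
Let utM : is_uniformizer M t. Proof. exact: (uniformizer_unram M_unram sLM utL). Qed.
Local Notation I := (ideal_power (integer_of M) t).
Let sKM : (K <= M)%VS. Proof. exact: subv_trans sKL sLM. Qed.

Variables (R : comNzRingType) (v : {rmorphism R -> Omega}) (w : R).
Hypotheses (v_inj : injective v) (vP : forall x, integer_of K0 x <-> exists a, x = v a).
Hypotheses (vw : v w = pi) (cd : cdvr w).
Variables (OL : comNzRingType) (vL : {rmorphism OL -> Omega}) (tL : OL).
Hypotheses (vL_inj : injective vL) (vLP : forall x, integer_of L x <-> exists a, x = vL a).
Hypotheses (vt : vL tL = t) (cdL : cdvr tL).

Let vO a : integer_of K0 (v a). Proof. by apply/vP; exists a. Qed.

Let mulK a d : integer_of K (fg_mul f (v a) d).
Proof.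
exact: (fg_mul_integer sK0K pi_unif K_unram k0_card phi_frob u_type u_height F_honda d (vO a)).
Qed.

Let mulM a d : integer_of M (fg_mul f (v a) d).
Proof. exact: (integer_ofS sKM (mulK a d)). Qed.

Let alg z : exists P : {poly padic_int p_pr}, P != 0 /\ root (map_poly (iota \o O) P) z.
Proof. by have [P [P0 _ rP]] := Kalg_algebraic z; apply: closure_algebraic P0 rP. Qed.

Let vX k : v (w ^+ k) = pi ^+ k. Proof. by rewrite rmorphXn /= vw. Qed.

Lemma torsion_iota k x : I 1%N x ->
  fg_act f (v (w ^+ k)) x = 0 <-> fg_torsion iota f pi k (iota x).
Proof.
move=> Ix; rewrite /fg_torsion -vX (fps_eval_iota alg utM (mulM _) Ix) /fg_act.
split=> [->|[_ /eqP]]; last by rewrite fmorph_eq0 => /eqP.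
split; last exact: rmorph0.
exact: (maxideal_iota iota (proj2 (proj1 (adic_I1 utM x) Ix))).
Qed.

(** [W_M] places a torsion point of [M] in [W^s], and [W_L] then places it in [L]. *)
Lemma torsion_kill k x : I 1%N x -> fg_act f (v (w ^+ k.+1)) x = 0 ->
  fg_act f (v (w ^+ s)) x = 0 /\ exists b, vL (tL * b) = x.
Proof.
move=> Ix /(torsion_iota k.+1 Ix) Tk.
have Mx := proj1 (adic_I1 utM x) Ix.
have Ts : fg_torsion iota f pi s (iota x).
  by apply/W_M; split; [exists k.+1|exists x].
split; first exact: (proj2 (torsion_iota s Ix) Ts).
have [_ [x' mx' Ex]] := proj2 (W_L _) Ts.
rewrite (fmorph_inj iota Ex); have [b ib ->] := proj1 (utL x') mx'.
by have [b' ->] := proj1 (vLP b) ib; exists b'; rewrite rmorphM /= vt.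
Qed.

Lemma torsion_points z : maxideal (iota \o O) z ->
  (forall n, exists k, forall d, (k <= d)%N ->
     small iota n (pev iota (fps_trunc d (fg_mul f (v (w ^+ s)))) z)) ->
  exists2 x, I 1%N x & iota x = z.
Proof.
rewrite vX => mz Hz.
have Tz : fg_torsion iota f pi s z.
  split; first exact: mz.
  apply: (closure_lim alg) => k; have [d Hd] := Hz k; exists d => d' le.
  by rewrite subr0 fps_trunc_iota; apply: Hd.
have [_ [x mx Ex]] := proj2 (W_L _) Tz.
exists x; last exact: esym Ex.
by apply/(adic_I1 utM); split; [apply: (subvP sLM); case: mx|case: mx].
Qed.

(** The low coefficients of [[pi]] are needed in two forms: as multiples of [tL] in [OL], for
    preparation over [L], and as multiples of [pi], for the bound on the height. *)
Lemma mul_pi_coefficients : exists aL : nat -> OL,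
  [/\ forall i, vL (aL i) = fg_mul f (v w) i,
      forall i, (i < q ^ h)%N -> exists b, aL i = tL * b,
      exists b, aL (q ^ h)%N * b = 1 &
      forall i, (i < q ^ h)%N -> exists2 c, integer_of M c & fg_mul f (v w) i = v w * c].
Proof.
have [low [b ib bu]] := fg_mul_pi sK0K pi_unif K_unram k0_card phi_frob u_type u_height F_honda.
have /choice[aL aLE] : forall i, exists a, fg_mul f (v w) i = vL a.
  by move=> i; apply/vLP; exact: (integer_ofS sKL (mulK w i)).
exists aL; rewrite vw in aLE *; split=> [i|i il||i il]; first exact: esym (aLE i).
- have [iK mi] := low i il.
  have [c ic Ec] := proj1 (utL _) (conj (subvP sKL _ iK) mi).
  have [c' Ec'] := proj1 (vLP c) ic; exists c'; apply: vL_inj.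
  by rewrite rmorphM /= vt -aLE Ec Ec'.
- have [b' Eb'] := proj1 (vLP b) (integer_ofS sKL ib); exists b'; apply: vL_inj.
  by rewrite rmorphM rmorph1 /= -aLE -Eb'.
have [c ic Ec] := proj1 (uniformizer_unram K_unram sK0K pi_unif _) (low i il).
by exists c; [exact: (integer_ofS sKM ic)|].
Qed.

Hypothesis lattice : exists e : nat -> Omega, [/\ forall i, (i < n)%N -> integer_of L (e i),
    forall x, integer_of L x -> exists a : nat -> R, x = \sum_(i < n) v (a i) * e i,
    forall a : nat -> R, \sum_(i < n) v (a i) * e i = 0 ->
      forall i, (i < n)%N -> a i = 0 &
    forall y : nat -> Omega, (forall i, (i <= n)%N -> integer_of L (y i)) ->
      exists (a : nat -> R) i, [/\ (i <= n)%N, a i <> 0 &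
        \sum_(i < n.+1) v (a i) * y i = 0]].

Lemma fixed_lattice : exists eb : nat -> Omega,
  [/\ forall j, integer_of M (eb j), forall j, sigma (eb j) = eb j,
      forall x, integer_of M x -> sigma x = x ->
        exists a : nat -> R, x = \sum_(j < n) v (a j) * eb j,
      forall a : nat -> R, \sum_(j < n) v (a j) * eb j = 0 ->
        forall j, (j < n)%N -> a j = 0 &
      exists (a : nat -> R) i, [/\ (i <= n)%N, a i <> 0 &
        \sum_(i < n.+1) v (a i) * vL tL ^+ i = 0]].
Proof.
have [eb [ebi ebg ebn dep]] := lattice.
(* Padding by zero, since the abstract statement asks integrality and invariance for every index. *)
pose eb' k := if (k < n)%N then eb k else 0.
have eb'i k : integer_of L (eb' k).
  by rewrite /eb'; case: ifP => [/ebi|_] //; apply: integer_of0.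
have eb'E (a : nat -> R) : \sum_(k < n) v (a k) * eb' k = \sum_(k < n) v (a k) * eb k.
  by apply: eq_bigr => k _; rewrite /eb' ltn_ord.
exists eb'; split=> [k|k|x ix sx|a|].
- exact: (integer_ofS sLM (eb'i k)).
- exact: (sigma_fix sLM G_gen (proj1 (eb'i k))).
- have [a Ea] := ebg x (conj (sigma_fixed M_galois G_gen (proj1 ix) sx) (proj2 ix)).
  by exists a; rewrite eb'E.
- by rewrite eb'E; apply: ebn.
apply: (dep (fun i => vL tL ^+ i)) => i _; apply: integer_ofX; rewrite vt.
exact: (maxideal_of_int (uniformizer_max utL)).
Qed.

Lemma sigma_mul a d : sigma (fg_mul f (v a) d) = fg_mul f (v a) d.
Proof. exact: (sigma_fix sLM G_gen (subvP sKL _ (proj1 (mulK a d)))). Qed.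

Lemma sigma_F d : sigma (F d) = F d.
Proof.
have FK : F d \in K by have [_ FO _ _ _] := F_honda; exact: (proj1 (FO d)).
exact: (sigma_fix sLM G_gen (subvP sKL _ FK)).
Qed.

Lemma sigma_vL a : sigma (vL a) = vL a.
Proof. by apply: (sigma_fix sLM G_gen); have [] := proj2 (vLP (vL a)) (ex_intro _ a erefl). Qed.

Lemma main_presentation : (h <= n)%N /\
  exists (theta : 'I_(n - h) -> Omega) (xi omega : 'I_h -> Omega),
    let gen := gens theta xi omega in
    let comb (c : {ffun gen_index (n - h) h -> {ffun gal_of M -> Omega}}) :=
      \big[fg_add F/0]_i \big[fg_add F/0]_(g in <[sigma]>%g)
        fg_act f (c i g) ((g : gal_of M) (gen i)) in
    let RG := in_group_ring (scalars v) <[sigma]>%g in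
    [/\ forall i, ideal_power (integer_of M) (vL tL) 1 (gen i),
        forall x, ideal_power (integer_of M) (vL tL) 1 x ->
          exists2 c : {ffun gen_index (n - h) h -> {ffun gal_of M -> Omega}},
            forall i, RG (c i) & x = comb c &
        forall c : {ffun gen_index (n - h) h -> {ffun gal_of M -> Omega}},
          (forall i, RG (c i)) ->
          (comb c = 0 <-> exists2 d : 'I_h -> {ffun gal_of M -> Omega}, forall k, RG (d k) &
             c = [ffun i => \sum_(k < h) gr_mul (d k) (gen_rel (n - h) (v w) s sigma k i)])].
Proof.
have fm : formal_module v (ideal_power (integer_of M) (vL tL)) F f (fg_add F) (fg_act f).
  rewrite vt; exact: (honda_formal_module sK0K pi_unif K_unram k0_card phi_frob u_type u_height
    F_honda sKM utM vO).
have [e e0 He] : exists2 e, (0 < e)%N & forall d x, ideal_power (integer_of M) (vL tL) (e + d)%N x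
    <-> exists2 y, ideal_power (integer_of M) (vL tL) d y & x = v w * y.
  by rewrite vt vw; exact: (pi_ramification sK0K pi_unif sKM utM).
have [rho [rho1 rho2]] := residue_representatives pi_unif k0_card v_inj vP vw.
have [aL [aL1 aL2 aL3 aL4]] := mul_pi_coefficients.
have [eb [eb1 eb2 eb3 eb4 eb5]] := fixed_lattice.
have [pw p0] := uniformizer_p pi_unif v_inj vP vw.
have [h0 _ _] := u_height.
have [tr trI tr1] := sigma_trace_one sLM G_order G_gen utL utM.
have q1 : (1 < q)%N.
  have [k -> k0] := residue_card_power k0_card.
  by rewrite -(expn0 p) ltn_exp2l // prime_gt1.
have pi0 : v w != 0 by rewrite vw; exact: (uniformizer_neq0 pi_unif).
have t0 : vL tL != 0 by rewrite vt; exact: (uniformizer_neq0 utL).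
have I1 : ~ ideal_power (integer_of M) (vL tL) 1 1.
  by rewrite vt => /(adic_I1 utM); apply: one_not_maxideal.
have vLO a : integer_of M (vL a).
  by apply: (integer_ofS sLM); apply/vLP; exists a.
have mt : maxideal (iota \o O) (iota (vL tL)).
  by rewrite vt; apply: maxideal_iota; exact: (proj2 (uniformizer_max utL)).
have iota_int c : integer_of M c -> integer (iota \o O) (iota c).
  by move=> [_ ic]; apply/integer_iota.
have iota_small k : exists l, forall d c, (l <= d)%N ->
    ideal_power (integer_of M) (vL tL) d c -> small iota k (iota c).
  by rewrite vt; exact: (small_adic iota utM k).
have tkill k x : ideal_power (integer_of M) (vL tL) 1 x -> fg_act f (v (w ^+ k.+1)) x = 0 ->
    fg_act f (v (w ^+ s)) x = 0 /\ exists b, vL (tL * b) = x.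
  by rewrite vt; exact: torsion_kill.
have tpoints z : maxideal (iota \o O) z ->
    (forall n, exists k, forall d, (k <= d)%N ->
       small iota n (pev iota (fps_trunc d (fg_mul f (v (w ^+ s)))) z)) ->
    exists2 x, ideal_power (integer_of M) (vL tL) 1 x & iota x = z.
  by rewrite vt; exact: torsion_points.
have sgI d x : ideal_power (integer_of M) (vL tL) d x ->
    ideal_power (integer_of M) (vL tL) d (sigma x).
  by rewrite vt; exact: (sigma_I sLM G_gen utL).
have sgQ x : integer_of M x -> iter (p ^ m) sigma x = x.
  by move=> [xM _]; exact: (iter_sigma_order G_order G_gen xM).
have trO : integer_of M tr by apply/(adic_I0 M t).
have gaE l x : ideal_power (integer_of M) (vL tL) 1 x -> (sigma ^+ l)%g x = iter l sigma x.
  by rewrite vt => /(adic_I1 utM)[xM _]; rewrite iter_sigma.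
have P := @points_presentation Omega R OL v vL (integer_of M) w tL F f (fg_add F)
  (fg_act f) fm p m q h s e n rho aL eb cd cdL pi0 t0 (integer_of1 M) (@integer_ofB _ _ _ M)
  (@integer_ofM _ _ _ M) vLO I1 v_inj p_pr pw p0 q1 h0 s_ge1 e0 He rho1 rho2 aL1 aL2 aL3 aL4
  Kalg iota (integer (iota \o O)) (maxideal (iota \o O)) (small iota)
  (integer_one _) (@integer_sub _ _ _ _) (@integer_mul _ _ _ _) (@smallD _ _ _ _ iota)
  (@smallN _ _ _ _ iota) (small_sep alg) (fun z mz => proj1 mz) iota_int iota_small
  (fun z k mz => small_power alg k mz)
  (fun D z mD sD lowD rD => monic_root_maxideal alg mD sD mt lowD rD)
  tpoints tkill sigma tr sgI sigma_F sigma_mul sigma_vL sgQ trO tr1 eb1 eb2 eb3 eb4 eb5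
  (gal_of M) sigma (fun (g : gal_of M) x => g x) (sigma_order G_order G_gen) gaE.
exact P.
Qed.

End Main.

Theorem mainTheorem1 (p : nat) (p_pr : prime p)
    (Omega : splittingFieldType (padic p_pr))
    (K0 K L M : {subfield Omega})
    (Kalg : closedFieldType) (iota : {rmorphism Omega -> Kalg})
    (pi : Omega) (q : nat) (phi : gal_of K)
    (m : nat) (sigma : gal_of M)
    (F : mfps 2 Omega) (f u : fps Omega) (h s : nat)
    (sK0K : (K0 <= K)%VS) (sKL : (K <= L)%VS) (sLM : (L <= M)%VS)
    (Kalg_algebraic : forall z : Kalg, exists P : {poly Omega},
       [/\ P != 0, P \is a polyOver K & root (map_poly iota P) z])
    (pi_unif : is_uniformizer K0 pi)
    (K_unram : unramified K0 K)
    (k0_card : residue_card K0 q)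
    (phi_frob : is_frobenius K0 q phi)
    (M_unram : unramified L M)
    (M_galois : galois L M)
    (G_order : #|'Gal(M / L)%g| = (p ^ m)%N)
    (G_gen : 'Gal(M / L)%g = <[sigma]>%g)
    (u_type : is_honda_type K pi u)
    (u_height : type_height K u h)
    (F_honda : is_honda_group pi q phi u F f)
    (s_ge1 : (1 <= s)%N)
    (W_L : forall z : Kalg,
       (fg_torsion_all iota f pi z /\ exists2 x, maxideal_of L x & z = iota x)
       <-> fg_torsion iota f pi s z)
    (W_M : forall z : Kalg,
       (fg_torsion_all iota f pi z /\ exists2 x, maxideal_of M x & z = iota x)
       <-> fg_torsion iota f pi s z) :
  let n := (\dim_K0 L)%N in
  let G := 'Gal(M / L)%g in
  let OK0G := in_group_ring (integer_of K0) G in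
  (h <= n)%N /\
  exists (theta : 'I_(n - h) -> Omega) (xi omega : 'I_h -> Omega),
    let gen := gens theta xi omega in
    [/\ forall i, maxideal_of M (gen i),
        forall x, maxideal_of M x ->
          exists2 c : {ffun gen_index (n - h) h -> {ffun gal_of M -> Omega}},
            forall i, OK0G (c i) & x = fg_lincomb G F f c gen
      & forall c : {ffun gen_index (n - h) h -> {ffun gal_of M -> Omega}},
          (forall i, OK0G (c i)) ->
          (fg_lincomb G F f c gen = 0 <->
           exists2 d : 'I_h -> {ffun gal_of M -> Omega},
             forall k, OK0G (d k) &
             c = [ffun i => \sum_(k < h)
                    gr_mul (d k) (gen_rel (n - h) pi s sigma k i)])].
Proof.
move=> n G OK0G.
(* As [M / L] is unramified, a uniformizer of [L] also serves for [M]. It is fixed by [sigma], so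
   the filtration of [M] by its powers is stable under the group. *)
have [t utL] := exists_uniformizer L.
have [R [v [v_inj vP v_cd v_lat]]] := integer_model K0.
have [OL [vL [vL_inj vLP vL_cd _]]] := integer_model L.
have [w Ew] := proj1 (vP pi) (maxideal_of_int (uniformizer_max pi_unif)).
have [tL Et] := proj1 (vLP t) (maxideal_of_int (uniformizer_max utL)).
have uw : is_uniformizer K0 (v w) by rewrite -Ew.
have utL' : is_uniformizer L (vL tL) by rewrite -Et.
have utM : is_uniformizer M (vL tL) := uniformizer_unram M_unram sLM utL'.
have lat := v_lat w L uw (subv_trans sK0K sKL).
have [hn [theta [xi [omega [H1 H2 H3]]]]] := main_presentation sK0K sKL sLM Kalg_algebraic
  pi_unif K_unram k0_card phi_frob M_unram M_galois G_order G_gen u_type u_height F_honda s_ge1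
  W_L W_M utL v_inj vP (esym Ew) (v_cd w uw) vL_inj vLP (esym Et) (vL_cd tL utL') lat.
have OKP a : OK0G a <-> in_group_ring (scalars v) <[sigma]>%g a.
  rewrite /OK0G /G G_gen; split=> H k; have [Ha Hn] := H k; split=> //; exact/vP.
split; first exact: hn.
exists theta, xi, omega; split=> [i|x mx|c Hc].
- by apply/(adic_I1 utM); apply: H1.
- have [c Hc Ec] := H2 x (proj2 (adic_I1 utM x) mx); exists c; first by move=> i; apply/OKP.
  by rewrite /fg_lincomb /fg_gact /G G_gen.
rewrite /fg_lincomb /fg_gact /G G_gen Ew.
have Hc' i : in_group_ring (scalars v) <[sigma]>%g (c i) by apply/OKP.
split=> [/(proj1 (H3 c Hc'))[d Hd Ed]|[d Hd Ed]].
  by exists d => // k; apply/OKP.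
by apply/(H3 c Hc'); exists d => // k; apply/OKP.
Qed.
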